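(* Let $d\ge 1$ and let $\Omega\subset\mathbb{R}^d$ be a bounded domain with $C^\infty$ boundary. Let $R: L^1(\Omega)\to[0,\infty]$ be the sparse vector field regularization functional $$R(u)=\inf\Big\{\Vert v\Vert_{\mathcal{M}(\Omega)} \;:\; v\in\mathcal{M}(\Omega)^d,\ \int_\Omega u\,\Delta\varphi\,dx+\int_\Omega\nabla\varphi\cdot dv=0\ \text{ for all }\varphi\in C^2(\overline{\Omega})\text{ with }\nabla\varphi\cdot n=0\text{ on }\partial\Omega\Big\}.$$ Then: (i) There exists a constant $c>0$ such that $\Vert u\Vert_{L^1(\Omega)}\le c\,R(u)$ for all $u\in L^1_\diamond(\Omega)$. (ii) The set $\mathrm{dom}(R)$ is a linear subspace of $L^1(\Omega)$, and $R$ is a norm on $\mathrm{dom}(R)\cap L^1_\diamond(\Omega)$. (iii) $R(u)\le TV(u)$ for all $u\in BV(\Omega)$.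
   Context: All functions and measures are real-valued. $\mathcal{M}(\Omega)^d$ denotes the space of finite $\mathbb{R}^d$-valued Radon measures on $\Omega$, with norm $$\Vert v\Vert_{\mathcal{M}(\Omega)}=\sup\Big\{\int_\Omega\varphi\cdot dv \;:\; \varphi:\Omega\to\mathbb{R}^d \text{ continuous},\ \Vert\varphi\Vert_\infty\le 1\Big\},$$ where $\Vert\varphi\Vert_\infty=\sup_{x\in\Omega}|\varphi(x)|$ and $|\cdot|$ is the Euclidean norm on $\mathbb{R}^d$ (so this is the total variation norm of the vector measure $v$). The vector $n$ is the outer unit normal on $\partial\Omega$. The constraint in the definition of $R$ is the weak formulation of $\Delta u=\nabla\cdot v$ in $\Omega$ with no-flux boundary conditions $(\nabla u-v)\cdot n=0$ on $\partial\Omega$. The infimum of the empty set is $+\infty$. $L^1_\diamond(\Omega)=\{u\in L^1(\Omega) : \int_\Omega u\,dx=0\}$ and $\mathrm{dom}(R)=\{u\in L^1(\Omega): R(u)<\infty\}$. $BV(\Omega)$ is the space of $u\in L^1(\Omega)$ whose distributional gradient $\nabla u$ is a finite $\mathbb{R}^d$-valued Radon measure on $\Omega$, and $TV(u)=\Vert\nabla u\Vert_{\mathcal{M}(\Omega)}$. *)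

(* Defs.v *)
From HB Require Import structures.
From mathcomp Require Import all_boot all_order all_algebra.
From mathcomp Require Import all_classical all_reals all_analysis.
From mathcomp Require Import measurable_realfun.

Set Implicit Arguments.
Unset Strict Implicit.
Unset Printing Implicit Defensive.

Import Order.TTheory GRing.Theory Num.Theory.
Import numFieldNormedType.Exports.

Local Open Scope classical_set_scope.
Local Open Scope ring_scope.

HB.instance Definition _ (R : realType) (d : nat) :=
  @isMeasurable.Build (sigma_display (@open 'rV[R]_d)) 'rV[R]_d
    <<s @open 'rV[R]_d >> (@sigma_algebra0 _ setT _) (@sigma_algebraC _ _)
    (@sigma_algebra_bigcup _ setT _).

Section borel_rV.
Context {R : realType}.

Lemma open_measurable_rV d (A : set 'rV[R]_d) : open A -> measurable A.
Proof. exact: sub_sigma_algebra. Qed.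

Lemma continuous_measurable_rV d d' (f : 'rV[R]_d -> 'rV[R]_d') :
  continuous f -> measurable_fun [set: 'rV[R]_d] f.
Proof.
move=> /continuousP cf; apply: (measurability (@open 'rV[R]_d')) => //.
by move=> _ [B oB <-]; rewrite setTI; apply: open_measurable_rV; exact: cf.
Qed.

Lemma measurable_coord d (i : 'I_d) :
  measurable_fun [set: 'rV[R]_d] (fun v : 'rV[R]_d => v 0 i).
Proof.
apply: (measurability _ (RGenOpens.measurableE R)).
move=> _ [_ [a [b ->]] <-]; rewrite setTI; apply: open_measurable_rV.
apply: open_comp; last exact: interval_open.
by move=> v _; exact: coord_continuous.
Qed.

Lemma measurable_fun_rV d0 (T : measurableType d0) d (f : T -> 'rV[R]_d) :
  (forall i, measurable_fun [set: T] (fun t => f t 0 i)) ->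
  measurable_fun [set: T] f.
Proof.
move=> mf; apply: (measurability (@open 'rV[R]_d)) => //.
move=> _ [A oA <-]; rewrite setTI.
pose c (q : 'rV[rat]_d) : 'rV[R]_d := map_mx ratr q.
pose B (p : 'rV[rat]_d * nat) : set 'rV[R]_d :=
  if pselect (ball (c p.1) p.2.+1%:R^-1 `<=` A)
  then ball (c p.1) p.2.+1%:R^-1 else set0.
have -> : A = \bigcup_p B p.
  apply/seteqP; split => [x Ax|x [p _]]; last first.
    by rewrite /B; case: pselect => // sA /sA.
  have [e e0 eA] : exists2 e : R, 0 < e & ball x e `<=` A.
    by have /nbhs_ballP[e /= ? ?] := open_nbhs_nbhs (conj oA Ax); exists e.
  have [k ke] : exists k, k.+1%:R^-1 < e / 2.
    have e20 : 0 < e / 2 by rewrite divr_gt0.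
    have [k _ /(_ _ (leqnn k)) kP] := near_infty_natSinv_lt (PosNum e20).
    by exists k.
  pose q : 'rV[rat]_d :=
    \row_i xget 0 [set r | `|ratr r - x 0 i| < k.+1%:R^-1].
  have xq : ball (c q) k.+1%:R^-1 x.
    split=> [|a i]; first by rewrite invr_gt0.
    rewrite /ball/= !mxE (ord1 a).
    case: xgetP => [r _ //|/= nr]; exfalso.
    have lt_k : x 0 i - k.+1%:R^-1 < x 0 i + k.+1%:R^-1.
      by rewrite ltrD2l gtrN// invr_gt0.
    have [r] := rat_in_itvoo lt_k.
    by rewrite in_itv/= -ltr_distl => /nr.
  exists (q, k) => //; rewrite /B; case: pselect => //= -[].
  move=> y qy; apply: eA; rewrite (splitr e).
  apply: le_ball (ball_triangle (ball_sym xq) qy).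
  by rewrite lerD// ltW.
rewrite preimage_bigcup; apply: countable_bigcupT_measurable => [|p]; first exact: countableP.
rewrite /B; case: (pselect _) => [sA|nsA] /=; last by rewrite preimage_set0.
have -> : f @^-1` ball (c p.1) p.2.+1%:R^-1 =
    \bigcap_(i in [set: 'I_d])
      (fun t => f t 0 i) @^-1` ball (c p.1 0 i) p.2.+1%:R^-1.
  apply/seteqP; split => [t [_ /= +] i _|t tP]; first exact.
  by split=> [|a i]; [rewrite invr_gt0|rewrite (ord1 a); exact: tP].
apply: fin_bigcap_measurable => // i _.
by rewrite -[X in measurable X]setTI; apply: mf => //; exact: measurable_ball.
Qed.

End borel_rV.

Section lebesgue_measure_rV.
Context {R : realType}.

Definition rV_cons d (p : R * 'rV[R]_d) : 'rV[R]_d.+1 :=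
  row_mx (const_mx p.1 : 'rV[R]_1) p.2.

Definition rV_uncons d (v : 'rV[R]_d.+1) : R * 'rV[R]_d :=
  (v 0 0, rsubmx (v : 'rV[R]_(1 + d))).

Lemma rV_consK d : cancel (@rV_cons d) (@rV_uncons d).
Proof.
move=> [x v]; rewrite /rV_uncons /rV_cons/= row_mxKr; congr pair.
by rewrite mxE; case: splitP => // j _; rewrite mxE.
Qed.

Lemma measurable_rV_cons d : measurable_fun setT (@rV_cons d).
Proof.
apply: measurable_fun_rV => i; rewrite /rV_cons.
under eq_fun do rewrite mxE.
case: (@fintype.split 1 d i) => j.
  under eq_fun do rewrite mxE; exact: measurable_fst.
exact: measurableT_comp (measurable_coord j) measurable_snd.
Qed.

Lemma measurable_rV_uncons d : measurable_fun setT (@rV_uncons d).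
Proof.
apply/measurable_fun_pair; first exact: measurable_coord.
apply: measurable_fun_rV => i.
under eq_fun do rewrite mxE.
exact: measurable_coord.
Qed.

HB.instance Definition _ d :=
  isMeasurableFun.Build _ _ _ _ (@rV_cons d) (@measurable_rV_cons d).

Section succ.
Variables (d : nat) (mu : {sigma_finite_measure set 'rV[R]_d -> \bar R}).

Definition lebesgue_rV_succ :=
  pushforward (@lebesgue_measure R \x mu)%E (@rV_cons d).

Let lebesgue_rV_succ0 : lebesgue_rV_succ set0 = 0%E.
Proof. by rewrite /lebesgue_rV_succ /pushforward preimage_set0 measure0. Qed.

Let lebesgue_rV_succ_ge0 A : (0 <= lebesgue_rV_succ A)%E.
Proof. by rewrite /lebesgue_rV_succ /pushforward measure_ge0. Qed.

Let lebesgue_rV_succ_sigma_additive : semi_sigma_additive lebesgue_rV_succ.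
Proof.
move=> F mF tF mUF; rewrite /lebesgue_rV_succ /pushforward preimage_bigcup.
have mcons A : measurable A -> measurable (@rV_cons d @^-1` A).
  by move=> mA; rewrite -[X in measurable X]setTI; exact: measurable_rV_cons.
apply: measure_semi_sigma_additive => [n| |]; first exact: mcons.
- apply/trivIsetP => i j _ _ ij; rewrite -preimage_setI.
  by move/trivIsetP : tF => /(_ _ _ _ _ ij) ->//; rewrite preimage_set0.
- by rewrite -preimage_bigcup; exact: mcons.
Qed.

HB.instance Definition _ := isMeasure.Build _ _ _ lebesgue_rV_succ
  lebesgue_rV_succ0 lebesgue_rV_succ_ge0 lebesgue_rV_succ_sigma_additive.

Let lebesgue_rV_succ_sigma_finite : sigma_finite setT lebesgue_rV_succ.
Proof.
have /sigma_finiteP[F [TF ndF Foo]] := sigma_finiteT (@lebesgue_measure R).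
have /sigma_finiteP[G [TG ndG Goo]] := sigma_finiteT mu.
exists (fun n => @rV_uncons d @^-1` (F n `*` G n)).
  rewrite -preimage_bigcup (_ : \bigcup_n _ = setT) ?preimage_setT//.
  apply/seteqP; split => // -[x y] _.
  have [n _ Fnx] : (\bigcup_n F n) x by rewrite -TF.
  have [k _ Gky] : (\bigcup_n G n) y by rewrite -TG.
  exists (maxn n k) => //; split.
  - by move: x Fnx; exact/subsetPset/ndF/leq_maxl.
  - by move: y Gky; exact/subsetPset/ndG/leq_maxr.
move=> n; have [mF Fn] := Foo n; have [mG Gn] := Goo n; split.
  rewrite -[X in measurable X]setTI; apply: measurable_rV_uncons => //.
  exact: measurableX.
rewrite /lebesgue_rV_succ /pushforward -comp_preimage.
rewrite (_ : _ \o _ = id) ?preimage_id; last exact/funext/rV_consK.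
by rewrite product_measure1E// lte_mul_pinfty// ge0_fin_numE.
Qed.

HB.instance Definition _ := Measure_isSigmaFinite.Build _ _ _
  lebesgue_rV_succ lebesgue_rV_succ_sigma_finite.

End succ.

Fixpoint lebesgue_rV d : {sigma_finite_measure set 'rV[R]_d -> \bar R} :=
  if d is d'.+1 then lebesgue_rV_succ (lebesgue_rV d') else \d_(0 : 'rV[R]_0).

End lebesgue_measure_rV.

Section vector_measures.
Context {R : realType}.

Lemma Hahn_decomposition_pair d0 (T : measurableType d0)
    (nu : {charge set T -> \bar R}) :
  exists PN : set T * set T, hahn_decomposition nu PN.1 PN.2.
Proof. by have [P [N nuPN]] := Hahn_decomposition nu; exists (P, N). Qed.

Definition charge_integral d0 (T : measurableType d0)
    (nu : {charge set T -> \bar R}) (D : set T) (f : T -> R) : R :=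
  let nuPN := projT2 (cid (Hahn_decomposition_pair nu)) in
  \int[jordan_pos nuPN]_(x in D) f x - \int[jordan_neg nuPN]_(x in D) f x.

Context {d : nat}.
Implicit Types (x y : 'rV[R]_d) (Omega : set 'rV[R]_d).

Definition dotv x y : R := \sum_i x 0 i * y 0 i.

(* The library norm on row vectors is the sup norm. *)
Definition enorm x : R := Num.sqrt (dotv x x).

(* A finite Borel measure on an open subset of R^d is automatically Radon; it is
   represented by its extension by zero to R^d. *)
Definition vmeasure := 'I_d -> {charge set 'rV[R]_d -> \bar R}.

Definition vmeasure_on Omega : set vmeasure :=
  [set v | forall i A, measurable A -> A `&` Omega = set0 -> v i A = 0%E].

Definition vintegral Omega (phi : 'rV[R]_d -> 'rV[R]_d) (v : vmeasure) : R :=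
  \sum_i charge_integral (v i) Omega (fun x => phi x 0 i).

Definition vmeasure_norm Omega (v : vmeasure) : \bar R :=
  ereal_sup [set (vintegral Omega phi v)%:E | phi in
    [set phi : 'rV[R]_d -> 'rV[R]_d | {within Omega, continuous phi} /\
      forall x, Omega x -> enorm (phi x) <= 1]].

End vector_measures.

Section smooth_functions.
Context {R : realType} {d : nat}.
Implicit Types (x : 'rV[R]_d) (Omega U : set 'rV[R]_d) (f g : 'rV[R]_d -> R).

Definition partial (i : 'I_d) f : 'rV[R]_d -> R :=
  fun x => 'D_(delta_mx 0 i) f x.

Definition grad f x : 'rV[R]_d := \row_i partial i f x.

Definition laplacian f x : R := \sum_i partial i (partial i f) x.

(* On U, f has all iterated partial derivatives up to order k, and f and these
   derivatives all satisfy P. *)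
Fixpoint regular (P : ('rV[R]_d -> R) -> Prop) U k f : Prop :=
  P f /\
  if k is k'.+1 then
    forall i, (forall x, U x -> derivable f x (delta_mx 0 i)) /\
              regular P U k' (partial i f)
  else True.

Definition Ck U k f : Prop :=
  regular (fun g => {within U, continuous g}) U k f.

Definition Cinfty U f : Prop := forall k, Ck U k f.

Definition continuous_extends Omega f : Prop :=
  exists g, {within closure Omega, continuous g} /\
            forall x, Omega x -> f x = g x.

(* C^k of the closure: the derivatives up to order k on the open set Omega
   extend continuously to the closure of Omega. *)
Definition Ck_closure Omega k f : Prop :=
  regular (continuous_extends Omega) Omega k f.

Definition Cc_infty Omega f : Prop :=
  [/\ Cinfty setT f, compact (closure [set x | f x != 0]) &
      closure [set x | f x != 0] `<=` Omega].

Definition bdry Omega : set 'rV[R]_d := closure Omega `\` Omega°.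

(* Value at a boundary point of the continuous extension of f. *)
Definition bdry_value Omega f x : R := lim (f y @[y --> within Omega (nbhs x)]).

Definition local_defining_function Omega U x (rho : 'rV[R]_d -> R) : Prop :=
  [/\ open U, U x, Cinfty U rho, forall y, U y -> grad rho y != 0 &
      Omega `&` U = [set y | U y /\ rho y < 0]].

Definition smooth_boundary Omega : Prop :=
  forall x, bdry Omega x -> exists U rho, local_defining_function Omega U x rho.

(* Unique, and defined at every point of the boundary, when that is smooth. *)
Definition outer_normal Omega x : 'rV[R]_d :=
  get [set n | exists U rho, local_defining_function Omega U x rho /\
                             n = (enorm (grad rho x))^-1 *: grad rho x].

Definition smooth_bounded_domain Omega : Prop :=
  [/\ open Omega, connected Omega, Omega !=set0, bounded_set Omega &
      smooth_boundary Omega].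

End smooth_functions.

Section sparse_vector_field_regularization.
Context {R : realType} {d : nat}.
Implicit Types (Omega : set 'rV[R]_d) (u : 'rV[R]_d -> R) (v : @vmeasure R d).

(* Elements of L^1(Omega) are represented by functions on R^d, of which only the
   restriction to Omega matters; they are identified up to ae_eq_on. *)
Definition L1 Omega : set ('rV[R]_d -> R) :=
  [set u | (lebesgue_rV d).-integrable Omega (EFin \o u)].

Definition ae_eq_on Omega u w : Prop :=
  {ae lebesgue_rV d, forall x, Omega x -> u x = w x}.

Definition L1_norm Omega u : \bar R :=
  (\int[lebesgue_rV d]_(x in Omega) `|u x|%:E)%E.

Definition L1_diamond Omega : set ('rV[R]_d -> R) :=
  [set u | L1 Omega u /\ \int[lebesgue_rV d]_(x in Omega) u x = 0].

Definition neumann_test Omega (phi : 'rV[R]_d -> R) : Prop :=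
  Ck_closure Omega 2 phi /\
  forall x, bdry Omega x ->
    dotv (\row_i bdry_value Omega (partial i phi) x) (outer_normal Omega x) = 0.

Definition weak_no_flux_poisson Omega u v : Prop :=
  forall phi, neumann_test Omega phi ->
    \int[lebesgue_rV d]_(x in Omega) (u x * laplacian phi x)
      + vintegral Omega (grad phi) v = 0.

Definition sparse_reg Omega u : \bar R :=
  ereal_inf [set vmeasure_norm Omega v | v in
    [set v | vmeasure_on Omega v /\ weak_no_flux_poisson Omega u v]].

Lemma continuous_extends_measurable Omega (f : 'rV[R]_d -> R) :
  open Omega -> continuous_extends Omega f -> measurable_fun Omega f.
Proof.
move=> oO [g [cg fg]].
apply: (@eq_measurable_fun _ _ _ _ Omega g) => [x /set_mem /fg //|].
apply: (measurability _ (RGenOpens.measurableE R)).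
move=> _ [_ [a [b ->]] <-]; apply: open_measurable_rV.
have /continuousP cgO := continuous_subspaceW (@subset_closure _ Omega) cg.
have /open_subspaceP[V oV VO] : open (from_subspace Omega g @^-1` `]a, b[).
  by apply: cgO; exact: interval_open.
by rewrite setIC -VO; exact: openI.
Qed.

Lemma sparse_reg_ae_eq Omega u w : open Omega -> L1 Omega u -> L1 Omega w ->
  ae_eq_on Omega u w -> sparse_reg Omega u = sparse_reg Omega w.
Proof.
move=> oO Lu Lw uw; rewrite /sparse_reg; congr (ereal_inf (image _ _)).
suff H v phi : neumann_test Omega phi ->
    \int[lebesgue_rV d]_(x in Omega) (u x * laplacian phi x) =
    \int[lebesgue_rV d]_(x in Omega) (w x * laplacian phi x).
  by apply/seteqP; split=> v [vO uv]; split=> // phi Tphi;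
    rewrite -(uv phi Tphi) H.
move=> [[_ Cphi] _].
have mlap : measurable_fun Omega (laplacian phi).
  apply: measurable_sum => i; apply: continuous_extends_measurable => //.
  by have [_ [_ /(_ i)[_ []]]] := Cphi i.
congr fine; apply: ae_eq_integral.
- exact: open_measurable_rV.
- apply/measurable_EFinP/measurable_funM => //.
  by apply/measurable_EFinP; case/integrableP: Lu.
- apply/measurable_EFinP/measurable_funM => //.
  by apply/measurable_EFinP; case/integrableP: Lw.
- by apply: filterS uw => x uwx Ox; rewrite uwx.
Qed.

Definition dom_sparse_reg Omega : set ('rV[R]_d -> R) :=
  [set u | L1 Omega u /\ (sparse_reg Omega u < +oo)%E].

Definition distributional_gradient Omega u v : Prop :=
  forall phi, Cc_infty Omega phi -> forall i,
    \int[lebesgue_rV d]_(x in Omega) (u x * partial i phi x)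
      = - charge_integral (v i) Omega phi.

Definition BV Omega u : Prop :=
  L1 Omega u /\
  exists v, vmeasure_on Omega v /\ distributional_gradient Omega u v.

Definition TV Omega u (uBV : BV Omega u) : \bar R :=
  vmeasure_norm Omega (projT1 (cid (proj2 uBV))).

Definition linear_subspace (V : set ('rV[R]_d -> R)) : Prop :=
  [/\ V (cst 0), forall u w, V u -> V w -> V (u \+ w) &
      forall a u, V u -> V (fun x => a * u x)].

Definition norm_on Omega (V : set ('rV[R]_d -> R))
    (N : ('rV[R]_d -> R) -> \bar R) : Prop :=
  [/\ forall u, V u -> (0 <= N u < +oo)%E,
      forall u, V u -> N u = 0%E <-> ae_eq_on Omega u (cst 0),
      forall a u, V u -> N (fun x => a * u x) = (`|a|%:E * N u)%E &
      forall u w, V u -> V w -> (N (u \+ w)%R <= N u + N w)%E].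

End sparse_vector_field_regularization.

(* Main.v *)
Require Import Defs.
From HB Require Import structures.
From mathcomp Require Import all_boot all_order all_algebra.
From mathcomp Require Import all_classical all_reals all_analysis.
From mathcomp Require Import measurable_realfun.
From mathcomp Require Import lra.

Set Implicit Arguments.
Unset Strict Implicit.
Unset Printing Implicit Defensive.

Import Order.TTheory GRing.Theory Num.Theory.
Import numFieldNormedType.Exports.

Local Open Scope classical_set_scope.
Local Open Scope ring_scope.


(* Part (iii) is the divergence theorem for BV functions and fields tangent to the boundary: such a
   field F, multiplied by a cutoff function of the distance to the boundary and mollified, becomes an
   admissible test field, and the error vanishes because F . grad rho = O(rho) for a global defining
   function rho.

   For part (i), a Neumann parametrix replaces elliptic regularity. With the reflection
   T x = x - 2 rho grad rho / |grad rho|^2 in the boundary and Gaussians G_s of width s, the kernel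
   k_s(x, y) = G_s(x - y) + Theta(x) G_s(T x - y) satisfies the Neumann condition exactly and the heat
   equation in the time t = s^2 up to an error O(1/s) G_s. Hence the integrals Phi of
   2 s exp(- lam s^2) k_s(x, y) f(y) over (s, y) in [eps, 1] x Omega are test functions such that
   (Delta - lam) Phi = - exp(- lam eps^2) S_eps f + r, where S_eps f tends to kappa f and |r| is
   small for large lam, while Phi and grad Phi are bounded uniformly in eps. Testing with them bounds
   the L^1 norm of u by R(u) and, by equicontinuity of Phi, finitely many integrals of u. These
   integrals are removed by contradiction: a limit u of counterexamples is a weak solution with zero
   vector field. Solving (Delta - lam) phi_n = - lam u approximately by a Neumann series gives smooth
   phi_n converging to u in L^1 with Delta phi_n tending to 0 in L^1; testing Delta phi_n with
   atan phi_n shows that grad (atan phi_n) tends to 0, so that u is constant. *)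

(** * Integration of real functions *)

(** The datum u is only integrable, so every estimate goes by duality, and the test functions must
    be C^2 up to the boundary and satisfy the Neumann condition exactly; this calls for a kernel
    adapted to the boundary. Reflection serves because the Jacobian of T is orthogonal up to a
    multiple of rho, while |rho x| <= C |T x - y| for y in Omega: the error in the heat equation
    thus gains a factor |T x - y|, comparable to s under the Gaussian, which turns s^-2 into s^-1.
    The time element 2 s ds absorbs this s^-1 and also that of one derivative, whence bounds uniform
    in eps. Splitting the times at a small delta leaves a small part and a part whose kernels are
    Lipschitz in x, so only integrals of u over finitely many fixed sets remain. In the uniqueness
    step the Laplacian of phi_n is small only in L^1, so a multiplier in the energy identity has to
    be bounded; atan is bounded, increasing and 1-Lipschitz, and its inverse recovers u. Since atan
    u has no gradient a priori, its constancy is read off finite differences. *)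

Section real_integrable.
Context d (T : measurableType d) (R : realType).
Variable mu : {measure set T -> \bar R}.
Implicit Types (D : set T) (f g : T -> R).

Definition rintegrable D f := mu.-integrable D (EFin \o f).

Lemma rintegrable_measurable D f : rintegrable D f -> measurable_fun D f.
Proof. by move=> /integrableP[/measurable_EFinP]. Qed.

Lemma rintegrableD D f g : measurable D -> rintegrable D f -> rintegrable D g ->
  rintegrable D (fun x => f x + g x).
Proof. by move=> mD If Ig; have := integrableD mD If Ig. Qed.

Lemma rintegrableZ D f (c : R) : measurable D -> rintegrable D f ->
  rintegrable D (fun x => c * f x).
Proof. by move=> mD If; have := integrableZl mD c If. Qed.

Lemma rintegrableN D f : measurable D -> rintegrable D f ->
  rintegrable D (fun x => - f x).
Proof.
move=> mD If; have := rintegrableZ (-1) mD If.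
by congr rintegrable; apply/funext => x; rewrite mulN1r.
Qed.

Lemma rintegrableB D f g : measurable D -> rintegrable D f -> rintegrable D g ->
  rintegrable D (fun x => f x - g x).
Proof. by move=> mD If Ig; apply: rintegrableD => //; exact: rintegrableN. Qed.

Lemma rintegrable_le D f g : measurable D -> measurable_fun D f ->
  (forall x, D x -> `|f x| <= g x) -> rintegrable D g -> rintegrable D f.
Proof.
move=> mD mf fg Ig; apply: le_integrable Ig => //; first exact/measurable_EFinP.
by move=> x Dx /=; rewrite lee_fin (le_trans (fg _ Dx))// ler_norm.
Qed.

Lemma rintegrable_norm D f : measurable D -> rintegrable D f ->
  rintegrable D (fun x => `|f x|).
Proof.
move=> mD If; have mf := rintegrable_measurable If.
apply: le_integrable If => //; first by apply/measurable_EFinP; exact: measurableT_comp.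
by move=> x Dx /=; rewrite normr_id.
Qed.

Lemma rintegrable_cst D (c : R) : measurable D -> (mu D < +oo)%E ->
  rintegrable D (fun=> c).
Proof.
move=> mD Doo; apply: measurable_bounded_integrable => //.
exact: bounded_cst.
Qed.

Lemma rintegrable_bounded D f (C : R) : measurable D -> (mu D < +oo)%E ->
  measurable_fun D f -> (forall x, D x -> `|f x| <= C) -> rintegrable D f.
Proof.
move=> mD Doo mf fC; apply: (rintegrable_le mD mf fC).
exact: rintegrable_cst.
Qed.

Lemma rintegrableMb D f g (C : R) : measurable D -> rintegrable D f ->
  measurable_fun D g -> (forall x, D x -> `|g x| <= C) ->
  rintegrable D (fun x => f x * g x).
Proof.
move=> mD If mg gC; apply: (@rintegrable_le _ _ (fun x => C * `|f x|)) => //.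
- by apply: measurable_funM => //; exact: rintegrable_measurable.
- by move=> x Dx; rewrite normrM mulrC ler_wpM2r// gC.
- by apply: rintegrableZ => //; exact: rintegrable_norm.
Qed.

Lemma rintegrable_sum D (I : finType) (f : I -> T -> R) : measurable D ->
  (forall i, rintegrable D (f i)) -> rintegrable D (fun x => \sum_i f i x).
Proof.
move=> mD If; have := @integrable_sum _ _ _ mu _ mD I (index_enum I) xpredT
  (fun i => EFin \o f i) (fun i _ => If i).
by congr integrable; apply/funext => x /=; rewrite sumEFin.
Qed.

Lemma rintegrableS D E f : measurable D -> measurable E -> E `<=` D ->
  rintegrable D f -> rintegrable E f.
Proof. by move=> mD mE ED; exact: integrableS. Qed.

Lemma rintegrable_eq D f g : measurable D -> (forall x, D x -> f x = g x) -> rintegrable D f ->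
  rintegrable D g.
Proof.
move=> mD fg; rewrite /rintegrable => If; apply: eq_integrable If => // x /set_mem Dx /=.
by rewrite fg.
Qed.

Lemma Rintegral_sum D (I : finType) (f : I -> T -> R) : measurable D ->
  (forall i, rintegrable D (f i)) ->
  \int[mu]_(x in D) (\sum_i f i x) = \sum_i \int[mu]_(x in D) f i x.
Proof.
move=> mD If.
suff H (s : seq I) : rintegrable D (fun x => \sum_(i <- s) f i x) /\
    \int[mu]_(x in D) (\sum_(i <- s) f i x) = \sum_(i <- s) \int[mu]_(x in D) f i x.
  by case: (H (index_enum I)).
elim: s => [|i s [IHi IH]].
  have E : (fun x : T => \sum_(i <- [::]) f i x) = cst 0.
    by apply/funext => x; rewrite big_nil.
  rewrite E; split; first exact: integrable0.
  by rewrite big_nil /Rintegral integral0.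
have E : (fun x : T => \sum_(j <- i :: s) f j x) =
    (fun x => f i x + \sum_(j <- s) f j x).
  by apply/funext => x; rewrite big_cons.
by rewrite E; split; [exact: rintegrableD|rewrite (RintegralD mD (If i) IHi) big_cons IH].
Qed.

Lemma Rintegral_bound D f (C : R) : measurable D -> (mu D < +oo)%E ->
  measurable_fun D f -> (forall x, D x -> `|f x| <= C) ->
  `|\int[mu]_(x in D) f x| <= C * fine (mu D).
Proof.
move=> mD Doo mf fC; have If := rintegrable_bounded mD Doo mf fC.
apply: (le_trans (le_normr_Rintegral mD If)).
rewrite -Rintegral_cst//; apply: le_Rintegral => //.
- exact: rintegrable_norm.
- exact: rintegrable_cst.
Qed.

Lemma Rintegral_normM D f g (C : R) : measurable D -> rintegrable D f ->
  measurable_fun D g -> (forall x, D x -> `|g x| <= C) ->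
  `|\int[mu]_(x in D) (f x * g x)| <= C * \int[mu]_(x in D) `|f x|.
Proof.
move=> mD If mg gC; have Ifg := rintegrableMb mD If mg gC.
apply: (le_trans (le_normr_Rintegral mD Ifg)).
rewrite -RintegralZl//; last exact: rintegrable_norm.
apply: le_Rintegral => //; [exact: rintegrable_norm| |].
- by apply: rintegrableZ => //; exact: rintegrable_norm.
- by move=> x Dx; rewrite normrM mulrC ler_wpM2r// gC.
Qed.

Lemma Rintegral_dominated D (f_ : nat -> T -> R) f g : measurable D ->
  (forall n, measurable_fun D (f_ n)) -> measurable_fun D f ->
  (forall x, D x -> f_ ^~ x @ \oo --> f x) -> rintegrable D g ->
  (forall n x, D x -> `|f_ n x| <= g x) ->
  rintegrable D f /\
  (fun n => \int[mu]_(x in D) f_ n x) @ \oo --> \int[mu]_(x in D) f x.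
Proof.
move=> mD mf_ mf ff Ig fg.
have mf_E n : measurable_fun D (EFin \o f_ n) by exact/measurable_EFinP.
have mfE : measurable_fun D (EFin \o f) by exact/measurable_EFinP.
have ffE : {ae mu, forall x, D x -> (EFin \o f_ n) x @[n --> \oo] --> (EFin \o f) x}.
  by apply: aeW => x Dx; apply: cvg_EFin; [exact: nearW|exact: ff].
have fgE : {ae mu, forall x n, D x -> (`|(EFin \o f_ n) x| <= (EFin \o g) x)%E}.
  by apply: aeW => x n Dx /=; rewrite lee_fin fg.
have [If _ cvgf] := dominated_convergence mD mf_E mfE ffE Ig fgE.
split => //; apply: fine_cvg; rewrite fineK//; exact: integrable_fin_num.
Qed.

Lemma EFin_Rintegral D f : measurable D -> rintegrable D f ->
  (\int[mu]_(x in D) f x)%:E = (\int[mu]_(x in D) (f x)%:E)%E.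
Proof. by move=> mD If; rewrite /Rintegral fineK//; exact: integrable_fin_num. Qed.

Lemma Rintegral_abs_eq0 D f : measurable D -> rintegrable D f ->
  \int[mu]_(x in D) `|f x| = 0 <-> {ae mu, forall x, D x -> f x = 0}.
Proof.
move=> mD If.
have If' := rintegrable_norm mD If.
have mf : measurable_fun D (EFin \o f) by exact: measurable_int If.
have [H1 H2] := ae_eq_integral_abs mu mD mf.
have E : (\int[mu]_(x in D) `|f x|)%:E = (\int[mu]_(x in D) `|(EFin \o f) x|)%E.
  by rewrite EFin_Rintegral.
split=> [f0|f0].
  have /H1 : (\int[mu]_(x in D) `|(EFin \o f) x| = 0)%E by rewrite -E f0.
  by apply: filterS => x /[apply] -[].
suff H : ae_eq mu D (EFin \o f) (cst 0%E) by have := H2 H; rewrite -E => -[].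
by apply: filterS f0 => x /[apply] /= ->.
Qed.

Lemma Rintegral_abs_ge0 D f : 0 <= \int[mu]_(x in D) `|f x|.
Proof. exact: Rintegral_ge0. Qed.

Lemma le_Rintegral_abs D f g : measurable D -> rintegrable D f ->
  rintegrable D g -> (forall x, D x -> `|f x| <= `|g x|) ->
  \int[mu]_(x in D) `|f x| <= \int[mu]_(x in D) `|g x|.
Proof. by move=> mD If Ig fg; apply: le_Rintegral => //; exact: rintegrable_norm. Qed.

Lemma Rintegral_absD D f g : measurable D -> rintegrable D f -> rintegrable D g ->
  \int[mu]_(x in D) `|f x + g x| <=
  \int[mu]_(x in D) `|f x| + \int[mu]_(x in D) `|g x|.
Proof.
move=> mD If Ig; have If' := rintegrable_norm mD If; have Ig' := rintegrable_norm mD Ig.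
rewrite -RintegralD//; apply: le_Rintegral => //.
- by apply: rintegrable_norm => //; exact: rintegrableD.
- exact: rintegrableD.
- by move=> x _; exact: ler_normD.
Qed.

Lemma Rintegral_absZ D f (c : R) : measurable D -> rintegrable D f ->
  \int[mu]_(x in D) `|c * f x| = `|c| * \int[mu]_(x in D) `|f x|.
Proof.
move=> mD If; rewrite -RintegralZl//; last exact: rintegrable_norm.
by under eq_Rintegral do rewrite normrM.
Qed.

Lemma rintegrable_ge0 D f : measurable_fun D f -> (forall x, D x -> 0 <= f x) ->
  (\int[mu]_(x in D) (f x)%:E < +oo)%E -> rintegrable D f.
Proof.
move=> mf f0 foo; apply/integrableP; split; first exact/measurable_EFinP.
rewrite (eq_integral (fun x => (f x)%:E))// => x /set_mem Dx /=.
by rewrite ger0_norm// f0.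
Qed.

End real_integrable.

(** * Tonelli and Fubini on rectangles *)

Section real_fubini.
Context d1 d2 (T1 : measurableType d1) (T2 : measurableType d2) (R : realType).
Variables (m1 : {sigma_finite_measure set T1 -> \bar R})
          (m2 : {sigma_finite_measure set T2 -> \bar R}).
Variables (A : set T1) (B : set T2).
Hypotheses (mA : measurable A) (mB : measurable B).
Implicit Types f : T1 * T2 -> R.

Let F f : T1 * T2 -> R := f \_ (A `*` B).

Let F_E f x y : F f (x, y) = if (x \in A) && (y \in B) then f (x, y) else 0.
Proof. by rewrite /F patchE in_setX. Qed.

(** Extension by zero ([F]) carries the rectangle to the whole product space, where Tonelli's
    theorem applies; off A or B the inner integrals vanish. *)
Lemma tonelli_set f : measurable_fun (A `*` B) f ->
  (forall z, (A `*` B) z -> 0 <= f z) ->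
  (\int[m1 \x m2]_(z in A `*` B) (f z)%:E =
     \int[m1]_(x in A) \int[m2]_(y in B) (f (x, y))%:E)%E /\
  (\int[m1 \x m2]_(z in A `*` B) (f z)%:E =
     \int[m2]_(y in B) \int[m1]_(x in A) (f (x, y))%:E)%E.
Proof.
move=> mf f0.
have mF : measurable_fun setT (fun z => (F f z)%:E).
  apply/measurable_EFinP; apply/(measurable_restrictT _ _).1 => //.
  exact: measurableX.
have F0 z : (0 <= (F f z)%:E)%E.
  by rewrite lee_fin /F patchE; case: ifPn => // /set_mem; exact: f0.
have -> : (\int[m1 \x m2]_(z in A `*` B) (f z)%:E = \int[m1 \x m2]_z (F f z)%:E)%E.
  rewrite integral_mkcond; apply: eq_integral => z _.
  by rewrite /F !patchE; case: ifPn.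
split.
  rewrite fubini_tonelli1// [RHS]integral_mkcond; apply: eq_integral => x _.
  rewrite /fubini_F patchE; case: ifPn => xA.
    rewrite [RHS]integral_mkcond; apply: eq_integral => y _.
    by rewrite F_E patchE xA/=; case: ifPn.
  by rewrite integral0_eq// => y _; rewrite F_E (negbTE xA).
rewrite fubini_tonelli2// [RHS]integral_mkcond; apply: eq_integral => y _.
rewrite /fubini_G patchE; case: ifPn => yB.
  rewrite [RHS]integral_mkcond; apply: eq_integral => x _.
  by rewrite F_E patchE yB andbT/=; case: ifPn.
by rewrite integral0_eq// => x _; rewrite F_E (negbTE yB) andbF.
Qed.

Lemma fubini_set f (C : R) : (m1 A < +oo)%E -> (m2 B < +oo)%E ->
  measurable_fun (A `*` B) f -> (forall z, (A `*` B) z -> `|f z| <= C) ->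
  \int[(m1 \x m2)%E]_(z in A `*` B) f z =
     \int[m1]_(x in A) \int[m2]_(y in B) f (x, y) /\
  \int[(m1 \x m2)%E]_(z in A `*` B) f z =
     \int[m2]_(y in B) \int[m1]_(x in A) f (x, y).
Proof.
move=> Aoo Boo mf fC.
have mAB : measurable (A `*` B) by exact: measurableX.
have ABoo : ((m1 \x m2)%E (A `*` B) < +oo)%E.
  by rewrite product_measure1E// lte_mul_pinfty// ge0_fin_numE.
have If := rintegrable_bounded mAB ABoo mf fC.
have IF : (m1 \x m2)%E.-integrable setT (EFin \o F f).
  rewrite /F; have /(integrable_mkcond _ mAB) := If.
  by congr (integrable _ _ _); apply/funext => z; rewrite restrict_EFin.
have mFf : measurable_fun setT (F f).
  by apply/(measurable_restrictT _ _).1.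
(* [F] vanishes off the rectangle and [C] may be negative when the rectangle is empty; hence the
   maximum with 0. *)
have FC x y : `|F f (x, y)| <= Num.max C 0.
  rewrite F_E; case: ifPn => [/andP[/set_mem ? /set_mem ?]|_].
    by rewrite le_max fC.
  by rewrite normr0 le_max lexx orbT.
have mFx x : measurable_fun setT (fun y => F f (x, y)).
  by apply: measurableT_comp => //; exact: measurable_pair1.
have mFy y : measurable_fun setT (fun x => F f (x, y)).
  by apply: measurableT_comp => //; exact: measurable_pair2.
have E : (\int[m1 \x m2]_(z in A `*` B) (f z)%:E =
    \int[m1 \x m2]_z (EFin \o F f) z)%E.
  rewrite integral_mkcond; apply: eq_integral => z _.
  by rewrite /F /= !patchE; case: ifPn.
split.
  rewrite {1}/Rintegral E -integral12_prod_meas1//.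
  rewrite Rintegral_mkcond; congr fine; apply: eq_integral => x _.
  rewrite /fubini_F patchE; case: ifPn => xA; last first.
    by rewrite integral0_eq// => y _ /=; rewrite F_E (negbTE xA).
  rewrite EFin_Rintegral//.
    rewrite [RHS]integral_mkcond; apply: eq_integral => y _ /=.
    by rewrite F_E patchE xA/=; case: ifPn.
  apply: (@rintegrable_eq _ _ _ m2 _ (fun y => F f (x, y))) => //.
    by move=> y By; rewrite F_E xA mem_set.
  by apply: (rintegrable_bounded mB Boo (C := Num.max C 0)) => //; exact: measurable_funTS.
rewrite {1}/Rintegral E -integral21_prod_meas1//.
rewrite Rintegral_mkcond; congr fine; apply: eq_integral => y _.
rewrite /fubini_G patchE; case: ifPn => yB; last first.
  by rewrite integral0_eq// => x _ /=; rewrite F_E (negbTE yB) andbF.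
rewrite EFin_Rintegral//.
  rewrite [RHS]integral_mkcond; apply: eq_integral => x _ /=.
  by rewrite F_E patchE yB andbT; case: ifPn.
apply: (@rintegrable_eq _ _ _ m1 _ (fun x => F f (x, y))) => //.
  by move=> x Ax; rewrite F_E yB mem_set.
by apply: (rintegrable_bounded mA Aoo (C := Num.max C 0)) => //; exact: measurable_funTS.
Qed.

End real_fubini.

(** * Translation invariance of Lebesgue measure *)

Section lebesgue_translation.
Context {R : realType}.
Local Notation leb := (@lebesgue_measure R).

Definition translate (a x : measurableTypeR R) : measurableTypeR R := x + a.

Lemma measurable_translate a : measurable_fun setT (translate a).
Proof. by apply: measurable_funD. Qed.

HB.instance Definition _ a :=
  isMeasurableFun.Build _ _ _ _ (translate a) (measurable_translate a).

(** The image of the measure under the translation agrees with it on half-open intervals, and these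
    determine Lebesgue measure. *)
Lemma lebesgue_measure_translate (a : R) (A : set R) : measurable A ->
  leb (translate a @^-1` A) = leb A.
Proof.
move=> mA; symmetry.
apply: (@lebesgue_measure_unique R (pushforward leb (translate a))) => // X [[b c] _ <-].
rewrite /pushforward/=.
rewrite [X in _ = leb X](_ : _ = `]b - a, c - a]%classic); last first.
  by apply/seteqP; split=> x /=; rewrite /translate !in_itv/= ltrBlDr lerBrDr.
rewrite !lebesgue_measure_itv/= !lte_fin.
have -> : (b - a < c - a) = (b < c) by lra.
by case: ifP => // _; rewrite -!EFinB; congr EFin; lra.
Qed.

Lemma ge0_integral_translate (a : R) (f : R -> \bar R) : measurable_fun setT f ->
  (forall x, (0 <= f x)%E) ->
  (\int[leb]_x f (x + a)%R = \int[leb]_x f x)%E.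
Proof.
move=> mf f0.
have -> : (\int[leb]_x f x = \int[pushforward leb (translate a)]_x f x)%E.
  by apply: eq_measure_integral => A mA _; symmetry; exact: lebesgue_measure_translate.
by rewrite ge0_integral_pushforward.
Qed.

Lemma ge0_integral_rV_succ d (f : 'rV[R]_d.+1 -> \bar R) :
  measurable_fun setT f -> (forall x, (0 <= f x)%E) ->
  (\int[lebesgue_rV d.+1]_x f x =
   \int[leb]_a \int[lebesgue_rV d]_b f (rV_cons (a, b)))%E.
Proof.
move=> mf f0.
have H := @ge0_integral_pushforward _ _ (measurableTypeR R * 'rV[R]_d)%type _ R
  (@rV_cons R d) (@measurable_rV_cons R d)
  (leb \x lebesgue_rV d)%E _ _ measurableT mf (in1W f0).
have mfc : measurable_fun [set: measurableTypeR R * 'rV[R]_d] (f \o @rV_cons R d).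
  by apply: measurableT_comp => //; exact: (@measurable_rV_cons R _).
transitivity (\int[(leb \x lebesgue_rV d)]_z (f \o @rV_cons R d) z)%E.
  rewrite -(preimage_setT (@rV_cons R d)) -H; apply: eq_measure_integral => [|//]; exact: (@measurable_rV_cons R d).
by rewrite (@fubini_tonelli1 _ _ _ _ _ leb (lebesgue_rV d) (f \o @rV_cons R d)) // => z; exact: f0.
Qed.

Lemma rV_cons_add d (a b : R) (x y : 'rV[R]_d) :
  rV_cons (a, x) + rV_cons (b, y) = rV_cons (a + b, x + y).
Proof.
apply/rowP => i; rewrite /rV_cons !mxE.
by case: (@fintype.split 1 d i) => j; rewrite !mxE.
Qed.

Lemma rV_unconsK d : cancel (@rV_uncons R d) (@rV_cons R d).
Proof.
move=> v; apply/rowP => i; rewrite /rV_cons !mxE.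
by case: splitP => j ij; rewrite !mxE; congr (v _ _); apply/val_inj; rewrite /= ij// (ord1 j).
Qed.

Lemma measurable_addr d (h : 'rV[R]_d) : measurable_fun [set: 'rV[R]_d] (fun x : 'rV[R]_d => x + h).
Proof.
apply: continuous_measurable_rV => x.
by apply: (@cvgD R 'rV[R]_d _ (nbhs x) _ id (cst h) x h); [exact: cvg_id|exact: cvg_cst].
Qed.

(** Induction on the dimension: splitting off the first coordinate turns the translation into one on
    the line and one in dimension d. In dimension 0 all row vectors coincide. *)
Lemma ge0_integral_rV_translate d (h : 'rV[R]_d) (f : 'rV[R]_d -> \bar R) :
  measurable_fun setT f -> (forall x, (0 <= f x)%E) ->
  (\int[lebesgue_rV d]_x f (x + h)%R = \int[lebesgue_rV d]_x f x)%E.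
Proof.
elim: d h f => [|d IH] h f mf f0.
  by apply: eq_integral => x _; congr f; apply/rowP => -[].
have mfh : measurable_fun [set: 'rV[R]_d.+1] (fun x : 'rV[R]_d.+1 => f (x + h)).
  by apply: measurableT_comp => //; exact: measurable_addr.
rewrite !ge0_integral_rV_succ//.
rewrite -(rV_unconsK h); case: (rV_uncons h) => a k.
pose g (s : R) := (\int[lebesgue_rV d]_b f (rV_cons (s, b)))%E.
have mg : measurable_fun setT g.
  apply: (@measurable_fun_fubini_tonelli_F _ _ _ _ _ (lebesgue_rV d)
    (fun z => f (rV_cons z))) => //.
  by apply: measurableT_comp => //; exact: (@measurable_rV_cons R _).
rewrite -(ge0_integral_translate a mg); last by move=> x; exact: integral_ge0.
apply: eq_integral => s _; rewrite /g.
under eq_integral do rewrite rV_cons_add.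
apply: (IH k (fun b => f (rV_cons (s + a, b)))) => //.
apply: measurableT_comp => //; apply: measurableT_comp; first exact: (@measurable_rV_cons R _).
exact: measurable_pair1.
Qed.

Lemma lebesgue_rV_translate d (h : 'rV[R]_d) (A : set 'rV[R]_d) : measurable A ->
  lebesgue_rV d ((fun x : 'rV[R]_d => x + h) @^-1` A) = lebesgue_rV d A.
Proof.
move=> mA.
have mA' : measurable ((fun x : 'rV[R]_d => x + h) @^-1` A).
  by rewrite -[X in measurable X]setTI; exact: measurable_addr.
rewrite -[LHS]mul1e -[RHS]mul1e -!integral_cst// integral_mkcond [RHS]integral_mkcond.
rewrite -[RHS](ge0_integral_rV_translate h).
- apply: eq_integral => x _; rewrite !patchE.
  by rewrite (_ : (x \in _) = (x + h \in A))//; apply/idP/idP; rewrite !inE.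
- by apply/(measurable_restrictT _ _).1 => //; exact: measurable_cst.
- by move=> x; rewrite patchE; case: ifP.
Qed.

Lemma Rintegral_rV_translate d (h : 'rV[R]_d) (D : set 'rV[R]_d) (f : 'rV[R]_d -> R) :
  measurable D -> rintegrable (lebesgue_rV d) D f ->
  rintegrable (lebesgue_rV d) ((fun x : 'rV[R]_d => x + h) @^-1` D) (fun x => f (x + h)) /\
  \int[lebesgue_rV d]_(x in (fun x => x + h) @^-1` D) f (x + h) =
  \int[lebesgue_rV d]_(x in D) f x.
Proof.
move=> mD If.
have mD' : measurable ((fun x : 'rV[R]_d => x + h) @^-1` D).
  by rewrite -[X in measurable X]setTI; exact: measurable_addr.
have [g gE] : {g | g = (EFin \o f) \_ D} by exists ((EFin \o f) \_ D).
have mg : measurable_fun setT g.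
  by rewrite gE; apply/(measurable_restrictT _ _).1 => //; exact: measurable_int If.
have gh : (fun x => g (x + h)%R) = (fun x => (f (x + h))%:E) \_ ((fun x : 'rV[R]_d => x + h) @^-1` D).
  apply/funext => x; rewrite gE !patchE.
  by rewrite (_ : (x \in _) = (x + h \in D))//; apply/idP/idP; rewrite !inE.
have mgh : measurable_fun [set: 'rV[R]_d] (fun x : 'rV[R]_d => g (x + h)).
  by apply: measurableT_comp => //; exact: measurable_addr.
have Ig : (lebesgue_rV d).-integrable setT g.
  by rewrite gE; exact/(integrable_mkcond _ mD).
have Igh : (lebesgue_rV d).-integrable setT (fun x : 'rV[R]_d => g (x + h)).
  apply/integrableP; split => //.
  rewrite (ge0_integral_rV_translate h (f := fun x => `|g x|%E))//; last exact: measurableT_comp.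
  by case/integrableP : Ig.
split; first by apply/(integrable_mkcond _ mD'); rewrite -gh.
rewrite /Rintegral.
have -> : (\int[lebesgue_rV d]_(x in (fun x : 'rV[R]_d => x + h)%R @^-1` D) (f (x + h)%R)%:E =
    \int[lebesgue_rV d]_x g (x + h)%R)%E.
  by rewrite integral_mkcond -gh.
have -> : (\int[lebesgue_rV d]_(x in D) (f x)%:E = \int[lebesgue_rV d]_x g x)%E.
  by rewrite integral_mkcond gE.
rewrite (integralE _ _ g) (integralE _ _ (fun x : 'rV[R]_d => g (x + h)%R)).
congr (fine (_ - _)%E).
- rewrite -[RHS](@ge0_integral_rV_translate d h g^\+%E (measurable_funepos mg))//.
  by apply: eq_integral => x _; rewrite !funeposE.
- rewrite -[RHS](@ge0_integral_rV_translate d h g^\-%E (measurable_funeneg mg))//.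
  by apply: eq_integral => x _; rewrite !funenegE.
Qed.

End lebesgue_translation.

(** * Gaussians *)

Section gaussian.
Context {R : realType}.
Local Notation leb := (@lebesgue_measure R).
Implicit Types b s : R.

Definition sqn d (x : 'rV[R]_d) : R := dotv x x.

Lemma sqn_ge0 d (x : 'rV[R]_d) : 0 <= sqn x.
Proof. by apply: sumr_ge0 => i _; rewrite -expr2 sqr_ge0. Qed.

Lemma continuous_coord d (i : 'I_d) : continuous (fun x : 'rV[R]_d => x 0 i).
Proof. exact: coord_continuous. Qed.

Lemma continuous_rsum (T : topologicalType) (I : finType) (F : I -> T -> R) (x : T) :
  (forall i, {for x, continuous (F i)}) ->
  {for x, continuous (fun x => \sum_i F i x)}.
Proof.
move=> cF; suff H (s : seq I) : {for x, continuous (fun x => \sum_(i <- s) F i x)}.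
  exact: H.
elim: s => [|i s IH].
  by under [X in {for _, continuous X}]eq_fun do rewrite big_nil; exact: cst_continuous.
have -> : (fun x => \sum_(j <- i :: s) F j x) = (fun x => F i x + \sum_(j <- s) F j x).
  by apply/funext => y; rewrite big_cons.
by apply: continuousD; [exact: cF|exact: IH].
Qed.

Lemma for_continuousM (T : topologicalType) (f g : T -> R) (x : T) :
  {for x, continuous f} -> {for x, continuous g} ->
  {for x, continuous (fun y => f y * g y)}.
Proof. exact: continuousM. Qed.

Lemma for_continuousD (T : topologicalType) (f g : T -> R) (x : T) :
  {for x, continuous f} -> {for x, continuous g} ->
  {for x, continuous (fun y => f y + g y)}.
Proof. exact: continuousD. Qed.

Lemma for_continuousN (T : topologicalType) (f : T -> R) (x : T) :
  {for x, continuous f} -> {for x, continuous (fun y => - f y)}.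
Proof. exact: continuousN. Qed.

Lemma for_continuous_cst (T : topologicalType) (c : R) (x : T) :
  {for x, continuous (fun=> c)}.
Proof. exact: cst_continuous. Qed.

Lemma for_continuous_comp (T : topologicalType) (f : T -> R) (g : R -> R) (x : T) :
  {for x, continuous f} -> {for f x, continuous g} ->
  {for x, continuous (fun y => g (f y))}.
Proof. exact: continuous_comp. Qed.

Lemma continuous_sqn d : continuous (@sqn d).
Proof.
by move=> x; apply: continuous_rsum => i; apply: continuousM; exact: continuous_coord.
Qed.

Lemma continuous_measurable_rV_real d (f : 'rV[R]_d -> R) :
  continuous f -> measurable_fun setT f.
Proof.
move=> /continuousP cf; apply: (measurability _ (RGenOpens.measurableE R)).
move=> _ [_ [a [b ->]] <-]; rewrite setTI; apply: open_measurable_rV.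
by apply: cf; exact: interval_open.
Qed.

(** The factor s^-d makes the integral independent of the width s. For b = 1/4 this is, up to the
    constant (4 pi)^(d/2), the heat kernel at time s^2. *)
Definition gauss d b s (z : 'rV[R]_d) : R := s^-1 ^+ d * expR (- (b * sqn z) * s^-1 ^+ 2).

Lemma gauss_ge0 d b s (z : 'rV[R]_d) : 0 <= s -> 0 <= gauss b s z.
Proof. by move=> s0; rewrite mulr_ge0 ?expR_ge0// exprn_ge0// invr_ge0. Qed.

Lemma for_continuous_gauss d b s (z : 'rV[R]_d) : {for z, continuous (@gauss d b s)}.
Proof.
rewrite (_ : @gauss d b s =
  fun z => s^-1 ^+ d * expR (- (b * sqn z) * s^-1 ^+ 2))//.
apply: for_continuousM; first exact: for_continuous_cst.
apply: for_continuous_comp; last exact: continuous_expR.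
apply: for_continuousM; last exact: for_continuous_cst.
apply: for_continuousN; apply: for_continuousM; first exact: for_continuous_cst.
exact: continuous_sqn.
Qed.

Lemma continuous_gauss d b s : continuous (@gauss d b s).
Proof. by move=> z; exact: for_continuous_gauss. Qed.

Lemma measurable_gauss d b s : measurable_fun setT (@gauss d b s).
Proof. by apply: continuous_measurable_rV_real; exact: continuous_gauss. Qed.

Lemma sqn_rV_cons d (a : R) (x : 'rV[R]_d) : sqn (rV_cons (a, x)) = a ^+ 2 + sqn x.
Proof.
rewrite /sqn /dotv big_ord_recl expr2; congr (_ * _ + _).
- by rewrite /rV_cons mxE; case: splitP => // j _; rewrite mxE.
- by rewrite /rV_cons mxE; case: splitP => // j _; rewrite mxE.
- apply: eq_bigr => i _.
  have -> : lift ord0 i = rshift 1 i :> 'I_d.+1 by exact/val_inj.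
  by rewrite /rV_cons/= (row_mxEr (const_mx a : 'rV[R]_1)).
Qed.

Lemma integral_gauss1 b s : 0 < b -> 0 < s ->
  (\int[leb]_x (s^-1 * expR (- (b * x ^+ 2) * s^-1 ^+ 2))%:E = (Num.sqrt (pi / b))%:E)%E.
Proof.
move=> b0 s0; set a := s^-1.
have a0 : 0 < a by rewrite invr_gt0.
have ba0 : 0 < b * a ^+ 2 by rewrite mulr_gt0// exprn_gt0.
(* The standard deviation for which the normal density has the exponent - b x^2 / s^2. *)
pose sg := Num.sqrt ((b * a ^+ 2)^-1 / 2).
have sgp : 0 < sg by rewrite sqrtr_gt0 divr_gt0// invr_gt0.
have sg2 : sg ^+ 2 *+ 2 = (b * a ^+ 2)^-1.
  rewrite sqr_sqrtr; last by rewrite ltW// divr_gt0// invr_gt0.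
  by rewrite -mulr_natr mulfVK.
have E x : a * expR (- (b * x ^+ 2) * a ^+ 2) =
    (a * (normal_peak sg)^-1) * normal_pdf 0 sg x.
  rewrite normal_pdfE ?gt_eqF// /normal_fun subr0 -mulrA; congr (_ * _).
  rewrite mulKf; last by rewrite gt_eqF// normal_peak_gt0// gt_eqF.
  by rewrite sg2 invrK; congr expR; lra.
have P0 : 0 <= a * (normal_peak sg)^-1.
  by rewrite mulr_ge0// ?invr_ge0 ?normal_peak_ge0// ltW.
under eq_integral do rewrite E EFinM.
rewrite ge0_integralZl_EFin//; last 2 first.
- by move=> x _; rewrite lee_fin normal_pdf_ge0.
- by apply/measurable_EFinP; exact: measurable_normal_pdf.
rewrite integral_normal_pdf mule1 /normal_peak invrK; congr EFin.
have -> : sg ^+ 2 * pi *+ 2 = a^-1 ^+ 2 * (pi / b).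
  rewrite -mulrnAl sg2 invfM exprVn; lra.
have -> : Num.sqrt (a^-1 ^+ 2 * (pi / b)) = a^-1 * Num.sqrt (pi / b).
  by rewrite sqrtrM ?sqr_ge0// sqrtr_sqr ger0_norm// invr_ge0 ltW.
by rewrite mulVKf// gt_eqF.
Qed.

Definition gauss_mass d b : R := Num.sqrt (pi / b) ^+ d.

Lemma gauss_mass_gt0 d b : 0 < b -> 0 < gauss_mass d b.
Proof. by move=> b0; rewrite exprn_gt0// sqrtr_gt0 divr_gt0// pi_gt0. Qed.

Lemma integral_gauss d b s : 0 < b -> 0 < s ->
  (\int[lebesgue_rV d]_x (gauss b s x)%:E = (gauss_mass d b)%:E)%E.
Proof.
move=> b0 s0; elim: d => [|d IH].
  rewrite integral_dirac//; last first.
    by apply/measurable_EFinP; exact: measurable_gauss.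
  rewrite diracT mul1e /gauss /gauss_mass !expr0 mul1r /sqn /dotv big_ord0.
  by rewrite mulr0 oppr0 mul0r expR0.
have mg k : measurable_fun setT (fun x : 'rV[R]_k => (gauss b s x)%:E).
  by apply/measurable_EFinP; exact: measurable_gauss.
have g0 k (x : 'rV[R]_k) : (0 <= (gauss b s x)%:E)%E by rewrite lee_fin gauss_ge0// ltW.
rewrite ge0_integral_rV_succ//.
have E a (x : 'rV[R]_d) : (gauss b s (rV_cons (a, x)))%:E =
   ((s^-1 * expR (- (b * a ^+ 2) * s^-1 ^+ 2))%:E * (gauss b s x)%:E)%E.
  rewrite -EFinM; congr EFin; rewrite /gauss sqn_rV_cons exprS mulrDr opprD mulrDl expRD.
  by rewrite mulrACA.
under eq_integral => a _.
  under eq_integral do rewrite E.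
  rewrite ge0_integralZl_EFin//; last by rewrite mulr_ge0 ?expR_ge0// invr_ge0 ltW.
  rewrite IH.
  over.
rewrite ge0_integralZr//.
- by rewrite integral_gauss1// -EFinM /gauss_mass exprS.
- apply/measurable_EFinP; apply: measurable_funM => //.
  apply: measurableT_comp => //; apply: measurable_funM => //.
  by apply: measurableT_comp => //; apply: measurable_funM => //; exact: exprn_measurable.
- by move=> x _; rewrite lee_fin mulr_ge0 ?expR_ge0// invr_ge0 ltW.
- by rewrite lee_fin exprn_ge0// sqrtr_ge0.
Qed.

Lemma sqnB d (x y : 'rV[R]_d) : sqn (x - y) = sqn (y - x).
Proof.
apply: eq_bigr => i _; rewrite !mxE; lra.
Qed.

Lemma gaussB d b s (x y : 'rV[R]_d) : gauss b s (x - y) = gauss b s (y - x).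
Proof. by rewrite /gauss sqnB. Qed.

Lemma integral_gauss_center d b s (y : 'rV[R]_d) : 0 < b -> 0 < s ->
  (\int[lebesgue_rV d]_x (gauss b s (x - y))%:E = (gauss_mass d b)%:E)%E.
Proof.
move=> b0 s0; rewrite -(integral_gauss d b0 s0).
apply: (@ge0_integral_rV_translate R d (- y) (fun x => (gauss b s x)%:E)).
- by apply/measurable_EFinP; exact: measurable_gauss.
- by move=> x; rewrite lee_fin gauss_ge0// ltW.
Qed.

Lemma coord_le_norm d (x : 'rV[R]_d) i : `|x 0 i| <= `|x|.
Proof. by rewrite [leRHS]/Num.norm/= mx_normrE; apply/bigmax_geP; right; exists (0, i). Qed.

Lemma sqn_le_norm d (x : 'rV[R]_d) : sqn x <= d%:R * `|x| ^+ 2.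
Proof.
rewrite mulr_natl -[X in _ *+ X]card_ord -sumr_const.
apply: ler_sum => i _; rewrite -expr2 -real_normK ?num_real//.
by rewrite lerXn2r ?nnegrE//; exact: coord_le_norm.
Qed.

(** The indicator of a bounded set lies below a multiple of the Gaussian of width 1, whose integral
    is known; the multiple [c] undoes the smallest value of the Gaussian on the set. *)
Lemma lebesgue_rV_bounded d (A : set 'rV[R]_d) : measurable A -> bounded_set A ->
  (lebesgue_rV d A < +oo)%E.
Proof.
move=> mA [M [_ /(_ (M + 1))]]; rewrite ltrDl ltr01 => /(_ isT) AM.
set c := expR (d%:R * (M + 1) ^+ 2).
apply: (@le_lt_trans _ _ (\int[lebesgue_rV d]_x (c * gauss 1 1 x)%:E)%E).
  rewrite -[leLHS]mul1e -integral_cst// [leLHS]integral_mkcond.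
  apply: ge0_le_integral => //.
  - by move=> x _; rewrite patchE; case: ifP.
  - by apply/(measurable_restrictT _ _).1 => //; exact: measurable_cst.
  - apply/measurable_EFinP; apply: measurable_funM => //; exact: measurable_gauss.
  - move=> x _; rewrite patchE; case: ifPn => [/set_mem Ax|_].
      rewrite /= lee_fin /gauss invr1 !expr1n !mul1r mulr1 /c -expRD.
      rewrite -[leLHS]expR0 ler_expR subr_ge0 (le_trans (sqn_le_norm x))//.
      by rewrite ler_wpM2l// lerXn2r ?nnegrE//; [apply: le_trans (AM _ Ax)|exact: AM].
    by rewrite lee_fin mulr_ge0 ?expR_ge0// gauss_ge0.
under eq_integral do rewrite EFinM.
rewrite ge0_integralZl_EFin ?expR_ge0//.
- by rewrite integral_gauss// -EFinM ltry.
- by move=> x _; rewrite lee_fin gauss_ge0.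
- by apply/measurable_EFinP; exact: measurable_gauss.
Qed.

End gaussian.

(** * Partial derivatives and parameter integrals *)

Section line_derivatives.
Context {R : realType}.
Implicit Types (d : nat).

Lemma mvt_bound (g dg : R -> R) (s c e : R) : 0 <= s ->
  (forall t, 0 <= t <= s -> is_derive t 1 g (dg t)) ->
  (forall t, 0 <= t <= s -> `|dg t - c| <= e) ->
  `|g s - g 0 - s * c| <= s * e.
Proof.
rewrite le_eqVlt => /predU1P[<- _ _|s0 Dg ce].
  by rewrite subrr !mul0r subrr normr0.
have D1 : forall x, x \in `]0, s[ -> is_derive x 1 g (dg x).
  by move=> x; rewrite in_itv/= => /andP[x0 xs]; apply: Dg; rewrite !ltW.
have cg : {within `[0, s], continuous g}.
  apply: derivable_within_continuous => x; rewrite in_itv/= => xs.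
  by have [] := Dg x xs.
have [t ts ->] := MVT s0 D1 cg.
rewrite subr0 mulrC -mulrBr normrM gtr0_norm// ler_pM2l//; apply: ce.
by move: ts; rewrite in_itv/= => /andP[/ltW-> /ltW->].
Qed.

Lemma is_derive_line (V W : normedModType R) (f : V -> W) x v (t : R) df :
  is_derive (x + t *: v) v f df <-> is_derive t 1 (fun s => f (x + s *: v)) df.
Proof.
have E : (fun h : R => h^-1 *: ((f \o shift (x + t *: v)) (h *: v) - f (x + t *: v))) =
    (fun h : R => h^-1 *: (((fun s => f (x + s *: v)) \o shift t) (h *: 1) -
      (fun s : R => f (x + s *: v)) t)).
  apply/funext => h /=; congr (_ *: (f _ - _)).
  by rewrite [h *: 1]mulr1 scalerDl [h *: v + _]addrC -addrA [t *: v + _]addrC.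
by split => -[D1 D2]; (apply: DeriveDef; [move: D1|move: D2]; rewrite /derivable /derive E).
Qed.

Lemma is_derive_comp_dir (V : normedModType R) (f : V -> R) (g : R -> R) x v df a :
  is_derive x v f df -> is_derive (f x) 1 g a -> is_derive x v (g \o f) (a * df).
Proof.
move=> Df Dg.
have x0 : x = x + 0 *: v by rewrite scale0r addr0.
have Df0 : is_derive (x + 0 *: v) v f df by rewrite -x0.
have Dg0 : is_derive (f (x + 0 *: v)) 1 g a by rewrite -x0.
rewrite x0; apply: (proj2 (is_derive_line _ _ _ _ _)).
move/(proj1 (is_derive_line _ _ _ _ _)) : Df0 => Df0.
exact: (@is_derive1_comp R g (fun s => f (x + s *: v)) 0 a df).
Qed.

Variable d : nat.
Implicit Types (x y z v : 'rV[R]_d) (f : 'rV[R]_d -> R) (U : set 'rV[R]_d).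
Local Notation e_ i := (delta_mx 0 i : 'rV[R]_d).

Lemma normr_delta (i : 'I_d) : `|e_ i| <= 1.
Proof.
rewrite [leLHS]/Num.norm/= mx_normrE; apply/bigmax_leP; split => // -[a b] _ /=.
by rewrite mxE; case: (_ && _); rewrite ?normr1 ?normr0.
Qed.

Lemma step_bound f x y (i : 'I_d) (r s c e : R) :
  (forall z, ball x r z -> derivable f z (e_ i)) ->
  (forall z, ball x r z -> `|partial i f z - c| <= e) ->
  ball x r y -> ball x r (y + s *: e_ i) ->
  `|f (y + s *: e_ i) - f y - s * c| <= `|s| * e.
Proof.
(* For negative s the two end points of the segment are exchanged. *)
wlog s0 : s y / 0 <= s => [H Df ce xy xys|Df ce xy xys].
  have [s0|s0] := leP 0 s; first exact: H.
  have := H (- s) (y + s *: e_ i).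
  rewrite scaleNr addrK oppr_ge0 ltW// normrN => /(_ isT Df ce xys xy).
  rewrite (_ : f y - _ - _ = - (f (y + s *: e_ i) - f y - s * c)) ?normrN//.
  by rewrite mulNr; lra.
rewrite (ger0_norm s0).
have H t : 0 <= t <= s -> ball x r (y + t *: e_ i).
  move=> /andP[t0 ts].
  have [r0 Hy] := xy; have [_ Hys] := xys; split => // a j.
  have := Hy a j; have := Hys a j.
  rewrite /ball/= !mxE !ltr_distl.
  case: (j == i) => /=; rewrite (ord1 a) ?eqxx /= ?mulr1 ?mulr0; lra.
have M := @mvt_bound (fun t => f (y + t *: e_ i))
   (fun t => partial i f (y + t *: e_ i)) s c e s0.
have -> : f y = (fun t : R => f (y + t *: e_ i)) 0 by rewrite /= scale0r addr0.
apply: M.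
- move=> t /H Ht; apply: (proj1 (is_derive_line f y (e_ i) t _)).
  by apply: DeriveDef; [exact: Df|].
- by move=> t /H; exact: ce.
Qed.

(** The points [y k] replace the first k coordinates of x by those of x + v, so each step is an
    estimate in one coordinate direction; every [y k] stays in the ball because the norm is the
    maximum norm. *)
Lemma diff_bound f x v (r e : R) (c : 'I_d -> R) :
  (forall i z, ball x r z -> derivable f z (e_ i)) ->
  (forall i z, ball x r z -> `|partial i f z - c i| <= e) ->
  `|v| < r -> 0 <= e ->
  `|f (x + v) - f x - \sum_i v 0 i * c i| <= d%:R * (`|v| * e).
Proof.
move=> Df ce vr e0.
have r0 : 0 < r by exact: le_lt_trans vr.
pose y k : 'rV[R]_d := \row_i (x 0 i + if (i < k)%N then v 0 i else 0).
have by_ k : ball x r (y k).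
  split => // a i; rewrite (ord1 a) /ball/= !mxE opprD addNKr normrN.
  by case: ifP => _; rewrite ?normr0//; exact: le_lt_trans (coord_le_norm _ _) vr.
suff H k : (k <= d)%N -> `|f (y k) - f x - \sum_(i < d | (i < k)%N) v 0 i * c i| <=
    k%:R * (`|v| * e).
  have := H d (leqnn _); have -> : y d = x + v.
    by apply/rowP => i; rewrite !mxE ltn_ord.
  by under eq_bigl do rewrite ltn_ord.
elim: k => [_|k IH kd].
  have -> : y 0%N = x by apply/rowP => i; rewrite !mxE addr0.
  by rewrite big_pred0// subrr subr0 normr0 mul0r.
pose i := Ordinal kd.
have yS : y k.+1 = y k + v 0 i *: e_ i.
  apply/rowP => j; rewrite !mxE eqxx/= ltnS leq_eqVlt -val_eqE/=.
  by case: (ltngtP j k) => [_|_|jk] /=; rewrite ?mulr0 ?addr0// mulr1 (_ : j = i)//; exact/val_inj.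
have -> : \sum_(j < d | (j < k.+1)%N) v 0 j * c j =
    v 0 i * c i + \sum_(j < d | (j < k)%N) v 0 j * c j.
  rewrite (bigD1 i) ?ltnS//=; congr (_ + _); apply: eq_bigl => j.
  by rewrite -val_eqE/= ltnS [in RHS]ltn_neqAle andbC.
have S := @step_bound f x (y k) i r (v 0 i) (c i) e (Df i) (ce i) (by_ k).
rewrite -yS in S; have {}S := S (by_ k.+1).
have {}IH := IH (ltnW kd).
rewrite (_ : _ - _ - _ = (f (y k.+1) - f (y k) - v 0 i * c i) +
  (f (y k) - f x - \sum_(j < d | (j < k)%N) v 0 j * c j)); last by lra.
rewrite -natr1 mulrDl mul1r addrC (le_trans (ler_normD _ _))// lerD//.
by rewrite (le_trans S)// ler_wpM2r// coord_le_norm.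
Qed.

Definition pcontinuous U f := forall x, U x -> {for x, continuous f}.

Lemma is_derive_C1 U f x v : open U -> U x ->
  (forall i y, U y -> derivable f y (e_ i)) ->
  (forall i, pcontinuous U (partial i f)) ->
  is_derive x v f (\sum_i v 0 i * partial i f x).
Proof.
move=> oU Ux Df cf; set l := \sum_i _.
suff H : (fun h : R => h^-1 *: ((f \o shift x) (h *: v) - f x)) @ 0^' --> l.
  by apply: DeriveDef; [apply/cvg_ex; exists l|apply/cvg_lim].
apply/cvgrPdist_le => e e0.
(* Makes the error d |v| e' of [diff_bound] at most e; the added ones keep the denominator positive
   when v or d vanishes. *)
pose e' := e / (d%:R * (`|v| + 1) + 1).
have D0 : 0 < d%:R * (`|v| + 1) + 1.
  by rewrite ltr_wpDl// mulr_ge0// addr_ge0.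
have e'0 : 0 < e' by rewrite divr_gt0.
have : \forall y \near x, U y /\ forall i, `|partial i f y - partial i f x| <= e'.
  near=> y; split; first by near: y; exact: open_nbhs_nbhs.
  move=> i; move: i; near: y; apply: filter_forall => i.
  have := cf i x Ux => /cvgrPdist_le/(_ _ e'0) ci.
  by near=> y; rewrite distrC; near: y; exact: ci.
move=> /nbhs_ballP[r /= r0 Hr].
have v10 : 0 < `|v| + 1 by rewrite ltr_wpDl.
near=> h.
have h0 : h != 0 by near: h; exact: nbhs_dnbhs_neq.
have hv : `|h *: v| < r.
  rewrite normrZ (@le_lt_trans _ _ (`|h| * (`|v| + 1)))//.
    by rewrite ler_wpM2l// lerDl.
  rewrite -ltr_pdivlMr//; near: h; apply: dnbhs0_lt; exact: divr_gt0.
have := @diff_bound f x (h *: v) r e' (fun i => partial i f x) _ _ hv (ltW e'0).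
move=> /(_ (fun i z Hz => Df i z (proj1 (Hr z Hz)))).
move=> /(_ (fun i z Hz => proj2 (Hr z Hz) i)) B.
have -> : l - h^-1 *: ((f \o shift x) (h *: v) - f x) =
   - (h^-1 * (f (x + h *: v) - f x - \sum_i (h *: v) 0 i * partial i f x)).
  rewrite /= [h *: v + x]addrC -[h^-1 *: _]/(h^-1 * _).
  have -> : \sum_i (h *: v) 0 i * partial i f x = h * l.
    by rewrite mulr_sumr; apply: eq_bigr => i _; rewrite mxE mulrA.
  by rewrite [in RHS]mulrBr mulKf// opprB.
rewrite normrN normrM normfV ler_pdivrMl ?normr_gt0//.
rewrite (le_trans B)// normrZ -!mulrA mulrCA ler_wpM2l//.
rewrite /e' mulrA mulrCA ler_piMr ?(ltW e0)// ler_pdivrMr// mul1r.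
by rewrite ler_wpDr// ler_wpM2l// lerDl.
Unshelve. all: by end_near. Qed.

End line_derivatives.

Section derive_rules.
Context {R : realType} {V : normedModType R}.
Implicit Types (f g : V -> R) (x v : V).

Lemma drvD f g x v a b : is_derive x v f a -> is_derive x v g b ->
  is_derive x v (fun y => f y + g y) (a + b).
Proof. by move=> Df Dg; exact: is_deriveD. Qed.

Lemma drvN f x v a : is_derive x v f a -> is_derive x v (fun y => - f y) (- a).
Proof. by move=> Df; exact: is_deriveN. Qed.

Lemma drvB f g x v a b : is_derive x v f a -> is_derive x v g b ->
  is_derive x v (fun y => f y - g y) (a - b).
Proof. by move=> Df Dg; apply: drvD => //; exact: drvN. Qed.

Lemma drvM f g x v a b : is_derive x v f a -> is_derive x v g b ->
  is_derive x v (fun y => f y * g y) (a * g x + f x * b).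
Proof.
move=> Df Dg; apply: (is_derive_eq (is_deriveM Df Dg)).
by rewrite addrC [g x *: a]mulrC.
Qed.

Lemma drv_cst (c : R) x v : is_derive x v (fun=> c) (0 : R).
Proof. exact: is_derive_cst. Qed.

Lemma drvZ f x v a (c : R) : is_derive x v f a ->
  is_derive x v (fun y => c * f y) (c * a).
Proof.
by move=> Df; have := drvM (drv_cst c x v) Df; rewrite mul0r add0r.
Qed.

Lemma drv_sum n (f : 'I_n -> V -> R) (a : 'I_n -> R) x v :
  (forall i, is_derive x v (f i) (a i)) ->
  is_derive x v (fun y => \sum_i f i y) (\sum_i a i).
Proof.
move=> Df; have := is_derive_sum Df.
suff -> : \sum_(i < n) f i = (fun y => \sum_i f i y) by [].
by apply/funext => y; rewrite fct_sumE.
Qed.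

Lemma drv_ex f x v : derivable f x v -> is_derive x v f ('D_v f x).
Proof. by move=> Df; apply: DeriveDef. Qed.

Lemma drv_near f g x v a : (\near x, f x = g x) -> is_derive x v f a ->
  is_derive x v g a.
Proof.
move=> fg [Df <-]; apply: DeriveDef; first exact: near_eq_derivable Df.
by symmetry; exact: near_eq_derive.
Qed.

End derive_rules.

Lemma for_continuous_near {R : realType} (T : topologicalType) (f g : T -> R) (x : T) :
  (\forall y \near x, f y = g y) -> {for x, continuous f} -> {for x, continuous g}.
Proof.
move=> fg cf A; rewrite /= -(nbhs_singleton fg) => /cf Af.
by apply: filterS2 fg Af => y /= <-.
Qed.

(** * Kernels p x z that are regular in x, uniformly in the parameter z *)

Section kernels.
Context {R : realType} {d : nat} {dZ : measure_display} {Z : measurableType dZ}.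
Implicit Types (W : set 'rV[R]_d) (D : set Z) (x : 'rV[R]_d) (k : nat).
Local Notation e_ i := (delta_mx 0 i : 'rV[R]_d).
Local Notation kernel := ('rV[R]_d -> Z -> R).
Implicit Types (p q : kernel).

Lemma drv_coord x (i j : 'I_d) :
  is_derive x (e_ j) (fun y : 'rV[R]_d => y 0 i) ((i == j)%:R : R).
Proof.
have x0 : x = x + 0 *: e_ j by rewrite scale0r addr0.
rewrite [in X in is_derive X]x0; apply: (proj2 (is_derive_line _ _ _ _ _)).
have -> : (fun s : R => (x + s *: e_ j) 0 i) = (fun s => x 0 i + (i == j)%:R * s).
  by apply/funext => s; rewrite !mxE eqxx/= mulrC.
have : is_derive (0 : R) 1 (fun s : R => x 0 i + (i == j)%:R * s) (0 + (i == j)%:R * 1).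
  exact: (drvD (drv_cst _ _ _) (drvZ _ (is_derive_id _ _))).
by rewrite add0r mulr1.
Qed.

(** These are the conditions under which dominated convergence in z, over a set D of finite measure,
    gives continuity of the integral in x. *)
Definition kreg0 W D p : Prop :=
  [/\ forall z, D z -> pcontinuous W (p^~ z),
      forall x, W x -> exists C : R, \forall y \near x, forall z, D z -> `|p y z| <= C &
      forall x, W x -> measurable_fun D (p x)].

Definition kpartial (i : 'I_d) p : kernel := fun x z => partial i (p^~ z) x.

(* Kernels that are C^k in x, with derivatives locally bounded uniformly in z. *)
Fixpoint kreg W D k p : Prop :=
  kreg0 W D p /\
  if k is k'.+1 then
    forall i, (forall z x, D z -> W x -> derivable (p^~ z) x (e_ i)) /\
              kreg W D k' (kpartial i p)
  else True.

Lemma kregW W D k p : kreg W D k.+1 p -> kreg W D k p.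
Proof.
elim: k p => [|k IH] p [p0 Hp]; split => // i; have [Dp Hi] := Hp i; split => //.
exact: IH.
Qed.

Lemma kreg_kreg0 W D k p : kreg W D k p -> kreg0 W D p.
Proof. by case: k => [|k] []. Qed.

(** Since W is open, equality on W is equality near each of its points, so derivatives agree as well
    and the induction goes through. *)
Lemma kreg_eq W D k p q : open W -> (forall x z, W x -> D z -> p x z = q x z) ->
  kreg W D k p -> kreg W D k q.
Proof.
move=> oW.
have nW x : W x -> \forall y \near x, W y by move=> Wx; exact: open_nbhs_nbhs.
have E0 p' q' : (forall x z, W x -> D z -> p' x z = q' x z) -> kreg0 W D p' -> kreg0 W D q'.
  move=> pq [c b m]; split.
  - move=> z Dz x Wx.
    have E : \forall y \near x, p' y z = q' y z.
      by near=> y; apply: pq => //; near: y; exact: nW.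
    exact: for_continuous_near E (c z Dz x Wx).
  - move=> x Wx; have [C HC] := b x Wx; exists C.
    near=> y => z Dz; rewrite -pq//; last by near: y; exact: nW.
    by move: z Dz; near: y.
  - move=> x Wx; apply: eq_measurable_fun (m x Wx) => z /set_mem Dz; exact: pq.
elim: k p q => [|k IH] p q pq [p0 Hp]; split => //; try exact: E0 p0.
move=> i; have [Dp Hi] := Hp i.
have E z x : D z -> W x -> \forall y \near x, p y z = q y z.
  by move=> Dz Wx; near=> y; apply: pq => //; near: y; exact: nW.
split.
  by move=> z x Dz Wx; apply: near_eq_derivable (Dp z x Dz Wx); exact: E.
apply: IH Hi => x z Wx Dz; apply: near_eq_derive; exact: E.
Unshelve. all: by end_near. Qed.

Lemma kreg0D W D p q : kreg0 W D p -> kreg0 W D q ->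
  kreg0 W D (fun x z => p x z + q x z).
Proof.
move=> [c b m] [c' b' m']; split.
- by move=> z Dz x Wx; apply: for_continuousD; [exact: c|exact: c'].
- move=> x Wx; have [C HC] := b x Wx; have [C' HC'] := b' x Wx; exists (C + C').
  near=> y => z Dz; rewrite (le_trans (ler_normD _ _))// lerD//.
    by move: z Dz; near: y.
  by move: z Dz; near: y.
- by move=> x Wx; apply: measurable_funD; [exact: m|exact: m'].
Unshelve. all: by end_near. Qed.

Lemma kreg0M W D p q : kreg0 W D p -> kreg0 W D q ->
  kreg0 W D (fun x z => p x z * q x z).
Proof.
move=> [c b m] [c' b' m']; split.
- by move=> z Dz x Wx; apply: for_continuousM; [exact: c|exact: c'].
- move=> x Wx; have [C HC] := b x Wx; have [C' HC'] := b' x Wx; exists (C * C').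
  near=> y => z Dz; rewrite normrM ler_pM//.
    by move: z Dz; near: y.
  by move: z Dz; near: y.
- by move=> x Wx; apply: measurable_funM; [exact: m|exact: m'].
Unshelve. all: by end_near. Qed.

Lemma kreg0_z W D (c : Z -> R) (C : R) : measurable_fun D c ->
  (forall z, D z -> `|c z| <= C) -> kreg0 W D (fun _ z => c z).
Proof.
move=> mc cC; split.
- by move=> z Dz x Wx; exact: for_continuous_cst.
- by move=> x Wx; exists C; near=> y.
- by [].
Unshelve. all: by end_near. Qed.

Lemma kregD W D k p q : open W -> kreg W D k p -> kreg W D k q ->
  kreg W D k (fun x z => p x z + q x z).
Proof.
move=> oW; elim: k p q => [|k IH] p q [p0 Hp] [q0 Hq]; split => //; try exact: kreg0D.
move=> i; have [Dp Hi] := Hp i; have [Dq Hj] := Hq i.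
have H z x : D z -> W x -> is_derive x (e_ i) (fun y => p y z + q y z)
    (kpartial i p x z + kpartial i q x z).
  by move=> Dz Wx; apply: drvD; apply: drv_ex; [exact: Dp|exact: Dq].
split; first by move=> z x Dz Wx; case: (H z x Dz Wx).
apply: (kreg_eq oW _ (IH _ _ Hi Hj)) => x z Wx Dz.
by case: (H z x Dz Wx) => _ <-.
Qed.

Lemma kregM W D k p q : open W -> kreg W D k p -> kreg W D k q ->
  kreg W D k (fun x z => p x z * q x z).
Proof.
move=> oW; elim: k p q => [|k IH] p q Kp Kq.
  by have [p0 _] := Kp; have [q0 _] := Kq; split => //; exact: kreg0M.
have [p0 Hp] := Kp; have [q0 Hq] := Kq; split; first exact: kreg0M.
move=> i; have [Dp Hi] := Hp i; have [Dq Hj] := Hq i.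
have H z x : D z -> W x -> is_derive x (e_ i) (fun y => p y z * q y z)
    (kpartial i p x z * q x z + p x z * kpartial i q x z).
  by move=> Dz Wx; apply: drvM; apply: drv_ex; [exact: Dp|exact: Dq].
split; first by move=> z x Dz Wx; case: (H z x Dz Wx).
apply: (kreg_eq oW _ (kregD oW (IH _ _ Hi (kregW Kq)) (IH _ _ (kregW Kp) Hj))) => x z Wx Dz.
by case: (H z x Dz Wx) => _ <-.
Qed.

Lemma kreg_z W D k (c : Z -> R) (C : R) : open W -> measurable_fun D c ->
  (forall z, D z -> `|c z| <= C) -> kreg W D k (fun _ z => c z).
Proof.
move=> oW; elim: k c C => [|k IH] c C mc cC; split => //; try exact: kreg0_z cC.
move=> i; split; first by move=> z x Dz Wx; case: (drv_cst (c z) x (e_ i)).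
apply: (kreg_eq oW _ (IH (fun=> 0) 0 _ _)) => // [x z Wx Dz|z Dz].
  by rewrite /kpartial /partial; case: (drv_cst (c z) x (e_ i)).
by rewrite normr0.
Qed.

Lemma kreg_cst W D k (c : R) : open W -> kreg W D k (fun _ _ => c).
Proof. by move=> oW; exact: (@kreg_z W D k (fun=> c) `|c|). Qed.

Lemma kregZ W D k (c : R) p : open W -> kreg W D k p ->
  kreg W D k (fun x z => c * p x z).
Proof. by move=> oW Kp; apply: kregM => //; exact: kreg_cst. Qed.

Lemma kregN W D k p : open W -> kreg W D k p -> kreg W D k (fun x z => - p x z).
Proof.
move=> oW /(kregZ (-1) oW); apply: kreg_eq => // x z _ _; exact: mulN1r.
Qed.

Lemma kregB W D k p q : open W -> kreg W D k p -> kreg W D k q ->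
  kreg W D k (fun x z => p x z - q x z).
Proof. by move=> oW Kp Kq; apply: kregD => //; exact: kregN. Qed.

Lemma kreg_sum W D k n (p : 'I_n -> kernel) : open W ->
  (forall i, kreg W D k (p i)) -> kreg W D k (fun x z => \sum_i p i x z).
Proof.
move=> oW Kp; suff H (s : seq 'I_n) : kreg W D k (fun x z => \sum_(i <- s) p i x z).
  exact: H.
elim: s => [|i s IH].
  by apply: (kreg_eq oW _ (kreg_cst D k 0 oW)) => x z _ _; rewrite big_nil.
by apply: (kreg_eq oW _ (kregD oW (Kp i) IH)) => x z _ _; rewrite big_cons.
Qed.

Lemma kreg_exp W D k p : open W -> kreg W D k p ->
  kreg W D k (fun x z => expR (p x z)).
Proof.
move=> oW.
have E0 q : kreg0 W D q -> kreg0 W D (fun x z => expR (q x z)).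
  move=> [c b m]; split.
  - by move=> z Dz x Wx; apply: for_continuous_comp; [exact: c|exact: continuous_expR].
  - move=> x Wx; have [C HC] := b x Wx; exists (expR C).
    near=> y => z Dz; rewrite ger0_norm ?expR_ge0// ler_expR (le_trans (ler_norm _))//.
    by move: z Dz; near: y.
  - by move=> x Wx; apply: measurableT_comp => //; exact: m.
elim: k p => [|k IH] p Kp; have [p0 Hp] := Kp; split => //; try exact: E0.
move=> i; have [Dp Hi] := Hp i.
have H z x : D z -> W x -> is_derive x (e_ i) (fun y => expR (p y z))
    (expR (p x z) * kpartial i p x z).
  move=> Dz Wx; exact: (@is_derive_comp_dir R _ (p^~ z) expR x (e_ i) _ _
    (drv_ex (Dp z x Dz Wx)) (is_derive_expR (p x z))).
split; first by move=> z x Dz Wx; case: (H z x Dz Wx).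
apply: (kreg_eq oW _ (kregM oW (IH _ (kregW Kp)) Hi)) => x z Wx Dz.
by case: (H z x Dz Wx) => _ <-.
Unshelve. all: by end_near. Qed.

(** Regularity is local. This is the gluing tool: a product with a cutoff is regular where its other
    factor is, and also where the cutoff vanishes. *)
Lemma kregU W W' D k p : kreg W D k p -> kreg W' D k p -> kreg (W `|` W') D k p.
Proof.
have E0 q : kreg0 W D q -> kreg0 W' D q -> kreg0 (W `|` W') D q.
  by move=> [c b m] [c' b' m']; split => [z Dz x []|x []|x []]; auto; [exact: c|exact: c'].
elim: k p => [|k IH] p [p0 Hp] [p0' Hp']; split => //; try exact: E0.
move=> i; have [Dp Hi] := Hp i; have [Dp' Hi'] := Hp' i; split; last exact: IH.
by move=> z x Dz []; auto.
Qed.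

Lemma kregS W W' D k p : W' `<=` W -> kreg W D k p -> kreg W' D k p.
Proof.
move=> W'W.
have E0 q : kreg0 W D q -> kreg0 W' D q.
  by move=> [c b m]; split => [z Dz x|x|x] /W'W Wx; auto; exact: c.
elim: k p => [|k IH] p [p0 Hp]; split => //; try exact: E0.
move=> i; have [Dp Hi] := Hp i; split; last exact: IH.
by move=> z x Dz /W'W; auto.
Qed.

End kernels.

(** Dominated convergence speaks of sequences; this turns its conclusion into continuity. *)
Lemma seq_continuous {R : realType} {V : normedModType R} (f : V -> R) (x : V) :
  (forall u : nat -> V, u n @[n --> \oo] --> x -> f (u n) @[n --> \oo] --> f x) ->
  {for x, continuous f}.
Proof.
move=> H; apply: contrapT => /cvgrPdist_le nc.
have [e [e0 He]] : exists e : R, 0 < e /\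
    forall n : nat, exists y, `|y - x| < n.+1%:R^-1 /\ e < `|f y - f x|.
  apply: contrapT => /forallNP nH; apply: nc => e e0.
  have /not_andP[//|/existsNP[n /forallNP Hn]] := nH e.
  near=> y; have /not_andP[|/negP] := Hn y; last by rewrite -leNgt distrC.
  case; near: y; have n0 : 0 < n.+1%:R^-1 :> R by rewrite invr_gt0.
  by near do rewrite distrC; apply: (@cvgr_dist_lt _ _ _ (nbhs x)) n0; exact: cvg_id.
have /choice[u Hu] := He.
have ux : u n @[n --> \oo] --> x.
  apply/cvgrPdist_lt => r r0; near=> n; rewrite distrC.
  have [/lt_trans + _] := Hu n; apply.
  by near: n; exact: (near_infty_natSinv_lt (PosNum r0)).
have /cvgrPdist_le/(_ _ e0)[n _ /(_ _ (leqnn n))] := H u ux.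
by have [_] := Hu n; rewrite distrC ltNge => /negP.
Unshelve. all: by end_near. Qed.

Section integral_of_kernels.
Context {R : realType} {d : nat} {dZ : measure_display} {Z : measurableType dZ}.
Variable mu : {measure set Z -> \bar R}.
Implicit Types (W : set 'rV[R]_d) (D : set Z) (x : 'rV[R]_d) (k : nat).
Local Notation e_ i := (delta_mx 0 i : 'rV[R]_d).
Implicit Types (p q : 'rV[R]_d -> Z -> R).

Definition kint D p : 'rV[R]_d -> R := fun x => \int[mu]_(z in D) p x z.

Lemma kreg0_rintegrable W D p x : measurable D -> (mu D < +oo)%E ->
  kreg0 W D p -> W x -> rintegrable mu D (p x).
Proof.
move=> mD Doo [_ b m] Wx; have [C /nbhs_singleton HC] := b x Wx.
exact: (rintegrable_bounded mD Doo (m x Wx) HC).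
Qed.

Lemma kint_continuous W D p : open W -> measurable D -> (mu D < +oo)%E ->
  kreg0 W D p -> pcontinuous W (kint D p).
Proof.
move=> oW mD Doo Kp x Wx; apply: seq_continuous => u ux.
have [c b m] := Kp; have [C HC] := b x Wx.
have A : \forall y \near x, W y /\ forall z, D z -> `|p y z| <= C.
  by near=> y; split; near: y; [exact: open_nbhs_nbhs|exact: HC].
(* Dropping the first N terms puts the whole sequence where the bound C is available. *)
have [N _ HN] := ux _ A; rewrite -(cvg_shiftn N).
have HN' n : W (u (n + N)%N) /\ forall z, D z -> `|p (u (n + N)%N) z| <= C.
  by apply: HN => /=; exact: leq_addl.
have m_ n : measurable_fun D (p (u (n + N)%N)) by apply: m; case: (HN' n).
have c_ z : D z -> (fun n => p (u (n + N)%N) z) @ \oo --> p x z.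
  move=> Dz; have := c z Dz x Wx; rewrite forE /continuous_at => cz.
  by rewrite (cvg_shiftn N (fun n => p (u n) z)); exact: (cvg_comp _ _ ux cz).
have C_ n z : D z -> `|p (u (n + N)%N) z| <= (fun=> C) z.
  by move=> Dz; have [_] := HN' n; apply.
by have [] := Rintegral_dominated mD m_ (m x Wx) c_ (rintegrable_cst C mD Doo) C_.
Unshelve. all: by end_near. Qed.

(** Restricted to the line x + t e_i, with |t| < r, this is differentiation under the integral sign;
    the local bound of the partial kernel is the dominating constant. *)
Lemma kint_derive W D p i x : open W -> measurable D -> (mu D < +oo)%E ->
  kreg W D 1 p -> W x ->
  is_derive x (e_ i) (kint D p) (kint D (kpartial i p) x).
Proof.
move=> oW mD Doo Kp Wx; have [p0 Hp] := Kp; have [Dp [q0 _]] := Hp i.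
have [_ b _] := q0; have [C HC] := b x Wx.
have /nbhs_ballP[r /= r0 Hr] : \forall y \near x,
    W y /\ forall z, D z -> `|kpartial i p y z| <= C.
  by near=> y; split; near: y; [exact: open_nbhs_nbhs|exact: HC].
have Hball (t : R) : `]- r, r[%classic t -> ball x r (x + t *: e_ i).
  rewrite /= in_itv/= -ltr_norml => tr; rewrite -ball_normE /ball_/= opprD addNKr normrN.
  by rewrite normrZ (le_lt_trans _ tr)// ler_piMr// normr_delta.
have x0 : x = x + 0 *: e_ i by rewrite scale0r addr0.
pose f (t : R) z := p (x + t *: e_ i) z.
have Df t z : `]- r, r[%classic t -> D z ->
    is_derive t 1 (f ^~ z) (kpartial i p (x + t *: e_ i) z).
  move=> /Hball/Hr[Wt _] Dz.
  apply: (proj1 (is_derive_line (p^~ z) x (e_ i) t _)).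
  by apply: drv_ex; exact: Dp.
have f0 t z : `]- r, r[%classic t -> D z ->
    partial1of2 f t z = kpartial i p (x + t *: e_ i) z.
  by move=> tr Dz; rewrite partial1of2E; case: (Df t z tr Dz).
have I0 : `]- r, r[%classic (0 : R) by rewrite /= in_itv/= oppr_lt0 r0.
have Hf t : `]- r, r[%classic t -> mu.-integrable D (EFin \o f t).
  by move=> /Hball/Hr[Wt _]; exact: (kreg0_rintegrable mD Doo p0 Wt).
have Hd t z : `]- r, r[%classic t -> D z -> derivable (f^~ z) t 1.
  by move=> tr Dz; case: (Df t z tr Dz).
(* The dominating function has to be nonnegative, whereas C may be negative if D is empty. *)
have IC : mu.-integrable D (EFin \o (fun=> Num.max C 0)) by exact: rintegrable_cst.
have C0 (z : Z) : 0 <= (fun=> Num.max C 0 : R) z by rewrite le_max lexx orbT.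
have Cub t z : `]- r, r[%classic t -> D z -> `|partial1of2 f t z| <= (fun=> Num.max C 0 : R) z.
  move=> tr Dz; rewrite f0// le_max; apply/orP; left.
  by have [_] := Hr _ (Hball _ tr); exact.
rewrite [in X in is_derive X]x0; apply: (proj2 (is_derive_line _ _ _ _ _)).
rewrite (_ : (fun s : R => kint D p (x + s *: e_ i)) =
  (fun t => \int[mu]_(z in D) f t z))//.
apply: DeriveDef; first exact: (derivable_under_integral mD I0 Hf Hd C0 IC Cub).
rewrite -derive1E (differentiation_under_integral mD I0 Hf Hd C0 IC Cub).
apply: eq_Rintegral => z /set_mem Dz.
by rewrite /= f0// scale0r addr0.
Unshelve. all: by end_near. Qed.

End integral_of_kernels.

(** * Calculus of functions of class C^k on open sets *)

Section regular_functions.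
Context {R : realType} {d : nat}.
Implicit Types (U W : set 'rV[R]_d) (x : 'rV[R]_d) (k : nat) (f g : 'rV[R]_d -> R).
Local Notation e_ i := (delta_mx 0 i : 'rV[R]_d).

(** Continuity is asked at the points of U within the whole space, which avoids subspace topologies;
    for open U this is [Ck], by [regc_Ck]. *)
Definition regc U k f := regular (pcontinuous U) U k f.

Lemma for_continuous_locally_bounded (T : topologicalType) (f : T -> R) (x : T) :
  {for x, continuous f} -> \forall y \near x, `|f y| <= `|f x| + 1.
Proof.
move=> /cvgrPdist_le/(_ _ ltr01) H; near=> y.
rewrite -[f y](subrK (f x)) addrC (le_trans (ler_normD _ _))// lerD2l distrC.
by near: y.
Unshelve. all: by end_near. Qed.

Lemma kreg_fun {dZ : measure_display} {Z : measurableType dZ} (D : set Z) U k f :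
  regc U k f -> kreg U D k (fun x _ => f x).
Proof.
have E0 g : pcontinuous U g -> kreg0 U D (fun x _ => g x).
  move=> cg; split => [z _|x Ux|x _]; first exact: cg.
    exists (`|g x| + 1); have := for_continuous_locally_bounded (cg x Ux).
    by apply: filterS => y By _ _.
  exact: measurable_cst.
elim: k f => [|k IH] f [cf Hf]; split => //; try exact: E0.
by move=> i; have [Df Hi] := Hf i; split; [move=> _ x _; exact: Df|exact: IH].
Qed.

(** A function is a kernel over a one-point parameter space. Together with [kreg_fun] this transfers
    the rules for kernels to functions. *)
Lemma regc_kreg U k f : kreg U [set: unit] k (fun x _ => f x) -> regc U k f.
Proof.
elim: k f => [|k IH] f [[cf _ _] Hf]; split => //; try exact: (cf tt).
by move=> i; have [Df Hi] := Hf i; split; [move=> x; exact: (Df tt)|exact: IH].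
Qed.

Lemma regc_eq U k f g : open U -> (forall x, U x -> f x = g x) ->
  regc U k f -> regc U k g.
Proof.
move=> oU fg /(kreg_fun [set: unit]) Kf; apply: regc_kreg.
by apply: kreg_eq Kf => // x _ Ux _; exact: fg.
Qed.

Lemma regcD U k f g : open U -> regc U k f -> regc U k g ->
  regc U k (fun x => f x + g x).
Proof.
by move=> oU Kf Kg; apply: regc_kreg; apply: kregD => //; exact: kreg_fun.
Qed.

Lemma regcM U k f g : open U -> regc U k f -> regc U k g ->
  regc U k (fun x => f x * g x).
Proof.
by move=> oU Kf Kg; apply: regc_kreg; apply: kregM => //; exact: kreg_fun.
Qed.

Lemma regc_cst U k (c : R) : open U -> regc U k (fun=> c).
Proof. by move=> oU; apply: regc_kreg; exact: kreg_cst. Qed.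

Lemma regcZ U k (c : R) f : open U -> regc U k f -> regc U k (fun x => c * f x).
Proof. by move=> oU Kf; apply: regcM => //; exact: regc_cst. Qed.

Lemma regcN U k f : open U -> regc U k f -> regc U k (fun x => - f x).
Proof. by move=> oU Kf; apply: regc_kreg; apply: kregN => //; exact: kreg_fun. Qed.

Lemma regcB U k f g : open U -> regc U k f -> regc U k g ->
  regc U k (fun x => f x - g x).
Proof. by move=> oU Kf Kg; apply: regcD => //; exact: regcN. Qed.

Lemma regc_sum U k n (f : 'I_n -> 'rV[R]_d -> R) : open U ->
  (forall i, regc U k (f i)) -> regc U k (fun x => \sum_i f i x).
Proof.
by move=> oU Kf; apply: regc_kreg; apply: kreg_sum => // i; exact: kreg_fun.
Qed.

Lemma regcW U k f : regc U k.+1 f -> regc U k f.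
Proof. by move=> /(kreg_fun [set: unit])/kregW; exact: regc_kreg. Qed.

Lemma regcS U U' k f : U' `<=` U -> regc U k f -> regc U' k f.
Proof. by move=> s /(kreg_fun [set: unit])/(kregS s); exact: regc_kreg. Qed.

Lemma regcU U U' k f : regc U k f -> regc U' k f -> regc (U `|` U') k f.
Proof.
move=> /(kreg_fun [set: unit]) K /(kreg_fun [set: unit]) K'.
by apply: regc_kreg; exact: kregU.
Qed.

Lemma regc_continuous U k f : regc U k f -> pcontinuous U f.
Proof. by case: k => [|k] []. Qed.

Lemma regc_partial U k f i : regc U k.+1 f -> regc U k (partial i f).
Proof. by move=> [_ /(_ i)[]]. Qed.

Lemma regc_drv U k f i x : regc U k.+1 f -> U x ->
  is_derive x (e_ i) f (partial i f x).
Proof. by move=> [_ /(_ i)[Df _]] Ux; apply: drv_ex; exact: Df. Qed.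

Lemma regc_drv_dir U f x (v : 'rV[R]_d) : open U -> regc U 1 f -> U x ->
  is_derive x v f (\sum_i v 0 i * partial i f x).
Proof.
move=> oU [_ Hf] Ux; apply: (is_derive_C1 v oU Ux) => i; have [Df Hi] := Hf i.
  exact: Df.
by case: Hi.
Qed.

Lemma regc_coord U k i : open U -> regc U k (fun x => x 0 i).
Proof.
case: k => [|k] oU; split => //; try by move=> x _; exact: continuous_coord.
move=> j; have D x := @drv_coord R d x i j; split; first by move=> x _; case: (D x).
apply: (regc_eq oU _ (regc_cst k (i == j)%:R oU)) => x _.
by rewrite /partial; case: (D x) => _ ->.
Qed.

(** The sequence [g] lists the successive derivatives of the outer function; the induction on k has
    to treat all g n at once, because the chain rule moves from g n to g n.+1. *)
Lemma regc_comp U k f (g : nat -> R -> R) : open U ->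
  (forall n x, U x -> is_derive (f x) 1 (g n) (g n.+1 (f x))) ->
  regc U k f -> regc U k (fun x => g 0%N (f x)).
Proof.
move=> oU Dg; suff H : forall n, regc U k f -> regc U k (fun x => g n (f x)) by exact: H.
have C n : pcontinuous U f -> pcontinuous U (fun x => g n (f x)).
  move=> cf x Ux; apply: for_continuous_comp; first exact: cf.
  have [Dgx _] := Dg n x Ux; apply/differentiable_continuous.
  by apply/derivable1_diffP.
elim: k => [|k IH] n Kf; split => //; try exact/C/regc_continuous/Kf.
move=> i.
have H x : U x -> is_derive x (e_ i) (fun y => g n (f y)) (g n.+1 (f x) * partial i f x).
  by move=> Ux; exact: (is_derive_comp_dir (regc_drv i Kf Ux) (Dg n x Ux)).
split; first by move=> x Ux; case: (H x Ux).
apply: (regc_eq oU _ (regcM oU (IH n.+1 (regcW Kf)) (regc_partial i Kf))) => x Ux.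
by rewrite /partial; case: (H x Ux) => _ <-.
Qed.

Lemma open_within_continuous U f : open U ->
  {within U, continuous f} <-> pcontinuous U f.
Proof.
move=> oU; rewrite continuous_open_subspace//; split => H x.
  by move=> Ux; apply: H; exact/mem_set.
by move=> /set_mem; exact: H.
Qed.

Lemma regc_Ck U k f : open U -> Ck U k f <-> regc U k f.
Proof.
move=> oU; elim: k f => [|k IH] f; split => -[cf Hf]; split => //;
  try exact/open_within_continuous.
- by move=> i; have [Df /IH Hi] := Hf i.
- by move=> i; have [Df Hi] := Hf i; split => //; exact/IH.
Qed.

Lemma kint_regc {dZ : measure_display} {Z : measurableType dZ}
    (mu : {measure set Z -> \bar R}) (D : set Z) (p : 'rV[R]_d -> Z -> R) U k :
  open U -> measurable D -> (mu D < +oo)%E -> kreg U D k p -> regc U k (kint mu D p).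
Proof.
move=> oU mD Doo; elim: k p => [|k IH] p Kp; split => //;
  try exact: (kint_continuous oU mD Doo (kreg_kreg0 Kp)).
have K1 : kreg U D 1 p.
  elim: k Kp {IH} => [//|k IH] Kp; apply: IH; exact: kregW.
move=> i; have H x := kint_derive i oU mD Doo K1 (x := x).
split; first by move=> x Ux; case: (H x Ux).
have [_ /(_ i)[_ Ki]] := Kp.
by apply: (regc_eq oU _ (IH _ Ki)) => x Ux; rewrite /partial; case: (H x Ux) => _ <-.
Qed.

End regular_functions.

(** * Bump and defining functions *)

Section flat_function.
Context {R : realType}.
Implicit Types (p : {poly R}) (t x : R).

Lemma expr_exp_le n x : 0 <= x -> x ^+ n * expR (- x) <= n`!%:R.
Proof.
move=> x0; rewrite expRN ler_pdivrMr ?expR_gt0//.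
case: n => [|n]; first by rewrite expr0 fact0 mul1r -expR0 ler_expR.
have n0 : 0 < (n.+1)`!%:R :> R by rewrite ltr0n fact_gt0.
rewrite mulrC -ler_pdivrMr// (le_trans _ (expR_ge1Dxn n x0))//.
by rewrite lerDr.
Qed.

Lemma horner_exp_le p : exists C : R, forall x, 0 <= x -> `|p.[x]| * expR (- x) <= C.
Proof.
exists (\sum_(i < size p) `|p`_i| * i`!%:R) => x x0.
rewrite horner_coef (le_trans (ler_wpM2r (expR_ge0 _) (ler_norm_sum _ _ _)))//.
rewrite mulr_suml; apply: ler_sum => i _.
rewrite normrM -mulrA ler_wpM2l// normrX ger0_norm//; exact: expr_exp_le.
Qed.

(** The derivative of p(1/t) exp(-1/t) is t^-2 (p - p')(1/t) exp(-1/t), whence the recursion. *)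
Fixpoint flatp n : {poly R} :=
  if n is n'.+1 then 'X^2 * (flatp n' - (flatp n')^`()) else 1.

(* The n-th derivative of [exp (- 1 / t)] extended by [0] to [t <= 0]. *)
Definition flatn n t : R := if 0 < t then (flatp n).[t^-1] * expR (- t^-1) else 0.

(** The exponential beats every polynomial in 1/t. Quadratic smallness is what [is_derive_sq0] asks
    for in order to get the zero derivative at 0. *)
Lemma flatn_sq n : exists C : R, forall t, `|flatn n t| <= C * t ^+ 2.
Proof.
have [C HC] := horner_exp_le (flatp n * 'X^2); exists (Num.max C 0) => t.
rewrite /flatn; case: ifPn => [t0|_]; last first.
  by rewrite normr0 mulr_ge0 ?sqr_ge0// le_max lexx orbT.
have ti : 0 <= t^-1 by rewrite invr_ge0 ltW.
have := HC _ ti; rewrite hornerM hornerXn !normrM (ger0_norm (expR_ge0 _)).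
rewrite (ger0_norm ti) -expr2 => H.
have -> : `|(flatp n).[t^-1]| * expR (- t^-1) =
    (`|(flatp n).[t^-1]| * t^-1 ^+ 2 * expR (- t^-1)) * t ^+ 2.
  have tt : t^-1 ^+ 2 * t ^+ 2 = 1 by rewrite exprVn mulVf// expf_neq0// gt_eqF.
  by rewrite mulrAC -[_ * t^-1 ^+ 2 * _]mulrA tt mulr1.
by rewrite ler_wpM2r ?sqr_ge0// le_max H.
Qed.

Lemma is_derive_inv t : t != 0 -> is_derive t 1 (fun x => x^-1) (- t^-1 ^+ 2).
Proof.
move=> t0; have := @is_deriveV R id t 1 1 t0 (is_derive_id _ _).
by move=> H; apply: (is_derive_eq H); rewrite -[_ *: _]/(_ * _) mulr1 exprVn.
Qed.

Lemma is_derive_horner p t : is_derive t 1 (fun x => p.[x]) p^`().[t].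
Proof.
elim/poly_ind: p => [|p c IH].
  rewrite deriv0 horner0; have := drv_cst (0 : R) t 1.
  by congr is_derive; apply/funext => x; rewrite horner0.
rewrite derivMXaddC hornerD hornerM hornerX.
have -> : (fun x : R => (p * 'X + c%:P).[x]) = (fun x => p.[x] * x + c).
  by apply/funext => x; rewrite hornerD hornerMX hornerC.
have H := drvD (drvM IH (is_derive_id t (1 : R))) (drv_cst c t 1).
by apply: (is_derive_eq H); rewrite addr0 mulr1 addrC.
Qed.

Lemma is_derive_sq0 (f : R -> R) (C : R) : (forall t, `|f t| <= C * t ^+ 2) ->
  is_derive (0 : R) 1 f 0.
Proof.
move=> fC; have f0 : f 0 = 0.
  by apply/eqP; rewrite -normr_le0 (le_trans (fC 0))// expr0n/= mulr0.
have C0 : 0 <= C by have := fC 1; rewrite expr1n mulr1; exact: le_trans.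
suff H : (fun h : R => h^-1 *: ((f \o shift 0) (h *: 1) - f 0)) @ 0^' --> (0 : R).
  by apply: DeriveDef; [apply/cvg_ex; exists 0|apply/cvg_lim].
apply/cvgrPdist_le => e e0; near=> h.
have h0 : h != 0 by near: h; exact: nbhs_dnbhs_neq.
rewrite sub0r normrN /= addr0 [h *: 1]mulr1 f0 subr0 normrM normfV.
rewrite ler_pdivrMl ?normr_gt0//; apply: (le_trans (fC h)).
rewrite -(real_normK (num_real h)) expr2 mulrCA ler_wpM2l//.
rewrite (@le_trans _ _ ((C + 1) * `|h|))//; first by rewrite ler_wpM2r// lerDl.
rewrite -ler_pdivlMl ?ltr_wpDl//; near: h; apply: dnbhs0_le.
by rewrite mulr_gt0// invr_gt0 ltr_wpDl.
Unshelve. all: by end_near. Qed.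

Lemma is_derive_flatn n t : is_derive t 1 (flatn n) (flatn n.+1 t).
Proof.
have [t0|t0|->] := ltgtP t 0.
- rewrite {2}/flatn ltNge (ltW t0)/=; apply: drv_near (drv_cst 0 t 1).
  by near=> x; rewrite /flatn ltNge ltW//=; near: x; exact: lt_nbhsl.
- have tn0 : t != 0 by rewrite gt_eqF.
  apply: (@drv_near _ _ (fun x => (flatp n).[x^-1] * expR (- x^-1))).
    by near=> x; rewrite /flatn ifT//; near: x; exact: lt_nbhsr.
  rewrite {1}/flatn t0.
  have D1 := @is_derive_comp_dir _ _ _ (fun x => (flatp n).[x]) _ _ _ _
    (is_derive_inv tn0) (is_derive_horner (flatp n) t^-1).
  have D2 := @is_derive_comp_dir _ _ _ expR _ _ _ _
    (drvN (is_derive_inv tn0)) (is_derive_expR (- t^-1)).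
  apply: (is_derive_eq (drvM D1 D2)) => /=.
  rewrite hornerM hornerXn hornerD hornerN; lra.
- rewrite [flatn n.+1 0]/flatn ltxx; have [C HC] := flatn_sq n; exact: is_derive_sq0 HC.
Unshelve. all: by end_near. Qed.

Definition flat := flatn 0.

Lemma flat_gt0 t : (0 < flat t) = (0 < t).
Proof.
by rewrite /flat /flatn; case: ifPn => [t0|_]; rewrite ?ltxx// hornerE mul1r expR_gt0.
Qed.

Lemma flat_ge0 t : 0 <= flat t.
Proof.
by rewrite /flat /flatn; case: ifPn => // t0; rewrite hornerE mul1r expR_ge0.
Qed.

Lemma flat_le1 t : flat t <= 1.
Proof.
rewrite /flat /flatn; case: ifPn => // t0; rewrite hornerE mul1r expR_le1.
by rewrite oppr_le0 invr_ge0 ltW.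
Qed.

Lemma flat_le0 t : t <= 0 -> flat t = 0.
Proof. by move=> t0; rewrite /flat /flatn ltNge t0. Qed.

End flat_function.

Section bumps.
Context {R : realType} {d : nat}.
Implicit Types (x a : 'rV[R]_d) (r : R) (U : set 'rV[R]_d) (k : nat).

Lemma regc_flat U k (f : 'rV[R]_d -> R) : open U -> regc U k f ->
  regc U k (fun x => flat (f x)).
Proof.
by move=> oU; apply: regc_comp => // n x _; exact: is_derive_flatn.
Qed.

Lemma regc_sqn U k a : open U -> regc U k (fun x => sqn (x - a)).
Proof.
move=> oU; rewrite /sqn /dotv; apply: regc_sum => // i.
have H : regc U k (fun x : 'rV[R]_d => (x - a) 0 i).
  apply: (regc_eq oU _ (regcB oU (regc_coord k i oU) (regc_cst k (a 0 i) oU))) => x _.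
  by rewrite !mxE.
exact: regcM.
Qed.

Definition bump a r x := flat (r ^+ 2 - sqn (x - a)).

Lemma regc_bump U k a r : open U -> regc U k (bump a r).
Proof.
move=> oU; apply: regc_flat => //; apply: regcB => //; first exact: regc_cst.
exact: regc_sqn.
Qed.

Lemma bump_gt0 a r x : (0 < bump a r x) = (sqn (x - a) < r ^+ 2).
Proof. by rewrite /bump flat_gt0 subr_gt0. Qed.

Lemma bump_ge0 a r x : 0 <= bump a r x.
Proof. exact: flat_ge0. Qed.

Lemma bump_eq0 a r x : r ^+ 2 <= sqn (x - a) -> bump a r x = 0.
Proof. by move=> rx; rewrite /bump flat_le0// subr_le0. Qed.

Lemma norm_le_sqn x r : 0 <= r -> sqn x <= r ^+ 2 -> `|x| <= r.
Proof.
move=> r0 xr; rewrite [leLHS]/Num.norm/= mx_normrE.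
apply/bigmax_leP; split => // -[a i] _ /=; rewrite (ord1 a).
rewrite -(@ler_pXn2r _ 2) ?nnegrE// real_normK ?num_real// (le_trans _ xr)//.
rewrite /sqn /dotv (bigD1 i)//= expr2 lerDl.
by apply: sumr_ge0 => j _; rewrite -expr2 sqr_ge0.
Qed.

Lemma norm_lt_sqn x r : 0 < r -> sqn x < r ^+ 2 -> `|x| < r.
Proof.
move=> r0 xr; rewrite -(sqr_sqrtr (sqn_ge0 x)) in xr.
apply: (@le_lt_trans _ _ (Num.sqrt (sqn x))).
  by apply: norm_le_sqn; rewrite ?sqrtr_ge0// sqr_sqrtr ?sqn_ge0.
by move: xr; rewrite ltr_pXn2r ?nnegrE ?sqrtr_ge0// ltW.
Qed.

End bumps.

(** * Global defining functions of smooth bounded domains *)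

Section defining_function.
Context {R : realType} {d : nat}.
Implicit Types (x y a v w : 'rV[R]_d) (f : 'rV[R]_d -> R) (U Omega : set 'rV[R]_d).
Local Notation e_ i := (delta_mx 0 i : 'rV[R]_d).

Lemma dotvC x y : dotv x y = dotv y x.
Proof. by apply: eq_bigr => i _; rewrite mulrC. Qed.

Lemma dotvDl x y w : dotv (x + y) w = dotv x w + dotv y w.
Proof. by rewrite -big_split; apply: eq_bigr => i _; rewrite mxE mulrDl. Qed.

Lemma dotvZl (c : R) x y : dotv (c *: x) y = c * dotv x y.
Proof. by rewrite mulr_sumr; apply: eq_bigr => i _; rewrite mxE mulrA. Qed.

Lemma dotvZr (c : R) x y : dotv x (c *: y) = c * dotv x y.
Proof. by rewrite dotvC dotvZl dotvC. Qed.

Lemma dotv_le0 x : dotv x x <= 0 -> x = 0.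
Proof.
move=> x0; apply/rowP => i; rewrite mxE; apply/eqP.
have : sqn x == 0 by rewrite eq_le x0 sqn_ge0.
rewrite /sqn /dotv psumr_eq0 => [/allP/(_ i)|j _]; last by rewrite -expr2 sqr_ge0.
by rewrite mem_index_enum => /(_ isT); rewrite mulf_eq0 orbb.
Qed.

Lemma dotv_gt0 x : x != 0 -> 0 < dotv x x.
Proof. by move=> x0; rewrite ltNge; apply: contra x0 => /dotv_le0/eqP. Qed.

Lemma enorm_gt0 x : x != 0 -> 0 < enorm x.
Proof. by move=> /dotv_gt0; rewrite sqrtr_gt0. Qed.

(** Farkas' lemma for one inequality. With w the part of y orthogonal to x, the directions w - s x
    give w.y <= s (x.y) for all s > 0, hence w.y <= 0; but w.y = w.w, so w = 0. *)
Lemma half_space_parallel x y : x != 0 ->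
  (forall v, dotv v x < 0 -> dotv v y <= 0) -> exists2 c : R, 0 <= c & y = c *: x.
Proof.
move=> x0 H; have xx := dotv_gt0 x0.
pose c := dotv x y / dotv x x; exists c.
  rewrite divr_ge0// ?(ltW xx)//; have := H (- x).
  have N z : dotv (- x) z = - dotv x z by rewrite -scaleN1r dotvZl mulN1r.
  by rewrite !N oppr_lt0 oppr_le0; apply.
have [w wE] : {w | w = y - c *: x} by exists (y - c *: x).
have wx : dotv w x = 0.
  rewrite wE -scaleN1r scalerA dotvDl dotvZl (dotvC y) /c mulN1r mulNr divfK ?subrr//.
  by rewrite gt_eqF.
have wy s : 0 < s -> dotv w y <= s * dotv x y.
  move=> s0; have := H (w - s *: x).
  rewrite -scaleN1r scalerA !dotvDl !dotvZl wx add0r !mulN1r mulNr oppr_lt0 mulr_gt0//.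
  by move=> /(_ isT); rewrite mulNr subr_le0.
have wy0 : dotv w y <= 0.
  rewrite leNgt; apply/negP => wy0.
  have [xy|xy] := leP (dotv x y) 0.
    have := wy 1 ltr01; rewrite mul1r => /le_trans/(_ xy); rewrite leNgt wy0//.
  (* With this s the bound says that w.y is at most its half. *)
  have := wy (dotv w y / (2 * dotv x y)).
  rewrite divr_gt0 ?mulr_gt0// => /(_ isT).
  by rewrite invfM mulrA divfK ?gt_eqF//; lra.
have : dotv w w <= 0.
  rewrite {2}wE -scaleN1r scalerA dotvC dotvDl dotvZl (dotvC x) wx mulr0 addr0.
  by rewrite dotvC.
by move=> /dotv_le0 /eqP; rewrite wE subr_eq0 => /eqP.
Qed.

Lemma deriv_pos_right (g : R -> R) (b : R) : is_derive (0 : R) 1 g b -> g 0 = 0 ->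
  0 < b -> \forall t \near 0^'+, 0 < g t.
Proof.
move=> [Dg bE] g0 b0.
have : (fun h : R => h^-1 *: ((g \o shift 0) (h *: 1) - g 0)) @ 0^' --> b.
  by rewrite -bE; exact: Dg.
move=> H0; have H : \forall h \near 0^', 0 < h^-1 *: ((g \o shift 0) (h *: 1) - g 0).
  by apply: (cvgr_gt _ H0 0 b0).
suff : \forall t \near 0^'+, 0 < t^-1 *: ((g \o shift 0) (t *: 1) - g 0).
  move=> H1; near=> t; have t0 : 0 < t by near: t; exact: nbhs_right_gt.
  have : 0 < t^-1 *: ((g \o shift 0) (t *: 1) - g 0) by near: t.
  by rewrite /= g0 subr0 addr0 [t *: 1]mulr1 pmulr_rgt0// invr_gt0.
rewrite near_withinE; move: H; rewrite near_withinE; apply: filterS => t H t0.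
by apply: H; rewrite gt_eqF.
Unshelve. all: by end_near. Qed.

(** Weaker than a local defining function: the gradient is controlled only at boundary points and f
    may vanish outside Omega. Thus a negative constant is a patch inside Omega. *)
Definition patch Omega U f :=
  [/\ open U, forall k, regc U k f, forall y, U y -> Omega y -> f y < 0,
      forall y, U y -> ~ Omega y -> 0 <= f y &
      forall y, U y -> bdry Omega y -> grad f y != 0].

Lemma bdry_not_in Omega x : open Omega -> bdry Omega x -> ~ Omega x.
Proof. by move=> oO [_ nx] Ox; apply: nx; rewrite /interior /=; exact: open_nbhs_nbhs. Qed.

Lemma local_defining_patch Omega U x f : open Omega ->
  local_defining_function Omega U x f -> patch Omega U f.
Proof.
move=> oO [oU Ux /= sf gf OU]; split => //.
- by move=> k; apply/regc_Ck.
- move=> y Uy Oy; have : (Omega `&` U) y by [].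
  by rewrite OU => -[].
- move=> y Uy nOy; rewrite leNgt; apply/negP => fy; apply: nOy.
  have : [set y | U y /\ f y < 0] y by [].
  by rewrite -OU => -[].
- by move=> y Uy _; exact: gf.
Qed.

(** A positive value at y would persist nearby, but points of Omega, where f is negative, accumulate
    at y. *)
Lemma patch_bdry0 Omega U f y : patch Omega U f -> open Omega -> U y ->
  bdry Omega y -> f y = 0.
Proof.
move=> [oU sf fn fp _] oO Uy By; apply/eqP; rewrite eq_le fp ?andbT//; last exact: bdry_not_in.
rewrite leNgt; apply/negP => f0; have [clO _] := By.
have cf : {for y, continuous f} by apply: (regc_continuous (sf 0%N)).
have : nbhs y (fun z => U z /\ 0 < f z).
  near=> z; split; near: z; first exact: open_nbhs_nbhs.
  exact: (cvgr_gt _ cf).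
move=> /clO[z [Oz [Uz fz]]].
by have := lt_trans fz (fn z Uz Oz); rewrite ltxx.
Unshelve. all: by end_near. Qed.

(** A direction in which f decreases leads from y into Omega, where g <= 0 = g y. So g cannot
    increase in it, and [half_space_parallel] applies. *)
Lemma patch_parallel Omega U f U' g y : open Omega -> patch Omega U f -> U y ->
  bdry Omega y -> open U' -> regc U' 1 g -> U' y -> g y = 0 ->
  (forall z, U' z -> Omega z -> g z <= 0) ->
  exists2 c : R, 0 <= c & grad g y = c *: grad f y.
Proof.
move=> oO pf Uy By oU' sg U'y g0 gO; have [oU sf fn fp fg] := pf.
have f0 := patch_bdry0 pf oO Uy By.
apply: half_space_parallel; first exact: fg.
move=> v; rewrite /dotv => v0.
rewrite leNgt; apply/negP => gv.
have D1 := @is_derive_line R _ _ f y v 0.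
have y0 : y + 0 *: v = y by rewrite scale0r addr0.
have Df : is_derive (0 : R) 1 (fun s => - f (y + s *: v)) (- \sum_i v 0 i * partial i f y).
  apply: drvN; apply: (proj1 (is_derive_line f y v 0 _)); rewrite y0.
  exact: regc_drv_dir (sf 1%N) Uy.
have Dg : is_derive (0 : R) 1 (fun s => g (y + s *: v)) (\sum_i v 0 i * partial i g y).
  apply: (proj1 (is_derive_line g y v 0 _)); rewrite y0.
  exact: regc_drv_dir sg U'y.
have E h : \sum_i v 0 i * grad h y 0 i = \sum_i v 0 i * partial i h y.
  by apply: eq_bigr => i _; rewrite mxE.
have Hf : \forall t \near 0^'+, 0 < - f (y + t *: v).
  by apply: (deriv_pos_right Df); rewrite ?y0 ?f0 ?oppr0// oppr_gt0 -E.
have Hg : \forall t \near 0^'+, 0 < g (y + t *: v).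
  by apply: (deriv_pos_right Dg); rewrite ?y0 ?g0// -E.
have HU : \forall t \near (0 : R)^'+, (U `&` U') (y + t *: v).
  have : (fun t : R => y + t *: v) @ 0^'+ --> y.
    rewrite -[X in _ --> X]y0; apply: cvgD; first exact: cvg_cst.
    by apply: cvgZr_tmp; apply: cvg_at_right_filter; exact: cvg_id.
  move=> cv; apply: (cv (U `&` U')).
  by apply: open_nbhs_nbhs; split; [exact: openI|split].
near (0 : R)^'+ => t.
have [Ut U't] : (U `&` U') (y + t *: v) by near: t.
have : 0 < g (y + t *: v) by near: t.
apply/negP; rewrite -leNgt; apply: gO => //.
apply: contrapT => nO; have := fp _ Ut nO.
have : 0 < - f (y + t *: v) by near: t.
by rewrite oppr_gt0 ltNge => /negP.
Unshelve. all: by end_near. Qed.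

(** Outside Omega only the weak sign can be had: the function constructed below is a sum of terms
    cut off by bumps and vanishes far away. *)
Definition defining_function Omega f :=
  [/\ forall k, regc setT k f, forall x, Omega x -> f x < 0,
      forall x, ~ Omega x -> 0 <= f x &
      forall x, bdry Omega x -> [/\ f x = 0, grad f x != 0 &
        exists2 c : R, 0 < c & outer_normal Omega x = c *: grad f x]].


Lemma ball_norm_lt x y (r : R) : `|y - x| < r -> ball x r y.
Proof. by rewrite -ball_normE /= distrC. Qed.

Lemma open_lt_fun (T : topologicalType) (f : T -> R) (c : R) :
  (forall t : T, {for t, continuous f}) -> open [set x | f x < c].
Proof.
move=> cf; apply: (@open_comp _ _ f [set z | z < c]); last exact: open_lt.
by move=> x _; exact: cf.
Qed.

Lemma open_gt_fun (T : topologicalType) (f : T -> R) (c : R) :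
  (forall t : T, {for t, continuous f}) -> open [set x | c < f x].
Proof.
move=> cf; apply: (@open_comp _ _ f [set z | c < z]); last exact: open_gt.
by move=> x _; exact: cf.
Qed.

Lemma continuous_sqnB a x : {for x, continuous (fun y => sqn (y - a))}.
Proof. exact: (regc_continuous (regc_sqn 0 a openT)). Qed.

Lemma bounded_closure Omega : bounded_set Omega -> bounded_set (closure Omega).
Proof.
move=> [M [Mr HM]]; exists M; split => // N MN x cx /=; rewrite leNgt; apply/negP => Nx.
have xN : 0 < `|x| - N by rewrite subr_gt0.
have [y [Oy /= xy]] := cx _ (nbhsx_ballx x _ xN).
have yN : `|y| <= N := HM N MN y Oy.
move: xy; rewrite -ball_normE /= => xy.
have := ler_distD 0 x y; rewrite subr0 sub0r normrN; have := lerB_dist x y; lra.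
Qed.

(** Bumps times patches are summed over a finite cover of the closure. At each point all terms have
    the same weak sign, and at a boundary point all gradients are nonnegative multiples of one
    vector, so nothing cancels. *)
Lemma exists_defining_function Omega : smooth_bounded_domain Omega ->
  exists rho, defining_function Omega rho.
Proof.
move=> [oO cO O0 bO sO].
have cptO : compact (closure Omega).
  apply: bounded_closed_compact; last exact: closed_closure.
  exact: bounded_closure.
have Hpatch a : exists p : (set 'rV[R]_d) * ('rV[R]_d -> R) * R, closure Omega a ->
    [/\ patch Omega p.1.1 p.1.2, 0 < p.2 & forall y, `|y - a| < 2 * p.2 -> p.1.1 y].
  have [ca|nca] := pselect (closure Omega a); last by exists (set0, cst 0, 1).
  have [U [f [pf Ua]]] : exists U f, patch Omega U f /\ U a.
    have [Oa|nOa] := pselect (Omega a).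
      (* At an interior point the constant -1 on Omega is a patch, since an open set contains none
         of its boundary points. *)
      exists Omega, (cst (-1)); split => //; split => //.
      - by move=> k; exact: regc_cst.
      - by move=> y _ _ /=; rewrite oppr_lt0.
      - by move=> y Oy /(bdry_not_in oO).
    have Ba : bdry Omega a by split => // /interior_subset.
    have [U [f lf]] := sO a Ba; exists U, f; split; last by case: lf.
    exact: local_defining_patch lf.
  have [oU _ _ _ _] := pf.
  have /nbhs_ballP[r /= r0 rU] := open_nbhs_nbhs (conj oU Ua).
  (* The patch lives on twice the radius of the bump, so that [U j] and the region [V j], on which
     the bump vanishes, cover the space; the product is smooth on each of the two. *)
  exists (U, f, r / 2) => _ /=; split => //; first exact: divr_gt0.
  by move=> y; rewrite mulrC divfK// => /ball_norm_lt/rU.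
have /choice[p Hp] := Hpatch.
pose rr a := (p a).2; pose ff a := (p a).1.2; pose UU a := (p a).1.1.
pose F a := [set x | sqn (x - a) < rr a ^+ 2].
move: (cptO); rewrite compact_cover => /(_ _ (closure Omega) F) [].
- by move=> a ca; apply: open_lt_fun; exact: continuous_sqnB.
- move=> a ca; exists a => //; rewrite /F/= subrr.
  have -> : sqn (0 : 'rV[R]_d) = 0 by apply: big1 => i _; rewrite mxE mul0r.
  by rewrite exprn_gt0//; case: (Hp a ca).
move=> D DO cov.
pose s : seq 'rV[R]_d := finmap.enum_fset D; pose n := size s; pose c (j : 'I_n) := nth 0 s j.
have cD j : closure Omega (c j).
  by have := DO (c j); rewrite inE; apply; exact: mem_nth.
have covO x : closure Omega x -> exists j, sqn (x - c j) < rr (c j) ^+ 2.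
  move=> /cov[a /= aD]; rewrite /F/= => xa.
  have la : (index a s < n)%N by rewrite index_mem.
  by exists (Ordinal la); rewrite /c/= nth_index.
pose b j := bump (c j) (rr (c j)); pose f j := ff (c j); pose U j := UU (c j).
have pf j : patch Omega (U j) (f j) by case: (Hp _ (cD j)).
have r0 j : 0 < rr (c j) by case: (Hp _ (cD j)).
have Ur j y : sqn (y - c j) < (2 * rr (c j)) ^+ 2 -> U j y.
  move=> H; have [_ _] := Hp _ (cD j); apply; apply: norm_lt_sqn => //.
  by rewrite mulr_gt0//; exact: (r0 j).
have rr2 j : rr (c j) ^+ 2 < (2 * rr (c j)) ^+ 2.
  by rewrite ltr_pXn2r// ?nnegrE ?mulr_ge0 ?(ltW (r0 j))// ltr_pMl// ltr1n.
have bU j y : 0 < b j y -> U j y.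
  by rewrite bump_gt0 => H; apply: Ur; exact: lt_trans (rr2 j).
pose V j := [set x | rr (c j) ^+ 2 < sqn (x - c j)].
have oV j : open (V j).
  by apply: open_gt_fun; exact: continuous_sqnB.
have UV j : U j `|` V j = setT.
  apply/seteqP; split => // x _; have [H|H] := ltP (sqn (x - c j)) ((2 * rr (c j)) ^+ 2).
    by left; exact: Ur.
  by right; exact: lt_le_trans H.
have bV j x : V j x -> b j x = 0 by move=> Vx; apply: bump_eq0; exact: ltW.
have sbf k j : regc setT k (fun x => b j x * f j x).
  rewrite -(UV j); apply: regcU.
    have [oU sf _ _ _] := pf j; apply: regcM => //; exact: regc_bump.
  by apply: (regc_eq (oV j) _ (regc_cst k 0 (oV j))) => x /bV ->; rewrite mul0r.
pose rho x := \sum_j b j x * f j x.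
have srho k : regc setT k rho by apply: regc_sum => //; exact: openT.
have bf0 j x : Omega x -> b j x * f j x <= 0.
  move=> Ox; have : 0 <= b j x by exact: bump_ge0.
  rewrite le_eqVlt => /predU1P[<-|b0]; first by rewrite mul0r.
  by rewrite pmulr_rle0//; have [_ _ H _ _] := pf j; apply/ltW/H => //; exact: bU.
have bf1 j x : ~ Omega x -> 0 <= b j x * f j x.
  move=> Ox; have : 0 <= b j x by exact: bump_ge0.
  rewrite le_eqVlt => /predU1P[<-|b0]; first by rewrite mul0r.
  by rewrite pmulr_rge0//; have [_ _ _ H _] := pf j; apply/H => //; exact: bU.
have rhoO x : Omega x -> rho x < 0.
  move=> Ox; have [j Hj] := covO x (subset_closure Ox).
  rewrite /rho (bigD1 j)//= ltr_nwDl//; last by apply: sumr_le0 => i _; exact: bf0.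
  have b0 : 0 < b j x by rewrite bump_gt0.
  by rewrite pmulr_rlt0//; have [_ _ H _ _] := pf j; apply/H => //; exact: bU.
have rhoN x : ~ Omega x -> 0 <= rho x by move=> nOx; apply: sumr_ge0 => i _; exact: bf1.
exists rho; split => // x Bx.
have bfB j : b j x * f j x = 0.
  have : 0 <= b j x by exact: bump_ge0.
  rewrite le_eqVlt => /predU1P[<-|b0]; first by rewrite mul0r.
  by rewrite (patch_bdry0 (pf j) oO (bU _ _ b0) Bx) mulr0.
have rho0 : rho x = 0 by rewrite /rho big1.
(* [outer_normal] is a choice; f0 is the local defining function behind that choice, and every
   gradient at x is compared with its gradient. *)
have [U0 [f0 [lf0 nE]]] : exists U0 f0, local_defining_function Omega U0 x f0 /\
    outer_normal Omega x = (enorm (grad f0 x))^-1 *: grad f0 x.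
  have [U0 [f0 lf0]] := sO x Bx.
  apply: (@getPex _ [set n | exists U rho, local_defining_function Omega U x rho /\
                             n = (enorm (grad rho x))^-1 *: grad rho x]).
  by exists ((enorm (grad f0 x))^-1 *: grad f0 x), U0, f0.
have pf0 := local_defining_patch oO lf0.
have U0x : U0 x by case: lf0.
have gf0 : grad f0 x != 0 by have [_ _ _ _] := pf0; apply.
(* At x the patch vanishes, so the gradient of the product is the bump times the gradient of the
   patch; it is a positive multiple of grad f0 x as soon as the bump is positive. *)
have Hj j : exists e : R, [/\ 0 <= e, (0 < b j x -> 0 < e) &
    forall i, partial i (fun y => b j y * f j y) x = e * partial i f0 x].
  have [Ux|nUx] := pselect (U j x); last first.
    have Vx : V j x by have : setT x by []; rewrite -(UV j) => -[].
    exists 0; split => //; first by rewrite bV// ltxx.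
    move=> i; rewrite mul0r /partial.
    have : is_derive x (e_ i) (fun y => b j y * f j y) (0 : R).
      apply: (drv_near _ (drv_cst 0 x (e_ i))).
      near=> y; have Vy : V j y by near: y; exact: open_nbhs_nbhs.
      by rewrite bV// mul0r.
    by case.
  have fx0 := patch_bdry0 (pf j) oO Ux Bx.
  have [oU sf fn _ fg] := pf j.
  have [e e0 ge] : exists2 e : R, 0 <= e & grad (f j) x = e *: grad f0 x.
    apply: (patch_parallel oO pf0 U0x Bx oU (sf 1%N) Ux fx0) => z Uz Oz.
    exact/ltW/fn.
  exists (b j x * e); split; first by rewrite mulr_ge0//; exact: bump_ge0.
    move=> b0; rewrite mulr_gt0// lt_neqAle e0 andbT eq_sym.
    by apply: contraNneq (fg x Ux Bx) => e00; rewrite ge e00 scale0r.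
  move=> i; have := drvM (regc_drv i (regc_bump 1 (c j) (rr (c j)) oU) Ux) (regc_drv i (sf 1%N) Ux).
  rewrite fx0 mulr0 add0r => -[_]; rewrite /partial => ->.
  by rewrite -mulrA; congr (_ * _); have /rowP/(_ i) := ge; rewrite !mxE.
have /choice[e He] := Hj.
have grho : grad rho x = (\sum_j e j) *: grad f0 x.
  apply/rowP => i; rewrite !mxE mulr_suml.
  have : is_derive x (e_ i) rho (\sum_j e j * partial i f0 x).
    apply: drv_sum => j; have [_ _ <-] := He j; exact: regc_drv (sbf 1%N j) _.
  by case.
have e0 : 0 < \sum_j e j.
  have [j Hjx] := covO x (proj1 Bx).
  rewrite (bigD1 j)//= ltr_wpDr//; first by apply: sumr_ge0 => i _; case: (He i).
  by have [_ H _] := He j; apply: H; rewrite bump_gt0.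
split => //; first by rewrite grho scaler_eq0 negb_or gf0 gt_eqF.
exists ((enorm (grad f0 x))^-1 / (\sum_j e j)).
  by rewrite divr_gt0// invr_gt0 enorm_gt0.
by rewrite nE grho scalerA divfK// gt_eqF.
Unshelve. all: by end_near. Qed.

End defining_function.

(** * Divergence theorem *)

Section charge_integrals.
Context {dT : measure_display} {T : measurableType dT} {R : realType}.
Implicit Types (nu : {charge set T -> \bar R}) (D : set T) (f g : T -> R).

Lemma Rintegral_measure_add (m1 m2 : {measure set T -> \bar R}) D f : measurable D ->
  rintegrable m1 D f -> rintegrable m2 D f ->
  \int[measure_add m1 m2]_(x in D) f x = \int[m1]_(x in D) f x + \int[m2]_(x in D) f x.
Proof.
move=> mD I1 I2; rewrite /Rintegral (integral_measure_add mD I1 I2) fineD//;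
  exact: integrable_fin_num.
Qed.

Lemma subr_swap (a b c e : R) : a + e = b + c -> a - b = c - e.
Proof. lra. Qed.

(** With the Jordan decomposition p - n of nu one has p + m2 = n + m1 as measures, so the integral
    does not depend on the decomposition that is used. *)
Lemma charge_integral_diff nu (m1 m2 : {measure set T -> \bar R}) D f (C : R) :
  measurable D -> (forall A, measurable A -> (m1 A < +oo)%E) ->
  (forall A, measurable A -> (m2 A < +oo)%E) ->
  (forall A, measurable A -> nu A = (m1 A - m2 A)%E) ->
  measurable_fun D f -> (forall x, D x -> `|f x| <= C) ->
  charge_integral nu D f = \int[m1]_(x in D) f x - \int[m2]_(x in D) f x.
Proof.
move=> mD f1 f2 nuE mf fC; rewrite /charge_integral.
set nuPN := projT2 _; set p := jordan_pos nuPN; set n := jordan_neg nuPN.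
have pfin A : measurable A -> p A \is a fin_num by move=> mA; exact: fin_num_measure.
have nfin A : measurable A -> n A \is a fin_num by move=> mA; exact: fin_num_measure.
have I (m : {measure set T -> \bar R}) : (m D < +oo)%E -> rintegrable m D f.
  by move=> mDoo; exact: rintegrable_bounded fC.
have Ip : rintegrable p D f by apply: I; rewrite ltey_eq pfin.
have In : rintegrable n D f by apply: I; rewrite ltey_eq nfin.
have I1 : rintegrable m1 D f by apply: I; exact: f1.
have I2 : rintegrable m2 D f by apply: I; exact: f2.
have E : \int[measure_add p m2]_(x in D) f x = \int[measure_add n m1]_(x in D) f x.
  congr fine; apply: eq_measure_integral => A mA _.
  apply: (eq_trans (measure_addE p m2 A)); apply: (eq_trans _ (esym (measure_addE n m1 A))).
  have := nuE A mA; rewrite {1}(jordan_decomp nuPN mA) /cadd/= cscaleN1 /= => H.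
  have m1f : m1 A \is a fin_num by rewrite ge0_fin_numE// f1.
  have m2f : m2 A \is a fin_num by rewrite ge0_fin_numE// f2.
  have := pfin A mA; have := nfin A mA; move: H.
  rewrite -/p -/n -(fineK m1f) -(fineK m2f).
  move: (p A) (n A) => [a| |] [b| |]//=.
  by rewrite -!EFinB -!EFinD => -[H] _ _; congr EFin; lra.
by move: E; rewrite !Rintegral_measure_add//; exact: subr_swap.
Qed.

Lemma charge_jordan nu : exists p n : {measure set T -> \bar R},
  [/\ forall A, measurable A -> (p A < +oo)%E, forall A, measurable A -> (n A < +oo)%E,
      forall A, measurable A -> nu A = (p A - n A)%E &
      forall D f, charge_integral nu D f = \int[p]_(x in D) f x - \int[n]_(x in D) f x].
Proof.
pose nuPN := projT2 (cid (Hahn_decomposition_pair nu)).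
exists (jordan_pos nuPN), (jordan_neg nuPN); split => //.
- by move=> A mA; rewrite ltey_eq fin_num_measure.
- by move=> A mA; rewrite ltey_eq fin_num_measure.
- by move=> A mA; rewrite {1}(jordan_decomp nuPN mA) /cadd/= cscaleN1.
Qed.

Lemma charge_integralD nu1 nu2 D f (C : R) : measurable D ->
  measurable_fun D f -> (forall x, D x -> `|f x| <= C) ->
  charge_integral (cadd nu1 nu2) D f = charge_integral nu1 D f + charge_integral nu2 D f.
Proof.
move=> mD mf fC; have [p1 [n1 [p1f n1f E1 ->]]] := charge_jordan nu1.
have [p2 [n2 [p2f n2f E2 ->]]] := charge_jordan nu2.
rewrite (@charge_integral_diff _ (measure_add p1 p2) (measure_add n1 n2) D f C)//.
- by rewrite !Rintegral_measure_add//; try (apply: (rintegrable_bounded mD _ mf fC); auto); lra.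
- move=> A mA; have := lte_add_pinfty (p1f A mA) (p2f A mA).
  by rewrite -(measure_addE p1 p2); exact.
- move=> A mA; have := lte_add_pinfty (n1f A mA) (n2f A mA).
  by rewrite -(measure_addE n1 n2); exact.
move=> A mA; transitivity ((p1 A + p2 A) - (n1 A + n2 A))%E; last first.
  by rewrite -(measure_addE p1 p2) -(measure_addE n1 n2).
transitivity ((p1 A - n1 A) + (p2 A - n2 A))%E; first by rewrite -E1// -E2.
rewrite fin_num_oppeD//.
  by rewrite addeACA.
by rewrite ge0_fin_numE// n2f.
Qed.

Lemma charge_integral0 D f : charge_integral (czero : {charge set T -> \bar R}) D f = 0.
Proof.
have [p [n [pf nf E ->]]] := charge_jordan (czero : {charge set T -> \bar R}).
suff -> : \int[p]_(x in D) f x = \int[n]_(x in D) f x by rewrite subrr.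
congr fine; apply: eq_measure_integral => A mA _; have := E A mA.
have pA : p A \is a fin_num by rewrite ge0_fin_numE// pf.
have nA : n A \is a fin_num by rewrite ge0_fin_numE// nf.
rewrite /czero -(fineK pA) -(fineK nA) -EFinB => -[H]; congr EFin; lra.
Qed.

Lemma charge_integralZ nu D f (c C : R) : measurable D ->
  measurable_fun D f -> (forall x, D x -> `|f x| <= C) ->
  charge_integral (cscale c nu) D f = c * charge_integral nu D f.
Proof.
move=> mD mf fC; have [p [n [pf nf E ->]]] := charge_jordan nu.
have Ip : rintegrable p D f by apply: (rintegrable_bounded mD _ mf fC); exact: pf.
have In : rintegrable n D f by apply: (rintegrable_bounded mD _ mf fC); exact: nf.
have S (m : {measure set T -> \bar R}) (r : {nonneg R}) : rintegrable m D f ->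
    \int[mscale r m]_(x in D) f x = r%:num * \int[m]_(x in D) f x.
  move=> Im; have mfE : measurable_fun D (EFin \o f) by exact/measurable_EFinP.
  rewrite /Rintegral [in RHS]integralE [in LHS]integralE !ge0_integral_mscale//.
  - have /integrableP[_] := Im; have := integrable_fin_num mD (integrable_funepos mD Im).
    have := integrable_fin_num mD (integrable_funeneg mD Im).
    move=> H1 H2 _; rewrite -(fineK H1) -(fineK H2) -!EFinM -!EFinB /=; lra.
  - exact: measurable_funeneg.
  - exact: measurable_funepos.
have Sf (m : {measure set T -> \bar R}) (r : {nonneg R}) A :
    (m A < +oo)%E -> (mscale r m A < +oo)%E.
  by move=> mA; rewrite /mscale lte_mul_pinfty// ge0_fin_numE.
have [c0|c0] := leP 0 c.
  rewrite (@charge_integral_diff _ (mscale (NngNum c0) p) (mscale (NngNum c0) n) D f C)//.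
  - by rewrite !S//= mulrBr.
  - by move=> A mA; exact/Sf/pf.
  - by move=> A mA; exact/Sf/nf.
  - move=> A mA; transitivity (c%:E * (p A - n A))%E; first by rewrite -E.
    have pA : p A \is a fin_num by rewrite ge0_fin_numE// pf.
    by rewrite muleBr// fin_num_adde_defr.
(* A negative factor exchanges the positive and the negative part. *)
have c1 : 0 <= - c by rewrite oppr_ge0 ltW.
rewrite (@charge_integral_diff _ (mscale (NngNum c1) n) (mscale (NngNum c1) p) D f C)//.
- by rewrite !S//=; lra.
- by move=> A mA; exact/Sf/nf.
- by move=> A mA; exact/Sf/pf.
- move=> A mA; transitivity (c%:E * (p A - n A))%E; first by rewrite -E.
  have pA : p A \is a fin_num by rewrite ge0_fin_numE// pf.
  have nA : n A \is a fin_num by rewrite ge0_fin_numE// nf.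
  transitivity ((- c)%:E * n A - (- c)%:E * p A)%E; last by [].
  move: (p A) (n A) pA nA => [a| |] [b| |]// _ _.
  by rewrite -EFinB; apply: (congr1 EFin); lra.
Qed.

Lemma charge_integral_bound nu D : measurable D -> exists M : R, 0 <= M /\
  forall f C, measurable_fun D f -> (forall x, D x -> `|f x| <= C) -> 
  `|charge_integral nu D f| <= M * C.
Proof.
move=> mD; have [p [n [pf nf _ E]]] := charge_jordan nu.
exists (fine (p D) + fine (n D)); split; first by rewrite addr_ge0// fine_ge0.
move=> f C mf fC; rewrite E (le_trans (ler_normB _ _))// mulrDl lerD//.
- by rewrite mulrC; apply: Rintegral_bound => //; exact: pf.
- by rewrite mulrC; apply: Rintegral_bound => //; exact: nf.
Qed.

Lemma charge_integralB nu D f g (C : R) : measurable D ->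
  measurable_fun D f -> (forall x, D x -> `|f x| <= C) ->
  measurable_fun D g -> (forall x, D x -> `|g x| <= C) ->
  charge_integral nu D (fun x => f x - g x) = charge_integral nu D f - charge_integral nu D g.
Proof.
move=> mD mf fC mg gC; have [p [n [pf nf _ E]]] := charge_jordan nu.
by rewrite !E !RintegralB//; try (apply: (rintegrable_bounded mD _ _ fC); auto);
  try (apply: (rintegrable_bounded mD _ _ gC); auto); lra.
Qed.

Lemma charge_integralM nu D f (c C : R) : measurable D ->
  measurable_fun D f -> (forall x, D x -> `|f x| <= C) ->
  charge_integral nu D (fun x => c * f x) = c * charge_integral nu D f.
Proof.
move=> mD mf fC; have [p [n [pf nf _ E]]] := charge_jordan nu.
by rewrite !E !RintegralZl//; try (apply: (rintegrable_bounded mD _ _ fC); auto); lra.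
Qed.

Lemma charge_integral_dominated nu D (f_ : nat -> T -> R) f (C : R) : measurable D ->
  (forall n, measurable_fun D (f_ n)) -> measurable_fun D f ->
  (forall x, D x -> f_ ^~ x @ \oo --> f x) ->
  (forall n x, D x -> `|f_ n x| <= C) ->
  (fun n => charge_integral nu D (f_ n)) @ \oo --> charge_integral nu D f.
Proof.
move=> mD mf_ mf ff fC; have [p [m [pf nf _ E]]] := charge_jordan nu.
rewrite E; under eq_fun do rewrite E.
have [_ Hp] := Rintegral_dominated mD mf_ mf ff (rintegrable_cst C mD (pf D mD)) fC.
have [_ Hm] := Rintegral_dominated mD mf_ mf ff (rintegrable_cst C mD (nf D mD)) fC.
exact: cvgB Hp Hm.
Qed.

Lemma eq_charge_integral nu D f g : (forall x, D x -> f x = g x) ->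
  charge_integral nu D f = charge_integral nu D g.
Proof.
move=> fg; rewrite /charge_integral; congr (_ - _);
  by apply: eq_Rintegral => x /set_mem; exact: fg.
Qed.

End charge_integrals.

Section compactness.
Context {R : realType}.

(** The common form of all passages from local to uniform constants below. Monotonicity in C allows
    the near-covering property of K to be used along the filter at infinity. *)
Lemma compact_uniform (X : topologicalType) (K : set X) (Q : R -> X -> Prop) :
  compact K -> (forall C C' y, C <= C' -> Q C y -> Q C' y) ->
  (forall x, K x -> exists C, \forall y \near x, Q C y) ->
  exists C, forall y, K y -> Q C y.
Proof.
move=> /compact_near_coveringP cK mono loc.
have /(_ (fun C y => Q C y)) := cK R (+oo : set_system R).
have H x : K x -> \forall x' \near x & i \near +oo, Q i x'.
  move=> /loc[C HC]; exists ([set y | Q C y], [set i | C <= i]).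
    by split => //=; exact/nbhs_pinfty_ge/num_real.
  by move=> [y i] /= [Qy Ci]; exact: mono Qy.
move=> /(_ _ H)-[M [_ HM]].
by exists (M + 1) => y Ky; apply: (HM (M + 1)) => //; rewrite ltrDl.
Qed.

Lemma compact_bounded_fun (X : topologicalType) (K : set X) (f : X -> R) :
  compact K -> (forall x, K x -> {for x, continuous f}) ->
  exists C, forall y, K y -> `|f y| <= C.
Proof.
move=> cK cf; apply: (@compact_uniform _ K (fun C y => `|f y| <= C)) => //.
  by move=> C C' y CC'; move/le_trans; apply.
move=> x Kx; exists (`|f x| + 1); exact: for_continuous_locally_bounded (cf x Kx).
Qed.

End compactness.

(** * Mollification *)

Section mollification.
Context {R : realType} {d : nat}.
Implicit Types (x y z w : 'rV[R]_d) (U : set 'rV[R]_d) (k : nat) (G : 'rV[R]_d -> R).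
Local Notation e_ i := (delta_mx 0 i : 'rV[R]_d).
Local Notation leb := (lebesgue_rV d : {sigma_finite_measure set 'rV[R]_d -> \bar R}).

Lemma closed_measurable_rV (A : set 'rV[R]_d) : closed A -> measurable A.
Proof.
move=> cA; rewrite -[A]setCK; apply: measurableC; apply: open_measurable_rV.
exact: closed_openC.
Qed.

Lemma pcontinuous_measurable U G : open U -> pcontinuous U G -> measurable_fun U G.
Proof.
move=> oU cG; apply: (measurability _ (RGenOpens.measurableE R)).
move=> _ [_ [a [b ->]] <-]; apply: open_measurable_rV.
have /continuousP cG' : {within U, continuous G} by exact/open_within_continuous.
have /open_subspaceP[V oV VO] : open (from_subspace U G @^-1` `]a, b[).
  by apply: cG'; exact: interval_open.
by rewrite setIC -VO; exact: openI.
Qed.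

Lemma near_norm_lt x (r : R) : 0 < r -> \forall y \near x, `|y - x| < r.
Proof.
by move=> r0; have := nbhsx_ballx x _ r0; apply: filterS => y; rewrite -ball_normE /= distrC.
Qed.

(** Half of the exponent is spent on the polynomial factor, by q^n exp(- b q / 2) <= (2 / b)^n
    n!. *)
Lemma gauss_pow (b s : R) n z : 0 < b -> 0 < s ->
  (sqn z * s^-1 ^+ 2) ^+ n * gauss b s z <= (2 / b) ^+ n * n`!%:R * gauss (b / 2) s z.
Proof.
move=> b0 s0; rewrite /gauss; set q := sqn z * _.
have q0 : 0 <= q by rewrite mulr_ge0 ?sqn_ge0// exprn_ge0// invr_ge0 ltW.
have -> : - (b * sqn z) * s^-1 ^+ 2 = - (b / 2 * sqn z) * s^-1 ^+ 2 + - (b / 2 * q).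
  by rewrite /q; lra.
rewrite expRD; have := expr_exp_le n (mulr_ge0 (ltW (divr_gt0 b0 (ltr0Sn R 1))) q0).
rewrite exprMn => H.
have E : q ^+ n * expR (- (b / 2 * q)) <= (2 / b) ^+ n * n`!%:R.
  have b2 : (b / 2) ^+ n * (2 / b) ^+ n = 1.
    by rewrite -exprMn mulrA divfK// divff ?gt_eqF// expr1n.
  have b2p : 0 < (2 / b) ^+ n by rewrite exprn_gt0// divr_gt0.
  rewrite -(ler_pM2l b2p) in H; apply: le_trans H.
  by rewrite -!mulrA [leRHS]mulrA [_ * (b / 2) ^+ n]mulrC b2 mul1r.
have P : 0 <= s^-1 ^+ d * expR (- (b / 2 * sqn z) * s^-1 ^+ 2).
  by rewrite mulr_ge0 ?expR_ge0// exprn_ge0// invr_ge0 ltW.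
have := ler_wpM2r P E; lra.
Qed.

(** At distance at least r, the factor 1 is at most |z|^2 / r^2, and [gauss_pow] with n = 1 converts
    |z|^2 into 2 s^2 / b. *)
Lemma gauss_tail (b s r : R) z : 0 < b -> 0 < s -> 0 < r -> r ^+ 2 <= sqn z ->
  gauss b s z <= 2 / b * s ^+ 2 / r ^+ 2 * gauss (b / 2) s z.
Proof.
move=> b0 s0 r0 rz; have := gauss_pow 1 z b0 s0; rewrite !expr1 mulr1 => H.
have r2 : 0 < r ^+ 2 by rewrite exprn_gt0.
have s2 : 0 < s ^+ 2 by rewrite exprn_gt0.
have -> : 2 / b * s ^+ 2 / r ^+ 2 * gauss (b / 2) s z =
  (2 / b * gauss (b / 2) s z) * s ^+ 2 / r ^+ 2 by lra.
rewrite ler_pdivlMr// -ler_pdivrMr//; apply: le_trans H.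
rewrite -exprVn mulrC mulrA [s^-1 ^+ 2 * _]mulrC -mulrA [gauss _ _ _ * _]mulrC mulrA.
rewrite [leLHS]mulrC mulrA.
rewrite -[leRHS]mulrA; have g0 := gauss_ge0 b z (ltW s0).
rewrite [leLHS](_ : _ = r ^+ 2 * (s^-1 ^+ 2 * gauss b s z)); last by lra.
by rewrite ler_wpM2r// mulr_ge0// exprn_ge0// invr_ge0 ltW.
Qed.

Definition eball (r : R) : set 'rV[R]_d := [set z | sqn z < r ^+ 2].

Lemma open_eball r : open (eball r).
Proof. by apply: open_lt_fun; exact: continuous_sqn. Qed.

Lemma measurable_eball r : measurable (eball r).
Proof. by apply: open_measurable_rV; exact: open_eball. Qed.

Lemma eball_norm r z : 0 < r -> eball r z -> `|z| < r.
Proof. by move=> r0; exact: norm_lt_sqn. Qed.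

Lemma eball_lty r : 0 < r -> (leb (eball r) < +oo)%E.
Proof.
move=> r0; apply: lebesgue_rV_bounded; first exact: measurable_eball.
by exists r; split => [|M rM z]; [exact: num_real|]; move=> /(eball_norm r0)/ltW zr; exact: le_trans zr (ltW rM).
Qed.

Lemma gauss_rintegrable (b s : R) : 0 < b -> 0 < s -> rintegrable leb setT (gauss b s).
Proof.
move=> b0 s0; apply: rintegrable_ge0.
- exact: measurable_gauss.
- by move=> x _; exact/gauss_ge0/ltW.
- by rewrite integral_gauss// ltry.
Qed.

(** If the ball were negligible, the Gaussian of any width would have all of its mass outside; for a
    small width the tail estimate leaves at most half of the mass there. *)
Lemma eball_gt0 r : 0 < r -> leb (eball r) != 0%E.
Proof.
move=> r0; apply/eqP => B0.
pose m := gauss_mass d (1 : R); pose m' := gauss_mass d (2^-1 : R).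
have m0 : 0 < m by exact: gauss_mass_gt0.
have m'0 : 0 < m' by apply: gauss_mass_gt0; rewrite invr_gt0.
(* With this width the tail bound 2 s^2 m' / r^2 equals m / 2. *)
pose s := Num.sqrt (r ^+ 2 * m / (4 * m')).
have H0 : 0 < r ^+ 2 * m / (4 * m') by rewrite !(divr_gt0, mulr_gt0)// exprn_gt0.
have s0 : 0 < s by rewrite sqrtr_gt0.
have s2 : s ^+ 2 = r ^+ 2 * m / (4 * m') by rewrite sqr_sqrtr// ltW.
have b2 : 0 < 1 / 2 :> R by rewrite divr_gt0.
have := gauss_rintegrable ltr01 s0; have := gauss_rintegrable b2 s0 => I2 I1.
have : m%:E = (\int[leb]_(x in ~` eball r) (gauss 1 s x)%:E)%E.
  rewrite /m -(integral_gauss d ltr01 s0).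
  rewrite (negligible_integral (measurable_eball r))//.
  by rewrite setTD.
apply/eqP; rewrite gt_eqF//.
apply: (@le_lt_trans _ _ (\int[leb]_x (2 * s ^+ 2 / r ^+ 2 * gauss (1 / 2) s x)%:E)%E).
  apply: (@le_trans _ _ (\int[leb]_(x in ~` eball r) (2 * s ^+ 2 / r ^+ 2 * gauss (1 / 2) s x)%:E)%E).
    apply: ge0_le_integral => //.
    - by apply: measurableC; exact: measurable_eball.
    - by move=> x _; rewrite lee_fin gauss_ge0// ltW.
    - by apply/measurable_EFinP; apply: measurable_funTS; exact: measurable_gauss.
    - apply/measurable_EFinP; apply: measurable_funTS; apply: measurable_funM => //.
      exact: measurable_gauss.
    - move=> x /= /negP; rewrite -leNgt => rx; rewrite lee_fin.
      by have := gauss_tail ltr01 s0 r0 rx; rewrite invr1 mulr1.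
  apply: ge0_subset_integral => //.
  - by apply: measurableC; exact: measurable_eball.
  - by apply/measurable_EFinP; apply: measurable_funM => //; exact: measurable_gauss.
  - move=> x _; rewrite lee_fin; apply: mulr_ge0; last exact/gauss_ge0/ltW.
    by rewrite mulr_ge0 ?invr_ge0 ?sqr_ge0// mulr_ge0// sqr_ge0.
under eq_integral do rewrite EFinM.
rewrite ge0_integralZl_EFin//.
- rewrite integral_gauss// -EFinM lte_fin (_ : 1 / 2 = 2^-1) ?mul1r//.
  rewrite -/m' s2.
  have -> : 2 * (r ^+ 2 * m / (4 * m')) / r ^+ 2 * m' = m * (2 / 4) * ((r ^+ 2)^-1 * r ^+ 2) * (m'^-1 * m').
    by rewrite invfM; lra.
  have e1 : (r ^+ 2)^-1 * r ^+ 2 = 1 by rewrite mulVf// gt_eqF// exprn_gt0.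
  have e2 : m'^-1 * m' = 1 by rewrite mulVf// gt_eqF.
  rewrite e1 e2 !mulr1; clear -m0; lra.
- by move=> x _; rewrite lee_fin gauss_ge0// ltW.
- by apply/measurable_EFinP; exact: measurable_gauss.
- by rewrite mulr_ge0// ?invr_ge0 ?sqr_ge0// mulr_ge0// sqr_ge0.
Qed.

Definition csupp G := exists M : R, forall x, M < `|x| -> G x = 0.

Lemma compact_cball (M : R) : compact [set x : 'rV[R]_d | `|x| <= M].
Proof.
apply: bounded_closed_compact.
  by exists M; split => [|N MN x /= /le_trans]; [exact: num_real|apply; exact: ltW].
apply: (@closed_comp _ _ (fun x : 'rV[R]_d => `|x|) [set t : R | t <= M]).
  by move=> x _; exact: norm_continuous.
exact: closed_le.
Qed.

Lemma csupp_bounded G : pcontinuous setT G -> csupp G -> exists C : R, forall x, `|G x| <= C.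
Proof.
move=> cG [M HM].
have [C HC] := compact_bounded_fun (@compact_cball M) (fun x _ => cG x I).
exists (Num.max C 0) => x; have [xM|xM] := leP `|x| M; first by rewrite le_max HC.
by rewrite HM// normr0 le_max lexx orbT.
Qed.

Lemma csupp_partial G i : csupp G -> csupp (partial i G).
Proof.
move=> [M HM]; exists M => x Mx; rewrite /partial.
have : is_derive x (e_ i) G (0 : R).
  apply: (drv_near _ (drv_cst 0 x (e_ i))).
  have oM : open [set y : 'rV[R]_d | M < `|y|] by apply: open_gt_fun => y; exact: norm_continuous.
  by have := open_nbhs_nbhs (conj oM Mx); apply: filterS => y /HM ->.
by case.
Qed.

Lemma is_derive_shift (V : normedModType R) (f : V -> R) (x v c : V) (df : R) :
  is_derive (x + c) v f df -> is_derive x v (fun y : V => f (y + c)) df.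
Proof.
have E : (fun h : R => h^-1 *: (((fun y : V => f (y + c)) \o shift x) (h *: v) - f (x + c))) =
    (fun h : R => h^-1 *: ((f \o shift (x + c)) (h *: v) - f (x + c))).
  by apply/funext => h /=; rewrite addrA.
by move=> [D1 D2]; apply: DeriveDef; [move: D1|move: D2]; rewrite /derivable /derive E.
Qed.

Lemma for_continuous_shift G x c : {for x + c, continuous G} ->
  {for x, continuous (fun y => G (y + c))}.
Proof.
move=> cG; apply: (@continuous_comp _ _ _ (fun y => y + c) G) => //.
by apply: (@cvgD R 'rV[R]_d _ (nbhs x) _ id (cst c) x c); [exact: cvg_id|exact: cvg_cst].
Qed.

Lemma kreg_shift {dZ : measure_display} {Z : measurableType dZ} (D : set Z)
    (c : Z -> 'rV[R]_d) U k G : open U -> measurable_fun D c ->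
  regc setT k G -> csupp G -> kreg U D k (fun x (z : Z) => G (x + c z)).
Proof.
move=> oU mc.
have E0 H : pcontinuous setT H -> csupp H -> kreg0 U D (fun x (z : Z) => H (x + c z)).
  move=> cH sH; have [C HC] := csupp_bounded cH sH; split.
  - by move=> z _ x _; apply: for_continuous_shift; exact: cH.
  - by move=> x _; exists C; near=> y => z _; exact: HC.
  - move=> x _; have mH : measurable_fun setT H.
      by apply: continuous_measurable_rV_real => y; exact: cH.
    apply: (measurableT_comp mH); apply: (measurableT_comp (f := fun y => x + y)) mc.
    have := @measurable_addr R d x; congr measurable_fun.
    by apply/funext => y; rewrite addrC.
elim: k G => [|k IH] G rG sG; have [cG HG] := rG; split => //; try exact: E0.
move=> i; have [DG Hi] := HG i.
have H (z : Z) x : is_derive x (e_ i) (fun y => G (y + c z)) (partial i G (x + c z)).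
  by apply: is_derive_shift; apply: drv_ex; exact: DG.
split; first by move=> z x _ _; case: (H z x).
apply: (kreg_eq oU _ (IH _ Hi (csupp_partial i sG))) => x z _ _.
by rewrite /kpartial {2}/partial; case: (H z x).
Unshelve. all: by end_near. Qed.

Lemma csupp_bump (r : R) : 0 < r -> csupp (bump (0 : 'rV[R]_d) r).
Proof.
move=> r0; exists r => x rx; apply: bump_eq0; rewrite subr0 leNgt; apply/negP.
by move=> /(norm_lt_sqn r0); rewrite ltNge (ltW rx).
Qed.

Lemma bump_eball (r : R) z : ~ eball r z -> bump (0 : 'rV[R]_d) r z = 0.
Proof.
by move=> /negP; rewrite -leNgt => H; apply: bump_eq0; rewrite subr0.
Qed.

Definition bump_mass (r : R) := \int[leb]_(z in eball r) bump 0 r z.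

Lemma measurable_bump (r : R) : measurable_fun setT (bump (0 : 'rV[R]_d) r).
Proof.
apply: continuous_measurable_rV_real => x.
exact: (regc_continuous (regc_bump 0 0 r openT)).
Qed.

Lemma bump_rintegrable (r : R) : 0 < r -> rintegrable leb (eball r) (bump 0 r).
Proof.
move=> r0; apply: (rintegrable_bounded (C := 1)); first exact: measurable_eball.
- exact: eball_lty.
- by apply: measurable_funTS; exact: measurable_bump.
- by move=> x _; rewrite ger0_norm ?bump_ge0// flat_le1.
Qed.

Lemma bump_mass_gt0 (r : R) : 0 < r -> 0 < bump_mass r.
Proof.
move=> r0; rewrite lt_neqAle Rintegral_ge0 ?andbT; last by move=> x _; exact: bump_ge0.
apply/eqP => B0.
have E : \int[leb]_(x in eball r) `|bump 0 r x| = 0.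
  by rewrite B0; apply: eq_Rintegral => x _; rewrite ger0_norm ?bump_ge0.
have [N [mN N0 HN]] := (Rintegral_abs_eq0 (measurable_eball r) (bump_rintegrable r0)).1 E.
apply/negP: (eball_gt0 r0); rewrite negbK -measure_le0 -N0.
apply: le_measure; rewrite ?inE//; first exact: measurable_eball.
move=> x Bx; apply: HN => /= H; have := H Bx.
by apply/eqP; rewrite gt_eqF// bump_gt0 subr0.
Qed.

Definition mollifier (r : R) z := (bump_mass r)^-1 * bump 0 r z.

Definition mollify (r : R) G x := \int[leb]_(z in eball r) (G (x + z) * mollifier r z).

End mollification.

Section mollification_properties.
Context {R : realType} {d : nat}.
Implicit Types (x y z w : 'rV[R]_d) (U K : set 'rV[R]_d) (k : nat) (G : 'rV[R]_d -> R).
Local Notation e_ i := (delta_mx 0 i : 'rV[R]_d).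
Local Notation leb := (lebesgue_rV d : {sigma_finite_measure set 'rV[R]_d -> \bar R}).

Lemma rintegrable_supp (D : set 'rV[R]_d) f : measurable D ->
  (forall x, ~ D x -> f x = 0) -> rintegrable leb D f ->
  rintegrable leb setT f /\ \int[leb]_x f x = \int[leb]_(x in D) f x.
Proof.
move=> mD f0 If.
have E : f \_ D = f.
  by apply/funext => x; rewrite patchE; case: ifPn => // /negP; rewrite inE => /f0.
split; last by rewrite [RHS]Rintegral_mkcond E.
have /(integrable_mkcond _ mD) := If.
by rewrite restrict_EFin E.
Qed.

Lemma mollifier_rintegrable (r : R) : 0 < r -> rintegrable leb (eball r) (mollifier r).
Proof.
move=> r0; apply: rintegrableZ; first exact: measurable_eball.
exact: bump_rintegrable.
Qed.

Lemma mollifier_ge0 (r : R) z : 0 < r -> 0 <= mollifier r z.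
Proof. by move=> r0; rewrite mulr_ge0 ?bump_ge0// invr_ge0 ltW// bump_mass_gt0. Qed.

Lemma mollifier_le (r : R) z : 0 < r -> `|mollifier r z| <= (@bump_mass R d r)^-1.
Proof.
move=> r0; rewrite ger0_norm ?mollifier_ge0// ler_piMr ?flat_le1//.
by rewrite invr_ge0 ltW// bump_mass_gt0.
Qed.

Lemma mollifier_eball (r : R) z : ~ eball r z -> mollifier r z = 0.
Proof. by move=> /bump_eball; rewrite /mollifier => ->; rewrite mulr0. Qed.

Lemma measurable_mollifier (r : R) : measurable_fun setT (@mollifier R d r).
Proof. by apply: measurable_funM => //; exact: measurable_bump. Qed.

Lemma integral_mollifier (r : R) : 0 < r -> \int[leb]_(z in eball r) mollifier r z = 1.
Proof.
move=> r0; rewrite RintegralZl; last exact: bump_rintegrable.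
  by rewrite mulVf// gt_eqF// bump_mass_gt0.
exact: measurable_eball.
Qed.

Lemma mollifierB (r : R) x y : mollifier r (x - y) = mollifier r (y - x).
Proof. by rewrite /mollifier /bump !subr0 sqnB. Qed.

Lemma regc_mollifier (r : R) U k : open U -> regc U k (mollifier r).
Proof. by move=> oU; apply: regcZ => //; exact: regc_bump. Qed.

Lemma csupp_mollifier (r : R) : 0 < r -> csupp (@mollifier R d r).
Proof.
by move=> /(@csupp_bump R d)[M HM]; exists M => x /HM; rewrite /mollifier => ->; rewrite mulr0.
Qed.

Lemma pcontinuous_measurableT G : pcontinuous setT G -> measurable_fun setT G.
Proof. by move=> cG; apply: continuous_measurable_rV_real => x; exact: cG. Qed.

Lemma mollify_kreg (r : R) k G : 0 < r -> regc setT k G -> csupp G ->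
  kreg setT (eball r) k (fun x z => G (x + z) * mollifier r z).
Proof.
move=> r0 rG sG; apply: kregM; first exact: openT.
- apply: kreg_shift => //; exact: openT.
- apply: (@kreg_z R d _ _ setT (eball r) k (mollifier r) (@bump_mass R d r)^-1) => //; first exact: openT.
    by apply: measurable_funTS; exact: measurable_mollifier.
  by move=> z _; exact: mollifier_le.
Qed.

(** The change of variables moves x from G into the mollifier, so that all derivatives fall on a
    smooth function and G need only be continuous. *)
Lemma mollify_conv (r M : R) G x : 0 < r -> pcontinuous setT G ->
  (forall x, M < `|x| -> G x = 0) ->
  mollify r G x = \int[leb]_(y in [set y | `|y| <= M]) (mollifier r (x + - y) * G y).
Proof.
move=> r0 cG HM.
have sG : csupp G by exists M.
have [C HC] := csupp_bounded cG sG.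
have mG := pcontinuous_measurableT cG.
have mK := closed_measurable_rV (compact_closed (@norm_hausdorff _ _) (@compact_cball R d M)).
have Koo : (leb [set y : 'rV[R]_d | `|y| <= M]%R < +oo)%E.
  apply: lebesgue_rV_bounded => //.
  exact: compact_bounded (@compact_cball R d M).
have mm : measurable_fun setT (fun y => mollifier r (x + - y)).
  have -> : (fun y => mollifier r (x + - y)) = (fun y => mollifier r (y + - x)).
    by apply/funext => y; exact: mollifierB.
  apply: (measurableT_comp (measurable_mollifier r)); exact: measurable_addr.
have mf : measurable_fun setT (fun y => mollifier r (x + - y) * G y).
  exact: measurable_funM.
have If : rintegrable leb [set y | `|y| <= M] (fun y => mollifier r (x + - y) * G y).
  apply: (rintegrable_bounded (C := (@bump_mass R d r)^-1 * C)) => //.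
    exact: measurable_funTS.
  by move=> y _; rewrite normrM ler_pM// mollifier_le.
have f0 y : ~ [set y | `|y| <= M] y -> mollifier r (x + - y) * G y = 0.
  by move=> /= /negP; rewrite -ltNge => /HM ->; rewrite mulr0.
have [IT <-] := rintegrable_supp mK f0 If.
have [_] := Rintegral_rV_translate x measurableT IT.
rewrite preimage_setT => <-; symmetry; rewrite [RHS]/mollify.
have mg : measurable_fun setT (fun z => G (x + z) * mollifier r z).
  apply: measurable_funM; last exact: measurable_mollifier.
  apply: (measurableT_comp mG).
  have := @measurable_addr R d x; congr measurable_fun.
  by apply/funext => y; rewrite addrC.
have Ig : rintegrable leb (eball r) (fun z => G (x + z) * mollifier r z).
  apply: (rintegrable_bounded (C := C * (@bump_mass R d r)^-1)).
  - exact: measurable_eball.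
  - exact: eball_lty.
  - exact: measurable_funTS.
  - by move=> y _; rewrite normrM ler_pM// mollifier_le.
have [_ <-] := rintegrable_supp (measurable_eball r) (fun z (H : ~ eball r z) =>
  etrans (congr1 (fun t => G (x + z) * t) (mollifier_eball H)) (mulr0 _)) Ig.
apply: eq_Rintegral => z _; rewrite [z + x]addrC opprD addrA subrr add0r mulrC.
by congr (_ * _); have := mollifierB r 0 z; rewrite sub0r subr0.
Qed.

Lemma regc_mollify (r : R) k G : 0 < r -> pcontinuous setT G -> csupp G ->
  regc setT k (mollify r G).
Proof.
move=> r0 cG sG; have [M HM] := sG.
have mG := pcontinuous_measurableT cG; have [C HC] := csupp_bounded cG sG.
apply: (@regc_eq R d _ _ (kint leb [set y | `|y| <= M]
  (fun x y => mollifier r (x + - y) * G y))) => [|x _|]; first exact: openT.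
  by rewrite (mollify_conv x r0 cG HM).
have mK := closed_measurable_rV (compact_closed (@norm_hausdorff _ _) (@compact_cball R d M)).
apply: kint_regc => //; first exact: openT.
  by apply: lebesgue_rV_bounded => //; exact: compact_bounded (@compact_cball R d M).
apply: kregM; first exact: openT.
  apply: (kreg_shift (c := fun y => - y)); [exact: openT| |exact: regc_mollifier openT|exact: csupp_mollifier].
  apply: measurable_funTS; apply: continuous_measurable_rV => x.
  by apply: (@cvgN _ _ _ (nbhs x) _ id); exact: cvg_id.
apply: (@kreg_z R d _ _ setT [set y : 'rV[R]_d | `|y| <= M] k G C) => //; first exact: openT.
exact: measurable_funTS.
Qed.

Lemma partial_mollify (r : R) G i x : 0 < r -> regc setT 1 G -> csupp G ->
  partial i (mollify r G) x = mollify r (partial i G) x.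
Proof.
move=> r0 rG sG.
have D := kint_derive i openT (measurable_eball r) (@eball_lty R d r r0) (mollify_kreg r0 rG sG) (x := x) I.
rewrite /partial; have -> : mollify r G = kint leb (eball r) (fun x z => G (x + z) * mollifier r z) by [].
have [_ ->] := D; apply: eq_Rintegral => z _; rewrite /kpartial {1}/partial.
have Dz : is_derive x (e_ i) (fun y => G (y + z)) (partial i G (x + z)).
  by apply: is_derive_shift; exact: (regc_drv i rG).
have := drvM Dz (drv_cst (mollifier r z) x (e_ i)).
by rewrite mulr0 addr0 => -[_ ->].
Qed.

Lemma mollify_near (r eta : R) G x : 0 < r -> pcontinuous setT G -> csupp G ->
  (forall z, `|z| < r -> `|G (x + z) - G x| <= eta) -> `|mollify r G x - G x| <= eta.
Proof.
move=> r0 cG sG Ge.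
have mG := pcontinuous_measurableT cG; have [C HC] := csupp_bounded cG sG.
have mB := @measurable_eball R d r.
have Im := mollifier_rintegrable r0.
have mGx : measurable_fun setT (fun z => G (x + z)).
  apply: (measurableT_comp mG).
  have := @measurable_addr R d x; congr measurable_fun.
  by apply/funext => y; rewrite addrC.
have I1 : rintegrable leb (eball r) (fun z => G (x + z) * mollifier r z).
  have := rintegrableMb mB Im (measurable_funTS mGx) (fun z _ => HC (x + z)).
  by congr rintegrable; apply/funext => z; rewrite mulrC.
have -> : mollify r G x - G x = \int[leb]_(z in eball r) (mollifier r z * (G (x + z) - G x)).
  have E : G x = \int[leb]_(z in eball r) (G x * mollifier r z).
    by rewrite RintegralZl// integral_mollifier// mulr1.
  rewrite [in LHS]E /mollify -RintegralB//; last exact: rintegrableZ.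
  by apply: eq_Rintegral => z _; lra.
have I2 : rintegrable leb (eball r) (fun z => mollifier r z * (G (x + z) - G x)).
  apply: (rintegrableMb (C := C + C)) => //.
    by apply: measurable_funB => //; exact: measurable_funTS.
  by move=> z _; rewrite (le_trans (ler_normB _ _))// lerD.
apply: (le_trans (le_normr_Rintegral mB I2)).
rewrite -[leRHS]mulr1 -(integral_mollifier r0) -RintegralZl//.
apply: le_Rintegral => //; first exact: rintegrable_norm.
  exact: rintegrableZ.
move=> z Bz; rewrite normrM mulrC (ger0_norm (mollifier_ge0 _ r0)).
by rewrite ler_wpM2r ?mollifier_ge0// Ge// eball_norm.
Qed.

(** [compact_uniform] is applied with C in the role of a reciprocal radius, which gives the required
    monotonicity. Beyond the radius M + 1, a shift by less than 1 stays outside the support. *)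
Lemma uniform_shift G (eta : R) : 0 < eta -> pcontinuous setT G -> csupp G ->
  exists r : R, 0 < r /\ forall x z, `|z| < r -> `|G (x + z) - G x| <= eta.
Proof.
move=> eta0 cG [M HM].
have [C HC] : exists C : R, forall y, [set y | `|y| <= M + 1] y ->
   0 < C /\ forall z, C * `|z| < 1 -> `|G (y + z) - G y| <= eta.
  apply: (@compact_uniform R _ _ (fun C y => 0 < C /\
    forall z, C * `|z| < 1 -> `|G (y + z) - G y| <= eta)) (@compact_cball R d (M + 1)) _ _.
    move=> C C' y CC' [C0 H]; split; first exact: lt_le_trans CC'.
    by move=> z Hz; apply: H; apply: le_lt_trans Hz; rewrite ler_wpM2r.
  move=> x _; have e2 : 0 < eta / 2 by rewrite divr_gt0.
  have := cG x Logic.I => /cvgrPdist_le/(_ _ e2)/nbhs_ballP[r /= r0 Hr].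
  exists (2 / r); near=> y; split; first by rewrite divr_gt0.
  have yx : `|y - x| < r / 2.
    by near: y; apply: near_norm_lt; rewrite divr_gt0.
  move=> z; rewrite mulrAC ltr_pdivrMr// mul1r => zr.
  have H1 : `|G x - G y| <= eta / 2 by apply/Hr/ball_norm_lt; lra.
  have H2 : `|G x - G (y + z)| <= eta / 2.
    apply/Hr/ball_norm_lt; rewrite addrAC (le_lt_trans (ler_normD _ _))//; lra.
  have := ler_distD (G x) (G (y + z)) (G y); rewrite (distrC _ (G x)); lra.
have C1 : 0 < Num.max C 1 by rewrite lt_max ltr01 orbT.
exists (Num.max C 1)^-1; split; first by rewrite invr_gt0.
move=> x z; rewrite -[_^-1]mul1r ltr_pdivlMr// mulrC => zC.
have [xM|xM] := leP `|x| (M + 1).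
  have [C0 H] := HC x xM; apply: H; apply: le_lt_trans zC.
  by rewrite ler_wpM2r// le_max lexx.
have z1 : `|z| < 1.
  by apply: le_lt_trans zC; rewrite ler_peMl// le_max lexx orbT.
rewrite !HM ?subrr ?normr0 ?ltW//; first by apply: lt_trans xM; rewrite ltrDl.
have := lerB_normD x z; lra.
Unshelve. all: by end_near. Qed.

End mollification_properties.

(** * Distributional gradients tested with compactly supported C^1 functions *)

Section compactly_supported_tests.
Context {R : realType} {d : nat}.
Implicit Types (x y z w : 'rV[R]_d) (Omega K : set 'rV[R]_d) (k : nat) (G u f g : 'rV[R]_d -> R).
Local Notation e_ i := (delta_mx 0 i : 'rV[R]_d).
Local Notation leb := (lebesgue_rV d : {sigma_finite_measure set 'rV[R]_d -> \bar R}).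

Lemma compact_margin K Omega : compact K -> open Omega -> K `<=` Omega ->
  exists r : R, 0 < r /\ forall x z, K x -> `|z| < r -> Omega (x + z).
Proof.
move=> cK oO KO.
have [C HC] : exists C : R, forall y, K y ->
   0 < C /\ forall z, C * `|z| < 1 -> Omega (y + z).
  apply: (@compact_uniform R _ K (fun C y => 0 < C /\
    forall z, C * `|z| < 1 -> Omega (y + z))) => //.
    move=> C C' y CC' [C0 H]; split; first exact: lt_le_trans CC'.
    by move=> z Hz; apply: H; apply: le_lt_trans Hz; rewrite ler_wpM2r.
  move=> x Kx; have /nbhs_ballP[r /= r0 Hr] := open_nbhs_nbhs (conj oO (KO _ Kx)).
  exists (2 / r); near=> y; split; first by rewrite divr_gt0.
  have yx : `|y - x| < r / 2 by near: y; apply: near_norm_lt; rewrite divr_gt0.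
  move=> z; rewrite mulrAC ltr_pdivrMr// mul1r => zr.
  apply/Hr/ball_norm_lt; rewrite addrAC (le_lt_trans (ler_normD _ _))//; lra.
have C1 : 0 < Num.max C 1 by rewrite lt_max ltr01 orbT.
exists (Num.max C 1)^-1; split; first by rewrite invr_gt0.
move=> x z Kx; rewrite -[_^-1]mul1r ltr_pdivlMr// mulrC => zC.
have [C0 H] := HC x Kx; apply: H; apply: le_lt_trans zC.
by rewrite ler_wpM2r// le_max lexx.
Unshelve. all: by end_near. Qed.

Lemma compact_norm_le K : compact K -> exists M : R, forall x, K x -> `|x| <= M.
Proof.
move=> /compact_bounded[M [_ HM]]; exists (M + 1) => x Kx.
by apply: (HM (M + 1)) => //; rewrite ltrDl.
Qed.

Lemma compact_csupp K G : compact K -> (forall x, ~ K x -> G x = 0) -> csupp G.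
Proof.
move=> /compact_norm_le[M HM] G0; exists M => x Mx; apply: G0 => /HM.
by rewrite leNgt Mx.
Qed.

(** The mollified function lives within r of K, hence its closed support within 2 r; this is where
    the factor 2 in the hypothesis comes from. *)
Lemma mollify_Cc_infty K Omega G (r : R) : compact K -> 
  (forall x, ~ K x -> G x = 0) -> pcontinuous setT G -> 0 < r ->
  (forall x z, K x -> `|z| < 2 * r -> Omega (x + z)) ->
  Cc_infty Omega (mollify r G).
Proof.
move=> cK G0 cG r0 KO; have sG := compact_csupp cK G0.
have S x : mollify r G x != 0 -> exists z, `|z| < r /\ K (x + z).
  apply: contra_neqP => /forallNP H; rewrite /mollify.
  rewrite (_ : \int[_]_(z in _) _ = \int[leb]_(z in eball r) (0 : R)).
    by rewrite Rintegral_cst ?mul0r//; exact: measurable_eball.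
  apply: eq_Rintegral => z /set_mem /(eball_norm r0) zr.
  by rewrite G0 ?mul0r// => Kz; apply: (H z).
have [M HM] := compact_norm_le cK.
split.
- by move=> k; apply/(regc_Ck _ _ openT); exact: regc_mollify.
- apply: bounded_closed_compact; last exact: closed_closure.
  apply: bounded_closure; exists (M + r); split => [|N MN x /= /S[z [zr Kz]]].
    exact: num_real.
  have := HM _ Kz; have := lerB_normD x z; move: MN zr; clear; lra.
- move=> x /(_ _ (nbhsx_ballx x _ r0))[y [/= /S[z [zr Kz]]]].
  rewrite -ball_normE /= => xy.
  have -> : x = (y + z) + (x - y - z) by rewrite addrC -addrA [- z + _]addrC addrK subrK.
  apply: KO => //; rewrite (le_lt_trans (ler_normB _ _))//; lra.
Qed.

Lemma le_small (a C : R) : 0 <= C -> (forall eta : R, 0 < eta -> a <= eta * C) -> a <= 0.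
Proof.
move=> C0 H; rewrite leNgt; apply/negP => a0.
have C1 : 0 < C + 1 by rewrite ltr_wpDl.
have e0 : 0 < a / (C + 1) by rewrite divr_gt0.
have := H _ e0; have E : a / (C + 1) * (C + 1) = a by rewrite divfK// gt_eqF.
by move: e0 E; move: (a / (C + 1)) => t; nra.
Qed.

(** Mollification approximates G and its partial derivative uniformly by elements of [Cc_infty]; the
    integrable u and the finite charge turn uniform errors into small errors of the two
    integrals. *)
Lemma ibp_c1 Omega K u v G i : open Omega -> L1 Omega u ->
  distributional_gradient Omega u v -> regc setT 1 G -> compact K -> K `<=` Omega ->
  (forall x, ~ K x -> G x = 0) ->
  \int[leb]_(x in Omega) (u x * partial i G x) = - charge_integral (v i) Omega G.
Proof.
move=> oO Lu dg rG cK KO G0.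
have sG := compact_csupp cK G0; have cG := regc_continuous rG.
have rGi := regc_partial i rG; have cGi := regc_continuous rGi.
have sGi := csupp_partial i sG.
have mO := open_measurable_rV oO.
have [M [M0 HM]] := charge_integral_bound (v i) mO.
have [C HC] := csupp_bounded cG sG; have [Ci HCi] := csupp_bounded cGi sGi.
have mG := measurable_funTS (D := Omega) (pcontinuous_measurableT cG).
have mGi := measurable_funTS (D := Omega) (pcontinuous_measurableT cGi).
apply/eqP; rewrite -subr_eq0 opprK -normr_le0.
apply: (@le_small _ (\int[leb]_(x in Omega) `|u x| + M)).
  by rewrite addr_ge0// Rintegral_abs_ge0.
move=> eta e0.
have [r0 [r00 Hr0]] := compact_margin cK oO KO.
have [r1 [r10 Hr1]] := uniform_shift e0 cG sG.
have [r2 [r20 Hr2]] := uniform_shift e0 cGi sGi.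
pose r := Num.min (r0 / 2) (Num.min r1 r2).
have rp : 0 < r by rewrite !lt_min r10 r20 divr_gt0.
have rle : [/\ r <= r0 / 2, r <= r1 & r <= r2].
  by rewrite /r !ge_min !lexx ?orbT; split.
have [le0 le1 le2] := rle.
pose phi := mollify r G.
have Cphi : Cc_infty Omega phi.
  apply: (mollify_Cc_infty cK G0 cG rp) => x z Kx zr; apply: Hr0 => //; lra.
have rphi := regc_mollify 1 rp cG sG.
have E1 x : `|phi x - G x| <= eta.
  by apply: mollify_near => // z zr; apply: Hr1; exact: lt_le_trans le1.
have E2 x : `|partial i phi x - partial i G x| <= eta.
  rewrite /phi (partial_mollify i x rp rG sG).
  by apply: mollify_near => // z zr; apply: Hr2; exact: lt_le_trans le2.
have cphi := regc_continuous rphi; have cphii := regc_continuous (regc_partial i rphi).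
have mphi := measurable_funTS (D := Omega) (pcontinuous_measurableT cphi).
have mphii := measurable_funTS (D := Omega) (pcontinuous_measurableT cphii).
have Bphi x : `|phi x| <= C + eta.
  by have := ler_distD (G x) (phi x) 0; rewrite !subr0; have := E1 x; have := HC x; lra.
have Bphii x : `|partial i phi x| <= Ci + eta.
  by have := ler_distD (partial i G x) (partial i phi x) 0; rewrite !subr0;
     have := E2 x; have := HCi x; lra.
have Iphi := rintegrableMb mO Lu mphii (fun x _ => Bphii x).
have IG := rintegrableMb mO Lu mGi (fun x _ => HCi x).
have H1 : `|\int[leb]_(x in Omega) (u x * partial i G x) -
   \int[leb]_(x in Omega) (u x * partial i phi x)| <= eta * \int[leb]_(x in Omega) `|u x|.
  rewrite -RintegralB//.
  have -> : \int[leb]_(x in Omega) (u x * partial i G x - u x * partial i phi x) =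
      \int[leb]_(x in Omega) (u x * (partial i G x - partial i phi x)).
    by apply: eq_Rintegral => x _; rewrite mulrBr.
  apply: Rintegral_normM => //; first exact: measurable_funB.
  by move=> x _; rewrite distrC.
have BG' x : Omega x -> `|G x| <= C + eta by move=> _; rewrite (le_trans (HC x))// lerDl ltW.
have H2 : `|charge_integral (v i) Omega G - charge_integral (v i) Omega phi| <= M * eta.
  rewrite -(charge_integralB _ mO mG BG' mphi (fun x _ => Bphi x)).
  by apply: HM; [exact: measurable_funB|move=> x _; rewrite distrC].
have H3 := dg phi Cphi i.
rewrite mulrDr [eta * M]mulrC.
apply: (le_trans _ (lerD H1 H2)); apply: (le_trans _ (ler_normD _ _)).
rewrite H3 opprK.
set a := Rintegral _ _ _; set b := charge_integral _ _ _; set c := charge_integral _ _ _.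
by rewrite (_ : a + c + (b - c) = a + b)// addrACA subrr addr0.
Qed.

End compactly_supported_tests.

(** * Extension to the closure and decay at the boundary *)

Section closure_extension.
Context {R : realType} {d : nat}.
Implicit Types (x y z w v : 'rV[R]_d) (Omega U W : set 'rV[R]_d) (f g h F : 'rV[R]_d -> R).
Local Notation e_ i := (delta_mx 0 i : 'rV[R]_d).
Local Notation leb := (lebesgue_rV d : {sigma_finite_measure set 'rV[R]_d -> \bar R}).

Lemma ce_pcontinuous Omega f : open Omega -> continuous_extends Omega f ->
  pcontinuous Omega f.
Proof.
move=> oO [g [cg fg]] x Ox.
have /(open_within_continuous _ oO) H := continuous_subspaceW (@subset_closure _ Omega) cg.
apply: for_continuous_near (H x Ox); near=> y.
by rewrite fg//; near: y; exact: open_nbhs_nbhs.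
Unshelve. all: by end_near. Qed.

Lemma pcontinuous_ce Omega W f : open W -> closure Omega `<=` W -> pcontinuous W f ->
  continuous_extends Omega f.
Proof.
move=> oW OW cf; exists f; split => //.
by apply: continuous_subspaceW OW _; apply/(open_within_continuous _ oW).
Qed.

Lemma regc_ce Omega W k f : open W -> closure Omega `<=` W -> regc W k f ->
  Ck_closure Omega k f.
Proof.
move=> oW OW; elim: k f => [|k IH] f [cf Hf]; split => //; try exact: pcontinuous_ce cf.
move=> i; have [Df Hi] := Hf i; split; last exact: IH.
by move=> x Ox; apply: Df; apply/OW/subset_closure.
Qed.

Lemma ce_regc Omega k f : open Omega -> Ck_closure Omega k f -> regc Omega k f.
Proof.
move=> oO; elim: k f => [|k IH] f [cf Hf]; split => //; try exact: ce_pcontinuous.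
by move=> i; have [Df Hi] := Hf i; split => //; exact: IH.
Qed.

Lemma compact_closure_bounded Omega : bounded_set Omega -> compact (closure Omega).
Proof.
move=> bO; apply: bounded_closed_compact; last exact: closed_closure.
exact: bounded_closure.
Qed.

Lemma ce_bounded Omega f : bounded_set Omega -> continuous_extends Omega f ->
  exists C : R, forall x, Omega x -> `|f x| <= C.
Proof.
move=> bO [g [/subspace_continuousP cg fg]].
have [C HC] : exists C : R, forall x, closure Omega x -> Omega x -> `|f x| <= C.
  apply: (@compact_uniform R _ _ (fun C x => Omega x -> `|f x| <= C)).
  - exact: compact_closure_bounded.
  - by move=> C C' y CC' H Oy; apply: le_trans (H Oy) CC'.
  move=> x cx; exists (`|g x| + 1).
  have /cvgrPdist_le/(_ _ ltr01) := cg x cx.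
  rewrite near_withinE; apply: filterS => y H Oy.
  have := H (subset_closure Oy); rewrite fg// distrC => H1.
  by rewrite -[g y](subrK (g x)) addrC (le_trans (ler_normD _ _))// lerD2l.
by exists C => x Ox; apply: HC => //; exact: subset_closure.
Qed.

Lemma closure_within_proper Omega x : closure Omega x -> ProperFilter (within Omega (nbhs x)).
Proof.
move=> cx; apply: Build_ProperFilter_ex => A /= /cx[y [Oy Ay]].
by exists y; exact: Ay.
Qed.

Lemma ce_lim Omega f x : closure Omega x -> continuous_extends Omega f ->
  f y @[y --> within Omega (nbhs x)] --> bdry_value Omega f x.
Proof.
move=> cx [g [/subspace_continuousP cg fg]].
have PF := closure_within_proper cx.
have H : f y @[y --> within Omega (nbhs x)] --> g x.
  have H1 : g y @[y --> within Omega (nbhs x)] --> g x.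
    apply: cvg_trans (cg x cx); apply: cvg_app; apply: within_subset.
    exact: subset_closure.
  apply: cvg_trans H1; apply: near_eq_cvg; rewrite near_withinE.
  by near=> y => Oy; rewrite fg.
by rewrite /bdry_value (cvg_lim _ H).
Unshelve. all: by end_near. Qed.

Lemma pcontinuous_bdry_value Omega W f x : open W -> W x -> closure Omega x ->
  pcontinuous W f -> bdry_value Omega f x = f x.
Proof.
move=> oW Wx cx cf; have PF := closure_within_proper cx.
apply: cvg_lim => //; apply: cvg_trans (cf x Wx); apply: cvg_app.
exact: cvg_within.
Qed.

(** Along the ray rho grows at rate at least m, hence reaches 0 by the intermediate value theorem.
    Monotonicity bounds the hitting time and makes rho negative before it, so the earlier points lie
    in Omega. *)
Lemma hit_boundary Omega rho y v (m t1 : R) : open Omega -> defining_function Omega rho ->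
  Omega y -> 0 < m -> 0 <= t1 ->
  (forall t : R, 0 <= t <= t1 -> m <= \sum_i v 0 i * partial i rho (y + t *: v)) ->
  - rho y <= t1 * m ->
  exists t : R, [/\ 0 < t, t * m <= - rho y, bdry Omega (y + t *: v) &
    forall s : R, 0 <= s < t -> Omega (y + s *: v)].
Proof.
move=> oO [sr rn rp rb] Oy m0 t10 Hm rt1.
pose p t := rho (y + t *: v).
have Dp (t : R) : is_derive t 1 p (\sum_i v 0 i * partial i rho (y + t *: v)).
  apply: (proj1 (is_derive_line rho y v t _)).
  exact: (regc_drv_dir v openT (sr 1%N)).
have cp : continuous p.
  move=> t; apply: differentiable_continuous; apply/derivable1_diffP.
  by case: (Dp t).
have p0 : p 0 = rho y by rewrite /p scale0r addr0.
have mono s t : 0 <= s -> s <= t -> t <= t1 -> p s + (t - s) * m <= p t.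
  move=> s0 st tt1; have st0 : 0 <= t - s by rewrite subr_ge0.
  have [c cst E] : exists2 c, c \in `[s, t] & p t - p s =
      (\sum_i v 0 i * partial i rho (y + c *: v)) * (t - s).
    apply: (@MVT_segment R p (fun c => \sum_i v 0 i * partial i rho (y + c *: v)) s t st).
    exact: continuous_subspaceT.
  move: cst; rewrite in_itv/= => /andP[sc ct].
  have := Hm c; rewrite (le_trans s0 sc) (le_trans ct tt1) => /(_ isT) Hc.
  have := ler_wpM2r st0 Hc; lra.
have pt1 : 0 <= p t1.
  have := mono 0 t1 (lexx _) t10 (lexx _); rewrite p0 subr0; lra.
have py : rho y < 0 by exact: rn.
have [t tI pt] : exists2 t, t \in `[0, t1] & p t = 0.
  apply: IVT => //; first exact: continuous_subspaceT.
  by rewrite p0 ge_min le_max (ltW py) pt1 orbT.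
move: tI; rewrite in_itv/= => /andP[t0 tt1].
have tp : 0 < t.
  rewrite lt_neqAle t0 andbT; apply: contraTneq py => t00.
  by move: pt; rewrite -t00 p0 => ->; rewrite ltxx.
have inO s : 0 <= s < t -> Omega (y + s *: v).
  move=> /andP[s0 st]; apply: contrapT => /rp; rewrite -/(p s) => ps.
  have := mono s t s0 (ltW st) tt1; rewrite pt => H.
  have : 0 < (t - s) * m by rewrite mulr_gt0// subr_gt0.
  lra.
exists t; split => //.
  by have := mono 0 t (lexx _) t0 tt1; rewrite pt p0 subr0; lra.
split; last first.
  move=> /interior_subset /rn; rewrite -/(p t) pt ltxx//.
have cv : (fun s : R => y + s *: v) @ t^'- --> y + t *: v.
  apply: cvgD; first exact: cvg_cst.
  by apply: cvgZr_tmp; apply: cvg_at_left_filter; exact: cvg_id.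
move=> B /cv HB.
have : \forall s \near t^'-, Omega (y + s *: v) /\ B (y + s *: v).
  near=> s; split; last by near: s; exact: HB.
  apply: inO; apply/andP; split; last by near: s; exact: nbhs_left_lt.
  by near: s; exact: nbhs_left_ge.
by move=> /filter_ex[s [? ?]]; exists (y + s *: v).
Unshelve. all: by end_near. Qed.

(** Near a boundary point x0 every y in Omega reaches the boundary along v = grad rho x0 in a time
    of order |rho y|; h changes at a bounded rate on the way and tends to 0 at its end. Away from
    the boundary |rho| is bounded below. *)
Lemma boundary_vanish Omega rho h (H L : R) : open Omega -> bounded_set Omega ->
  defining_function Omega rho -> regc Omega 1 h ->
  (forall x, Omega x -> `|h x| <= H) ->
  (forall i x, Omega x -> `|partial i h x| <= L) ->
  (forall x, bdry Omega x -> h y @[y --> within Omega (nbhs x)] --> (0 : R)) ->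
  exists C, forall x, Omega x -> `|h x| <= C * - rho x.
Proof.
move=> oO bO dr rh hH hL h0; have [sr rn rp rb] := dr.
have crho x : {for x, continuous rho} by exact: (regc_continuous (sr 0%N)).
suff [C HC] : exists C : R, forall x, closure Omega x -> Omega x -> `|h x| <= C * - rho x.
  by exists C => x Ox; apply: HC => //; exact: subset_closure.
apply: (@compact_uniform R _ _ (fun C x => Omega x -> `|h x| <= C * - rho x)).
- exact: compact_closure_bounded.
- move=> C C' y CC' Hy Oy; apply: le_trans (Hy Oy) _; rewrite ler_wpM2r// oppr_ge0.
  exact/ltW/rn.
move=> x0 cx0; have [Ox0|nOx0] := pselect (Omega x0).
  (* Near an interior point |rho| exceeds half of its value there, and the bound H is enough. *)
  have r0 := rn _ Ox0; exists (H / (- rho x0 / 2)); near=> y => Oy.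
  have ry : rho y < rho x0 / 2.
    by near: y; apply: (cvgr_lt _ (crho x0)); lra.
  have H0 : 0 <= H := le_trans (normr_ge0 _) (hH y Oy).
  apply: le_trans (hH y Oy) _; rewrite mulrAC ler_pdivlMr; last by lra.
  by rewrite ler_wpM2l//; lra.
have Bx0 : bdry Omega x0 by split => // /interior_subset.
have [rx0 gx0 _] := rb x0 Bx0.
pose v := grad rho x0; pose m := dotv v v.
have m0 : 0 < m by exact: dotv_gt0.
have cs : {for x0, continuous (fun y => \sum_i v 0 i * partial i rho y)}.
  apply: continuous_rsum => i; apply: for_continuousM; first exact: for_continuous_cst.
  exact: (regc_continuous (regc_partial i (sr 1%N))).
have sx0 : \sum_i v 0 i * partial i rho x0 = m.
  by apply: eq_bigr => i _; rewrite /v mxE.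
have : \forall y \near x0, m / 2 < \sum_i v 0 i * partial i rho y.
  by apply: (cvgr_gt _ cs); rewrite sx0; lra.
move=> /nbhs_ballP[r /= r0 Hr].
(* Bounds the derivative of h along v. *)
pose A := \sum_i `|v 0 i| * L.
exists (A / (m / 2)); near=> y => Oy.
have A0 : 0 <= A.
  by apply: sumr_ge0 => i _; rewrite mulr_ge0// (le_trans (normr_ge0 _) (hL i y Oy)).
have ry : rho y < 0 by exact: rn.
have m20 : 0 < m / 2 by lra.
(* y is so close to x0, and |rho y| so small, that the path up to time t1 stays in the ball on which
   rho grows at rate at least m / 2. *)
have yr : `|y - x0| < r / 2 by near: y; apply: near_norm_lt; lra.
have ryr : - rho y < r / 2 * (m / 2) / (`|v| + 1).
  have : rho x0 - r / 2 * (m / 2) / (`|v| + 1) < rho y.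
    near: y; apply: (cvgr_gt _ (crho x0)); rewrite ltrBlDr ltrDl.
    by rewrite !(divr_gt0, mulr_gt0)// ltr_wpDl.
  by rewrite rx0; lra.
have v1 : 0 < `|v| + 1 by rewrite ltr_wpDl.
have [t1 t1E] : {t1 | t1 = - rho y / (m / 2)} by exists (- rho y / (m / 2)).
have t1m : t1 * (m / 2) = - rho y by rewrite t1E divfK// gt_eqF.
have t10 : 0 <= t1 by rewrite t1E divr_ge0//; lra.
have t1v : t1 * (`|v| + 1) < r / 2.
  move: ryr; rewrite ltr_pdivlMr// -t1m mulrAC ltr_pM2r//.
have [t [tp tm Bt inO]] : exists t, [/\ 0 < t, t * (m / 2) <= - rho y, bdry Omega (y + t *: v) &
    forall s, 0 <= s < t -> Omega (y + s *: v)].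
  apply: (hit_boundary oO dr Oy m20 t10); last by rewrite t1m.
  move=> t /andP[t0 tt1]; apply/ltW/Hr/ball_norm_lt.
  rewrite addrAC (le_lt_trans (ler_normD _ _))// normrZ ger0_norm//.
  have : t * `|v| <= t1 * (`|v| + 1).
    by apply: ler_pM => //; rewrite ?lerDl.
  by move: yr t1v; clear; lra.
(* h is differentiable inside Omega, so the mean value bound is used up to times s < t; the end
   point is then reached by letting s tend to t. *)
have bnd s : 0 <= s < t -> `|h y| <= `|h (y + s *: v)| + t * A.
  move=> /andP[s0 st].
  have := @mvt_bound R (fun s => h (y + s *: v)) (fun s => \sum_i v 0 i * partial i h (y + s *: v)) s 0 A s0.
  rewrite scale0r addr0 mulr0 subr0 => /(_ _ _)H1.
  have : `|h (y + s *: v) - h y| <= s * A.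
    apply: H1 => q /andP[q0 qs].
      apply: (proj1 (is_derive_line h y v q _)).
      by apply: (regc_drv_dir v oO rh); apply: inO; rewrite q0 (le_lt_trans qs).
    rewrite subr0 (le_trans (ler_norm_sum _ _ _))//; apply: ler_sum => i _.
    rewrite normrM ler_wpM2l//; apply: hL; apply: inO; rewrite q0 (le_lt_trans qs)//.
  have : s * A <= t * A by rewrite ler_wpM2r// ltW.
  have := ler_distD (h (y + s *: v)) (h y) 0; rewrite !subr0 distrC.
  by move: (h y) (h _) => a b; lra.
have : `|h y| <= t * A.
  apply/ler_addgt0Pl => e e0.
  have := h0 _ Bt => /cvgrPdist_lt/(_ e e0); rewrite near_withinE => He.
  have cv : (fun s : R => y + s *: v) @ t^'- --> y + t *: v.
    apply: cvgD; first exact: cvg_cst.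
    by apply: cvgZr_tmp; apply: cvg_at_left_filter; exact: cvg_id.
  have : \forall s \near t^'-, 0 <= s < t /\ `|h (y + s *: v)| < e.
    near=> s.
    have s0t : 0 <= s < t.
      apply/andP; split; last by near: s; exact: nbhs_left_lt.
      by near: s; exact: nbhs_left_ge.
    split => //; rewrite -normrN -[- _]add0r.
    have : Omega (y + s *: v) by exact: inO.
    by near: s; exact: (cv _ He).
  by move=> /filter_ex[s [st hs]]; have := bnd s st; lra.
move=> /le_trans; apply; rewrite mulrAC ler_pdivlMr//.
by rewrite mulrAC [A * _]mulrC ler_wpM2r.
Unshelve. all: by end_near. Qed.

End closure_extension.

(** * Integration by parts for fields tangent to the boundary *)

Section integration_by_parts.
Context {R : realType} {d : nat}.
Implicit Types (x y z w : 'rV[R]_d) (Omega U W : set 'rV[R]_d) (u f g h : 'rV[R]_d -> R).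
Local Notation e_ i := (delta_mx 0 i : 'rV[R]_d).
Local Notation leb := (lebesgue_rV d : {sigma_finite_measure set 'rV[R]_d -> \bar R}).

Lemma cvg_rsum (T : Type) (FF : set_system T) {FFF : Filter FF} (J : finType)
    (f : J -> T -> R) (l : J -> R) : (forall i, f i @ FF --> l i) ->
  (fun x : T => \sum_i f i x) @ FF --> \sum_i l i.
Proof.
move=> fl.
elim: (index_enum J) => [|i s IH].
  rewrite big_nil (_ : (fun x : T => _) = fun=> 0); first exact: cvg_cst.
  by apply/funext => x; rewrite big_nil.
rewrite big_cons (_ : (fun x : T => _) = fun x : T => f i x + \sum_(j <- s) f j x).
  exact: cvgD.
by apply/funext => x; rewrite big_cons.
Qed.

Lemma flat_near1 (t : R) : 0 < t -> `|flat t - 1| <= t^-1.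
Proof.
move=> t0; rewrite distrC ger0_norm ?subr_ge0 ?flat_le1//.
rewrite /flat /flatn t0 hornerC mul1r.
by have := expR_ge1Dx (- t^-1); lra.
Qed.

Lemma flatn1E (t : R) : 0 < t -> flatn 1 t = t^-1 ^+ 2 * expR (- t^-1).
Proof. by move=> t0; rewrite /flatn t0 /= derivC subr0 mulr1 hornerXn. Qed.

Lemma flatn1_ge0 (t : R) : 0 <= flatn 1 t.
Proof.
have [t0|t0] := ltP 0 t; last by rewrite /flatn ltNge t0.
by rewrite flatn1E// mulr_ge0 ?expR_ge0// sqr_ge0.
Qed.

(** With t = n |rho| - 1 the left-hand side is n |rho| flat'(t): the derivative of the cutoff
    explodes like n, but its product with |rho| stays bounded. *)
Lemma flatn1_le3 (t : R) : -1 <= t -> (t + 1) * flatn 1 t <= 3.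
Proof.
move=> t1; have [t0|t0] := ltP 0 t; last first.
  by rewrite /flatn ltNge t0 mulr0.
rewrite flatn1E//; have s0 : 0 <= t^-1 by rewrite invr_ge0 ltW.
have E : t * t^-1 = 1 by rewrite divff// gt_eqF.
have := expr_exp_le 1 s0; have := expr_exp_le 2 s0.
have -> : 1`! = 1%N by []; have -> : 2`! = 2%N by [].
rewrite expr1.
have -> : (t + 1) * (t^-1 ^+ 2 * expR (- t^-1)) =
  (t * t^-1) * (t^-1 * expR (- t^-1)) + t^-1 ^+ 2 * expR (- t^-1) by lra.
by rewrite E; lra.
Qed.

(** The same quantity tends to 0 at a fixed interior point, where t tends to infinity with n. *)
Lemma flatn1_far (t : R) : 1 <= t -> (t + 1) * flatn 1 t <= 2 * t^-1.
Proof.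
move=> t1; have t0 : 0 < t by exact: lt_le_trans t1.
rewrite flatn1E//; have s0 : 0 < t^-1 by rewrite invr_gt0.
have E : t * t^-1 = 1 by rewrite divff// gt_eqF.
have H : expR (- t^-1) <= 1 by rewrite -expR0 ler_expR oppr_le0 ltW.
have s1 : t^-1 <= 1 by rewrite invf_le1.
have -> : (t + 1) * (t^-1 ^+ 2 * expR (- t^-1)) =
  (t * t^-1) * (t^-1 * expR (- t^-1)) + t^-1 * (t^-1 * expR (- t^-1)) by lra.
rewrite E mul1r.
have : t^-1 * expR (- t^-1) <= t^-1 by rewrite ler_piMr// ltW.
have : t^-1 * (t^-1 * expR (- t^-1)) <= t^-1 * expR (- t^-1).
  by rewrite ler_piMl// mulr_ge0 ?expR_ge0// ltW.
lra.
Qed.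

Lemma cvg_cutoff (f : R -> R) (C l r : R) : 0 < r ->
  (forall t, 1 <= t -> `|f t - l| <= C * t^-1) ->
  (fun n => f (n.+1%:R * r - 1)) @ \oo --> l.
Proof.
move=> r0 H; apply/cvgrPdist_lt => e e0; near=> n.
have n1 : (Num.max 1 (`|C| / e + 1) + 1) / r < n%:R by near: n; exact: nbhs_infty_gtr.
have {n1} n1 : Num.max 1 (`|C| / e + 1) + 1 < n.+1%:R * r.
  by rewrite -ltr_pdivrMr// (lt_trans n1)// ltr_nat.
have [t tE] : {t | t = n.+1%:R * r - 1} by exists (n.+1%:R * r - 1).
have : Num.max 1 (`|C| / e + 1) < t by rewrite tE; lra.
rewrite gt_max -tE => /andP[t1 t2]; have t0 : 0 < t by lra.
rewrite distrC (le_lt_trans (H _ (ltW t1)))//.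
rewrite ltr_pdivrMr// (le_lt_trans (ler_norm _))//.
have E : `|C| / e * e = `|C| by rewrite divfK// gt_eqF.
by move: E t2; move: (`|C| / e) => q E t2; rewrite -E mulrC ltr_pM2l//; lra.
Unshelve. all: by end_near. Qed.

(** [ibp_c1] is applied to the cut-off fields. Their divergence contains the extra term - n flat'(t)
    (grad rho . F); by [boundary_vanish] it is at most a constant times n |rho| flat'(t), hence
    bounded and pointwise convergent to 0. *)
Lemma ibp Omega rho u v (F : 'I_d -> 'rV[R]_d -> R) : open Omega -> bounded_set Omega ->
  defining_function Omega rho -> L1 Omega u -> distributional_gradient Omega u v ->
  (forall i : 'I_d, Ck_closure Omega 1 (F i)) ->
  (forall x, bdry Omega x ->
     dotv (\row_i bdry_value Omega (F i) x) (outer_normal Omega x) = 0) ->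
  \int[leb]_(x in Omega) (u x * \sum_i partial i (F i) x)
    + \sum_i charge_integral (v i) Omega (F i) = 0.
Proof.
move=> oO bO dr Lu dg rF FN; have [sr rn rp rb] := dr.
have mO := open_measurable_rV oO.
have crho x : {for x, continuous rho} by exact: (regc_continuous (sr 0%N)).
have rFO i := ce_regc oO (rF i).
have ceF i : continuous_extends Omega (F i) by case: (rF i).
have ceFi i j : continuous_extends Omega (partial j (F i)).
  by have [_ /(_ j)[_ []]] := rF i.
have OT : closure Omega `<=` setT by [].
have cer i : continuous_extends Omega (partial i rho).
  exact: pcontinuous_ce openT OT (regc_continuous (regc_partial i (sr 1%N))).
have cerij i j : continuous_extends Omega (partial j (partial i rho)).
  apply: pcontinuous_ce openT OT (regc_continuous _).
  by apply: regc_partial; apply: (regc_partial i (sr 2%N)).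
have /choice[B HB] i := ce_bounded bO (ceF i).
have /choice[B' HB'] i := ce_bounded bO (ceFi i i).
have /choice[B2 HB2] (p : 'I_d * 'I_d) := ce_bounded bO (ceFi p.1 p.2).
have /choice[A HA] i := ce_bounded bO (cer i).
have /choice[A2 HA2] (p : 'I_d * 'I_d) := ce_bounded bO (cerij p.1 p.2).
(* The normal component of F up to a factor; the tangency hypothesis makes it vanish at the
   boundary. *)
have [h hE] : {h | h = fun x => \sum_i partial i rho x * F i x} by eexists.
have rri i : regc Omega 1 (partial i rho) by apply: regcS (regc_partial i (sr 2%N)).
have rh : regc Omega 1 h.
  by rewrite hE; apply: (regc_sum oO) => i; exact: (regcM oO (rri i) (rFO i)).
have [C HC] : exists C, forall x, Omega x -> `|h x| <= C * - rho x.
  apply: (@boundary_vanish _ _ Omega rho h (\sum_i A i * B i)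
     (\sum_j \sum_i (A2 (i, j) * B i + A i * B2 (i, j)))) => //.
  - move=> x Ox; rewrite hE (le_trans (ler_norm_sum _ _ _))//; apply: ler_sum => i _.
    by rewrite normrM ler_pM//; [exact: HA|exact: HB].
  - move=> j x Ox.
    have -> : partial j h x = \sum_i (partial j (partial i rho) x * F i x +
        partial i rho x * partial j (F i) x).
      have : is_derive x (e_ j) h (\sum_i (partial j (partial i rho) x * F i x +
        partial i rho x * partial j (F i) x)).
        rewrite hE; apply: drv_sum => i; apply: drvM.
          exact: regc_drv (rri i) Ox.
        exact: regc_drv (rFO i) Ox.
      by case.
    have T i k : `|partial k (partial i rho) x * F i x + partial i rho x * partial k (F i) x|
       <= A2 (i, k) * B i + A i * B2 (i, k).
      rewrite (le_trans (ler_normD _ _))// !normrM lerD// ler_pM//.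
      + exact: (HA2 (i, k)).
      + exact: HB.
      + exact: HA.
      + exact: (HB2 (i, k)).
    rewrite (le_trans (ler_norm_sum _ _ _))//.
    rewrite (le_trans (ler_sum _ (fun i _ => T i j)))//.
    rewrite [leRHS](bigD1 j)//= lerDl; apply: sumr_ge0 => k _; apply: sumr_ge0 => i _.
    exact: le_trans (T i k).
  - move=> x Bx; have [cx _] := Bx.
    have PF := closure_within_proper cx.
    have [rx0 gx0 [c c0 nE]] := rb x Bx.
    have E : \sum_i partial i rho x * bdry_value Omega (F i) x = 0.
      have := FN x Bx; rewrite nE dotvZr => /eqP; rewrite mulf_eq0 gt_eqF//= => /eqP E.
      by rewrite -[RHS]E; apply: eq_bigr => i _; rewrite !mxE mulrC.
    rewrite -[X in _ --> X]E hE; apply: cvg_rsum => i; apply: cvgM; last exact: ce_lim.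
    have H : {for x, continuous (partial i rho)}.
      exact: (regc_continuous (regc_partial i (sr 1%N))).
    by apply: cvg_trans H; apply: cvg_app; exact: cvg_within.
(* The cutoff [flat (t n x)] vanishes unless - rho x exceeds 1 / (n + 1), so its support lies in the
   compact subset [K n] of Omega; at a fixed point of Omega it tends to 1. *)
pose t n x : R := n.+1%:R * (- rho x) - 1.
pose G n i x := flat (t n x) * F i x.
have rt n : regc setT 1 (t n).
  apply: (regcB openT); last by apply: regc_cst; exact: openT.
  by apply: (regcZ _ openT); apply: (regcN openT).
have rcut n : regc setT 1 (fun x => flat (t n x)) by apply: (regc_flat openT).
have Dcut n i x : is_derive x (e_ i) (fun x => flat (t n x))
    (flatn 1 (t n x) * (n.+1%:R * - partial i rho x)).
  apply: (is_derive_comp_dir (f := t n) (g := flatn 0)); last exact: is_derive_flatn.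
  have D1 : is_derive x (e_ i) rho (partial i rho x) by exact: regc_drv (sr 1%N) _.
  by have := drvB (drvZ n.+1%:R (drvN D1)) (drv_cst (1 : R) x (e_ i)); rewrite subr0.
pose K n := [set x | rho x <= - n.+1%:R^-1].
have tK n x : 0 < t n x -> K n x.
  rewrite /t /K /= subr_gt0 => H.
  by rewrite lerNr -div1r ler_pdivrMr// mulrC ltW.
have KO n : K n `<=` Omega.
  move=> x /= Kx; apply: contrapT => /rp; rewrite leNgt => /negP; apply.
  by rewrite (le_lt_trans Kx)// oppr_lt0 invr_gt0.
have cK n : compact (K n).
  apply: bounded_closed_compact; last first.
    rewrite (_ : K n = rho @^-1` [set y | y <= - n.+1%:R^-1])//.
    by apply: closed_comp => [x _|]; [exact: crho|exact: closed_le].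
  by have [M [Mr HM]] := bO; exists M; split=> // N MN x /KO; exact: HM.
have G0 n i x : ~ K n x -> G n i x = 0.
  move=> nK; rewrite /G flat_le0 ?mul0r// leNgt; apply/negP => /tK; exact: nK.
have rG n i : regc setT 1 (G n i).
  have -> : [set: 'rV[R]_d] = Omega `|` ~` K n.
    apply/seteqP; split => // x _; have [Kx|nKx] := pselect (K n x); [left; exact: KO Kx|by right].
  apply: regcU.
    by apply: (regcM oO _ (rFO i)); apply: regcS (rcut n).
  have oK : open (~` K n) by apply: closed_openC; apply: compact_closed; [exact: norm_hausdorff|exact: cK].
  apply: (regc_eq oK (f := fun=> 0)); last exact: regc_cst.
  by move=> x nK; rewrite G0.
have DG n i x : Omega x -> partial i (G n i) x =
    flatn 1 (t n x) * (n.+1%:R * - partial i rho x) * F i x + flat (t n x) * partial i (F i) x.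
  move=> Ox; have := drvM (Dcut n i x) (regc_drv i (rFO i) Ox).
  by case.
have mu' : measurable_fun Omega u by exact: rintegrable_measurable Lu.
have cG n i := regc_continuous (rG n i).
have cGi n i := regc_continuous (regc_partial i (rG n i)).
have mGi n i := measurable_funTS (D := Omega) (pcontinuous_measurableT (cGi n i)).
have mG n i := measurable_funTS (D := Omega) (pcontinuous_measurableT (cG n i)).
have mF i : measurable_fun Omega (F i) by exact: continuous_extends_measurable.
have mFi i : measurable_fun Omega (partial i (F i)) by exact: continuous_extends_measurable.
have sG n i := csupp_partial i (compact_csupp (cK n) (G0 n i)).
have IG n i : rintegrable leb Omega (fun x => u x * partial i (G n i) x).
  have [c Hc] := csupp_bounded (cGi n i) (sG n i).
  by apply: rintegrableMb => // x _; exact: Hc.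
pose S n x := \sum_i partial i (G n i) x.
have E1 n : \int[leb]_(x in Omega) (u x * S n x) = - \sum_i charge_integral (v i) Omega (G n i).
  have EI i : \int[leb]_(x in Omega) (u x * partial i (G n i) x) = - charge_integral (v i) Omega (G n i).
    by apply: (@ibp_c1 _ _ Omega (K n)) => //; first [exact: KO|exact: G0].
  rewrite -sumrN -(eq_bigr _ (fun i _ => EI i)).
  by rewrite -Rintegral_sum//; apply: eq_Rintegral => x _; rewrite mulr_sumr.
have SE n x : Omega x -> S n x =
    - (n.+1%:R * flatn 1 (t n x) * h x) + flat (t n x) * \sum_i partial i (F i) x.
  move=> Ox; rewrite /S (eq_bigr _ (fun i _ => DG n i x Ox)) big_split /= -mulr_sumr.
  congr (_ + _); rewrite hE mulr_sumr -sumrN; apply: eq_bigr => i _; lra.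
have Sh n x : Omega x -> `|n.+1%:R * flatn 1 (t n x) * h x| <= C * ((t n x + 1) * flatn 1 (t n x)).
  move=> Ox; rewrite normrM ger0_norm; last by rewrite mulr_ge0// flatn1_ge0.
  have := HC x Ox; have := flatn1_ge0 (t n x); rewrite {3}/t subrK.
  have : (0 : R) <= n.+1%:R by [].
  move: (flatn 1 _) (n.+1%:R) => q k k0 q0 H.
  have := ler_wpM2l (mulr_ge0 k0 q0) H; lra.
have t1 n x : Omega x -> -1 <= t n x.
  by move=> Ox; rewrite /t -[leLHS]add0r lerD2r mulr_ge0// oppr_ge0 ltW// rn.
(* A point of Omega shows that C is nonnegative; for empty Omega both integrals are 0. *)
have [x0|nO] := pselect (exists x, Omega x); last first.
  have O0 : Omega = set0 by apply/seteqP; split => // x Ox; apply: nO; exists x.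
  rewrite O0 Rintegral_set0 add0r big1// => i _.
  by rewrite /charge_integral !Rintegral_set0 subrr.
have C0 : 0 <= C.
  have [x Ox] := x0; have := le_trans (normr_ge0 _) (HC x Ox).
  by rewrite pmulr_lge0// oppr_gt0 rn.
have L1' : (fun n => \int[leb]_(x in Omega) (u x * S n x)) @ \oo -->
    \int[leb]_(x in Omega) (u x * \sum_i partial i (F i) x).
  (* The factor 3 is that of [flatn1_le3]; the sum bounds the divergence of F. *)
  have Iu := rintegrableZ (3 * C + \sum_i B' i) mO (rintegrable_norm mO Lu).
  apply: (proj2 (Rintegral_dominated mO _ _ _ Iu _)).
  - by move=> n; apply: measurable_funM => //; apply: measurable_sum => i; exact: mGi.
  - by apply: measurable_funM => //; apply: measurable_sum => i; exact: mFi.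
  - move=> x Ox; apply: cvgM; first exact: cvg_cst.
    have r0 : 0 < - rho x by rewrite oppr_gt0 rn.
    rewrite (_ : S ^~ x = fun n => - (n.+1%:R * flatn 1 (t n x) * h x) +
      flat (t n x) * \sum_i partial i (F i) x); last by apply/funext => n; exact: SE.
    rewrite -[X in _ --> X]add0r -[X in _ --> _ + X]mul1r; apply: cvgD.
      rewrite -oppr0; apply: cvgN; apply: norm_cvg0.
      apply: (@squeeze_cvgr _ _ _ _ (fun=> 0) (fun n => C * ((t n x + 1) * flatn 1 (t n x)))).
      + by near=> n; rewrite normr_ge0 /= Sh.
      + exact: cvg_cst.
      + rewrite -[X in _ --> X](mulr0 C); apply: cvgM; first exact: cvg_cst.
        apply: (@cvg_cutoff (fun t => (t + 1) * flatn 1 t) 2 0 _ r0) => s s1.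
        rewrite subr0 ger0_norm; first exact: flatn1_far.
        by rewrite mulr_ge0 ?flatn1_ge0//; lra.
    apply: cvgM; last exact: cvg_cst.
    apply: (@cvg_cutoff flat 1 1 _ r0) => s s1; rewrite mul1r; apply: flat_near1; lra.
  - move=> n x Ox; rewrite normrM mulrC ler_wpM2r// SE// (le_trans (ler_normD _ _))// lerD//.
      rewrite normrN (le_trans (Sh n x Ox))// mulrC ler_wpM2r//; exact/flatn1_le3/t1.
    rewrite normrM -[leRHS]mul1r ler_pM//; first by rewrite ger0_norm ?flat_ge0// flat_le1.
    by rewrite (le_trans (ler_norm_sum _ _ _))//; apply: ler_sum => i _; exact: HB'.
have L2 : (fun n => - \sum_i charge_integral (v i) Omega (G n i)) @ \oo -->
    - \sum_i charge_integral (v i) Omega (F i).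
  apply: cvgN; apply: cvg_rsum => i.
  apply: (@charge_integral_dominated _ _ _ (v i) Omega (fun n => G n i) (F i) (B i)) => //.
  - move=> x Ox; have r0 : 0 < - rho x by rewrite oppr_gt0 rn.
    rewrite /G -[X in _ --> X]mul1r; apply: cvgM; last exact: cvg_cst.
    apply: (@cvg_cutoff flat 1 1 _ r0) => s s1; rewrite mul1r; apply: flat_near1; lra.
  - move=> n x Ox; rewrite normrM -[leRHS]mul1r ler_pM//; last exact: HB.
    by rewrite ger0_norm ?flat_ge0// flat_le1.
have := L1'; rewrite (_ : (fun n => _) = fun n => - \sum_i charge_integral (v i) Omega (G n i)).
  by move=> /(cvg_unique _)/(_ L2) ->; rewrite ?addNr.
by apply/funext => n; exact: E1.
Unshelve. all: by end_near. Qed.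

(** By translation invariance the integral of phi(x + z) over z does not depend on x;
    differentiating it under the integral at x = 0 shows that the integral of a partial derivative
    of phi is 0. *)
Lemma distributional_gradient1 Omega : open Omega ->
  distributional_gradient Omega (cst 1) (fun _ => czero).
Proof.
move=> oO phi [sphi cphi suO] i; rewrite charge_integral0 oppr0.
have rphi : regc setT 1 phi by apply/(regc_Ck _ _ openT).
have S0 x : ~ closure [set x | phi x != 0] x -> phi x = 0.
  by move=> H; apply: contrapT => /eqP; move=> /(@subset_closure _ [set x | phi x != 0]).
have cs := compact_csupp cphi S0; have [M HM] := csupp_partial i cs; have [M' HM'] := cs.
have cpi := regc_continuous (regc_partial i rphi).
have cp := regc_continuous rphi.
(* One unit larger than the supports of phi and of its derivative, so that D also contains the
   supports of the translates by |x| < 1. *)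
have [D DE] : {D : set 'rV[R]_d | D = [set x | `|x| <= Num.max M M' + 1]} by eexists.
have mD : measurable D by rewrite DE; apply: closed_measurable_rV; apply: compact_closed; [exact: norm_hausdorff|exact: compact_cball].
have Dlt : (leb D < +oo)%E.
  apply: lebesgue_rV_bounded => //; rewrite DE; exists (Num.max M M' + 1); split => [|N MN x /=].
    exact: num_real.
  by move=> /le_trans; apply; exact: ltW.
have nD x y : `|x| < 1 -> ~ D y -> M < `|x + y| /\ M' < `|x + y|.
  rewrite DE /= => x1 /negP; rewrite -ltNge => My.
  have : Num.max M M' < `|x + y|.
    by have := lerB_normD y x; rewrite [y + x]addrC; move: x1 My; clear; lra.
  by rewrite gt_max => /andP[].
have n0 : `|0 : 'rV[R]_d| < 1 by rewrite normr0.
have iD : rintegrable leb D (partial i phi).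
  have [c Hc] := csupp_bounded cpi (csupp_partial i cs).
  apply: (rintegrable_bounded mD Dlt (C := c)) => //.
  by apply: measurable_funTS; exact: pcontinuous_measurableT.
have pD x : ~ D x -> partial i phi x = 0.
  by move=> /(nD _ _ n0)[+ _]; rewrite add0r; exact: HM.
have [iT ET] := rintegrable_supp mD pD iD.
have mO := open_measurable_rV oO.
have pO x : ~ Omega x -> partial i phi x = 0.
  move=> nO; have : is_derive x (e_ i) phi (0 : R); last by case.
  apply: (drv_near _ (drv_cst 0 x (e_ i))).
  have oC : open (~` closure [set x | phi x != 0]) by apply/closed_openC/closed_closure.
  near=> y; apply/esym/S0; near: y; apply: open_nbhs_nbhs; split => //.
  by move=> /suO.
have iO : rintegrable leb Omega (partial i phi) by exact: rintegrableS iT.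
have [_ EO] := rintegrable_supp mO pO iO.
rewrite (_ : Rintegral _ _ _ = \int[leb]_(x in Omega) partial i phi x); last first.
  by apply: eq_Rintegral => x _; rewrite mul1r.
rewrite -EO ET.
have mid : measurable_fun D (fun z : 'rV[R]_d => z).
  by apply: measurable_funTS; apply: measurable_id.
have K := kreg_shift openT mid rphi cs.
have Dk := kint_derive i openT mD Dlt K (I : [set: 'rV[R]_d] 0).
have I1 : rintegrable leb setT phi.
  have [c Hc] := csupp_bounded cp cs.
  have [] // := rintegrable_supp (f := phi) mD.
    by move=> x /(nD _ _ n0)[_ +]; rewrite add0r; exact: HM'.
  apply: (rintegrable_bounded mD Dlt (C := c)) => //.
  by apply: measurable_funTS; exact: pcontinuous_measurableT.
have Dc : is_derive (0 : 'rV[R]_d) (e_ i) (kint leb D (fun x z => phi (x + z))) (0 : R).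
  apply: (drv_near _ (drv_cst (\int[leb]_x phi x) 0 (e_ i))).
  near=> x; rewrite /kint.
  have x1 : `|x| < 1 by rewrite -[x]subr0; near: x; exact: near_norm_lt.
  have [_ <-] := rintegrable_supp mD (f := fun z => phi (x + z))
    (fun y Dy => HM' _ (proj2 (nD x y x1 Dy))) (kreg0_rintegrable mD Dlt (kreg_kreg0 K) I).
  have [_] := Rintegral_rV_translate x measurableT I1; rewrite preimage_setT => <-.
  by apply: eq_Rintegral => z _; rewrite addrC.
case: Dk => _ E; case: Dc => _; rewrite E => <-.
apply: eq_Rintegral => z _; rewrite /kpartial /partial.
have : is_derive (0 : 'rV[R]_d) (e_ i) (fun x => phi (x + z)) (partial i phi z).
  by apply: is_derive_shift; rewrite add0r; exact: regc_drv rphi _.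
by case=> _ ->.
Unshelve. all: by end_near. Qed.

(** The gradient measure of u is itself an admissible vector field: [ibp] with F = grad phi is the
    weak equation, and the Neumann condition on phi is the tangency of F. *)
Lemma sparse_reg_le_TV Omega u (uBV : BV Omega u) : smooth_bounded_domain Omega ->
  (sparse_reg Omega u <= TV uBV)%E.
Proof.
move=> sO; have [oO _ _ bO _] := sO; have [rho dr] := exists_defining_function sO.
rewrite /TV; case: cid => v [vO dg] /=; apply: ereal_inf_lbound; exists v => //; split => //.
move=> phi [[_ rphi] nphi].
have rF i : Ck_closure Omega 1 (partial i phi) by have [] := rphi i.
rewrite -[RHS](ibp oO bO dr (proj1 uBV) dg rF nphi); congr (_ + _).
by apply: eq_bigr => i _; apply: eq_charge_integral => x _; rewrite mxE.
Qed.

End integration_by_parts.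

(** * Neumann parametrix *)

Section reflection.
Context {R : realType} {d : nat} (rho : 'rV[R]_d -> R) (sr : forall k, regc setT k rho).
Implicit Types (x y z w v : 'rV[R]_d) (U W : set 'rV[R]_d) (f g h F : 'rV[R]_d -> R).
Local Notation e_ i := (delta_mx 0 i : 'rV[R]_d).
Local Notation oT := (@openT 'rV[R]_d).

(** The derivatives of 1/t are polynomials in 1/t, and differentiating p(1/t) gives - t^-2
    p'(1/t). *)
Fixpoint invp n : {poly R} := if n is n'.+1 then - ('X^2 * (invp n')^`()) else 'X.

Lemma regc_inv U k f : open U -> (forall x, U x -> f x != 0) -> regc U k f ->
  regc U k (fun x => (f x)^-1).
Proof.
move=> oU f0 rf.
have H := @regc_comp R d U k f (fun n t => (invp n).[t^-1]) oU _ rf.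
apply: (regc_eq oU _ (H _)) => [x _|n x /f0 fx]; first by rewrite hornerX.
apply: (is_derive_eq (is_derive_comp_dir (is_derive_inv fx) (is_derive_horner _ _))).
by rewrite /= hornerN hornerM hornerXn; lra.
Qed.

Lemma sum_delta (i : 'I_d) (a : 'I_d -> R) : \sum_j (i == j)%:R * a j = a i.
Proof.
rewrite (bigD1 i)//= eqxx mul1r big1 ?addr0// => j ji.
by rewrite eq_sym (negbTE ji) mul0r.
Qed.

Definition sgrad x : R := \sum_i partial i rho x * partial i rho x.

Definition nondeg : set 'rV[R]_d := [set x | 0 < sgrad x].

(** Component of grad rho / |grad rho|^2, normalised so that its product with grad rho is 1; the
    displacement - rho nrm therefore leads to the zero set of rho up to second order. *)
Definition nrm i x : R := partial i rho x * (sgrad x)^-1.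

Definition refl i x : R := x 0 i - 2 * (rho x * nrm i x).

Definition reflv x : 'rV[R]_d := \row_i refl i x.

(* The Jacobian of [reflv] is orthogonal up to [rho] times this matrix. *)
Definition rdefect i l x : R :=
  \sum_j (- 2 * (((i == j)%:R - 2 * (partial j rho x * nrm i x)) * partial j (nrm l) x
     + partial j (nrm i) x * ((l == j)%:R - 2 * (partial j rho x * nrm l x)))
     + 4 * (rho x * (partial j (nrm i) x * partial j (nrm l) x))).

Lemma regc_partial_rho k i U : regc U k (partial i rho).
Proof. by apply: regcS (regc_partial i (sr k.+1)). Qed.

Lemma regc_sgrad k U : open U -> regc U k sgrad.
Proof.
by move=> oU; apply: (regc_sum oU) => i; apply: (regcM oU); exact: regc_partial_rho.
Qed.

Lemma open_nondeg : open nondeg.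
Proof.
by apply: open_gt_fun => x; exact: (regc_continuous (regc_sgrad 0 oT)).
Qed.

Lemma regc_nrm k i : regc nondeg k (nrm i).
Proof.
apply: (regcM open_nondeg); first exact: regc_partial_rho.
apply: (regc_inv open_nondeg) => [x x0|]; first by rewrite gt_eqF.
exact: (regc_sgrad _ open_nondeg).
Qed.

Lemma regc_rho U k : regc U k rho.
Proof. by apply: regcS (sr k). Qed.

Lemma regc_refl k i : regc nondeg k (refl i).
Proof.
have oN := open_nondeg.
apply: (regcB oN); first exact: regc_coord.
by apply/(regcZ _ oN)/(regcM oN); [exact: regc_rho|exact: regc_nrm].
Qed.

Lemma regc_rdefect k i l : regc nondeg k (rdefect i l).
Proof.
have oN := open_nondeg; apply: (regc_sum oN) => j.
have A i' j' : regc nondeg k (partial j' (nrm i')) by exact: regc_partial (regc_nrm k.+1 i').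
have B i' : regc nondeg k (fun x => (i' == j)%:R - 2 * (partial j rho x * nrm i' x)).
  apply: (regcB oN); first exact: regc_cst.
  by apply/(regcZ _ oN)/(regcM oN); [exact: regc_partial_rho|exact: regc_nrm].
apply: (regcD oN).
  by apply/(regcZ _ oN)/(regcD oN); apply: (regcM oN).
by apply/(regcZ _ oN)/(regcM oN); [exact: regc_rho|exact: (regcM oN)].
Qed.

Lemma partial_refl i j x : nondeg x -> partial j (refl i) x =
  (i == j)%:R - 2 * (partial j rho x * nrm i x) - 2 * (rho x * partial j (nrm i) x).
Proof.
move=> x0.
have D1 : is_derive x (e_ j) rho (partial j rho x) by exact: regc_drv (sr 1%N) _.
have D2 := regc_drv j (regc_nrm 1 i) x0.
have [_] := drvB (drv_coord x i j) (drvZ 2 (drvM D1 D2)).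
by rewrite /partial /refl => ->; lra.
Qed.

Lemma sum_rho_nrm x : nondeg x -> \sum_j partial j rho x * nrm j x = 1.
Proof.
move=> x0; rewrite /nrm; under eq_bigr do rewrite mulrA.
by rewrite -mulr_suml divff// gt_eqF.
Qed.

(** To leading order the Jacobian is the Householder matrix that reflects in the hyperplane
    orthogonal to grad rho, which is orthogonal; all other terms carry a factor rho. *)
Lemma refl_orth i l x : nondeg x ->
  \sum_j partial j (refl i) x * partial j (refl l) x = (i == l)%:R + rho x * rdefect i l x.
Proof.
move=> x0.
have E j : partial j (refl i) x * partial j (refl l) x =
   (i == j)%:R * (l == j)%:R + ((i == j)%:R * (- 2 * nrm l x * partial j rho x)
   + ((l == j)%:R * (- 2 * nrm i x * partial j rho x)
   + (4 * nrm i x * nrm l x * (partial j rho x * partial j rho x)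
   + rho x * (- 2 * (((i == j)%:R - 2 * (partial j rho x * nrm i x)) * partial j (nrm l) x
     + partial j (nrm i) x * ((l == j)%:R - 2 * (partial j rho x * nrm l x)))
     + 4 * (rho x * (partial j (nrm i) x * partial j (nrm l) x)))))).
  rewrite (partial_refl i j x0) (partial_refl l j x0).
  move: (nrm i x) (nrm l x) (partial j (nrm i) x) (partial j (nrm l) x) (rho x) (partial j rho x).
  move: ((i == j)%:R : R) ((l == j)%:R : R) => a b a1 a2 a3 a4 a5 a6; lra.
rewrite (eq_bigr _ (fun j _ => E j)) !big_split /= -!mulr_sumr !sum_delta -/(sgrad x).
rewrite -/(rdefect i l x) !addrA; congr (_ + _).
rewrite [(l == i)]eq_sym -!addrA -[RHS]addr0; congr (_ + _).
rewrite /nrm; have : sgrad x * (sgrad x)^-1 = 1 by rewrite divff// gt_eqF.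
move: (sgrad x) (partial i rho x) (partial l rho x) => g a b.
move: g^-1 => g' gg'.
have -> : 4 * (a * g') * (b * g') * g = 4 * a * b * g' * (g * g') by lra.
rewrite gg'; lra.
Qed.

(** On the boundary the Jacobian reverses the normal. This is what cancels the normal derivatives of
    a Gaussian and its reflected copy. *)
Lemma refl_normal i x : nondeg x -> rho x = 0 ->
  \sum_j partial j rho x * partial j (refl i) x = - partial i rho x.
Proof.
move=> x0 r0; rewrite (eq_bigr (fun j => (i == j)%:R * partial j rho x -
    2 * nrm i x * (partial j rho x * partial j rho x))); last first.
  by move=> j _; rewrite partial_refl// r0; lra.
rewrite sumrB sum_delta -mulr_sumr -/(sgrad x) /nrm.
have : sgrad x * (sgrad x)^-1 = 1 by rewrite divff// gt_eqF.
move: (sgrad x) (partial i rho x) => g a.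
by move: g^-1 => g' gg'; rewrite (_ : 2 * (a * g') * g = 2 * a * (g * g')); [rewrite gg'; lra|lra].
Qed.

Lemma lipschitz_cball (M : R) f : regc setT 1 f -> exists L : R, 0 <= L /\
  forall x y, `|x| <= M -> `|y| <= M -> `|f x - f y| <= L * `|x - y|.
Proof.
move=> rf; have cf i := regc_continuous (regc_partial i rf).
have /choice[C HC] (i : 'I_d) : exists C : R, forall x, `|x| <= M -> `|partial i f x| <= C.
  by apply: (compact_bounded_fun (@compact_cball R d M)) => x _; exact: cf.
exists (\sum_i `|C i|); split; first by apply: sumr_ge0.
move=> x y xM yM; pose v := x - y.
have := @mvt_bound R (fun s => f (y + s *: v)) (fun s => \sum_i v 0 i * partial i f (y + s *: v)) 1 0 (\sum_i `|C i| * `|v|) ler01.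
have -> : y + 1 *: v = x by rewrite scale1r /v addrC subrK.
rewrite scale0r addr0 mulr0 subr0 mul1r -/v mulr_suml; apply.
  by move=> t _; apply: (proj1 (is_derive_line f y v t _)); exact: (regc_drv_dir v oT rf).
move=> t /andP[t0 t1]; rewrite subr0 (le_trans (ler_norm_sum _ _ _))//; apply: ler_sum => i _.
rewrite normrM mulrC ler_pM//; last exact: coord_le_norm.
rewrite (le_trans _ (ler_norm _))//; apply: HC.
rewrite (_ : y + _ = (1 - t) *: y + t *: x); last first.
  by rewrite scalerBl scale1r scalerBr -!addrA [- _ + _]addrC.
rewrite (le_trans (ler_normD _ _))// !normrZ !ger0_norm ?subr_ge0//.
have : (1 - t) * `|y| <= (1 - t) * M by rewrite ler_wpM2l// subr_ge0.
have : t * `|x| <= t * M by rewrite ler_wpM2l.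
lra.
Qed.

Lemma sqr_norm_le_sqn x : `|x| ^+ 2 <= sqn x.
Proof.
have H : `|x| <= Num.sqrt (sqn x).
  by apply: norm_le_sqn; rewrite ?sqrtr_ge0// sqr_sqrtr ?sqn_ge0.
by rewrite -(@sqr_sqrtr _ (sqn x)) ?sqn_ge0// ler_sqr ?nnegrE ?sqrtr_ge0.
Qed.

Context (Omega : set 'rV[R]_d) (oO : open Omega) (bO : bounded_set Omega)
  (dr : defining_function Omega rho).

(** rho^2 + |grad rho|^2 has no zero on the compact closure, hence a positive lower bound; where
    |rho| is small, the gradient has to supply it. *)
Lemma collar_nondeg : exists c : R, 0 < c /\
  forall x, closure Omega x -> `|rho x| <= c -> nondeg x.
Proof.
have cs x : {for x, continuous sgrad} by exact: (regc_continuous (regc_sgrad 0 oT)).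
have cr x : {for x, continuous rho} by exact: (regc_continuous (sr 0)).
have sg0 x : 0 <= sgrad x by apply: sumr_ge0 => i _; rewrite -expr2 sqr_ge0.
have [_ rn rp rb] := dr.
have [C HC] : exists C : R, forall y, closure Omega y ->
    0 < C /\ 1 <= C * (rho y * rho y + sgrad y).
  apply: (@compact_uniform R _ _ (fun C y => 0 < C /\ 1 <= C * (rho y * rho y + sgrad y))).
  - exact: compact_closure_bounded.
  - move=> C C' y CC' [C0 H]; split; first exact: lt_le_trans CC'.
    apply: le_trans H _; rewrite ler_wpM2r// addr_ge0//; first by rewrite -expr2 sqr_ge0.
  move=> x cx; have q0 : 0 < rho x * rho x + sgrad x.
    have [Ox|nOx] := pselect (Omega x).
      by rewrite ltr_pwDl// nmulr_rgt0 rn.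
    have [_ gx _] : [/\ rho x = 0, grad rho x != 0 & exists2 c : R, 0 < c & outer_normal Omega x = c *: grad rho x].
      by apply: rb; split => // /interior_subset.
    rewrite ltr_wpDl//; first by rewrite -expr2 sqr_ge0.
    have := dotv_gt0 gx; rewrite /dotv /sgrad.
    by under eq_bigr do rewrite !mxE.
  have cq : {for x, continuous (fun y => rho y * rho y + sgrad y)}.
    by apply: for_continuousD => //; exact: for_continuousM.
  exists (2 / (rho x * rho x + sgrad x)); near=> y; split; first by rewrite divr_gt0.
  have : (rho x * rho x + sgrad x) / 2 < rho y * rho y + sgrad y.
    by near: y; apply: (cvgr_gt _ cq); lra.
  by rewrite mulrAC ler_pdivlMr//; lra.
have C1 : 0 < Num.max C 1 by rewrite lt_max ltr01 orbT.
exists (2 * Num.max C 1)^-1; split; first by rewrite invr_gt0 mulr_gt0.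
move=> x cx rx; have [C0 H] := HC x cx; rewrite /nondeg /= ltNge; apply/negP => s0.
have s00 : sgrad x = 0 by apply/le_anti; rewrite s0 sg0.
move: H; rewrite s00 addr0.
have C2 : 1 <= Num.max C 1 by rewrite le_max lexx orbT.
have C3 : C <= Num.max C 1 by rewrite le_max lexx.
have -> : rho x * rho x = `|rho x| * `|rho x| by rewrite -normrM ger0_norm// -expr2 sqr_ge0.
have : 2 * Num.max C 1 * `|rho x| <= 1.
  by rewrite -ler_pdivlMl ?mulr_gt0// mulr1.
have := normr_ge0 (rho x); move: `|rho x| (Num.max C 1) C1 C2 C3 => r m C1 C2 C3 r0 mr.
have : C * (r * r) <= m * (r * r) by rewrite ler_wpM2r// mulr_ge0.
have : m * r * r <= 1 * r by rewrite ler_wpM2r//; lra.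
have : r <= m * r by rewrite ler_peMl.
lra.
Unshelve. all: by end_near. Qed.

(** Near the boundary rho (T x) is about - rho x >= 0 while rho y < 0, so the Lipschitz bound of rho
    separates T x from y by a multiple of |rho x|. As |x - T x| is also at most a multiple of |rho
    x|, the distance from x to y is controlled by that from T x. *)
Lemma collar_refl : exists c C : R, [/\ 0 < c, 0 <= C &
  forall x y, closure Omega x -> `|rho x| <= c -> Omega y ->
  [/\ nondeg x, rho x ^+ 2 <= C * sqn (reflv x - y) & sqn (x - y) <= C * sqn (reflv x - y)]].
Proof.
have [_ rn rp rb] := dr.
have cr x : {for x, continuous rho} by exact: (regc_continuous (sr 0)).
have [c1 [c10 Hc1]] := collar_nondeg.
pose K := closure Omega `&` [set x | `|rho x| <= c1].
have cK : compact K.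
  apply: compact_closedI; first exact: compact_closure_bounded.
  rewrite (_ : [set x | _] = (fun x => `|rho x|) @^-1` [set r | r <= c1])//.
  apply: closed_comp; last exact: closed_le.
  by move=> x _; apply: (@for_continuous_comp R _ rho (fun r : R => `|r|)); [exact: cr|exact: norm_continuous].
have /choice[Nb HN] (i : 'I_d) : exists C : R, forall x, K x -> `|nrm i x| <= C.
  apply: (compact_bounded_fun cK) => x [cx rx].
  by apply: (regc_continuous (regc_nrm 0 i)); exact: Hc1.
have [M0 HM0] := compact_norm_le (compact_closure_bounded bO).
pose A := \sum_i `|Nb i|.
have A0 : 0 <= A by exact: sumr_ge0.
have NA i x : K x -> `|nrm i x| <= A.
  move=> Kx; rewrite (le_trans (HN i x Kx))// (le_trans (ler_norm _))//.
  by rewrite /A (bigD1 i)//= lerDl sumr_ge0.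
have nA x : K x -> `|\row_i nrm i x : 'rV[R]_d| <= A.
  by move=> Kx; rewrite [leLHS]/Num.norm/= mx_normrE; apply: bigmax_le => // -[a i] _; rewrite mxE; exact: NA.
have [L [L0 HL]] := lipschitz_cball (M0 + 2 * A) (sr 1).
have /choice[L2 HL2] i := lipschitz_cball (M0 + 2 * A) (regc_partial_rho 1 i setT).
pose B := \sum_i `|Nb i| * L2 i.
have B0 : 0 <= B by apply: sumr_ge0 => i _; rewrite mulr_ge0//; case: (HL2 i).
have D0 : 0 < 8 * (B * A + 1) by rewrite mulr_gt0// ltr_wpDl// mulr_ge0.
(* The last entry makes the second-order error of rho along the displacement at most |rho x| / 2, so
   that rho (T x) >= |rho x| / 2. *)
pose c := Num.min c1 (Num.min 1 (8 * (B * A + 1))^-1).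
have c0 : 0 < c by rewrite !lt_min c10 ltr01 invr_gt0.
(* One summand for each of the two estimates. *)
exists c, (4 * L ^+ 2 + d%:R * (4 * A * L + 1) ^+ 2).
split => //; first by apply: addr_ge0; apply: mulr_ge0 => //; exact: sqr_ge0.
move=> x y cx rc Oy.
have rc1 : `|rho x| <= c1 by rewrite (le_trans rc)// ge_min lexx.
have r1 : `|rho x| <= 1 by rewrite (le_trans rc)// !ge_min lexx orbT.
have r2 : 8 * (B * A + 1) * `|rho x| <= 1.
  by rewrite -ler_pdivlMl// mulr1 (le_trans rc)// !ge_min lexx !orbT.
have Kx : K x by [].
have nx := Hc1 x cx rc1.
have rx0 : rho x <= 0.
  have [Ox|nOx] := pselect (Omega x); first exact/ltW/rn.
  have Bx : bdry Omega x by split => // /interior_subset.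
  by have [->] := rb x Bx.
have [w wE] : {w : 'rV[R]_d | w = - (rho x *: \row_i nrm i x)} by eexists.
have wn : `|w| <= `|rho x| * A by rewrite wE normrN normrZ ler_wpM2l//; exact: nA.
have wi i : w 0 i = - (rho x * nrm i x) by rewrite wE !mxE.
have TE : reflv x = x + 2 *: w by apply/rowP => i; rewrite !mxE wi /refl; lra.
have nxw t : 0 <= t <= 2 -> `|x + t *: w| <= M0 + 2 * A.
  move=> /andP[t0 t2]; rewrite (le_trans (ler_normD _ _))// lerD ?HM0// normrZ ger0_norm//.
  rewrite ler_pM// (le_trans wn)// ler_piMl//.
have xM : `|x| <= M0 + 2 * A by have := nxw 0; rewrite scale0r addr0; apply; rewrite lexx ler0n.
have yM : `|y| <= M0 + 2 * A.
  by rewrite (le_trans (HM0 _ (subset_closure Oy)))// lerDl mulr_ge0.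
have TM : `|reflv x| <= M0 + 2 * A by rewrite TE nxw// lexx ler0n.
have hT : `|rho (reflv x) - rho x - 2 * (- rho x)| <= 2 * (`|rho x| / 4).
  have := @mvt_bound R (fun s => rho (x + s *: w)) (fun s => \sum_i w 0 i * partial i rho (x + s *: w))
     2 (- rho x) (`|rho x| / 4) (ler0n _ _).
  rewrite scale0r addr0 -TE; apply.
    by move=> t _; apply: (proj1 (is_derive_line rho x w t _)); exact: (regc_drv_dir w oT (sr 1)).
  move=> t t2.
  have -> : - rho x = \sum_i w 0 i * partial i rho x.
    rewrite (eq_bigr (fun i => - rho x * (partial i rho x * nrm i x))); last first.
      by move=> i _; rewrite wi; lra.
    by rewrite -mulr_sumr sum_rho_nrm// mulr1.
  rewrite -sumrB (@le_trans _ _ (\sum_i `|rho x| * (2 * (`|rho x| * A)) * (`|Nb i| * L2 i)))//.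
    rewrite (le_trans (ler_norm_sum _ _ _))//; apply: ler_sum => i _.
    rewrite -mulrBr normrM wi normrN normrM.
    have H1 : `|nrm i x| <= `|Nb i| by rewrite (le_trans (HN i x Kx))// ler_norm.
    have [L20 HL2'] := HL2 i.
    have H2 : `|partial i rho (x + t *: w) - partial i rho x| <= L2 i * (2 * (`|rho x| * A)).
      rewrite (le_trans (HL2' _ _ (nxw _ t2) xM))// ler_wpM2l// addrC addKr normrZ.
      by case/andP: t2 => t0 t2; rewrite ger0_norm// ler_pM.
    have H3 := ler_pM (normr_ge0 _) (normr_ge0 _) H1 H2.
    have := ler_wpM2l (normr_ge0 (rho x)) H3.
    move: `|rho x| `|nrm i x| `|Nb i| (L2 i) `|_ - _| => a b e f g; lra.
  rewrite -mulr_sumr -/B.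
  have : `|rho x| * (8 * (B * A + 1) * `|rho x|) <= `|rho x| * 1 by rewrite ler_wpM2l.
  have : 0 <= `|rho x| * `|rho x| by rewrite mulr_ge0.
  clear; move: `|rho x| A B => a b e; lra.
have hr : `|rho x| / 2 <= L * `|reflv x - y|.
  apply: le_trans (HL _ _ TM yM); apply: le_trans (ler_norm _).
  move: hT; rewrite ler_norml => /andP[+ _]; have := rn y Oy.
  by rewrite ler0_norm//; move: (rho (reflv x)) (rho x) (rho y) => a b e; lra.
have n0 := normr_ge0 (reflv x - y); have s2 := sqr_norm_le_sqn (reflv x - y).
have sq0 : 0 <= sqn (reflv x - y) by exact: sqn_ge0.
have L20 : 0 <= 4 * L ^+ 2 by rewrite mulr_ge0// sqr_ge0.
have A20 : 0 <= d%:R * (4 * A * L + 1) ^+ 2 by rewrite mulr_ge0// sqr_ge0.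
split => //.
  have : `|rho x| ^+ 2 <= (2 * L * `|reflv x - y|) ^+ 2.
    by rewrite ler_sqr ?nnegrE ?mulr_ge0//; lra.
  rewrite real_normK ?num_real// => /le_trans; apply.
  rewrite exprMn [leRHS]mulrDl (@le_trans _ _ (4 * L ^+ 2 * sqn (reflv x - y)))//; last first.
    by rewrite lerDl mulr_ge0.
  by rewrite (_ : (2 * L) ^+ 2 = 4 * L ^+ 2) ?ler_wpM2l//; lra.
have xy : `|x - y| <= (4 * A * L + 1) * `|reflv x - y|.
  have -> : x - y = (reflv x - y) - 2 *: w.
    by rewrite TE [RHS]addrAC addrK.
  rewrite (le_trans (ler_normB _ _))// normrZ ger0_norm//.
  have := ler_wpM2l A0 hr; move: wn; move: `|w| `|rho x| `|reflv x - y| => a b e; lra.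
rewrite (le_trans (sqn_le_norm _))// [leRHS]mulrDl (@le_trans _ _ (d%:R * (4 * A * L + 1) ^+ 2 * sqn (reflv x - y)))//; last first.
  by rewrite lerDr mulr_ge0.
rewrite -mulrA ler_wpM2l// (@le_trans _ _ (((4 * A * L + 1) * `|reflv x - y|) ^+ 2))//.
  by rewrite ler_sqr ?nnegrE ?mulr_ge0 ?addr_ge0 ?mulr_ge0.
by rewrite exprMn ler_wpM2l// sqr_ge0.
Qed.

End reflection.

Opaque partial regc kreg.

(** * Derivatives and bounds of transported Gaussians *)

Section gaussian_kernels.
Context {R : realType} {d : nat}.
Implicit Types (x y z w : 'rV[R]_d) (U W : set 'rV[R]_d) (f g h q Th : 'rV[R]_d -> R)
  (T : 'I_d -> 'rV[R]_d -> R).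
Local Notation e_ i := (delta_mx 0 i : 'rV[R]_d).

Lemma partial_is_derive f x j (a : R) : is_derive x (e_ j) f a -> partial j f x = a.
Proof. by case. Qed.

Lemma drv_eq_on U f g x v (a : R) : open U -> U x -> (forall y, U y -> f y = g y) ->
  is_derive x v f a -> is_derive x v g a.
Proof.
move=> oU Ux fg; apply: drv_near; near=> y; apply: fg; near: y; exact: open_nbhs_nbhs.
Unshelve. all: by end_near. Qed.

Lemma partial_eq_on U f g x j : open U -> U x -> (forall y, U y -> g y = f y) ->
  regc U 1 f -> partial j g x = partial j f x.
Proof.
move=> oU Ux fg rf; apply: partial_is_derive.
exact: (drv_eq_on oU Ux (fun y Uy => esym (fg y Uy)) (regc_drv j rf Ux)).
Qed.

Lemma partialM U f g x j : U x -> regc U 1 f -> regc U 1 g ->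
  partial j (fun y => f y * g y) x = partial j f x * g x + f x * partial j g x.
Proof.
by move=> Ux rf rg; apply/partial_is_derive/(drvM (regc_drv j rf Ux) (regc_drv j rg Ux)).
Qed.

Lemma partialMM U f g x j : open U -> U x -> regc U 2 f -> regc U 2 g ->
  partial j (partial j (fun y => f y * g y)) x =
  partial j (partial j f) x * g x + 2 * (partial j f x * partial j g x) +
  f x * partial j (partial j g) x.
Proof.
move=> oU Ux rf rg; have [rf1 rg1] := (regcW rf, regcW rg).
have [rfj rgj] := (regc_partial j rf, regc_partial j rg).
have rR := regcD oU (regcM oU rfj rg1) (regcM oU rf1 rgj).
rewrite (partial_eq_on j oU Ux (fun y Uy => partialM j Uy rf1 rg1) rR).
rewrite (partial_is_derive (drvD (drvM (regc_drv j rfj Ux) (regc_drv j rg1 Ux))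
     (drvM (regc_drv j rf1 Ux) (regc_drv j rgj Ux)))).
move: (partial j (partial j f) x) (partial j (partial j g) x) (partial j f x) (partial j g x).
by move: (f x) (g x) => *; lra.
Qed.

Definition expq (c m : R) q x := c * expR (- (m * q x)).

Lemma regc_expq U k (c m : R) q : open U -> regc U k q -> regc U k (expq c m q).
Proof.
move=> oU rq; apply: (regcZ _ oU).
apply: (@regc_comp R d U k (fun x => - (m * q x)) (fun _ => expR) oU).
  exact: (regcN oU (regcZ _ oU rq)).
Qed.

Lemma partial_expq U (c m : R) q x j : open U -> U x -> regc U 1 q ->
  partial j (expq c m q) x = - m * partial j q x * expq c m q x.
Proof.
move=> oU Ux rq; apply: partial_is_derive.
have D := drvN (drvZ m (regc_drv j rq Ux)).
have D2 := is_derive_comp_dir D (is_derive_expR (- (m * q x))).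
by apply: (is_derive_eq (drvZ c D2)); rewrite /expq; move: (partial j q x) (expR _) => *; lra.
Qed.

Lemma partial2_expq U (c m : R) q x j : open U -> U x -> regc U 2 q ->
  partial j (partial j (expq c m q)) x =
  (m ^+ 2 * partial j q x ^+ 2 - m * partial j (partial j q) x) * expq c m q x.
Proof.
move=> oU Ux rq; have rq1 := regcW rq; have rqj := regc_partial j rq.
have rE := regc_expq c m oU rq1.
have rR := regcM oU (regcZ (- m) oU rqj) rE.
rewrite (partial_eq_on j oU Ux (fun y Uy => partial_expq c m j oU Uy rq1) rR).
rewrite (partialM j Ux (regcZ (- m) oU rqj) rE) (partial_is_derive (drvZ (- m) (regc_drv j rqj Ux))).
rewrite (partial_expq c m j oU Ux rq1).
by move: (partial j (partial j q) x) (partial j q x) (expq c m q x) => *; lra.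
Qed.

Definition qdist T y x := \sum_i (T i x - y 0 i) * (T i x - y 0 i).

Lemma regc_qdist U k T y : open U -> (forall i, regc U k (T i)) -> regc U k (qdist T y).
Proof.
move=> oU rT; apply: (regc_sum oU) => i.
by apply: (regcM oU); apply: (regcB oU) => //; exact: regc_cst.
Qed.

Lemma partial_qdist U T y x j : U x -> (forall i, regc U 1 (T i)) ->
  partial j (qdist T y) x = \sum_i 2 * ((T i x - y 0 i) * partial j (T i) x).
Proof.
move=> Ux rT; apply/partial_is_derive/drv_sum => i.
have D := drvB (regc_drv j (rT i) Ux) (drv_cst (y 0 i) x (e_ j)).
by apply: (is_derive_eq (drvM D D)); move: (partial j (T i) x) => *; lra.
Qed.

Lemma partial2_qdist U T y x j : open U -> U x -> (forall i, regc U 2 (T i)) ->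
  partial j (partial j (qdist T y)) x =
  \sum_i 2 * (partial j (T i) x * partial j (T i) x + (T i x - y 0 i) * partial j (partial j (T i)) x).
Proof.
move=> oU Ux rT; have rT1 i := regcW (rT i).
have rZ i := regcB oU (rT1 i) (regc_cst 1 (y 0 i) oU).
have rR := regc_sum oU (fun i => regcZ 2 oU (regcM oU (rZ i) (regc_partial j (rT i)))).
rewrite (partial_eq_on j oU Ux (fun z Uz => partial_qdist y j Uz rT1) rR).
apply/partial_is_derive/drv_sum => i.
have D := drvB (regc_drv j (rT1 i) Ux) (drv_cst (y 0 i) x (e_ j)).
have D2 := regc_drv j (regc_partial j (rT i)) Ux.
apply: (is_derive_eq (drvZ 2 (drvM D D2))).
by move: (partial j (partial j (T i)) x) (partial j (T i) x) => *; lra.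
Qed.

(** E is the defect of the Jacobian of T from orthogonality. For E = 0 this is the eikonal identity
    |grad q|^2 = 4 q, which makes the transported Gaussian solve the heat equation to leading
    order. *)
Lemma sum_sqr_partial_qdist U T y x (E : 'I_d -> 'I_d -> R) : U x ->
  (forall i, regc U 1 (T i)) ->
  (forall i l, \sum_j partial j (T i) x * partial j (T l) x = (i == l)%:R + E i l) ->
  \sum_j partial j (qdist T y) x ^+ 2 =
  4 * qdist T y x + 4 * \sum_i \sum_l (T i x - y 0 i) * (T l x - y 0 l) * E i l.
Proof.
move=> Ux rT HE; rewrite /qdist.
pose Z i := T i x - y 0 i.
under eq_bigr => j _.
  rewrite (partial_qdist y j Ux rT) expr2 mulr_suml.
  rewrite (eq_bigr (fun i => \sum_l 4 * (Z i * Z l) * (partial j (T i) x * partial j (T l) x))); last first.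
    by move=> i _; rewrite mulr_sumr; apply: eq_bigr => l _; rewrite /Z; move: (partial j (T i) x) (partial j (T l) x) => *; lra.
  over.
rewrite exchange_big /= (eq_bigr (fun i => 4 * (Z i * Z i) + 4 * \sum_l Z i * Z l * E i l)).
  by rewrite big_split /= -!mulr_sumr.
move=> i _; rewrite exchange_big /=.
rewrite (eq_bigr (fun l => (i == l)%:R * (4 * (Z i * Z l)) + 4 * (Z i * Z l * E i l))); last first.
  by move=> l _; rewrite -mulr_sumr HE; lra.
by rewrite big_split /= sum_delta -mulr_sumr.
Qed.

Lemma qdistE T y x : qdist T y x = sqn ((\row_i T i x) - y).
Proof. by apply: eq_bigr => i _; rewrite !mxE. Qed.

Lemma gauss_qdist (b s : R) T y x :
  gauss b s ((\row_i T i x) - y) = expq (s^-1 ^+ d) (b * s^-1 ^+ 2) (qdist T y) x.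
Proof. by rewrite /gauss /expq qdistE; congr (_ * expR _); lra. Qed.

Definition gkern Th T (s : R) x y := Th x * gauss (1 / 4) s ((\row_i T i x) - y).

(* The derivative of [gkern] in the time [s ^+ 2]. *)
Definition gkern_t Th T (s : R) x y :=
  (1 / 4 * sqn ((\row_i T i x) - y) * s^-1 ^+ 4 - d%:R / 2 * s^-1 ^+ 2) * gkern Th T s x y.

Lemma is_derive_gauss (b s : R) z : s != 0 -> is_derive s 1 (fun s => gauss b s z)
  ((2 * (b * sqn z) * s^-1 ^+ 3 - d%:R * s^-1) * gauss b s z).
Proof.
move=> s0; have Di := is_derive_inv s0.
have Dp := is_derive_comp_dir Di (is_derive_horner 'X^d s^-1).
have De := is_derive_comp_dir (drvZ (- (b * sqn z)) (drvM Di Di)) (is_derive_expR _).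
apply: (is_derive_eq (drv_near (g := fun s => gauss b s z) _ (drvM Dp De))).
  by near=> t; rewrite /gauss /= hornerXn expr2.
rewrite /gauss /= hornerXn derivXn hornerMn hornerXn.
rewrite -(mulr_natr _ d) expr2.
have -> : s^-1 ^+ d.-1 * d%:R * - (s^-1 * s^-1) = - d%:R * s^-1 * s^-1 ^+ d.
  case: d => [|n]; first by rewrite mulr0 oppr0 !mul0r.
  by rewrite /= exprS; lra.
move: (s^-1 ^+ d) (expR _) => a e; lra.
Unshelve. all: by end_near. Qed.

Lemma gkern_t_is_derive Th T (s : R) x y : s != 0 ->
  is_derive s 1 (fun s => gkern Th T s x y) (2 * s * gkern_t Th T s x y).
Proof.
move=> s0; apply: (is_derive_eq (drvZ (Th x) (is_derive_gauss _ _ s0))).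
rewrite /gkern_t /gkern; have E : s * s^-1 = 1 by rewrite divff.
move: (gauss _ _ _) (sqn _) (Th x) => g q t.
rewrite (_ : 2 * s * _ = t * ((1 / 2 * q * (s * s^-1) * s^-1 ^+ 3 - d%:R * (s * s^-1) * s^-1) * g)); last lra.
by rewrite E; lra.
Qed.

(** [gauss_pow] with b = 1/4 gives the factor 1 for n = 0 and 8^2 2! = 128 for n = 2, whence 259 = 3
    + 2 * 128. *)
Lemma gauss_lin (s : R) z : 0 < s -> 0 <= gauss (1 / 4) s z /\
  (3 + 2 * (sqn z * s^-1 ^+ 2) ^+ 2) * gauss (1 / 4) s z <= 259 * gauss (1 / 8) s z.
Proof.
move=> s0; split; first exact/gauss_ge0/ltW.
have b0 : 0 < 1 / 4 :> R by lra.
have := gauss_pow 2 z b0 s0; have := gauss_pow 0 z b0 s0.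
have -> : 1 / 4 / 2 = 1 / 8 :> R by lra.
have -> : 2 / (1 / 4) = 8 :> R by lra.
have -> : 0`! = 1%N by []; have -> : 2`! = 2%N by [].
rewrite !expr0 !mul1r; move: (gauss _ _ _) (gauss _ _ _) (_ ^+ 2) => a b e; lra.
Qed.

Lemma coord_sqrt z i : `|z 0 i| <= Num.sqrt (sqn z).
Proof.
rewrite (le_trans (coord_le_norm _ _))//; apply: norm_le_sqn; rewrite ?sqrtr_ge0//.
by rewrite sqr_sqrtr ?sqn_ge0.
Qed.

Lemma pow_le14 (t : R) : 0 <= t -> t <= 1 + (t ^+ 2) ^+ 2 /\ t ^+ 3 <= 1 + (t ^+ 2) ^+ 2.
Proof.
move=> t0; have := sqr_ge0 (t - 1); have := sqr_ge0 (t ^+ 2 - 1); have := sqr_ge0 (t - t ^+ 2).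
rewrite !expr2 => h1 h2 h3; have := mulr_ge0 t0 (mulr_ge0 t0 t0).
by rewrite (_ : t ^+ 3 = t * (t * t)); [split; nra|rewrite !exprS expr0 mulr1].
Qed.

Section bounds.
Variables (U : set 'rV[R]_d) (Th : 'rV[R]_d -> R) (T : 'I_d -> 'rV[R]_d -> R).
Variables (x y : 'rV[R]_d) (s M : R) (E : 'I_d -> 'I_d -> R).
Hypotheses (oU : open U) (Ux : U x) (rTh : regc U 2 Th) (rT : forall i, regc U 2 (T i)).
Hypotheses (s0 : 0 < s) (s1 : s <= 1) (M0 : 0 <= M).
Let sg := Num.sqrt (sqn ((\row_i T i x) - y)).
Hypotheses (bTh : `|Th x| <= M) (bTh1 : forall i, `|partial i Th x| <= M)
  (bTh2 : `|laplacian Th x| <= M) (bT1 : forall i j, `|partial j (T i) x| <= M)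
  (bT2 : forall i, `|laplacian (T i) x| <= M)
  (HE : forall i l, \sum_j partial j (T i) x * partial j (T l) x = (i == l)%:R + E i l)
  (bE : forall i l, `|E i l| <= M * sg).

Let m := 1 / 4 * s^-1 ^+ 2.
Let H := expq (s^-1 ^+ d) m (qdist T y).
Let Gs := gauss (1 / 4) s ((\row_i T i x) - y).
Let al := sg * s^-1.
Let n : R := d%:R.

Let HG : H x = Gs. Proof. by rewrite /Gs gauss_qdist. Qed.
Let rT1 i : regc U 1 (T i). Proof. exact: regcW (rT i). Qed.
Let rq : regc U 2 (qdist T y). Proof. exact: regc_qdist. Qed.
Let rH : regc U 2 H. Proof. exact: regc_expq. Qed.
Let gkE : gkern Th T s ^~ y = fun x => Th x * H x.
Proof. by apply/funext => z; rewrite /gkern gauss_qdist. Qed.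
Let sg0 : 0 <= sg. Proof. exact: sqrtr_ge0. Qed.
Let sg2 : sg ^+ 2 = qdist T y x. Proof. by rewrite qdistE sqr_sqrtr// sqn_ge0. Qed.
Let al0 : 0 <= al. Proof. by rewrite mulr_ge0// invr_ge0 ltW. Qed.
Let si1 : 1 <= s^-1. Proof. by rewrite invf_ge1. Qed.
Let n0 : 0 <= n. Proof. exact: ler0n. Qed.
Let Zsg i : `|T i x - y 0 i| <= sg.
Proof. by have := coord_sqrt ((\row_i T i x) - y) i; rewrite !mxE. Qed.

Let sum_le (a : 'I_d -> R) (c : R) : (forall i, `|a i| <= c) -> `|\sum_i a i| <= n * c.
Proof.
move=> ac; rewrite (le_trans (ler_norm_sum _ _ _))// (le_trans (ler_sum _ (fun i _ => ac i)))//.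
by rewrite sumr_const card_ord -mulr_natl.
Qed.

Let bq i : `|partial i (qdist T y) x| <= n * (2 * (sg * M)).
Proof.
rewrite (partial_qdist y i Ux rT1); apply: sum_le => j.
rewrite normrM ger0_norm// ler_wpM2l// normrM.
exact: ler_pM (normr_ge0 _) (normr_ge0 _) (Zsg j) (bT1 j i).
Qed.

Let e1 := \sum_i \sum_l (T i x - y 0 i) * (T l x - y 0 l) * E i l.
Let be1 : `|e1| <= n * (n * (sg * sg * (M * sg))).
Proof.
apply: (sum_le) => i; apply: sum_le => l.
rewrite normrM; apply: ler_pM (normr_ge0 _) (normr_ge0 _) _ (bE i l); rewrite normrM.
exact: ler_pM (normr_ge0 _) (normr_ge0 _) (Zsg i) (Zsg l).
Qed.

Let e2 := \sum_i (E i i + (T i x - y 0 i) * laplacian (T i) x).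
Let be2 : `|e2| <= n * (M * sg + sg * M).
Proof.
apply: sum_le => i; apply: le_trans (ler_normD _ _) (lerD (bE i i) _); rewrite normrM.
exact: ler_pM (normr_ge0 _) (normr_ge0 _) (Zsg i) (bT2 i).
Qed.

Let lapH : laplacian H x = (m ^+ 2 * (4 * sg ^+ 2 + 4 * e1) - m * (2 * n + 2 * e2)) * Gs.
Proof.
rewrite /laplacian (eq_bigr _ (fun j _ => partial2_expq _ _ j oU Ux rq)).
rewrite -mulr_suml -/H HG sumrB -!mulr_sumr; congr ((_ * _ - _ * _) * _).
  by rewrite sg2; exact: (sum_sqr_partial_qdist y Ux rT1 HE).
rewrite (eq_bigr _ (fun j _ => partial2_qdist y j oU Ux rT)) exchange_big /=.
have -> : n = \sum_(i < d) 1 by rewrite sumr_const card_ord.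
rewrite -mulrDr /e2 -big_split /= mulr_sumr; apply: eq_bigr => i _.
by rewrite -mulr_sumr big_split /= -mulr_sumr HE eqxx -addrA.
Qed.

Let hT := sum_le.

(** The leading terms of the Laplacian, m^2 4 q - 2 m d with m = 1 / (4 s^2), are those of [gkern_t]
    and cancel. Every remaining term is 1/s times a polynomial in al = |T x - y| / s and the
    Gaussian: the hypothesis |E| <= M |T x - y| supplies the power of s that is lacking. *)
Lemma gkern_bounds :
  [/\ `|gkern Th T s x y| <= M * 259 * gauss (1 / 8) s ((\row_i T i x) - y),
   forall i, `|partial i (gkern Th T s ^~ y) x| <=
     (M + n * M * M) * 259 * s^-1 * gauss (1 / 8) s ((\row_i T i x) - y) &
   `|laplacian (gkern Th T s ^~ y) x - gkern_t Th T s x y| <=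
     (M + n * n * M * M + M * (n * n * M + n * M)) * 259 * s^-1 * gauss (1 / 8) s ((\row_i T i x) - y)].
Proof.
have [G0 GL] := gauss_lin ((\row_i T i x) - y) s0.
have a2 : al ^+ 2 = sqn ((\row_i T i x) - y) * s^-1 ^+ 2.
  by rewrite /al exprMn sg2 qdistE.
move: GL G0; rewrite -a2 -/Gs => GL G0.
have sG : 0 <= s^-1 * Gs by rewrite mulr_ge0// (le_trans ler01).
(* The polynomial in al is absorbed into the wider Gaussian by [gauss_lin]. *)
have fin (A X : R) : 0 <= A -> X <= A * (3 + 2 * (al ^+ 2) ^+ 2) * (s^-1 * Gs) ->
   X <= A * 259 * s^-1 * gauss (1 / 8) s ((\row_i T i x) - y).
  move=> A0 /le_trans; apply.
  have s0' : 0 <= A * s^-1 by rewrite mulr_ge0// (le_trans ler01).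
  have := ler_wpM2l s0' GL.
  by move: Gs (gauss _ _ _) => a b; lra.
have al4 : 0 <= (al ^+ 2) ^+ 2 by rewrite sqr_ge0.
have [a1 a3] := pow_le14 al0.
have nM : 0 <= n * M by rewrite mulr_ge0.
have nMM : 0 <= n * M * M by rewrite mulr_ge0.
have nnMM : 0 <= n * n * M * M by rewrite !mulr_ge0.
have bH i : `|partial i H x| <= n * M / 2 * al * (s^-1 * Gs).
  rewrite (partial_expq _ _ i oU Ux (regcW rq)) -/H HG normrM (ger0_norm G0) mulNr normrN normrM.
  rewrite [`|m|]ger0_norm ?mulr_ge0 ?exprn_ge0 ?invr_ge0// ?(ltW s0)//.
  have m0 : 0 <= m by rewrite mulr_ge0// exprn_ge0// invr_ge0 ltW.
  have := ler_wpM2r G0 (ler_wpM2l m0 (bq i)); rewrite /m /al.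
  by move: (partial _ _ _) Gs s^-1 => p a b; lra.
split.
- rewrite /gkern normrM -/Gs (ger0_norm G0) -mulrA ler_pM//.
  apply: le_trans GL; rewrite -[leLHS]mul1r ler_wpM2r//; lra.
- move=> i; rewrite gkE (partialM i Ux (regcW rTh) (regcW rH)) HG.
  apply: fin; first by rewrite addr_ge0.
  apply: le_trans (ler_normD _ _) _; rewrite [`|_ * Gs|]normrM [`|Th x * _|]normrM (ger0_norm G0).
  have H1 : `|partial i Th x| * Gs <= M * (s^-1 * Gs).
    by rewrite ler_pM// -[leLHS]mul1r ler_wpM2r.
  have H2 := ler_pM (normr_ge0 _) (normr_ge0 _) bTh (bH i).
  apply: le_trans (lerD H1 H2) _.
  have : M * 1 * (s^-1 * Gs) <= M * (3 + 2 * (al ^+ 2) ^+ 2) * (s^-1 * Gs).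
    by rewrite ler_wpM2r// ler_wpM2l//; lra.
  have : n * M * M * al * (s^-1 * Gs) <= n * M * M * (1 + (al ^+ 2) ^+ 2) * (s^-1 * Gs).
    by rewrite ler_wpM2r// ler_wpM2l.
  have : 0 <= n * M * M * (2 + (al ^+ 2) ^+ 2) * (s^-1 * Gs).
    by rewrite mulr_ge0// mulr_ge0//; lra.
  have := mulr_ge0 (mulr_ge0 nMM al0) sG.
  by move: (s^-1 * Gs) ((al ^+ 2) ^+ 2) => a b; lra.
- have -> : laplacian (gkern Th T s ^~ y) x - gkern_t Th T s x y =
     laplacian Th x * Gs + 2 * \sum_i (partial i Th x * partial i H x) +
     Th x * ((m ^+ 2 * (4 * e1) - m * (2 * e2)) * Gs).
    have -> : laplacian (gkern Th T s ^~ y) x = laplacian Th x * Gs +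
        2 * \sum_i (partial i Th x * partial i H x) + Th x * laplacian H x.
      rewrite gkE /laplacian -HG mulr_suml 2!mulr_sumr -2!big_split.
      by apply: eq_bigr => i _; exact: (partialMM i oU Ux rTh rH).
    rewrite lapH.
    rewrite /gkern_t /gkern -/Gs -(sqr_sqrtr (sqn_ge0 _)) -/sg /m /n.
    by move: (\sum_i _) (laplacian _ _) s^-1 Gs => a b e f; lra.
  apply: fin.
    by apply: addr_ge0; [exact: addr_ge0|apply: mulr_ge0 => //; apply: addr_ge0 => //; rewrite !mulr_ge0].
  rewrite (le_trans (ler_normD _ _))// (le_trans (lerD (ler_normD _ _) (lexx _)))//.
  have H1 : `|laplacian Th x * Gs| <= M * (s^-1 * Gs).
    by rewrite normrM (ger0_norm G0) ler_pM// -[leLHS]mul1r ler_wpM2r.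
  have H2 : `|2 * \sum_i (partial i Th x * partial i H x)| <=
      2 * (n * (M * (n * M / 2 * al * (s^-1 * Gs)))).
    by rewrite normrM ger0_norm// ler_wpM2l//; apply: hT => i; rewrite normrM ler_pM.
  have m0 : 0 <= m by rewrite mulr_ge0// exprn_ge0// invr_ge0 ltW.
  have H3 : `|Th x * ((m ^+ 2 * (4 * e1) - m * (2 * e2)) * Gs)| <=
     M * ((m ^+ 2 * (4 * (n * (n * (sg * sg * (M * sg))))) + m * (2 * (n * (M * sg + sg * M)))) * Gs).
    rewrite normrM ler_pM// normrM (ger0_norm G0) ler_wpM2r//.
    rewrite (le_trans (ler_normB _ _))// lerD// normrM.
      by rewrite (ger0_norm (sqr_ge0 _)) ler_wpM2l ?sqr_ge0// normrM ger0_norm// ler_wpM2l.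
    by rewrite (ger0_norm m0) ler_wpM2l// normrM ger0_norm// ler_wpM2l.
  apply: le_trans (lerD (lerD H1 H2) H3) _.
  have -> : M * ((m ^+ 2 * (4 * (n * (n * (sg * sg * (M * sg))))) + m * (2 * (n * (M * sg + sg * M)))) * Gs)
     = (M * (n * n * M) / 4 * al ^+ 3 + M * (n * M) * al) * (s^-1 * Gs).
    by rewrite /m /al; move: s^-1 Gs => a b; lra.
  have P1 : 0 <= M * (n * n * M) by rewrite !mulr_ge0.
  have P2 : 0 <= M * (n * M) by rewrite !mulr_ge0.
  have K1 : M * (n * n * M) * al ^+ 3 * (s^-1 * Gs) <= M * (n * n * M) * (1 + (al ^+ 2) ^+ 2) * (s^-1 * Gs).
    by rewrite ler_wpM2r// ler_wpM2l.
  have K2 : M * (n * M) * al * (s^-1 * Gs) <= M * (n * M) * (1 + (al ^+ 2) ^+ 2) * (s^-1 * Gs).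
    by rewrite ler_wpM2r// ler_wpM2l.
  have K3 : n * n * M * M * al * (s^-1 * Gs) <= n * n * M * M * (1 + (al ^+ 2) ^+ 2) * (s^-1 * Gs).
    by rewrite ler_wpM2r// ler_wpM2l.
  have L0 (A : R) : 0 <= A -> 0 <= A * (1 + (al ^+ 2) ^+ 2) * (s^-1 * Gs).
    by move=> A0; rewrite mulr_ge0// mulr_ge0//; lra.
  have J1 := L0 _ P1; have J2 := L0 _ P2; have J3 := L0 _ nnMM; have J4 := L0 _ M0.
  have L1 (A : R) : 0 <= A -> 0 <= A * (s^-1 * Gs) by move=> A0; rewrite mulr_ge0.
  have I1 := L1 _ P1; have I2 := L1 _ P2; have I3 := L1 _ nnMM; have I4 := L1 _ M0.
  have J5 : 0 <= M * (n * n * M) * al ^+ 3 * (s^-1 * Gs) by rewrite mulr_ge0// mulr_ge0// exprn_ge0.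
  clear L0 L1 H1 H2 H3 bH; move: K1 K2 K3 J1 J2 J3 J4 I1 I2 I3 I4 J5.
  move: (s^-1 * Gs) (al ^+ 3) ((al ^+ 2) ^+ 2) => a b e; lra.
Qed.

End bounds.

Lemma kreg_gkern U k Th T (D : set (measurableTypeR R * 'rV[R]_d)%type) (Omega : set 'rV[R]_d) (eps : R) :
  open U -> 0 < eps -> bounded_set Omega -> measurable D ->
  (forall p, D p -> eps <= p.1 /\ Omega p.2) ->
  regc U k Th -> (forall i, regc U k (T i)) ->
  kreg U D k (fun x (p : measurableTypeR R * 'rV[R]_d) => gkern Th T p.1 x p.2).
Proof.
move=> oU e0 [M [Mr HM]] mD HD rTh rT.
have minv : measurable_fun D (fun p : measurableTypeR R * 'rV[R]_d => (p.1 : R)^-1).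
  apply: (eq_measurable_fun (fun p : measurableTypeR R * 'rV[R]_d => expR (- ln (p.1 : R)))).
    move=> p /set_mem/HD[ep _]; rewrite expRN lnK// posrE; exact: lt_le_trans ep.
  apply: measurable_funTS; apply: (measurableT_comp (@measurable_expR R)).
  apply: (measurableT_comp (f := fun r : R => - r)); first exact: oppr_measurable.
  by apply: (measurableT_comp (@measurable_ln R)); exact: measurable_fst.
have iv p : D p -> 0 < (p.1 : R)^-1 /\ (p.1 : R)^-1 <= eps^-1.
  move=> /HD[ez _]; split; first by rewrite invr_gt0 (lt_le_trans e0).
  by rewrite lef_pV2// posrE// (lt_le_trans e0).
have kinv n : kreg U D k (fun _ (p : measurableTypeR R * 'rV[R]_d) => (p.1 : R)^-1 ^+ n).
  apply: (@kreg_z R d _ _ U D k _ (eps^-1 ^+ n) oU); first exact: measurable_funX.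
  move=> p /iv[i0 i1]; rewrite ger0_norm; last by apply: exprn_ge0; exact: ltW.
  by apply: lerXn2r => //; rewrite nnegrE; [exact: ltW|rewrite invr_ge0 ltW].
have ky i : kreg U D k (fun _ (p : measurableTypeR R * 'rV[R]_d) => p.2 0 i).
  apply: (@kreg_z R d _ _ U D k _ (M + 1) oU).
    apply: measurable_funTS; apply: (measurableT_comp (measurable_coord i)).
    exact: measurable_snd.
  move=> p /HD[_ Oz]; rewrite (le_trans (coord_le_norm _ _))//; apply: HM => //.
  by rewrite ltrDl.
have kq : kreg U D k (fun x (p : measurableTypeR R * 'rV[R]_d) => qdist T p.2 x).
  apply: (kreg_sum oU) => i.
  have K : kreg U D k (fun x (p : measurableTypeR R * 'rV[R]_d) => T i x - p.2 0 i).
    by apply: (kregB oU) => //; exact: kreg_fun.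
  exact: (kregM oU K K).
have K2 : kreg U D k (fun x (p : measurableTypeR R * 'rV[R]_d) => expR (- (1 / 4 * (p.1 : R)^-1 ^+ 2 * qdist T p.2 x))).
  apply: (kreg_exp oU); apply: (kregN oU); apply: (kregM oU) => //.
  exact: (kregZ _ oU).
apply: (kreg_eq oU _ (kregM oU (kreg_fun D rTh) (kregM oU (kinv d) K2))).
by move=> x p Ux Dp; rewrite /gkern gauss_qdist.
Qed.

End gaussian_kernels.

(** * Construction of the parametrix *)

Section parametrix.
Context {R : realType} {d : nat}.
Implicit Types (x y z w : 'rV[R]_d) (U W Omega : set 'rV[R]_d) (f g h q Th rho : 'rV[R]_d -> R)
  (T : 'I_d -> 'rV[R]_d -> R) (s : R).
Local Notation e_ i := (delta_mx 0 i : 'rV[R]_d).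
Local Notation oT := (@openT 'rV[R]_d).

Lemma norm_le_sum n (a : 'I_n -> R) i : `|a i| <= \sum_j `|a j|.
Proof. by rewrite (bigD1 i)//= lerDl sumr_ge0. Qed.

Lemma quarters : [/\ 0 < 1 / 4 :> R, 1 / 4 / 2 = 1 / 8 :> R & 2 / (1 / 4) = 8 :> R].
Proof. by split; lra. Qed.

Lemma le_sum6 (a1 a2 a3 a4 a5 a6 M : R) : 0 <= a1 -> 0 <= a2 -> 0 <= a3 -> 0 <= a4 ->
  0 <= a5 -> 0 <= a6 -> a1 + a2 + a3 + a4 + a5 + a6 <= M ->
  [/\ a1 <= M, a2 <= M & a3 <= M] /\ [/\ a4 <= M, a5 <= M & a6 <= M].
Proof. by move=> *; split; split; lra. Qed.

Lemma gauss_mono (b b' s : R) z z' : 0 <= s -> b * sqn z <= b' * sqn z' ->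
  gauss b' s z' <= gauss b s z.
Proof.
move=> s0 H; rewrite /gauss ler_wpM2l ?exprn_ge0 ?invr_ge0// ler_expR !mulNr lerN2.
by rewrite ler_wpM2r// sqr_ge0.
Qed.

Lemma partialD U f g x j : U x -> regc U 1 f -> regc U 1 g ->
  partial j (fun y => f y + g y) x = partial j f x + partial j g x.
Proof.
by move=> Ux rf rg; apply/partial_is_derive/(drvD (regc_drv j rf Ux) (regc_drv j rg Ux)).
Qed.

Lemma laplacianD U f g x : open U -> U x -> regc U 2 f -> regc U 2 g ->
  laplacian (fun y => f y + g y) x = laplacian f x + laplacian g x.
Proof.
move=> oU Ux rf rg; rewrite /laplacian -big_split; apply: eq_bigr => j _.
have [rf1 rg1] := (regcW rf, regcW rg).
have [rfj rgj] := (regc_partial j rf, regc_partial j rg).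
rewrite (partial_eq_on j oU Ux (fun y Uy => partialD j Uy rf1 rg1) (regcD oU rfj rgj)).
exact: partialD Ux rfj rgj.
Qed.

Lemma regc_gkern U k Th T s y : open U -> regc U k Th -> (forall i, regc U k (T i)) ->
  regc U k (gkern Th T s ^~ y).
Proof.
move=> oU rTh rT; have rE := regc_expq (s^-1 ^+ d) (1 / 4 * s^-1 ^+ 2) oU (regc_qdist y oU rT).
apply: (regc_eq oU _ (regcM oU rTh rE)) => x _; by rewrite /gkern gauss_qdist.
Qed.

Lemma partial_gkern U Th T s x y i : open U -> U x -> regc U 1 Th ->
  (forall i, regc U 1 (T i)) ->
  partial i (gkern Th T s ^~ y) x =
  (partial i Th x - Th x * (1 / 4 * s^-1 ^+ 2) *
    \sum_l 2 * ((T l x - y 0 l) * partial i (T l) x)) * gauss (1 / 4) s ((\row_l T l x) - y).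
Proof.
move=> oU Ux rTh rT; have rq := regc_qdist y oU rT.
have rE := regc_expq (s^-1 ^+ d) (1 / 4 * s^-1 ^+ 2) oU rq.
have -> : gkern Th T s ^~ y = fun x => Th x * expq (s^-1 ^+ d) (1 / 4 * s^-1 ^+ 2) (qdist T y) x.
  by apply/funext => z; rewrite /gkern gauss_qdist.
rewrite (partialM i Ux rTh rE) (partial_expq _ _ i oU Ux rq) gauss_qdist.
rewrite (partial_qdist y i Ux rT); move: (partial i Th x) (\sum_l _) (expq _ _ _ _) => *; lra.
Qed.

Lemma measurable_gkern_t Th T x (D : set (measurableTypeR R * 'rV[R]_d)%type) :
  measurable D -> (forall p, D p -> 0 < (p.1 : R)) ->
  measurable_fun D (fun p : measurableTypeR R * 'rV[R]_d => gkern Th T p.1 x p.2) ->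
  measurable_fun D (fun p : measurableTypeR R * 'rV[R]_d => gkern_t Th T p.1 x p.2).
Proof.
move=> mD D0 mg; apply: measurable_funM => //.
have minv : measurable_fun D (fun p : measurableTypeR R * 'rV[R]_d => (p.1 : R)^-1).
  apply: (eq_measurable_fun (fun p : measurableTypeR R * 'rV[R]_d => expR (- ln (p.1 : R)))).
    by move=> p /set_mem/D0 ep; rewrite expRN lnK// posrE.
  apply: measurable_funTS; apply: (measurableT_comp (@measurable_expR R)).
  apply: (measurableT_comp (f := fun r : R => - r)); first exact: oppr_measurable.
  by apply: (measurableT_comp (@measurable_ln R)); exact: measurable_fst.
apply: measurable_funB.
  apply: measurable_funM; last exact: measurable_funX.
  apply: measurable_funM; first exact: measurable_cst.
  apply: measurable_funTS.
  have c1 : continuous (fun y : 'rV[R]_d => sqn (\row_i T i x - y)).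
    by move=> y; under eq_fun do rewrite sqnB; exact: continuous_sqnB.
  exact: (measurableT_comp (continuous_measurable_rV_real c1) measurable_snd).
by apply: measurable_funM; [exact: measurable_cst|exact: measurable_funX].
Qed.

Lemma continuous_gkern_t Th T x y s : 0 < s ->
  {for s, continuous (fun s => gkern Th T s x y)} /\
  {for s, continuous (fun s => gkern_t Th T s x y)}.
Proof.
move=> s0; have sn0 : s != 0 by rewrite gt_eqF.
have cg : {for s, continuous (fun s => gkern Th T s x y)}.
  apply: differentiable_continuous; apply/derivable1_diffP.
  by case: (gkern_t_is_derive Th T x y sn0).
split => //; apply: for_continuousM => //.
have ci n : {for s, continuous (fun s : R => s^-1 ^+ n)}.
  elim: n => [|n IH]; first by exact: for_continuous_cst.
  rewrite (_ : (fun s : R => _) = fun s => s^-1 * s^-1 ^+ n); last first.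
    by apply/funext => t; rewrite exprS.
  by apply: for_continuousM => //; exact: inv_continuous.
apply: for_continuousD; first by apply: for_continuousM => //; exact: for_continuous_cst.
by apply/for_continuousN/for_continuousM => //; exact: for_continuous_cst.
Qed.

(* [s] is the square root of the time, and [kt] is the derivative of [k] in the time. *)
Definition parametrix Omega rho W (k kt : R -> 'rV[R]_d -> 'rV[R]_d -> R) (b C : R) :=
  [/\ [/\ open W, closure Omega `<=` W, 0 < b & 0 <= C],
   forall (eps : R) (D : set (measurableTypeR R * 'rV[R]_d)%type) n, 0 < eps -> measurable D ->
     (forall p, D p -> eps <= (p.1 : R) /\ Omega p.2) ->
     kreg W D n (fun x (p : measurableTypeR R * 'rV[R]_d) => k p.1 x p.2) /\
     forall x, W x ->
       measurable_fun D (fun p : measurableTypeR R * 'rV[R]_d => kt p.1 x p.2),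
   forall s x y, 0 < s ->
     [/\ is_derive s 1 (fun s => k s x y) (2 * s * kt s x y),
       {for s, continuous (fun s => k s x y)} & {for s, continuous (fun s => kt s x y)}],
   forall s x y, bdry Omega x ->
     dotv (\row_i partial i (k s ^~ y) x) (outer_normal Omega x) = 0 &
   forall s x y, 0 < s -> s <= 1 -> Omega x -> Omega y ->
     [/\ `|k s x y| <= C * gauss b s (x - y),
       forall i, `|partial i (k s ^~ y) x| <= C * s^-1 * gauss b s (x - y),
       `|laplacian (k s ^~ y) x - kt s x y| <= C * s^-1 * gauss b s (x - y) &
       `|k s x y - gauss (1 / 4) s (x - y)| <= C * s ^+ 2 / rho x ^+ 2 * gauss b s (x - y)]].

Definition idc (i : 'I_d) x : R := x 0 i.

Lemma row_idc x : \row_i idc i x = x.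
Proof. by apply/rowP => i; rewrite mxE. Qed.

Lemma gkern_idc s x y : gkern (cst 1) idc s x y = gauss (1 / 4) s (x - y).
Proof. by rewrite /gkern /= mul1r row_idc. Qed.

Lemma partial_cst (c : R) i x : partial i (fun=> c) x = 0.
Proof. by apply: partial_is_derive; exact: (drv_cst c). Qed.

Lemma laplacian_cst (c : R) x : laplacian (fun=> c) x = 0.
Proof.
rewrite /laplacian big1// => i _; rewrite (_ : partial i (fun=> c) = fun=> 0) ?partial_cst//.
by apply/funext => y; rewrite partial_cst.
Qed.

Lemma partial_idc i j x : partial j (idc i) x = (i == j)%:R.
Proof. exact/partial_is_derive/drv_coord. Qed.

(** The identity map has Jacobian defect E = 0 and the cutoff is constant, so M = 1 works. *)
Lemma gkern_idc_bounds : exists C : R, 0 <= C /\ forall s x y, 0 < s -> s <= 1 ->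
   [/\ `|gkern (cst 1) idc s x y| <= C * gauss (1 / 8) s (x - y),
   forall i, `|partial i (gkern (cst 1) idc s ^~ y) x| <= C * s^-1 * gauss (1 / 8) s (x - y) &
   `|laplacian (gkern (cst 1) idc s ^~ y) x - gkern_t (cst 1) idc s x y| <=
     C * s^-1 * gauss (1 / 8) s (x - y)].
Proof.
pose n : R := d%:R; have n0 : 0 <= n by exact: ler0n.
have nn0 : 0 <= n * n by exact: mulr_ge0.
exists ((1 + n + n * n * 2 + n) * 259); split; first by rewrite mulr_ge0//; lra.
move=> s x y s0 s1.
have rid i : regc setT 2 (idc i) by exact: (regc_coord 2 i oT).
have r1 : regc (setT : set 'rV[R]_d) 2 (cst 1) by exact: (regc_cst 2 1 oT).
have [] := @gkern_bounds R d setT (cst 1) idc x y s 1 (fun _ _ => 0) oT I r1 rid s0 s1 ler01.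
- by rewrite /= normr1.
- by move=> i; rewrite partial_cst normr0.
- by rewrite laplacian_cst normr0.
- by move=> i j; rewrite partial_idc normr_nat lern1 leq_b1.
- move=> i; rewrite /laplacian big1 ?normr0// => j _.
  rewrite (_ : partial j (idc i) = fun=> (i == j)%:R) ?partial_cst//.
  by apply/funext => z; rewrite partial_idc.
- move=> i l; rewrite addr0 (eq_bigr (fun j => (i == j)%:R * (l == j)%:R)).
    by rewrite sum_delta eq_sym.
  by move=> j _; rewrite !partial_idc.
- by move=> i l; rewrite normr0 mul1r sqrtr_ge0.
rewrite row_idc -/n => B1 B2 B3.
have g0 : 0 <= gauss (1 / 8) s (x - y) by exact/gauss_ge0/ltW.
have si : 0 <= s^-1 by rewrite invr_ge0 ltW.
have sg : 0 <= s^-1 * gauss (1 / 8) s (x - y) by exact: mulr_ge0.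
split => [|i|].
- apply: le_trans B1 _; rewrite ler_wpM2r//; lra.
- by apply: le_trans (B2 i) _; do 3 rewrite ler_wpM2r//; clear -n0 nn0; lra.
- by apply: le_trans B3 _; do 3 rewrite ler_wpM2r//; clear -n0 nn0; lra.
Qed.

(** The kernel is the Gaussian plus its reflected copy, cut off to the collar in which reflection is
    controlled. At the boundary the cutoff is 1 with zero gradient, T x = x, and the Jacobian of T
    reverses the normal, so the two normal derivatives cancel exactly. *)
Lemma exists_parametrix Omega rho : open Omega -> bounded_set Omega ->
  defining_function Omega rho ->
  exists W k kt b C, parametrix Omega rho W k kt b C.
Proof.
move=> oO bO dr; have [sr rn rp rb] := dr.
have cr x : {for x, continuous rho} by exact: (regc_continuous (sr 0%N)).
have [c [C0 [c0 C00 HC0]]] := collar_refl sr bO dr.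
have oN := open_nondeg sr.
(* The factor exp 1 makes the value at the boundary 1; dependence on rho^2 makes the gradient vanish
   there. The support lies in |rho| <= c. *)
pose Th x := expR 1 * flat (1 - c^-1 ^+ 2 * (rho x * rho x)).
have rTh k : regc setT k Th.
  apply: (regcZ _ oT (regc_flat oT (regcB oT (regc_cst k 1 oT) (regcZ (c^-1 ^+ 2) oT (regcM oT (sr k) (sr k)))))).
pose O : set 'rV[R]_d := [set x | c ^+ 2 < rho x * rho x].
have oO' : open O by apply: open_gt_fun => x; exact: for_continuousM.
have Th0 x : O x -> Th x = 0.
  rewrite /O /Th /= => Ox; rewrite flat_le0 ?mulr0// subr_le0 exprVn.
  by rewrite -ler_pdivrMl ?invr_gt0 ?exprn_gt0// invrK mulr1 ltW.
have Oc x : closure Omega x -> O x \/ `|rho x| <= c.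
  move=> _; have [|H] := leP `|rho x| c; [by right|left].
  rewrite /O /= -[rho x * rho x]ger0_norm -?expr2 ?sqr_ge0// expr2 normrM.
  by apply: ltr_pM => //; exact: ltW.
(* On [O] the cutoff, and with it the reflected kernel, is 0; on [nondeg rho] the reflection is
   smooth. *)
pose W := O `|` nondeg rho.
have oW : open W by exact: openU.
have rT k i : regc (nondeg rho) k (refl rho i) by exact: regc_refl.
have rThN k : regc (nondeg rho) k Th by exact: regcS (rTh k).
pose k2 := gkern Th (refl rho).
have k20 s x y : O x -> k2 s x y = 0 by move=> Ox; rewrite /k2 /gkern Th0// mul0r.
have rk2 k s y : regc W k (k2 s ^~ y).
  apply: regcU; last exact: regc_gkern.
  by apply: (regc_eq oO' _ (regc_cst k 0 oO')) => x Ox; rewrite k20.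
pose k1 := gkern (cst 1) idc.
have rk1T k s y : regc setT k (k1 s ^~ y).
  by apply: regc_gkern; [exact: oT|exact: regc_cst oT|move=> i; exact: regc_coord oT].
have rk1 k s y : regc W k (k1 s ^~ y) by exact: regcS (rk1T k s y).
have [C1 [C10 HC1]] := gkern_idc_bounds.
pose K := closure Omega `&` [set x | `|rho x| <= c].
have cK : compact K.
  apply: compact_closedI; first exact: compact_closure_bounded.
  rewrite (_ : [set x | _] = (fun x => `|rho x|) @^-1` [set r | r <= c])//.
  apply: closed_comp; last exact: closed_le.
  by move=> x _; apply: (@for_continuous_comp R _ rho (fun r : R => `|r|)); [exact: cr|exact: norm_continuous].
have cNd x : closure Omega x -> `|rho x| <= c -> Omega !=set0 -> nondeg rho x.
  by move=> cx rx [y Oy]; have [] := HC0 x y cx rx Oy.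
(* [collar_refl] yields nondegeneracy in the presence of a point of Omega; for empty Omega any
   kernel will do. *)
have [neO|neO] := pselect (Omega !=set0); last first.
  have E0 : Omega = set0 by apply/seteqP; split => // x Ox; apply: neO; exists x.
  exists setT, k1, (gkern_t (cst 1) idc), 1, 0; split.
  - by split => //; exact: oT.
  - move=> eps D n e0 mD HD; have D0 : D = set0 by apply/seteqP; split => // p /HD[_]; rewrite E0.
    have K1 := @kreg_gkern R d setT n (cst 1) idc D Omega eps oT e0 bO mD HD
       (regc_cst n 1 oT) (fun i => regc_coord n i oT).
    by split => // x _; rewrite D0; exact: measurable_fun_set0.
  - move=> s x y s0; have [? ?] := continuous_gkern_t (cst 1) idc x y s0; split => //.
    by apply: gkern_t_is_derive; rewrite gt_eqF.
  - by move=> s x y [+ _]; rewrite E0 closure0.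
  - by move=> s x y _ _; rewrite E0.
(* All quantities that [gkern_bounds] wants bounded are summed, so that one compactness argument
   serves them all. *)
pose F x := `|Th x| + \sum_i `|partial i Th x| + `|laplacian Th x| +
  \sum_i \sum_j `|partial j (refl rho i) x| + \sum_i `|laplacian (refl rho i) x| +
  \sum_i \sum_l `|rdefect rho i l x|.
have nc f x : {for x, continuous f} -> {for x, continuous (fun x => `|f x|)}.
  by move=> cf; apply: (@for_continuous_comp R _ f (fun r : R => `|r|)); [exact: cf|exact: norm_continuous].
have clap f x : nondeg rho x -> regc (nondeg rho) 2 f -> {for x, continuous (laplacian f)}.
  move=> Nx rf; apply: continuous_rsum => i.
  exact: (regc_continuous (regc_partial i (regc_partial i rf))).
have [M HM] : exists M : R, forall x, K x -> `|F x| <= M.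
  apply: (compact_bounded_fun cK) => x [cx rx]; have Nx := cNd x cx rx neO.
  rewrite /F; do 5?[apply: for_continuousD].
  - exact/nc/(regc_continuous (rThN 0%N)).
  - by apply: continuous_rsum => i; apply/nc; exact: (regc_continuous (regc_partial i (rThN 1%N))).
  - exact/nc/clap.
  - apply: continuous_rsum => i; apply: continuous_rsum => j; apply/nc.
    exact: (regc_continuous (regc_partial j (rT 1%N i))).
  - by apply: continuous_rsum => i; exact/nc/clap.
  - apply: continuous_rsum => i; apply: continuous_rsum => l; apply/nc.
    exact: (regc_continuous (regc_rdefect sr 0 i l)).
have FM x : K x -> [/\ `|Th x| <= M, forall i, `|partial i Th x| <= M, `|laplacian Th x| <= M,
   forall i j, `|partial j (refl rho i) x| <= M &
   (forall i, `|laplacian (refl rho i) x| <= M) /\ (forall i l, `|rdefect rho i l x| <= M)].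
  move=> /HM; have p1 := normr_ge0 (Th x).
  have p2 : 0 <= \sum_i `|partial i Th x| by apply: sumr_ge0 => i _; exact: normr_ge0.
  have p3 := normr_ge0 (laplacian Th x).
  have p4 : 0 <= \sum_i \sum_j `|partial j (refl rho i) x|.
    by do 2 (apply: sumr_ge0 => ? _); exact: normr_ge0.
  have p5 : 0 <= \sum_i `|laplacian (refl rho i) x| by apply: sumr_ge0 => i _; exact: normr_ge0.
  have p6 : 0 <= \sum_i \sum_l `|rdefect rho i l x|.
    by do 2 (apply: sumr_ge0 => ? _); exact: normr_ge0.
  have H2 i := norm_le_sum (fun i => partial i Th x) i.
  have H5 i := norm_le_sum (fun i => laplacian (refl rho i) x) i.
  have H4 i j : `|partial j (refl rho i) x| <= \sum_i \sum_j `|partial j (refl rho i) x|.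
    apply: le_trans (norm_le_sum (fun j => partial j (refl rho i) x) j) _.
    by rewrite [leRHS](bigD1 i)//= lerDl; do 2 (apply: sumr_ge0 => ? _); exact: normr_ge0.
  have H6 i j : `|rdefect rho i j x| <= \sum_i \sum_j `|rdefect rho i j x|.
    apply: le_trans (norm_le_sum (fun j => rdefect rho i j x) j) _.
    by rewrite [leRHS](bigD1 i)//= lerDl; do 2 (apply: sumr_ge0 => ? _); exact: normr_ge0.
  move=> /(le_trans (ler_norm _)); rewrite /F.
  move=> /(le_sum6 p1 p2 p3 p4 p5 p6)[[q1 q2 q3] [q4 q5 q6]].
  split=> [|i||i j|]; [exact: q1|exact: le_trans (H2 i) q2|exact: q3|exact: le_trans (H4 i j) q4|].
  by split=> [i|i j]; [exact: le_trans (H5 i) q5|exact: le_trans (H6 i j) q6].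
pose M0 := Num.max M 0.
have M00 : 0 <= M0 by rewrite le_max lexx orbT.
have MM0 : M <= M0 by rewrite le_max lexx.
(* The defect is rho times [rdefect], and |rho x| <= sqrt C0 |T x - y| in the collar; hence the
   factor with sqrt C0. *)
have [M' M'E] : {M' | M' = M0 * (1 + Num.sqrt C0)} by eexists.
have sC0 : 0 <= Num.sqrt C0 by exact: sqrtr_ge0.
have M0M' : M0 <= M' by rewrite M'E ler_peMr// lerDl.
have M'0 : 0 <= M' by exact: le_trans M0M'.
pose n : R := d%:R.
have n0 : 0 <= n by exact: ler0n.
have [C2 C2E] : {C2 | C2 = (M' + n * n * M' * M' + M' * (n * n * M' + n * M') + n * M' * M') * 259} by eexists.
have t1 : 0 <= n * M' by exact: mulr_ge0.
have t2 : 0 <= n * M' * M' by exact: mulr_ge0.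
have t3 : 0 <= n * n * M' * M' by rewrite !mulr_ge0.
have t4 : 0 <= M' * (n * n * M' + n * M') by rewrite mulr_ge0// addr_ge0// !mulr_ge0.
have C20 : 0 <= C2 by rewrite C2E; move: M'0 t1 t2 t3 t4; clear; lra.
(* As |x - y|^2 <= C0 |T x - y|^2, this exponent lets Gaussians centred at T x be bounded by
   Gaussians in x - y; it is also at most 1/8. *)
have [b bbE] : {b | b = (8 * (C0 + 1))^-1} by eexists.
have b8 : 0 < 8 * (C0 + 1) by rewrite mulr_gt0// ltr_wpDl.
have b0 : 0 < b by rewrite bbE invr_gt0.
have gm s x y : 0 < s -> K x -> Omega y ->
    gauss (1 / 8) s (reflv rho x - y) <= gauss b s (x - y).
  move=> s0 [cx rx] Oy; apply: gauss_mono; first exact: ltW.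
  have [_ _ H] := HC0 x y cx rx Oy; have := sqn_ge0 (reflv rho x - y).
  have E : b * (8 * (C0 + 1)) = 1 by rewrite bbE mulVf// gt_eqF.
  have E' : b * C0 = 1 / 8 - b by move: E; clear -R; move: b C0 => u v; lra.
  have := ler_wpM2l (ltW b0) H; rewrite mulrA E'; move: b0; clear -R.
  by move: (sqn _) (sqn _) b => u v a *; nra.
have gm1 s x y : 0 < s -> gauss (1 / 8) s (x - y) <= gauss b s (x - y).
  move=> s0; apply: gauss_mono; first exact: ltW.
  rewrite ler_wpM2r ?sqn_ge0// bbE invfM -[leRHS]mulr1 div1r ler_wpM2l ?invr_ge0//.
  by rewrite invf_le1 ?lerDr// ltr_wpDl.
have B2 s x y : 0 < s -> s <= 1 -> Omega x -> Omega y ->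
    [/\ `|k2 s x y| <= C2 * gauss b s (x - y),
     forall i, `|partial i (k2 s ^~ y) x| <= C2 * s^-1 * gauss b s (x - y),
     `|laplacian (k2 s ^~ y) x - gkern_t Th (refl rho) s x y| <= C2 * s^-1 * gauss b s (x - y) &
     `|k2 s x y| <= M' * 8 * (C0 + 1) * s ^+ 2 / rho x ^+ 2 * gauss b s (x - y)].
  move=> s0 s1 Ox Oy; have g0 : 0 <= gauss b s (x - y) by exact/gauss_ge0/ltW.
  have cx := @subset_closure _ Omega x Ox.
  have si : 0 <= s^-1 by rewrite invr_ge0 ltW.
  have sg : 0 <= s^-1 * gauss b s (x - y) by exact: mulr_ge0.
  have Cg : 0 <= C2 * s^-1 * gauss b s (x - y) by rewrite -mulrA mulr_ge0.
  have Cg4 : 0 <= M' * 8 * (C0 + 1) * s ^+ 2 / rho x ^+ 2 * gauss b s (x - y).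
    by rewrite mulr_ge0// mulr_ge0 ?invr_ge0 ?sqr_ge0// mulr_ge0 ?sqr_ge0// mulr_ge0 ?mulr_ge0// addr_ge0.
  have [Ox'|rx] := Oc x cx.
    have P0 z i : O z -> partial i (k2 s ^~ y) z = 0.
      move=> Oz; rewrite -(partial_cst 0 i z).
      by apply: (partial_eq_on i oO' Oz _ (regc_cst 1 0 oO')) => w Ow; rewrite k20.
    have L0 : laplacian (k2 s ^~ y) x = 0.
      rewrite /laplacian big1// => i _; rewrite -(partial_cst 0 i x).
      by apply: (partial_eq_on i oO' Ox' _ (regc_cst 1 0 oO')) => w Ow; rewrite P0.
    split.
    - by rewrite k20// normr0 mulr_ge0.
    - by move=> i; rewrite P0// normr0.
    - by rewrite L0 /gkern_t -/(k2 s x y) k20// mulr0 subr0 normr0.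
    - by rewrite k20// normr0.
  have Kx : K x by [].
  have [Nx rT2 _] := HC0 x y cx rx Oy.
  have [f1 f2 f3 f4 [f5 f6]] := FM x Kx.
  have leM (a : R) : `|a| <= M -> `|a| <= M'.
    by move=> H; exact: le_trans H (le_trans MM0 M0M').
  have sqr : `|rho x| <= Num.sqrt C0 * Num.sqrt (sqn (reflv rho x - y)).
    rewrite -sqrtrM// -sqrtr_sqr ler_wsqrtr//.
  have bE i l : `|rho x * rdefect rho i l x| <= M' * Num.sqrt (sqn (\row_i refl rho i x - y)).
    rewrite normrM mulrC M'E -mulrA; apply: ler_pM => //.
      exact: le_trans (f6 i l) MM0.
    by apply: le_trans sqr _; rewrite ler_wpM2r ?sqrtr_ge0// lerDr.
  have [B1 B2 B3] := @gkern_bounds R d (nondeg rho) Th (refl rho) x y s M'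
    (fun i l => rho x * rdefect rho i l x) oN Nx (rThN 2%N) (rT 2%N) s0 s1 M'0
    (leM _ f1) (fun i => leM _ (f2 i)) (leM _ f3) (fun i j => leM _ (f4 i j))
    (fun i => leM _ (f5 i)) (fun i l => refl_orth sr i l Nx) bE.
  have := gm s x y s0 Kx Oy; rewrite -/(reflv rho x) in B1 B2 B3 * => gmx.
  have H0 (A : R) : 0 <= A -> A <= C2 -> A * s^-1 * gauss (1 / 8) s (reflv rho x - y) <=
      C2 * s^-1 * gauss b s (x - y).
    move=> A0 AC; apply: ler_pM => //; [by rewrite mulr_ge0|exact/gauss_ge0/ltW|by rewrite ler_wpM2r].
  split.
  - apply: le_trans B1 _; apply: ler_pM gmx; [by rewrite mulr_ge0|exact/gauss_ge0/ltW|].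
    by rewrite C2E; move: M'0 t1 t2 t3 t4; clear -R; lra.
  - move=> i; apply: le_trans (B2 i) _.
    by apply: H0; rewrite -/n ?C2E; move: M'0 t1 t2 t3 t4; clear -R; lra.
  - apply: le_trans B3 _.
    by apply: H0; rewrite -/n ?C2E; move: M'0 t1 t2 t3 t4; clear -R; lra.
  (* The difference from the plain Gaussian is the reflected term, and T x stays at distance at
     least |rho x| / sqrt (C0 + 1) from y, so [gauss_tail] gives the factor s^2 / rho^2. *)
  - have r0 : 0 < `|rho x| by rewrite normr_gt0 lt_eqF// rn.
    have C1p : 0 < C0 + 1 by rewrite ltr_wpDl.
    have sC1 : 0 < Num.sqrt (C0 + 1) by rewrite sqrtr_gt0.
    have rr0 : 0 < `|rho x| / Num.sqrt (C0 + 1) by rewrite divr_gt0.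
    have rr2 : (`|rho x| / Num.sqrt (C0 + 1)) ^+ 2 = rho x ^+ 2 / (C0 + 1).
      by rewrite exprMn exprVn sqr_sqrtr ?(ltW C1p)// real_normK ?num_real.
    have [b4 b48 b42] := quarters.
    have := @gauss_tail R d (1 / 4) s _ (reflv rho x - y) b4 s0 rr0.
    rewrite rr2 ler_pdivrMr// => /(_ _)GT.
    have GT' : gauss (1 / 4) s (reflv rho x - y) <=
        2 / (1 / 4) * s ^+ 2 / (rho x ^+ 2 / (C0 + 1)) * gauss (1 / 4 / 2) s (reflv rho x - y).
      by apply: GT; apply: le_trans rT2 _; rewrite mulrC ler_wpM2l ?sqn_ge0// lerDl.
    rewrite /k2 /gkern normrM [`|gauss _ _ _|]ger0_norm; last exact/gauss_ge0/ltW.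
    apply: le_trans (ler_pM (normr_ge0 _) _ (leM _ f1) GT') _; first exact/gauss_ge0/ltW.
    rewrite b48 b42 -/(reflv rho x) in GT' *.
    have gg : M' * 8 * (C0 + 1) * s ^+ 2 / rho x ^+ 2 * gauss (1 / 8) s (reflv rho x - y) <=
       M' * 8 * (C0 + 1) * s ^+ 2 / rho x ^+ 2 * gauss b s (x - y).
      by rewrite ler_wpM2l// mulr_ge0 ?invr_ge0 ?sqr_ge0// mulr_ge0 ?sqr_ge0// mulr_ge0 ?mulr_ge0// ltW.
    apply: le_trans gg; rewrite invfM invrK -/(reflv rho x).
    by move: (gauss _ _ _) (rho x ^- 2) => *; clear -R; lra.
pose k s x y := k1 s x y + k2 s x y.
pose kt s x y := gkern_t (cst 1) idc s x y + gkern_t Th (refl rho) s x y.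
exists W, k, kt, b, (C1 + C2 + M' * 8 * (C0 + 1)); split.
- split => //; last by rewrite !addr_ge0// !mulr_ge0// addr_ge0.
  by move=> x cx; have [Ox|rx] := Oc x cx; [left|right; exact: cNd].
- move=> eps D m e0 mD HD.
  have K1 := @kreg_gkern R d setT m (cst 1) idc D Omega eps oT e0 bO mD HD
       (regc_cst m 1 oT) (fun i => regc_coord m i oT).
  have K2 := @kreg_gkern R d (nondeg rho) m Th (refl rho) D Omega eps oN e0 bO mD HD (rThN m) (rT m).
  have K2W : kreg W D m (fun x (p : measurableTypeR R * 'rV[R]_d) => k2 p.1 x p.2).
    apply: kregU => //.
    by apply: (kreg_eq oO' _ (@kreg_cst R d _ _ O D m 0 oO')) => x p Ox Dp; rewrite k20.
  have K1W := kregS (@subsetT _ W) K1.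
  split; first exact: (kregD oW K1W K2W).
  have D0 p : D p -> 0 < (p.1 : R) by move=> /HD[+ _]; exact: lt_le_trans.
  move=> x Wx; apply: measurable_funD; apply: measurable_gkern_t => //.
    by have [_ _ H] := kreg_kreg0 K1W; exact: H.
  by have [_ _ H] := kreg_kreg0 K2W; exact: H.
- move=> s x y s0; have sn0 : s != 0 by rewrite gt_eqF.
  have [c1 c1t] := continuous_gkern_t (cst 1) idc x y s0.
  have [c2 c2t] := continuous_gkern_t Th (refl rho) x y s0.
  split; [|exact: for_continuousD|exact: for_continuousD].
  apply: (is_derive_eq (drvD (gkern_t_is_derive (cst 1) idc x y sn0)
     (gkern_t_is_derive Th (refl rho) x y sn0))).
  by rewrite /kt mulrDr.
- move=> s x y Bx; have [r0 _ [a a0 nE]] := rb x Bx; have [cx _] := Bx.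
  have Nx : nondeg rho x by apply: cNd => //; rewrite r0 normr0 ltW.
  rewrite nE dotvZr /dotv.
  have Wx : W x by right.
  have Th1 : Th x = 1.
    by rewrite /Th r0 mulr0 mulr0 subr0 /flat /flatn ltr01 invr1 hornerC mul1r -expRD subrr expR0.
  have pTh i : partial i Th x = 0.
    have D1 : is_derive x (e_ i) rho (partial i rho x) by exact: regc_drv (sr 1%N) _.
    have D2 := drvB (drv_cst (1 : R) x (e_ i)) (drvZ (c^-1 ^+ 2) (drvM D1 D1)).
    have D3 := is_derive_comp_dir (g := flatn 0) D2 (is_derive_flatn 0 _).
    apply: partial_is_derive; apply: (is_derive_eq (drvZ (expR 1) D3)).
    have -> : partial i rho x * rho x + rho x * partial i rho x = 0 by rewrite r0 mulr0 mul0r addr0.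
    by rewrite mulr0 subr0 !mulr0.
  have T0 : reflv rho x = x.
    by apply/rowP => l; rewrite mxE /refl r0 mul0r mulr0 subr0.
  have T0' l : refl rho l x = x 0 l by rewrite /refl r0 mul0r mulr0 subr0.
  set G := gauss (1 / 4) s (x - y).
  (* Both Gaussians have the same value G at a boundary point, so the normal derivative is G times a
     sum in which the identity contributes the gradient of rho and the reflection its negative. *)
  have E i : (\row_i0 partial i0 (k s ^~ y) x) 0 i * grad rho x 0 i =
     - (1 / 4 * s^-1 ^+ 2) * G * 2 *
      \sum_l (x 0 l - y 0 l) * (partial i rho x * partial i (idc l) x +
        partial i rho x * partial i (refl rho l) x).
    rewrite !mxE /k (partialD i Wx (rk1 1%N s y) (rk2 1%N s y)).
    rewrite (partial_gkern s y i oT I (regc_cst 1 1 oT) (fun l => regc_coord 1 l oT)).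
    rewrite (partial_gkern s y i oN Nx (rThN 1%N) (rT 1%N)).
    rewrite -/(reflv rho x) T0 row_idc -/G Th1 pTh partial_cst !mul1r -!mulr_sumr !sub0r.
    have -> : \sum_l (x 0 l - y 0 l) * (partial i rho x * partial i (idc l) x +
        partial i rho x * partial i (refl rho l) x) = partial i rho x *
       (\sum_l (idc l x - y 0 l) * partial i (idc l) x + \sum_l (refl rho l x - y 0 l) * partial i (refl rho l) x).
      rewrite -big_split mulr_sumr; apply: eq_bigr => l _; rewrite T0' /idc /=.
      move: (partial _ _ _) (partial _ _ _) (partial _ _ _) => *; lra.
    move: (\sum_l _) (\sum_l _) (partial i rho x) G => *; lra.
  rewrite (eq_bigr _ (fun i _ => E i)) -mulr_sumr exchange_big /= big1 ?mulr0//.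
  move=> l _; rewrite -mulr_sumr big_split /= (refl_normal sr l Nx r0).
  rewrite (eq_bigr (fun i => (l == i)%:R * partial i rho x)) ?sum_delta ?subrr ?mulr0//.
  by move=> i _; rewrite partial_idc mulrC.
- move=> s x y s0 s1 Ox Oy.
  have Wx : W x by have [Ox'|rx] := Oc x (subset_closure Ox); [left|right; apply: cNd => //; exact: subset_closure].
  have [P1 P2 P3] := HC1 s x y s0 s1; have [Q1 Q2 Q3 Q4] := B2 s x y s0 s1 Ox Oy.
  have g0 : 0 <= gauss b s (x - y) by exact/gauss_ge0/ltW.
  have gg := gm1 s x y s0.
  have si : 0 <= s^-1 by rewrite invr_ge0 ltW.
  have C3 : 0 <= M' * 8 * (C0 + 1) by rewrite !mulr_ge0// addr_ge0.
  have sg : 0 <= s^-1 * gauss b s (x - y) by exact: mulr_ge0.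
  have X (u v A : R) : 0 <= A -> `|u| <= C1 * A * gauss (1 / 8) s (x - y) ->
     `|v| <= C2 * A * gauss b s (x - y) ->
     `|u + v| <= (C1 + C2 + M' * 8 * (C0 + 1)) * A * gauss b s (x - y).
    move=> A0 H1 H2; apply: le_trans (ler_normD _ _) _; apply: le_trans (lerD H1 H2) _.
    have : C1 * A * gauss (1 / 8) s (x - y) <= C1 * A * gauss b s (x - y).
      by rewrite ler_wpM2l// mulr_ge0.
    have : 0 <= (M' * 8 * (C0 + 1)) * A * gauss b s (x - y) by rewrite mulr_ge0// mulr_ge0.
    by move: (M' * 8 * (C0 + 1)) (gauss _ _ _) (gauss _ _ _) => *; lra.
  split.
  - by have := X (k1 s x y) (k2 s x y) 1 ler01; rewrite !mulr1; exact.
  - by move=> i; rewrite (partialD i Wx (rk1 1%N s y) (rk2 1%N s y)); exact: X.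
  - rewrite (laplacianD oW Wx (rk1 2%N s y) (rk2 2%N s y)) /kt opprD addrACA; exact: X.
  - rewrite /k /k1 gkern_idc addrC addKr; apply: le_trans Q4 _.
    do 3 rewrite ler_wpM2r ?invr_ge0 ?sqr_ge0//.
    by rewrite lerDr addr_ge0.
Qed.

End parametrix.

Import HBSimple.

(** * Approximate resolvent *)

Section continuous_approximation.
Context {R : realType} {d : nat}.
Implicit Types (x y z : 'rV[R]_d) (A B : set 'rV[R]_d) (f g h w : 'rV[R]_d -> R).
Local Notation leb := (lebesgue_rV d : {sigma_finite_measure set 'rV[R]_d -> \bar R}).
Local Notation oT := (@openT 'rV[R]_d).

Lemma Rintegral_ext (D : set 'rV[R]_d) f g : (forall x, D x -> f x = g x) ->
  \int[leb]_(x in D) f x = \int[leb]_(x in D) g x.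
Proof. by move=> fg; apply: eq_Rintegral => x /set_mem; exact: fg. Qed.

Lemma Rintegral_eventually_small (D : set 'rV[R]_d) (f_ : nat -> 'rV[R]_d -> R) g (eta : R) :
  measurable D -> (forall n, measurable_fun D (f_ n)) ->
  (forall x, D x -> f_ ^~ x @ \oo --> (0 : R)) -> rintegrable leb D g ->
  (forall n x, D x -> `|f_ n x| <= g x) -> 0 < eta ->
  \forall n \near \oo, `|\int[leb]_(x in D) f_ n x| <= eta.
Proof.
move=> mD mf f0 Ig fg e0.
have [_] := Rintegral_dominated mD mf (measurable_cst (0 : R)) f0 Ig fg.
rewrite Rintegral_cst// mul0r => /cvgrPdist_le/(_ _ e0).
by apply: filterS => n; rewrite sub0r normrN.
Qed.

Context (Omega : set 'rV[R]_d) (mO : measurable Omega).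

Lemma rintegrable_absM w f (C : R) : rintegrable leb Omega w -> measurable_fun Omega f ->
  (forall x, Omega x -> `|f x| <= C) -> rintegrable leb Omega (fun x => `|w x * f x|).
Proof. by move=> Iw mf fC; apply: rintegrable_norm => //; exact: (rintegrableMb mO Iw mf fC). Qed.

Lemma Rintegral_absM_triangle w f g h (C : R) : rintegrable leb Omega w ->
  measurable_fun Omega f -> measurable_fun Omega g -> measurable_fun Omega h ->
  (forall x, Omega x -> `|f x| <= C) -> (forall x, Omega x -> `|g x| <= C) ->
  (forall x, Omega x -> `|h x| <= C) ->
  (forall x, Omega x -> `|h x| <= `|f x| + `|g x|) ->
  \int[leb]_(x in Omega) `|w x * h x| <=
  \int[leb]_(x in Omega) `|w x * f x| + \int[leb]_(x in Omega) `|w x * g x|.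
Proof.
move=> Iw mf mg mh fC gC hC H.
have If := rintegrable_absM Iw mf fC; have Ig := rintegrable_absM Iw mg gC.
have Ih := rintegrable_absM Iw mh hC.
rewrite -RintegralD//; apply: le_Rintegral => //; first exact: rintegrableD.
by move=> x Ox; rewrite !normrM -mulrDr ler_wpM2l// H.
Qed.

(** The sets whose indicator is a limit of continuous functions in L^1 with weight |w|; they will
    turn out to be all Borel sets. *)
Definition capprox w A := measurable A /\ forall eta : R, 0 < eta ->
  exists f, [/\ pcontinuous setT f, forall x, 0 <= f x <= 1 &
    \int[leb]_(x in Omega) `|w x * (\1_A x - f x)| <= eta].

Lemma indic01 A x : 0 <= (\1_A x : R) <= 1.
Proof. by rewrite indicE; case: (x \in A); rewrite /= ?ler01 lexx. Qed.

Lemma diff01 (a b : R) : 0 <= a <= 1 -> 0 <= b <= 1 -> `|a - b| <= 2.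
Proof. by move=> /andP[? ?] /andP[? ?]; rewrite ler_norml; apply/andP; split; lra. Qed.

Lemma measurable_indic_sub A f : measurable A -> pcontinuous setT f ->
  measurable_fun Omega (fun x => \1_A x - f x).
Proof.
move=> mA cf; apply: measurable_funB; first exact: measurable_indic.
by apply: measurable_funTS; exact: pcontinuous_measurableT.
Qed.

Lemma capproxU w A B : rintegrable leb Omega w -> capprox w A -> capprox w B ->
  capprox w (A `|` B).
Proof.
move=> Iw [mA HA] [mB HB]; split; first exact: measurableU.
move=> eta e0; have e2 : 0 < eta / 2 by rewrite divr_gt0.
have [f [cf f01 fA]] := HA _ e2; have [g [cg g01 gB]] := HB _ e2.
(* This is 1 - (1 - f)(1 - g), which stays between 0 and 1 and whose error is at most the sum of the
   two errors. *)
pose h x := f x + g x - f x * g x.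
have ch : pcontinuous setT h.
  move=> x _; apply: for_continuousD; first by apply: for_continuousD; [exact: cf|exact: cg].
  by apply/for_continuousN/for_continuousM; [exact: cf|exact: cg].
have h01 x : 0 <= h x <= 1.
  by have /andP[? ?] := f01 x; have /andP[? ?] := g01 x; rewrite /h; apply/andP; split; nra.
exists h; split => //.
have mU : measurable (A `|` B) by exact: measurableU.
have := @Rintegral_absM_triangle w (fun x => \1_A x - f x) (fun x => \1_B x - g x)
  (fun x => \1_(A `|` B) x - h x) 2 Iw (measurable_indic_sub mA cf) (measurable_indic_sub mB cg)
  (measurable_indic_sub mU ch).
move=> /(_ (fun x _ => diff01 (indic01 A x) (f01 x)) (fun x _ => diff01 (indic01 B x) (g01 x))
  (fun x _ => diff01 (indic01 _ x) (h01 x)))H.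
apply: le_trans (H _) _; last first.
  by apply: le_trans (lerD fA gB) _; rewrite -splitr.
move=> x _; have /andP[f0 f1] := f01 x; have /andP[g0 g1] := g01 x.
have -> : \1_(A `|` B) x - h x = (\1_A x - f x) * (1 - \1_B x) + (\1_B x - g x) * (1 - f x).
  rewrite !indicE in_setU /h; case: (x \in A); case: (x \in B) => /=; lra.
apply: le_trans (ler_normD _ _) _; rewrite !normrM; apply: lerD.
  by rewrite ler_piMr// ler_norml; have /andP[? ?] := indic01 B x; apply/andP; split; lra.
by rewrite ler_piMr// ler_norml; apply/andP; split; lra.
Qed.

(** Complements use 1 - f; countable unions are reduced to finite ones by dominated convergence. *)
Lemma capprox_sigma_algebra w : rintegrable leb Omega w -> sigma_algebra setT (capprox w).
Proof.
move=> Iw; have c0 : capprox w set0.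
  split=> // eta e0; exists (fun=> 0); split.
  - by move=> x _; exact: for_continuous_cst.
  - by move=> x; rewrite lexx ler01.
  rewrite (Rintegral_ext (g := fun=> 0)) ?Rintegral_cst ?mul0r ?ltW//.
  by move=> x _; rewrite indicE in_set0 subr0 mulr0 normr0.
split => //.
- move=> A [mA HA]; rewrite setTD; split; first exact: measurableC.
  move=> eta e0; have [f [cf f01 fA]] := HA _ e0.
  exists (fun x => 1 - f x); split.
  - move=> x _; apply: for_continuousD; first exact: for_continuous_cst.
    by apply: for_continuousN; exact: cf.
  - by move=> x; have /andP[? ?] := f01 x; apply/andP; split; lra.
  rewrite (Rintegral_ext (g := fun x => `|w x * (\1_A x - f x)|))// => x _.
  rewrite -normrN -mulrN; congr (`|_ * _|).
  by rewrite !indicE in_setC; case: (x \in A) => /=; lra.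
- move=> A HA; pose B n := \bigcup_(i in [set k | (k < n)%N]) A i.
  have BS n : B n.+1 = B n `|` A n.
    apply/seteqP; split => x.
      move=> [i /=]; rewrite ltnS leq_eqVlt => /orP[/eqP->|ilt] Aix; [by right|by left; exists i].
    move=> [[i /= ilt Aix]|Anx]; [exists i => //=; exact: ltnW|exists n => //=].
  have cB n : capprox w (B n).
    elim: n => [|n IH]; last by rewrite BS; exact: capproxU.
    by rewrite (_ : B 0%N = set0)//; apply/seteqP; split => // x [i].
  have mA i : measurable (A i) by case: (HA i).
  have mU : measurable (\bigcup_k A k) by exact: bigcup_measurable.
  have mB n : measurable (B n) by case: (cB n).
  split => // eta e0; have e2 : 0 < eta / 2 by rewrite divr_gt0.
  have Iw' := rintegrable_norm mO Iw.
  have mw : measurable_fun Omega w by exact: rintegrable_measurable Iw.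
  have mI n : measurable_fun Omega (fun x => \1_(\bigcup_k A k) x - \1_(B n) x : R).
    by apply: measurable_funB; exact: measurable_indic.
  have : \forall n \near \oo,
      `|\int[leb]_(x in Omega) `|w x * (\1_(\bigcup_k A k) x - \1_(B n) x)| | <= eta / 2.
    apply: (Rintegral_eventually_small (g := fun x => `|w x|)) => //.
    - by move=> n; apply/measurableT_comp => //; exact: measurable_funM.
    - move=> x Ox; apply: cvg_near_cst.
      have [[k _ Akx]|nx] := pselect ((\bigcup_k A k) x).
        near=> n; have kn : (k < n)%N by near: n; exact: nbhs_infty_gt.
        rewrite !indicE !mem_set ?subrr ?mulr0 ?normr0//; [by exists k|by exists k].
      near=> n; rewrite !indicE !memNset ?subrr ?mulr0 ?normr0//.
      by move=> [i _ Aix]; apply: nx; exists i.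
    - move=> n x Ox; rewrite normr_id normrM ler_piMr//.
      have BU : \1_(B n) x <= (\1_(\bigcup_k A k) x : R).
        rewrite !indicE ler_nat; have [xB|//] := boolP (x \in B n).
        by rewrite mem_set//; have := set_mem xB => -[i _ Aix]; exists i.
      have /andP[? ?] := indic01 (\bigcup_k A k) x; have /andP[? ?] := indic01 (B n) x.
      by rewrite ler_norml; apply/andP; split; lra.
  move=> [n _ /(_ n (leqnn n))] Hn.
  have [f [cf f01 fA]] := (cB n).2 _ e2; exists f; split => //.
  have mf : measurable_fun Omega f by apply: measurable_funTS; exact: pcontinuous_measurableT.
  have := @Rintegral_absM_triangle w (fun x => \1_(\bigcup_k A k) x - \1_(B n) x)
    (fun x => \1_(B n) x - f x) (fun x => \1_(\bigcup_k A k) x - f x) 2 Iw (mI n)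
    (measurable_indic_sub (mB n) cf) (measurable_indic_sub mU cf).
  move=> /(_ (fun x _ => diff01 (indic01 _ x) (indic01 _ x)) (fun x _ => diff01 (indic01 _ x) (f01 x))
    (fun x _ => diff01 (indic01 _ x) (f01 x)))H2.
  apply: le_trans (H2 _) _.
    move=> x _; apply: le_trans (ler_normD _ _); rewrite le_eqVlt; apply/orP; left; apply/eqP.
    by congr (`| _ |); lra.
  rewrite [eta]splitr; apply: lerD => //; apply: le_trans Hn; exact: ler_norm.
Unshelve. all: by end_near. Qed.

Lemma capprox_half_space w (i : 'I_d) (c : R) : rintegrable leb Omega w ->
  capprox w [set x | c < x 0 i].
Proof.
move=> Iw; pose A := [set x : 'rV[R]_d | c < x 0 i].
have mA : measurable A.
  apply: open_measurable_rV; apply: (open_gt_fun (f := fun x : 'rV[R]_d => x 0 i)) => x.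
  exact: continuous_coord.
split => // eta e0; pose f n x := flat (n.+1%:R * (x 0 i - c) - 1) : R.
have cf n : pcontinuous setT (f n).
  have r1 := regcB oT (regc_coord 0 i oT) (regc_cst 0 c oT).
  exact: (regc_continuous (regc_flat oT (regcB oT (regcZ n.+1%:R oT r1) (regc_cst 0 1 oT)))).
have f01 n x : 0 <= f n x <= 1 by rewrite flat_ge0 flat_le1.
have mw : measurable_fun Omega w by exact: rintegrable_measurable Iw.
have Iw' := rintegrable_norm mO Iw.
have : \forall n \near \oo, `|\int[leb]_(x in Omega) `|w x * (\1_A x - f n x)| | <= eta.
  apply: (Rintegral_eventually_small (g := fun x => `|w x|)) => //.
  - move=> n; apply/measurableT_comp => //; apply: measurable_funM => //.
    exact: measurable_indic_sub.
  - move=> x Ox; rewrite -(normr0 R) -(mulr0 (w x)); apply: (cvg_norm (V := R)).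
    apply: cvgM; first exact: cvg_cst.
    rewrite -[X in _ --> X](subrr (\1_A x)); apply: cvgB; first exact: cvg_cst.
    rewrite indicE; have [cx|cx] := ltP c (x 0 i).
      rewrite mem_set//=; have r0 : 0 < x 0 i - c by rewrite subr_gt0.
      by apply: (@cvg_cutoff R flat 1 1 _ r0) => s s1; rewrite mul1r; apply: flat_near1; lra.
    rewrite memNset/=; last by rewrite /A /= ltNge cx.
    apply: cvg_near_cst; near=> n; rewrite /f flat_le0//.
    have : n.+1%:R * (x 0 i - c) <= 0 by rewrite pmulr_rle0// subr_le0.
    lra.
  - move=> n x Ox; rewrite normr_id normrM ler_piMr//.
    have := f01 n x; have := indic01 A x => /andP[? ?] /andP[? ?].
    by rewrite ler_norml; apply/andP; split; lra.
move=> [n _ /(_ n (leqnn n))] Hn; exists (f n); split => //.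
exact: le_trans (ler_norm _) Hn.
Unshelve. all: by end_near. Qed.

(** Half-spaces belong to the sigma-algebra [capprox w], so the identity is coordinatewise
    measurable from it to the Borel sigma-algebra; hence it contains every Borel set. *)
Lemma measurable_capprox w A : rintegrable leb Omega w -> measurable A -> capprox w A.
Proof.
move=> Iw mA.
have sa := capprox_sigma_algebra Iw.
pose T0 := g_sigma_algebraType (capprox w).
have m0 : measurable_fun [set: T0] (fun t : T0 => (t : 'rV[R]_d)).
  apply: measurable_fun_rV => i.
  apply: (measurability _ (RGenOInfty.measurableE R)).
  move=> _ [_ [c ->]] <-; apply: sub_sigma_algebra.
  rewrite setTI (_ : _ @^-1` _ = [set x : 'rV[R]_d | c < x 0 i]).
    exact: capprox_half_space.
  by apply/seteqP; split => x /=; rewrite in_itv/= andbT.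
have := m0 measurableT A mA; rewrite setTI preimage_id.
by rewrite -[X in X -> _]/(<<s capprox w >> A) sigma_algebra_id.
Qed.

(** The sign of w is 2 1_A - 1 with A the set where w >= 0; a continuous approximation f of 1_A
    gives 2 f - 1, still bounded by 1. This is how L^1 norms are recovered by duality. *)
Lemma sign_approximation w (eta : R) : rintegrable leb Omega w -> 0 < eta ->
  exists f, [/\ pcontinuous setT f, forall x, `|f x| <= 1 &
    \int[leb]_(x in Omega) `|w x| - eta <= \int[leb]_(x in Omega) (w x * f x)].
Proof.
move=> Iw e0; have mw := rintegrable_measurable Iw.
pose A := Omega `&` w @^-1` `[0, +oo[.
have mA : measurable A by exact: mw.
have e2 : 0 < eta / 2 by rewrite divr_gt0.
have [f [cf f01 fA]] := (measurable_capprox Iw mA).2 _ e2.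
have mf : measurable_fun Omega f by apply: measurable_funTS; exact: pcontinuous_measurableT.
have c2 : pcontinuous setT (fun x => 2 * f x - 1).
  move=> x _; apply: for_continuousD; last by exact: for_continuous_cst.
  by apply: for_continuousM; [exact: for_continuous_cst|exact: cf].
have b2 x : `|2 * f x - 1| <= 1.
  by have /andP[? ?] := f01 x; rewrite ler_norml; apply/andP; split; lra.
exists (fun x => 2 * f x - 1); split => //.
have m2 : measurable_fun Omega (fun x => 2 * f x - 1).
  by apply: measurable_funTS; exact: pcontinuous_measurableT.
have I1 := rintegrable_norm mO Iw.
have I2 := rintegrableMb mO Iw m2 (fun x _ => b2 x).
have I3 := rintegrable_absM Iw (measurable_indic_sub mA cf) (fun x _ => diff01 (indic01 A x) (f01 x)).
have -> : \int[leb]_(x in Omega) (w x * (2 * f x - 1)) =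
   \int[leb]_(x in Omega) `|w x| - \int[leb]_(x in Omega) (`|w x| - w x * (2 * f x - 1)).
  by rewrite RintegralB// opprB addrCA subrr addr0.
rewrite lerD2l lerN2; apply: (@le_trans _ _ (\int[leb]_(x in Omega) (2 * `|w x * (\1_A x - f x)|))).
  apply: le_Rintegral => //; [exact: rintegrableB|exact: rintegrableZ|].
  move=> x Ox; have [w0|w0] := leP 0 (w x).
    have -> : \1_A x = 1 :> R by rewrite indicE mem_set//; split => //; rewrite /= in_itv/= w0.
    have := ler_norm (w x * (1 - f x)); rewrite [`|w x|]ger0_norm//.
    by move: (`|w x * _|) => a; lra.
  have -> : \1_A x = 0 :> R.
    by rewrite indicE memNset// => -[_]; rewrite /= in_itv/= andbT leNgt w0.
  have := ler_norm (w x * (0 - f x)); rewrite [`|w x|]ltr0_norm//.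
  move: (`|w x * _|) => a; lra.
rewrite RintegralZl//; lra.
Qed.

(** The class [Q] contains multiples of indicators, by [capprox] with weight 1, and is closed under
    sums; so it contains the simple functions, which are dense. *)
Lemma continuous_dense g (eta : R) : (leb Omega < +oo)%E -> rintegrable leb Omega g ->
  0 < eta -> exists h, [/\ pcontinuous setT h, exists M : R, forall x, `|h x| <= M &
    \int[leb]_(x in Omega) `|g x - h x| <= eta].
Proof.
move=> Oo Ig e0; have I1 : rintegrable leb Omega (cst 1) by exact: rintegrable_cst.
pose Q g := measurable_fun Omega g /\ forall eta : R, 0 < eta ->
  exists h, [/\ pcontinuous setT h, exists M : R, forall x, `|h x| <= M &
    rintegrable leb Omega g /\ \int[leb]_(x in Omega) `|g x - h x| <= eta].
have cI h : pcontinuous setT h -> (exists M : R, forall x, `|h x| <= M) -> rintegrable leb Omega h.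
  move=> ch [M HM]; apply: (rintegrable_bounded mO Oo (C := M)) => //.
  by apply: measurable_funTS; exact: pcontinuous_measurableT.
have Qind A (c : R) : measurable A -> Q (fun x => c * \1_A x).
  move=> mA; have Ic : rintegrable leb Omega (fun x => c * \1_A x).
    apply: rintegrableZ => //; apply: (rintegrable_bounded mO Oo (C := 1)).
      exact: measurable_indic.
    by move=> x _; have /andP[? ?] := indic01 A x; rewrite ger0_norm.
  split; first exact: rintegrable_measurable Ic.
  move=> e {}e0; have c1 : 0 < `|c| + 1 by rewrite ltr_wpDl.
  have [f [cf f01 fA]] := (measurable_capprox I1 mA).2 (e / (`|c| + 1)) (divr_gt0 e0 c1).
  exists (fun x => c * f x); split.
  - by move=> x _; apply: for_continuousM; [exact: for_continuous_cst|exact: cf].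
  - exists `|c| => x; have /andP[? ?] := f01 x; rewrite normrM ler_piMr// ger0_norm//.
  split => //.
  rewrite (Rintegral_ext (g := fun x => `|c * (cst 1 x * (\1_A x - f x))|)); last first.
    by move=> x _; rewrite /= mul1r mulrBr.
  have I := rintegrableMb mO I1 (measurable_indic_sub mA cf) (fun x _ => diff01 (indic01 A x) (f01 x)).
  rewrite (Rintegral_absZ c mO I).
  apply: le_trans (ler_wpM2l (normr_ge0 c) fA) _; rewrite mulrCA ler_piMr ?(ltW e0)//.
  by rewrite ler_pdivrMr// mul1r lerDl.
have QD f1 f2 : Q f1 -> Q f2 -> Q (fun x => f1 x + f2 x).
  move=> [m1 Q1] [m2 Q2]; split; first exact: measurable_funD.
  move=> e {}e0; have e2 : 0 < e / 2 by rewrite divr_gt0.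
  have [h1 [c1 [M1 b1] [J1 i1]]] := Q1 _ e2; have [h2 [c2 [M2 b2] [J2 i2]]] := Q2 _ e2.
  exists (fun x => h1 x + h2 x); split.
  - by move=> x _; apply: for_continuousD; [exact: c1|exact: c2].
  - by exists (M1 + M2) => x; apply: le_trans (ler_normD _ _) _; exact: lerD.
  split; first exact: rintegrableD.
  have K1 := rintegrableB mO J1 (cI _ c1 (ex_intro _ M1 b1)).
  have K2 := rintegrableB mO J2 (cI _ c2 (ex_intro _ M2 b2)).
  have := Rintegral_absD mO K1 K2.
  rewrite (Rintegral_ext (g := fun x => `|f1 x + f2 x - (h1 x + h2 x)|)); last first.
    by move=> x _; rewrite opprD addrACA.
  by move=> /le_trans; apply; rewrite [e]splitr; exact: lerD.
have Q0 : Q (fun=> 0).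
  split; first exact: measurable_cst.
  move=> e {}e0; exists (fun=> 0); split.
  - by move=> x _; exact: for_continuous_cst.
  - by exists 0 => x; rewrite normr0.
  split; first exact: rintegrable_cst.
  rewrite (Rintegral_ext (g := fun=> 0)) ?Rintegral_cst ?mul0r ?ltW//.
  by move=> x _; rewrite subr0 normr0.
have Qs (s : {sfun 'rV[R]_d >-> R}) : Q (fun x => s x).
  have -> : (fun x => s x) = fun x => \sum_(y <- finmap.enum_fset (fset_set (range s))) (y * \1_(s @^-1` [set y]) x).
    apply/funext => x; rewrite [LHS]fimfunE fsbig_finite//.
  elim: (finmap.enum_fset _) => [|y l IH].
    by rewrite (_ : (fun x => _) = fun=> 0)//; apply/funext => x; rewrite big_nil.
  rewrite (_ : (fun x => _) = fun x => y * \1_(s @^-1` [set y]) x + \sum_(y <- l) (y * \1_(s @^-1` [set y]) x)).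
    by apply: QD => //; apply: Qind.
  by apply/funext => x; rewrite big_cons.
have [s [sI _ scv]] := approximation_sfun_integrable mO Ig.
have e2 : 0 < eta / 2 by rewrite divr_gt0.
have sIr n : rintegrable leb Omega (s n) by exact: sI.
have [n Hn] : exists n, \int[leb]_(x in Omega) `|g x - s n x| <= eta / 2.
  have /fine_cvgP[_ /cvgrPdist_le/(_ _ e2)[n _ /(_ n (leqnn n))]] := scv.
  by rewrite sub0r normrN => Hn; exists n; exact: le_trans (ler_norm _) Hn.
have [h [ch bh [_ ih]]] := (Qs (s n)).2 _ e2.
exists h; split => //.
have K1 := rintegrableB mO Ig (sIr n); have K2 := rintegrableB mO (sIr n) (cI _ ch bh).
have := Rintegral_absD mO K1 K2.
rewrite (Rintegral_ext (g := fun x => `|g x - h x|)); last by move=> x _; rewrite addrA subrK.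
by move=> /le_trans; apply; rewrite [eta]splitr; exact: lerD.
Qed.

End continuous_approximation.

Section kernel_lemmas.
Context {R : realType} {d : nat} {dZ : measure_display} {Z : measurableType dZ}.
Implicit Types (x y : 'rV[R]_d) (W : set 'rV[R]_d) (D : set Z) (p : 'rV[R]_d -> Z -> R).
Local Notation e_ i := (delta_mx 0 i : 'rV[R]_d).

Lemma kreg_regc W D k p z : kreg W D k p -> D z -> regc W k (p^~ z).
Proof.
Transparent kreg regc.
elim: k p => [|k IH] p [[cp _ _] Hp] Dz; split => //; try exact: cp.
by move=> i; have [Dp Hi] := Hp i; split; [move=> x Wx; exact: Dp|exact: IH Hi Dz].
Opaque kreg regc.
Qed.

Lemma kreg_kpartial W D k p i : kreg W D k.+1 p -> kreg W D k (kpartial i p).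
Proof.
Transparent kreg.
by move=> [_ /(_ i)[]].
Opaque kreg.
Qed.

Context (mu : {measure set Z -> \bar R}) (W : set 'rV[R]_d) (D : set Z).
Hypotheses (oW : open W) (mD : measurable D) (Doo : (mu D < +oo)%E).

Lemma partial_kint p i x : kreg W D 1 p -> W x ->
  partial i (kint mu D p) x = kint mu D (kpartial i p) x.
Proof. by move=> Kp Wx; apply/partial_is_derive/(kint_derive i oW mD Doo Kp Wx). Qed.

Lemma laplacian_kint p x : kreg W D 2 p -> W x ->
  laplacian (kint mu D p) x = \int[mu]_(z in D) laplacian (p^~ z) x.
Proof.
move=> Kp Wx; rewrite /laplacian Rintegral_sum//.
  apply: eq_bigr => i _.
  have K1 := kreg_kpartial i Kp.
  rewrite (partial_eq_on i oW Wx (fun y Wy => partial_kint i (kregW Kp) Wy) (kint_regc oW mD Doo K1)).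
  by rewrite (partial_kint i K1 Wx).
move=> i; have K2 := kreg_kpartial i (kreg_kpartial i Kp).
exact: kreg0_rintegrable mD Doo (kreg_kreg0 K2) Wx.
Qed.

End kernel_lemmas.

Section scaling.
Context {R : realType} {d : nat}.
Implicit Types (x : 'rV[R]_d) (W : set 'rV[R]_d) (f : 'rV[R]_d -> R).

Lemma partialZ W (c : R) f i x : W x -> regc W 1 f ->
  partial i (fun y => c * f y) x = c * partial i f x.
Proof. by move=> Wx rf; apply/partial_is_derive/drvZ/(regc_drv i rf Wx). Qed.

Lemma laplacianZ W (c : R) f x : open W -> W x -> regc W 2 f ->
  laplacian (fun y => c * f y) x = c * laplacian f x.
Proof.
move=> oW Wx rf; rewrite /laplacian mulr_sumr; apply: eq_bigr => i _.
have r1 := regcW rf; have ri := regc_partial i rf.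
rewrite (partial_eq_on i oW Wx (fun y Wy => partialZ c i Wy r1) (regcZ c oW ri)).
exact: partialZ Wx ri.
Qed.

End scaling.

(** * Potentials of the parametrix *)

Section parabolic_potential.
Context {R : realType} {d : nat}.
Implicit Types (x y z : 'rV[R]_d) (f g h : 'rV[R]_d -> R) (s lam eps : R).
Local Notation leb := (lebesgue_rV d : {sigma_finite_measure set 'rV[R]_d -> \bar R}).
Local Notation leb1 := (@lebesgue_measure R).
Local Notation Zt := (measurableTypeR R * 'rV[R]_d)%type.

Context (Omega : set 'rV[R]_d) (rho : 'rV[R]_d -> R) (W : set 'rV[R]_d)
  (k kt : R -> 'rV[R]_d -> 'rV[R]_d -> R) (b C : R).
Context (oO : open Omega) (bO : bounded_set Omega) (par : parametrix Omega rho W k kt b C).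

Let mO : measurable Omega. Proof. exact: open_measurable_rV. Qed.
Let Ooo : (leb Omega < +oo)%E. Proof. exact: lebesgue_rV_bounded. Qed.
Let mu := (leb1 \x leb)%E.

(** Staying away from time 0 keeps all kernels bounded. General sets are allowed because the
    potential is later split into short and long times. *)
Definition times eps (S : set (measurableTypeR R)) :=
  [/\ measurable S, 0 < eps & forall s : R, S s -> eps <= s /\ s <= 1].

(* The factor [2 s] comes from the time being [s ^+ 2]. *)
Definition weight lam f (p : Zt) : R := 2 * (p.1 : R) * expR (- (lam * (p.1 : R) ^+ 2)) * f p.2.

(** A truncated Laplace transform, in the time s^2, of the approximate heat flow applied to f: an
    approximation of a constant times (lam - Laplacian)^-1 f. *)
Definition potential lam f S : 'rV[R]_d -> R :=
  kint mu (S `*` Omega) (fun x (p : Zt) => weight lam f p * k p.1 x p.2).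

Definition admissible f := measurable_fun Omega f /\ forall y, Omega y -> `|f y| <= 1.

Section fixed.
Context (eps : R) (S : set (measurableTypeR R)) (HS : times eps S).
Context (lam : R) (lam0 : 0 <= lam) (f : 'rV[R]_d -> R) (Hf : admissible f).

Let D := S `*` Omega.
Let mS : measurable S. Proof. by case: HS. Qed.
Let eps0 : 0 < eps. Proof. by case: HS. Qed.
Let mD : measurable D. Proof. exact: measurableX. Qed.
Let oW : open W. Proof. by case: par => -[]. Qed.
Let OW : closure Omega `<=` W. Proof. by case: par => -[]. Qed.
Let b0 : 0 < b. Proof. by case: par => -[]. Qed.
Let C0 : 0 <= C. Proof. by case: par => -[]. Qed.

Lemma times_lty : (leb1 S < +oo)%E.
Proof.
apply: (@le_lt_trans _ _ (leb1 `[0, 1]%classic)).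
  apply: le_measure; rewrite ?inE//.
  move=> s Ss; have [_ e0 H] := HS; have [es s1] := H s Ss.
  by rewrite /= in_itv/= s1 andbT (le_trans (ltW e0)).
by rewrite lebesgue_measure_itv/= lte_fin ltr01 -EFinD ltry.
Qed.

Lemma product_lty : (mu D < +oo)%E.
Proof. by rewrite /mu product_measure1E// lte_mul_pinfty ?times_lty// ge0_fin_numE// times_lty. Qed.

Let Doo := product_lty.

Let D_eps (p : Zt) : D p -> eps <= (p.1 : R) /\ Omega p.2.
Proof. by move=> [Sp Op]; have [_ _ H] := HS; have [] := H _ Sp. Qed.

Let D_1 (p : Zt) : D p -> 0 < (p.1 : R) /\ (p.1 : R) <= 1.
Proof.
by move=> [Sp Op]; have [_ e0 H] := HS; have [? ?] := H _ Sp; split => //; exact: lt_le_trans e0 _.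
Qed.

Lemma measurable_snd_fun (g : 'rV[R]_d -> R) : measurable_fun Omega g ->
  measurable_fun D (fun p : Zt => g p.2).
Proof.
move=> mg; apply: (measurable_comp (F := Omega)) => //.
  by move=> _ [p [_ Op] <-].
by apply: measurable_funTS; exact: measurable_snd.
Qed.

Lemma measurable_fst_fun (g : R -> R) : continuous g -> measurable_fun D (fun p : Zt => g p.1).
Proof.
move=> cg; apply: measurable_funTS; apply: (measurableT_comp (f := g)); last exact: measurable_fst.
exact: continuous_measurable_fun.
Qed.

Lemma measurable_weight : measurable_fun D (weight lam f).
Proof.
apply: measurable_funM; last by apply: measurable_snd_fun; case: Hf.
apply: (@measurable_fst_fun (fun s => 2 * s * expR (- (lam * s ^+ 2)))) => s.
apply: for_continuousM; first by apply: for_continuousM; [exact: for_continuous_cst|exact: cvg_id].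
apply: (@for_continuous_comp R _ (fun s => - (lam * s ^+ 2)) expR); last exact: continuous_expR.
apply/for_continuousN/for_continuousM; first exact: for_continuous_cst.
exact: exprn_continuous.
Qed.

Lemma weight_le (p : Zt) : D p -> `|weight lam f p| <= 2 * (p.1 : R) /\ `|weight lam f p| <= 2.
Proof.
move=> Dp; have [p0 p1] := D_1 Dp; have [_ Op] := D_eps Dp.
have H : `|weight lam f p| <= 2 * (p.1 : R).
  have p2 : 0 <= 2 * (p.1 : R) by rewrite mulr_ge0// ltW.
  have e1 : expR (- (lam * (p.1 : R) ^+ 2)) <= 1.
    by rewrite -expR0 ler_expR oppr_le0 mulr_ge0// sqr_ge0.
  rewrite /weight normrM normrM (ger0_norm p2) (ger0_norm (expR_ge0 _)) -mulrA ler_piMr//.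
  by rewrite mulr_ile1 ?expR_ge0//; case: Hf => _; exact.
by split => //; apply: le_trans H _; rewrite ler_piMr.
Qed.

Lemma kreg_potential n : kreg W D n (fun x (p : Zt) => weight lam f p * k p.1 x p.2).
Proof.
have [_ /(_ eps D n eps0 mD D_eps)[Kk _] _ _ _] := par.
apply: (kregM oW) => //; apply: (@kreg_z R d _ _ W D n _ 2 oW measurable_weight).
by move=> p /weight_le[].
Qed.

Lemma regc_potential n : regc W n (potential lam f S).
Proof. exact: kint_regc oW mD Doo (kreg_potential n). Qed.

Let kk_regc n (p : Zt) : D p -> regc W n (k p.1 ^~ p.2).
Proof.
move=> Dp; have [_ /(_ eps D n eps0 mD D_eps)[Kk _] _ _ _] := par.
exact: (kreg_regc Kk Dp).
Qed.

Lemma partial_potential i x : W x -> partial i (potential lam f S) x =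
  \int[mu]_(p in D) (weight lam f p * partial i (k p.1 ^~ p.2) x).
Proof.
move=> Wx; rewrite (partial_kint oW mD Doo i (kreg_potential 1) Wx).
by apply: eq_Rintegral => p /set_mem Dp; rewrite /kpartial (partialZ _ i Wx (kk_regc 1 Dp)).
Qed.

Lemma laplacian_potential x : W x -> laplacian (potential lam f S) x =
  \int[mu]_(p in D) (weight lam f p * laplacian (k p.1 ^~ p.2) x).
Proof.
move=> Wx; rewrite (laplacian_kint oW mD Doo (kreg_potential 2) Wx).
by apply: eq_Rintegral => p /set_mem Dp; rewrite (laplacianZ _ oW Wx (kk_regc 2 Dp)).
Qed.

Lemma neumann_potential : neumann_test Omega (potential lam f S).
Proof.
split; first exact: regc_ce oW OW (regc_potential 2).
move=> x Bx; have [cx _] := Bx; have Wx := OW cx.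
have E i : (\row_i0 bdry_value Omega (partial i0 (potential lam f S)) x) 0 i * outer_normal Omega x 0 i =
   \int[mu]_(p in D) (weight lam f p * partial i (k p.1 ^~ p.2) x * outer_normal Omega x 0 i).
  rewrite mxE (pcontinuous_bdry_value oW Wx cx (regc_continuous (regc_partial i (regc_potential 1)))).
  rewrite partial_potential// RintegralZr//.
  have K1 := kreg_kpartial i (kreg_potential 1).
  apply: rintegrable_eq (kreg0_rintegrable mD Doo (kreg_kreg0 K1) Wx) => //.
  by move=> p Dp; rewrite /kpartial (partialZ _ i Wx (kk_regc 1 Dp)).
rewrite /dotv (eq_bigr _ (fun i _ => E i)) -Rintegral_sum//.
  rewrite -[RHS](mul0r (fine (mu D))) -(Rintegral_cst mu mD).
  apply: eq_Rintegral => p /set_mem Dp.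
  have [_ _ _ Hb _] := par; have := Hb p.1 x p.2 Bx; rewrite /dotv => H.
  have E2 := congr1 (fun t => weight lam f p * t) H; rewrite mulr0 mulr_sumr in E2.
  rewrite -[RHS]E2; apply: eq_bigr => i _.
  by rewrite mxE mulrA.
move=> i; have K1 := kreg_kpartial i (kreg_potential 1).
have I1 := kreg0_rintegrable mD Doo (kreg_kreg0 K1) Wx.
have I2 : rintegrable mu D (fun p : Zt => outer_normal Omega x 0 i * (weight lam f p * partial i (k p.1 ^~ p.2) x)).
  apply: rintegrableZ => //; apply: rintegrable_eq I1 => // p Dp.
  by rewrite /kpartial (partialZ _ i Wx (kk_regc 1 Dp)).
by apply: rintegrable_eq I2 => // p Dp; rewrite mulrC.
Qed.

Lemma measurable_gauss_fst (B : set 'rV[R]_d) x : measurable_fun (S `*` B) (fun p : Zt => gauss b (p.1 : R) (x - p.2)).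
Proof.
have minv : measurable_fun (S `*` B) (fun p : Zt => (p.1 : R)^-1).
  apply: (eq_measurable_fun (fun p : Zt => expR (- ln (p.1 : R)))).
    move=> p /set_mem[Sp _]; have [_ e0 H] := HS; have [ep _] := H _ Sp.
    by rewrite expRN lnK// posrE; exact: lt_le_trans e0 ep.
  apply: measurable_funTS; apply: (measurableT_comp (@measurable_expR R)).
  apply: (measurableT_comp (f := fun r : R => - r)); first exact: oppr_measurable.
  by apply: (measurableT_comp (@measurable_ln R)); exact: measurable_fst.
have msq : measurable_fun (S `*` B) (fun p : Zt => sqn (x - p.2)).
  apply: measurable_funTS; apply: (measurableT_comp (f := fun y => sqn (x - y))); last exact: measurable_snd.
  by apply: continuous_measurable_rV_real => y; under eq_fun do rewrite sqnB; exact: continuous_sqnB.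
apply: measurable_funM; first exact: measurable_funX.
apply: (measurableT_comp (@measurable_expR R)); apply: measurable_funM; last exact: measurable_funX.
apply: (measurableT_comp (f := fun r : R => - r)); first exact: oppr_measurable.
by apply: measurable_funM => //; exact: measurable_cst.
Qed.

(** For each time the Gaussian has mass [gauss_mass d b] over all of space, whatever the width; so
    the final bound depends on A only and not on eps, which enters merely in the crude bound that
    secures integrability. *)
Lemma space_time_bound x (F : Zt -> R) (A : R -> R) (A0 : R) : measurable_fun D F ->
  measurable_fun S A -> (forall s, S s -> 0 <= A s /\ A s <= A0) ->
  (forall p : Zt, D p -> `|F p| <= A p.1 * gauss b (p.1 : R) (x - p.2)) ->
  [/\ rintegrable mu D F, exists M : R, forall p, D p -> `|F p| <= M &
  `|\int[mu]_(p in D) F p| <= gauss_mass d b * \int[leb1]_(s in S) A s].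
Proof.
move=> mF mA HA FA.
have gle (p : Zt) : D p -> gauss b (p.1 : R) (x - p.2) <= eps^-1 ^+ d.
  move=> Dp; have [p0 _] := D_1 Dp; have [ep _] := D_eps Dp.
  have h1 : (p.1 : R)^-1 ^+ d <= eps^-1 ^+ d.
    by apply: lerXn2r; rewrite ?nnegrE ?invr_ge0 ?(ltW p0) ?(ltW eps0)// lef_pV2 ?posrE.
  have h2 : expR (- (b * sqn (x - p.2)) * (p.1 : R)^-1 ^+ 2) <= 1.
    by rewrite -expR0 ler_expR mulNr oppr_le0 mulr_ge0 ?sqr_ge0// mulr_ge0 ?sqn_ge0// ltW.
  rewrite -[leRHS]mulr1; apply: ler_pM => //; rewrite ?expR_ge0// exprn_ge0// invr_ge0 ltW//.
have FM (p : Zt) : D p -> `|F p| <= A0 * eps^-1 ^+ d.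
  move=> Dp; apply: le_trans (FA p Dp) _; have [Sp _] := Dp; have [a0 a1] := HA _ Sp.
  by apply: ler_pM => //; [apply: gauss_ge0; have [/ltW] := D_1 Dp|exact: gle].
have IF : rintegrable mu D F by exact: rintegrable_bounded mD Doo mF FM.
have IA : rintegrable leb1 S A.
  apply: (rintegrable_bounded mS times_lty (C := A0)) => // s Ss.
  by have [? ?] := HA s Ss; rewrite ger0_norm.
split => //; first by exists (A0 * eps^-1 ^+ d).
apply: (@le_trans _ _ (\int[mu]_(p in D) `|F p|)).
  exact: le_normr_Rintegral.
rewrite -lee_fin EFin_Rintegral//; last exact: rintegrable_norm.
have mg B := measurable_gauss_fst (B := B) x.
have mAp B : measurable_fun (S `*` B) (fun p : Zt => A p.1).
  case: (pselect (measurable (S `*` B))) => [mB|nB]; last by move=> /nB.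
  apply: (measurable_comp (F := S)) => //; first by move=> _ [p [Sp _] <-].
  by apply: measurable_funTS; exact: measurable_fst.
have mH B : measurable_fun (S `*` B) (fun p : Zt => A p.1 * gauss b (p.1 : R) (x - p.2)).
  exact: measurable_funM (mAp B) (mg B).
have s0 s : S s -> 0 < s by have [_ e0 H] := HS => /H[es _]; exact: lt_le_trans e0 es.
have H0 (p : Zt) : (S `*` setT) p -> 0 <= A p.1 * gauss b (p.1 : R) (x - p.2).
  by move=> [Sp _]; rewrite mulr_ge0//; [have [] := HA _ Sp|exact/gauss_ge0/ltW/s0].
have mST : measurable (S `*` [set: 'rV[R]_d]) by exact: measurableX.
apply: (@le_trans _ _ (\int[mu]_(p in D) (A p.1 * gauss b (p.1 : R) (x - p.2))%:E)%E).
  apply: ge0_le_integral => //.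
  - by apply/measurable_EFinP; apply: measurableT_comp.
  - by apply/measurable_EFinP; exact: (mH Omega).
apply: (@le_trans _ _ (\int[mu]_(p in S `*` setT) (A p.1 * gauss b (p.1 : R) (x - p.2))%:E)%E).
  apply: ge0_subset_integral => //.
  - by apply/measurable_EFinP; exact: (mH setT).
  - by move=> p [Sp Op].
have [-> _] := tonelli_set leb1 leb mS measurableT (mH setT) H0.
rewrite (_ : (\int[leb1]_(s in S) _ = \int[leb1]_(s in S) (gauss_mass d b * A s)%:E)%E); last first.
  apply: eq_integral => s /set_mem Ss; have [a0 _] := HA s Ss; have sp := s0 s Ss.
  rewrite (_ : (\int[leb]_(y in setT) _ = \int[leb]_(y in setT) ((A s)%:E * (gauss b s (y - x))%:E))%E); last first.
    by apply: eq_integral => y _; rewrite EFinM gaussB.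
  rewrite ge0_integralZl_EFin//.
  - by rewrite integral_gauss_center// mulrC EFinM.
  - by move=> y _; rewrite lee_fin gauss_ge0// ltW.
  - apply/measurable_EFinP; apply: (@continuous_measurable_rV_real _ d (fun y => gauss b s (y - x))) => y.
    by apply: (@for_continuous_shift R d (gauss b s) y (- x)); exact: for_continuous_gauss.
rewrite -EFin_Rintegral//; last exact: rintegrableZ.
by rewrite RintegralZl.
Qed.

End fixed.
End parabolic_potential.

(** * The operator Laplacian - lam applied to potentials *)

Section generator.
Context {R : realType} {d : nat}.
Implicit Types (x y z : 'rV[R]_d) (f g h : 'rV[R]_d -> R) (s lam eps : R).
Local Notation leb := (lebesgue_rV d : {sigma_finite_measure set 'rV[R]_d -> \bar R}).
Local Notation leb1 := (@lebesgue_measure R).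
Local Notation Zt := (measurableTypeR R * 'rV[R]_d)%type.

Context (Omega : set 'rV[R]_d) (rho : 'rV[R]_d -> R) (W : set 'rV[R]_d)
  (k kt : R -> 'rV[R]_d -> 'rV[R]_d -> R) (b C : R).
Context (oO : open Omega) (bO : bounded_set Omega) (par : parametrix Omega rho W k kt b C).

Let mO : measurable Omega. Proof. exact: open_measurable_rV. Qed.
Let Ooo : (leb Omega < +oo)%E. Proof. exact: lebesgue_rV_bounded. Qed.
Let mu := (leb1 \x leb)%E.
Let oW : open W. Proof. by case: par => -[]. Qed.
Let OW : Omega `<=` W. Proof. by case: par => -[_ H _ _] _ _ _ _ x /subset_closure; exact: H. Qed.
Let b0 : 0 < b. Proof. by case: par => -[]. Qed.
Let C0 : 0 <= C. Proof. by case: par => -[]. Qed.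
Let gm := gauss_mass d b.
Let gm0 : 0 < gm. Proof. exact: gauss_mass_gt0. Qed.

Lemma timesI (eps e : R) : 0 < eps -> e <= 1 ->
  times eps (`[eps, e]%classic : set (measurableTypeR R)) /\
  times eps (`[eps, e[%classic : set (measurableTypeR R)).
Proof.
move=> e0 e1; split; split => // s; rewrite /= in_itv/= => /andP[es se]; split => //.
  exact: le_trans e1.
exact: le_trans (ltW se) e1.
Qed.

Section bounds.
Context (eps : R) (S : set (measurableTypeR R)) (HS : times eps S).
Context (lam : R) (lam0 : 0 <= lam) (f : 'rV[R]_d -> R) (Hf : admissible Omega f).
Let D := S `*` Omega.
Let mS : measurable S. Proof. by case: HS. Qed.
Let mD : measurable D. Proof. exact: measurableX. Qed.
Local Notation Phi := (potential Omega k lam f S).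
Local Notation wt := (weight lam f).

Let Sp (p : Zt) : D p -> [/\ 0 < (p.1 : R), (p.1 : R) <= 1, S p.1 & Omega p.2].
Proof.
by move=> [Sp Op]; have [_ e0 H] := HS; have [? ?] := H _ Sp; split => //; exact: lt_le_trans e0 _.
Qed.

Let D_eps (p : Zt) : D p -> eps <= (p.1 : R) /\ Omega p.2.
Proof. by move=> [Sp' Op]; have [_ _ H] := HS; have [] := H _ Sp'. Qed.

Let Kw n := kreg_potential oO par HS lam0 Hf n.

Let kkr n (p : Zt) : D p -> regc W n (k p.1 ^~ p.2).
Proof.
move=> Dp; have e0 : 0 < eps by case: HS.
have [_ /(_ eps D n e0 mD D_eps)[Kk _] _ _ _] := par.
exact: (kreg_regc Kk Dp).
Qed.

(** The weight is at most 2 s <= 2 e; this makes the contribution of short times small even though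
    the Gaussian concentrates. *)
Lemma potential_le x (e : R) : Omega x -> (forall s, S s -> s <= e) ->
  `|Phi x| <= 2 * C * gm * e * fine (leb1 S).
Proof.
move=> Ox Se; have [_ _ _ _ Hb] := par.
have mF : measurable_fun D (fun p : Zt => wt p * k p.1 x p.2).
  by have [_ _ H] := kreg_kreg0 (Kw 0); exact: H (OW Ox).
(* An element of S shows that e is nonnegative; for empty S both sides are 0. *)
have [s0 [Ss0|nS]] : exists s0 : R, S s0 \/ ~ (exists s : R, S s).
- have [[s0 Ss0]|nS] := pselect (exists s : R, S s); [by exists s0; left|by exists 0; right].
- have e0 : 0 <= e.
    by apply: le_trans (Se _ Ss0); have [_ /ltW e0 H] := HS; have [? _] := H _ Ss0; exact: le_trans e0 _.
  have HA s : S s -> 0 <= (fun=> 2 * C * e : R) s /\ (fun=> 2 * C * e : R) s <= 2 * C * e.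
    by move=> _; rewrite lexx !mulr_ge0.
  have HF (p : Zt) : D p -> `|wt p * k p.1 x p.2| <= 2 * C * e * gauss b (p.1 : R) (x - p.2).
    move=> Dp; have [p0 p1 Sp1 Op] := Sp Dp; have [k1 _ _ _] := Hb _ x p.2 p0 p1 Ox Op.
    have [w1 _] := weight_le HS lam0 Hf Dp.
    rewrite normrM; apply: le_trans (ler_pM (normr_ge0 _) (normr_ge0 _) w1 k1) _.
    have g0 : 0 <= gauss b (p.1 : R) (x - p.2) by exact/gauss_ge0/ltW.
    have := ler_wpM2r (mulr_ge0 C0 g0) (Se _ Sp1); move: (gauss _ _ _) g0 => g g0; lra.
  have [_ _] := space_time_bound oO bO par HS mF (measurable_cst _) HA HF.
  move=> /le_trans; apply; rewrite Rintegral_cst//; rewrite -/gm; move: (fine _) => v; lra.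
- have S0 : S = set0 by apply/seteqP; split => // s Ss; apply: nS; exists s.
  by rewrite /potential /kint S0 set0X Rintegral_set0 normr0 measure0 mulr0.
Qed.

(** The weight 2 s cancels the 1/s from the derivative of the kernel, so the bound is uniform in
    eps. *)
Lemma partial_potential_le x i : Omega x ->
  `|partial i Phi x| <= 2 * C * gm * fine (leb1 S).
Proof.
move=> Ox; have [_ _ _ _ Hb] := par; have Wx := OW Ox.
rewrite (partial_potential oO bO par HS lam0 Hf i Wx).
have mF : measurable_fun D (fun p : Zt => wt p * partial i (k p.1 ^~ p.2) x).
  have [_ _ H] := kreg_kreg0 (kreg_kpartial i (Kw 1)).
  apply: (eq_measurable_fun _ _ (H x Wx)) => p /set_mem Dp.
  by rewrite /kpartial (partialZ _ i Wx (kkr 1 Dp)).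
have HA s : S s -> 0 <= (fun=> 2 * C : R) s /\ (fun=> 2 * C : R) s <= 2 * C.
  by move=> _; rewrite lexx !mulr_ge0.
have HF (p : Zt) : D p -> `|wt p * partial i (k p.1 ^~ p.2) x| <= 2 * C * gauss b (p.1 : R) (x - p.2).
  move=> Dp; have [p0 p1 Sp1 Op] := Sp Dp; have [_ /(_ i) k1 _ _] := Hb _ x p.2 p0 p1 Ox Op.
  have [w1 _] := weight_le HS lam0 Hf Dp.
  rewrite normrM; apply: le_trans (ler_pM (normr_ge0 _) (normr_ge0 _) w1 k1) _.
  have E : (p.1 : R) * (p.1 : R)^-1 = 1 by rewrite divff// gt_eqF.
  rewrite (_ : 2 * (p.1 : R) * (C * (p.1 : R)^-1 * _) = 2 * C * ((p.1 : R) * (p.1 : R)^-1) * gauss b (p.1 : R) (x - p.2)).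
    by rewrite E mulr1.
  by move: (gauss _ _ _) (p.1 : R)^-1 => g t; lra.
have [_ _] := space_time_bound oO bO par HS mF (measurable_cst _) HA HF.
move=> /le_trans; apply; rewrite Rintegral_cst//; rewrite -/gm; move: (fine _) => v; lra.
Qed.

(** The first integral collects the failure of k to solve the heat equation, whose 1/s is cancelled
    by the weight; the second one is an exact derivative in time and is integrated in
    [time_derivative_integral]. *)
Lemma generator_split x : Omega x ->
  [/\ laplacian Phi x - lam * Phi x =
   \int[mu]_(p in D) (wt p * (laplacian (k p.1 ^~ p.2) x - kt p.1 x p.2)) +
   \int[mu]_(p in D) (wt p * (kt p.1 x p.2 - lam * k p.1 x p.2)),
   `|\int[mu]_(p in D) (wt p * (laplacian (k p.1 ^~ p.2) x - kt p.1 x p.2))| <=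
     gm * \int[leb1]_(s in S) (2 * C * expR (- (lam * s ^+ 2))),
   measurable_fun D (fun p : Zt => wt p * (kt p.1 x p.2 - lam * k p.1 x p.2)) &
   exists M : R, forall p, D p -> `|wt p * (kt p.1 x p.2 - lam * k p.1 x p.2)| <= M].
Proof.
move=> Ox; have [_ Hm _ _ Hb] := par; have Wx := OW Ox.
have e0 : 0 < eps by case: HS.
have [_ /(_ x Wx) mkt] := Hm eps D 0%N e0 mD D_eps.
have mw : measurable_fun D (weight lam f) by apply: (measurable_weight oO) => //.
have [_ /(_ x Wx)[M1 /nbhs_singleton HM1] /(_ x Wx) mk] := kreg_kreg0 (Kw 0).
have Ik := kreg0_rintegrable mD (product_lty oO bO HS) (kreg_kreg0 (Kw 0)) Wx.
have K2 i := kreg_kreg0 (kreg_kpartial i (kreg_kpartial i (Kw 2))).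
have E2 (p : Zt) : D p -> \sum_i kpartial i (kpartial i (fun x (p : Zt) => wt p * k p.1 x p.2)) x p =
    wt p * laplacian (k p.1 ^~ p.2) x.
  by move=> Dp; rewrite -(laplacianZ (wt p) oW Wx (kkr 2 Dp)).
have Il : rintegrable mu D (fun p : Zt => wt p * laplacian (k p.1 ^~ p.2) x).
  apply: (rintegrable_eq mD E2); apply: rintegrable_sum => // i.
  exact: kreg0_rintegrable mD (product_lty oO bO HS) (K2 i) Wx.
have [M2 HM2] : exists M : R, forall p : Zt, D p -> `|wt p * laplacian (k p.1 ^~ p.2) x| <= M.
  have /choice[M HM] i : exists M : R, forall p : Zt, D p ->
      `|kpartial i (kpartial i (fun x (p : Zt) => wt p * k p.1 x p.2)) x p| <= M.
    by have [_ /(_ x Wx)[M /nbhs_singleton HM] _] := K2 i; exists M.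
  exists (\sum_i M i) => p Dp; rewrite -(E2 p Dp) (le_trans (ler_norm_sum _ _ _))//.
  by apply: ler_sum => i _; exact: HM.
have ml := rintegrable_measurable Il.
have E1 (p : Zt) : wt p * (laplacian (k p.1 ^~ p.2) x - kt p.1 x p.2) =
    wt p * laplacian (k p.1 ^~ p.2) x - wt p * kt p.1 x p.2 by rewrite mulrBr.
have m1 : measurable_fun D (fun p : Zt => wt p * (laplacian (k p.1 ^~ p.2) x - kt p.1 x p.2)).
  under eq_fun do rewrite E1; apply: measurable_funB => //; exact: measurable_funM.
have mA : measurable_fun S (fun s : R => 2 * C * expR (- (lam * s ^+ 2))).
  apply: measurable_funTS; apply: continuous_measurable_fun => s.
  apply: (@for_continuousM _ _ (fun=> 2 * C) (fun s : R => expR (- (lam * s ^+ 2)))).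
    exact: for_continuous_cst.
  apply: (@for_continuous_comp R _ (fun s => - (lam * s ^+ 2)) expR); last exact: continuous_expR.
  apply/for_continuousN/for_continuousM; first exact: for_continuous_cst.
  exact: exprn_continuous.
have HA s : S s -> 0 <= 2 * C * expR (- (lam * s ^+ 2)) /\ 2 * C * expR (- (lam * s ^+ 2)) <= 2 * C.
  move=> _; rewrite mulr_ge0 ?expR_ge0 ?mulr_ge0//; split => //.
  by rewrite ler_piMr ?mulr_ge0// -expR0 ler_expR oppr_le0 mulr_ge0// sqr_ge0.
have HF (p : Zt) : D p -> `|wt p * (laplacian (k p.1 ^~ p.2) x - kt p.1 x p.2)| <=
    2 * C * expR (- (lam * (p.1 : R) ^+ 2)) * gauss b (p.1 : R) (x - p.2).
  move=> Dp; have [p0 p1 Sp1 Op] := Sp Dp; have [_ _ k1 _] := Hb _ x p.2 p0 p1 Ox Op.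
  rewrite normrM.
  have w1 : `|wt p| <= 2 * (p.1 : R) * expR (- (lam * (p.1 : R) ^+ 2)).
    have p2 : 0 <= 2 * (p.1 : R) by rewrite mulr_ge0// ltW.
    rewrite /weight normrM normrM (ger0_norm p2) (ger0_norm (expR_ge0 _)) ler_piMr//.
      by rewrite mulr_ge0 ?expR_ge0.
    by case: Hf => _; exact.
  apply: le_trans (ler_pM (normr_ge0 _) (normr_ge0 _) w1 k1) _.
  have E : (p.1 : R) * (p.1 : R)^-1 = 1 by rewrite divff// gt_eqF.
  move: (gauss _ _ _) (expR _) => g ex.
  rewrite (_ : 2 * (p.1 : R) * ex * (C * (p.1 : R)^-1 * g) = 2 * C * ex * ((p.1 : R) * (p.1 : R)^-1) * g).
    by rewrite E mulr1.
  by move: (p.1 : R)^-1 => t; lra.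
have [I1 [M3 HM3] B1] := space_time_bound oO bO par HS m1 mA HA HF.
have E3 (p : Zt) : wt p * (kt p.1 x p.2 - lam * k p.1 x p.2) =
   wt p * laplacian (k p.1 ^~ p.2) x - wt p * (laplacian (k p.1 ^~ p.2) x - kt p.1 x p.2) -
   lam * (wt p * k p.1 x p.2).
  by move: (wt p) (laplacian _ _) (kt _ _ _) (k _ _ _) => *; lra.
have I3 := rintegrableZ lam mD Ik.
have I12 := rintegrableB mD Il I1.
split => //.
- rewrite (laplacian_potential oO bO par HS lam0 Hf Wx) /potential /kint -RintegralZl//.
  rewrite -RintegralB// -RintegralD//.
    by apply: eq_Rintegral => p _; rewrite E3; move: (wt p) (laplacian _ _) (kt _ _ _) (k _ _ _) => *; lra.
  by apply: rintegrable_eq (rintegrableB mD I12 I3) => // p _; rewrite E3.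
- under eq_fun do rewrite E3.
  apply: rintegrable_measurable; exact: (rintegrableB mD I12 I3).
- exists (M2 + M3 + lam * M1) => p Dp; rewrite E3.
  apply: le_trans (ler_normB _ _) _; apply: lerD; last first.
    by rewrite normrM (ger0_norm lam0) ler_wpM2l//; exact: HM1.
  by apply: le_trans (ler_normB _ _) _; apply: lerD; [exact: HM2|exact: HM3].
Qed.

End bounds.

(** The integrand is the derivative in s of exp(- lam s^2) k s x y. *)
Lemma time_derivative_integral lam x y (eps : R) : 0 < eps -> eps < 1 ->
  \int[leb1]_(s in `[eps, 1]) (2 * s * expR (- (lam * s ^+ 2)) * (kt s x y - lam * k s x y)) =
  expR (- lam) * k 1 x y - expR (- (lam * eps ^+ 2)) * k eps x y.
Proof.
move=> e0 e1; have [_ _ Hs _ _] := par.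
pose F s := expR (- (lam * s ^+ 2)) * k s x y.
pose f s := 2 * s * expR (- (lam * s ^+ 2)) * (kt s x y - lam * k s x y).
have ce s : {for s, continuous (fun s => expR (- (lam * s ^+ 2)))}.
  apply: (@for_continuous_comp R _ (fun s => - (lam * s ^+ 2)) expR); last exact: continuous_expR.
  apply/for_continuousN/for_continuousM; first exact: for_continuous_cst.
  exact: exprn_continuous.
have DF s : 0 < s -> is_derive s 1 F (f s).
  move=> s0; have [Dk _ _] := Hs s x y s0.
  have Ds := drvN (drvZ lam (drvM (is_derive_id s 1) (is_derive_id s 1))).
  have De := is_derive_comp_dir Ds (is_derive_expR _).
  have D := drvM De Dk.
  rewrite (_ : F = fun s => (expR \o (fun y0 : R => - (lam * (y0 * y0)))) s * k s x y); last first.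
    by apply/funext => t; rewrite /F /= expr2.
  apply: (is_derive_eq D); rewrite /f /= expr2; move: (expR _) => e; lra.
have cF s : 0 < s -> {for s, continuous F}.
  by move=> s0; have [_ ck _] := Hs s x y s0; exact: for_continuousM.
have cf s : 0 < s -> {for s, continuous f}.
  move=> s0; have [_ ck ckt] := Hs s x y s0; apply: for_continuousM.
    apply: for_continuousM => //; apply: for_continuousM; first exact: for_continuous_cst.
    exact: cvg_id.
  apply: for_continuousD => //; apply/for_continuousN/for_continuousM => //.
  exact: for_continuous_cst.
rewrite /Rintegral (@continuous_FTC2 _ f F)//.
- by rewrite /F expr1n mulr1.
- apply: continuous_in_subspaceT => s /set_mem; rewrite /= in_itv/= => /andP[es _].
  by apply: cf; exact: lt_le_trans es.
- split.
  + move=> s; rewrite in_itv/= => /andP[es _].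
    by have [] := DF s (lt_trans e0 es).
  + by apply: cvg_at_right_filter; exact: cF.
  + by apply: cvg_at_left_filter; exact: cF.
- move=> s; rewrite in_itv/= => /andP[es _]; rewrite derive1E.
  by have [_] := DF s (lt_trans e0 es).
Qed.

Definition smoothing s f x := \int[leb]_(y in Omega) (k s x y * f y).

Lemma smoothing_facts s f : 0 < s -> s <= 1 -> admissible Omega f ->
  [/\ pcontinuous W (smoothing s f),
   forall x, Omega x -> rintegrable leb Omega (fun y => k s x y * f y) &
   forall x, Omega x -> `|smoothing s f x| <= C * gm].
Proof.
move=> s0 s1 [mf f1]; have [_ Hm _ _ Hb] := par.
(* The parametrix supplies regularity over any measurable set of times bounded below, here a single
   time. *)
pose D : set Zt := [set (s : measurableTypeR R)] `*` Omega.
have mD : measurable D by apply: measurableX.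
have [Kk _] := Hm s D 0%N s0 mD (fun p Dp => conj (eq_ind_r (fun t : R => s <= t) (lexx s) (proj1 Dp)) (proj2 Dp)).
have [c1 c2 c3] := kreg_kreg0 Kk.
have kO : kreg0 W Omega (k s).
  split.
  - by move=> y Oy; exact: (c1 (s, y)).
  - move=> x Wx; have [M HM] := c2 x Wx; exists M; apply: filterS HM => w Hw y Oy.
    exact: (Hw (s, y)).
  - move=> x Wx; apply: (measurable_comp (F := D) (f := fun p : Zt => k p.1 x p.2) (g := pair (s : measurableTypeR R))) => //.
    + by move=> _ [y Oy <-].
    + exact: c3.
    + exact/measurable_funTS/measurable_pair1.
have kf : kreg0 W Omega (fun x y => k s x y * f y).
  by apply: kreg0M => //; apply: (@kreg0_z R d _ _ W Omega f 1).
split.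
- exact: kint_continuous oW mO Ooo kf.
- by move=> x Ox; exact: kreg0_rintegrable mO Ooo kf (OW Ox).
- move=> x Ox; have I1 := kreg0_rintegrable mO Ooo kf (OW Ox).
  apply: le_trans (le_normr_Rintegral mO I1) _.
  rewrite -lee_fin EFin_Rintegral//; last exact: rintegrable_norm.
  have mg : measurable_fun setT (fun y => gauss b s (y - x)).
    apply: (@continuous_measurable_rV_real _ d (fun y => gauss b s (y - x))) => y.
    by apply: (@for_continuous_shift R d (gauss b s) y (- x)); exact: for_continuous_gauss.
  have mCg : measurable_fun setT (fun y => (C * gauss b s (y - x))%:E).
    by apply/measurable_EFinP; apply: measurable_funM => //; exact: measurable_cst.
  have g0 y : 0 <= gauss b s (y - x) by exact/gauss_ge0/ltW.
  apply: (@le_trans _ _ (\int[leb]_(y in Omega) (C * gauss b s (y - x))%:E)%E).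
    apply: ge0_le_integral => //.
    - by apply/measurable_EFinP; apply: measurableT_comp => //; exact: rintegrable_measurable I1.
    - exact: measurable_funTS.
    - move=> y Oy; have [k1 _ _ _] := Hb s x y s0 s1 Ox Oy; rewrite lee_fin normrM gaussB.
      by rewrite -[leRHS]mulr1; apply: ler_pM => //; exact: f1.
  apply: (@le_trans _ _ (\int[leb]_y (C%:E * (gauss b s (y - x))%:E))%E).
    by apply: ge0_subset_integral => // y _; rewrite lee_fin mulr_ge0.
  rewrite ge0_integralZl_EFin//; first by rewrite integral_gauss_center// EFinM.
  - by move=> y _; rewrite lee_fin.
  - exact/measurable_EFinP.
Qed.

(** The first term bounds the error of the parametrix through the integral of exp(- lam s^2) over
    the line; the second is the end point s = 1 of the time integral. *)
Definition remainder_bound lam : R := gm * (2 * C * Num.sqrt (pi / lam)) + expR (- lam) * (C * gm).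

Lemma generator_estimate lam eps f x : 0 < lam -> 0 < eps -> eps < 1 -> admissible Omega f -> Omega x ->
  `|laplacian (potential Omega k lam f `[eps, 1]%classic) x -
    lam * potential Omega k lam f `[eps, 1]%classic x + expR (- (lam * eps ^+ 2)) * smoothing eps f x| <= remainder_bound lam.
Proof.
set Phi := potential _ _ _ _ _; move=> lam0 e0 e1 Hf Ox; have [HS _] := timesI e0 (lexx 1).
have [E B1 mF2 [M HM]] := generator_split HS (ltW lam0) Hf Ox.
have [_ I1 b1] := smoothing_facts ltr01 (lexx 1) Hf.
have [_ Ie be] := smoothing_facts e0 (ltW e1) Hf.
have mS : measurable (`[eps, 1]%classic : set (measurableTypeR R)) by [].
have [_ E2] := fubini_set mS mO (times_lty HS) Ooo mF2 HM.
have E3 : \int[leb]_(y in Omega) \int[leb1]_(s in `[eps, 1]%classic)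
    (weight lam f (s, y) * (kt s x y - lam * k s x y)) =
    expR (- lam) * smoothing 1 f x - expR (- (lam * eps ^+ 2)) * smoothing eps f x.
  rewrite /smoothing -RintegralZl//; last exact: I1.
  rewrite -RintegralZl//; last exact: Ie.
  rewrite -RintegralB//; [|by apply: rintegrableZ => //; exact: I1|by apply: rintegrableZ => //; exact: Ie].
  apply: eq_Rintegral => y _.
  have T := time_derivative_integral lam x y e0 e1.
  rewrite [RHS](_ : _ = (expR (- lam) * k 1 x y - expR (- (lam * eps ^+ 2)) * k eps x y) * f y); last by rewrite mulrBl !mulrA.
  rewrite -T -RintegralZr//.
    apply: eq_Rintegral => s _; rewrite /weight /=; lra.
  apply: continuous_compact_integrable; first exact: segment_compact.
  apply: continuous_in_subspaceT => s /set_mem; rewrite /= in_itv/= => /andP[es _].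
  have s0 : 0 < s by exact: lt_le_trans es.
  have [_ _ Hs _ _] := par; have [_ ck ckt] := Hs s x y s0.
  suff cc : {for s, continuous (fun s : R => 2 * s * expR (- (lam * s ^+ 2)) * (kt s x y - lam * k s x y))}.
    exact: cc.
  apply: for_continuousM.
    apply: for_continuousM; first by apply: for_continuousM; [exact: for_continuous_cst|exact: cvg_id].
    apply: (@for_continuous_comp R _ (fun s => - (lam * s ^+ 2)) expR); last exact: continuous_expR.
    apply/for_continuousN/for_continuousM; first exact: for_continuous_cst.
    exact: exprn_continuous.
  apply: for_continuousD => //; apply/for_continuousN/for_continuousM => //.
  exact: for_continuous_cst.
have -> : laplacian Phi x - lam * Phi x + expR (- (lam * eps ^+ 2)) * smoothing eps f x =
  \int[mu]_(p in `[eps, 1]%classic `*` Omega) (weight lam f p * (laplacian (k p.1 ^~ p.2) x - kt p.1 x p.2)) +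
  expR (- lam) * smoothing 1 f x.
  by rewrite E /mu E2 E3 addrA subrK.
apply: le_trans (ler_normD _ _) _; apply: lerD; last first.
  by rewrite normrM (ger0_norm (expR_ge0 _)) ler_wpM2l ?expR_ge0//; exact: b1.
apply: le_trans B1 _; rewrite ler_pM2l//.
have mE : measurable_fun setT (fun s : R => expR (- (lam * s ^+ 2))).
  apply: continuous_measurable_fun => s.
  apply: (@for_continuous_comp R _ (fun s => - (lam * s ^+ 2)) expR); last exact: continuous_expR.
  apply/for_continuousN/for_continuousM; first exact: for_continuous_cst.
  exact: exprn_continuous.
have IE : rintegrable leb1 `[eps, 1]%classic (fun s : R => expR (- (lam * s ^+ 2))).
  apply: (rintegrable_bounded mS (times_lty HS) (C := 1)); first exact: measurable_funTS.
  move=> s _; rewrite ger0_norm ?expR_ge0// -expR0 ler_expR oppr_le0 mulr_ge0 ?sqr_ge0// ltW//.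
rewrite RintegralZl// ler_wpM2l ?mulr_ge0//.
rewrite -lee_fin EFin_Rintegral// -(integral_gauss1 lam0 ltr01).
rewrite (_ : (\int[leb1]_x _ = \int[leb1]_x (expR (- (lam * x ^+ 2)))%:E)%E); last first.
  by apply: eq_integral => s _; rewrite invr1 mul1r expr1n mulr1.
apply: ge0_subset_integral => //; exact/measurable_EFinP.
Qed.

Lemma remainder_bound_small (eta : R) : 0 < eta -> exists lam : R, 0 < lam /\ remainder_bound lam <= eta.
Proof.
move=> e0; pose A := gm * C * (2 * Num.sqrt pi + 1).
have sp : 0 <= Num.sqrt pi :> R by exact: sqrtr_ge0.
have A0 : 0 <= A by rewrite !mulr_ge0 ?(ltW gm0)//; lra.
(* With lam = N^2 both terms are O(1/N), the second because exp(- N^2) <= 1/N; together they are at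
   most A / N <= eta. *)
pose N : R := A / eta + 1.
have N1 : 1 <= N by rewrite lerDr divr_ge0// ltW.
have N0 : 0 < N by exact: lt_le_trans N1.
exists (N ^+ 2); split; first by rewrite exprn_gt0.
rewrite /remainder_bound.
have -> : Num.sqrt (pi / N ^+ 2) = Num.sqrt pi * N^-1 :> R.
  rewrite sqrtrM ?pi_ge0// -exprVn sqrtr_sqr ger0_norm// invr_ge0 ltW//.
have eN : expR (- (N ^+ 2)) <= N^-1.
  rewrite expRN lef_pV2 ?posrE ?expR_gt0//.
  apply: le_trans (expR_ge1Dx _); rewrite expr2.
  by have : N * 1 <= N * N; [rewrite ler_pM2l|move=> ?; lra].
have H : expR (- N ^+ 2) * (C * gm) <= N^-1 * (C * gm).
  by rewrite ler_wpM2r// mulr_ge0// ltW.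
apply: le_trans (lerD (lexx _) H) _.
rewrite (_ : _ + _ = A / N); last by rewrite /A; move: (N^-1) (Num.sqrt _) => *; lra.
rewrite ler_pdivrMr// /N mulrDr mulr1 mulrC divfK ?gt_eqF// lerDl ltW//.
Qed.

End generator.

(** * Recovering L^1 norms from potentials *)

Section core.
Context {R : realType} {d : nat}.
Implicit Types (x y z : 'rV[R]_d) (f g h u : 'rV[R]_d -> R) (s lam eps : R).
Local Notation leb := (lebesgue_rV d : {sigma_finite_measure set 'rV[R]_d -> \bar R}).
Local Notation leb1 := (@lebesgue_measure R).

Context (Omega : set 'rV[R]_d) (rho : 'rV[R]_d -> R) (W : set 'rV[R]_d)
  (k kt : R -> 'rV[R]_d -> 'rV[R]_d -> R) (b C : R).
Context (oO : open Omega) (bO : bounded_set Omega) (par : parametrix Omega rho W k kt b C).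

Let mO : measurable Omega. Proof. exact: open_measurable_rV. Qed.
Let Ooo : (leb Omega < +oo)%E. Proof. exact: lebesgue_rV_bounded. Qed.
Let oW : open W. Proof. by case: par => -[]. Qed.
Let OW : Omega `<=` W. Proof. by case: par => -[_ H _ _] _ _ _ _ x /subset_closure; exact: H. Qed.
Let b0 : 0 < b. Proof. by case: par => -[]. Qed.
Let C0 : 0 <= C. Proof. by case: par => -[]. Qed.
Let gm := gauss_mass d b.
Let gm0 : 0 < gm. Proof. exact: gauss_mass_gt0. Qed.

(** The Gaussians are not normalised, so [smoothing] tends to kappa times the identity. *)
Definition kappa : R := gauss_mass d (1 / 4).

Lemma kappa_gt0 : 0 < kappa. Proof. by apply: gauss_mass_gt0; lra. Qed.

Lemma gauss_center_rintegrable (a s : R) x : 0 < a -> 0 < s ->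
  rintegrable leb setT (fun y => gauss a s (x - y)) /\
  \int[leb]_y gauss a s (x - y) = gauss_mass d a.
Proof.
move=> a0 s0.
have E : (\int[leb]_y (gauss a s (x - y))%:E = (gauss_mass d a)%:E)%E.
  rewrite -(integral_gauss_center x a0 s0); apply: eq_integral => y _; by rewrite gaussB.
have m : measurable_fun setT (fun y => gauss a s (x - y)).
  rewrite (_ : (fun y => _) = fun y => gauss a s (y - x)); last by apply/funext => y; rewrite gaussB.
  apply: (@continuous_measurable_rV_real _ d (fun y => gauss a s (y - x))) => y.
  by apply: (@for_continuous_shift R d (gauss a s) y (- x)); exact: for_continuous_gauss.
have I : rintegrable leb setT (fun y => gauss a s (x - y)).
  apply: rintegrable_ge0 => //; first by move=> y _; exact/gauss_ge0/ltW.
  by rewrite E ltry.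
by split => //; apply: EFin_inj; rewrite EFin_Rintegral.
Qed.

(** Replacing k by the plain Gaussian costs s^2 / rho^2. The Gaussian average of f is close to kappa
    f x by continuity inside radius r and by [gauss_tail] outside, where 16 = 2 * 8. The rate
    degenerates at the boundary, but pointwise convergence in Omega is enough. *)
Lemma smoothing_near s f x (eta r : R) : 0 < s -> s <= 1 -> admissible Omega f -> Omega x ->
  0 <= eta -> 0 < r ->
  (forall y, sqn (x - y) < r ^+ 2 -> Omega y /\ `|f y - f x| <= eta) ->
  `|smoothing Omega k s f x - kappa * f x| <=
   eta * kappa + (C * gm / rho x ^+ 2 + 16 / r ^+ 2 * gauss_mass d (1 / 8)) * s ^+ 2.
Proof.
move=> s0 s1 Hf Ox e0 r0 Hr; have [mf f1] := Hf; have [_ _ _ _ Hb] := par.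
have [_ /(_ x Ox) I1 _] := smoothing_facts oO bO par s0 s1 Hf.
have q0 : 0 < 1 / 4 :> R by lra.
have q8 : 0 < 1 / 8 :> R by lra.
have [Ig Eg] := gauss_center_rintegrable x q0 s0.
have [Ib Eb] := gauss_center_rintegrable x b0 s0.
have [I8 E8] := gauss_center_rintegrable x q8 s0.
have IgO := rintegrableS measurableT mO (@subsetT _ Omega) Ig.
have Igf := rintegrableMb mO IgO mf f1.
pose F y := if y \in Omega then gauss (1 / 4) s (x - y) * f y else 0.
have F0 y : ~ Omega y -> F y = 0 by move=> nO; rewrite /F memNset.
have FO y : Omega y -> F y = gauss (1 / 4) s (x - y) * f y by move=> Oy; rewrite /F mem_set.
have IFO : rintegrable leb Omega F by apply: rintegrable_eq Igf => // y Oy; rewrite FO.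
have [IF EF] := rintegrable_supp mO F0 IFO.
have -> : smoothing Omega k s f x - kappa * f x =
   \int[leb]_(y in Omega) ((k s x y - gauss (1 / 4) s (x - y)) * f y) +
   \int[leb]_y (F y - f x * gauss (1 / 4) s (x - y)).
  rewrite RintegralB//; last exact: rintegrableZ.
  rewrite RintegralZl// Eg -/kappa EF (_ : \int[leb]_(x in Omega) F x = \int[leb]_(y in Omega) (gauss (1 / 4) s (x - y) * f y)).
    rewrite addrA [kappa * _]mulrC; congr (_ - _).
    rewrite -RintegralD//; last first.
      by apply: rintegrable_eq (rintegrableB mO I1 Igf) => // y _; rewrite mulrBl.
    by apply: eq_Rintegral => y _; rewrite mulrBl subrK.
  by apply: eq_Rintegral => y /set_mem Oy; rewrite FO.
apply: le_trans (ler_normD _ _) _; rewrite mulrDl [leRHS]addrCA; apply: lerD.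
  have Ik : rintegrable leb Omega (fun y => (k s x y - gauss (1 / 4) s (x - y)) * f y).
    by apply: rintegrable_eq (rintegrableB mO I1 Igf) => // y _; rewrite mulrBl.
  apply: le_trans (le_normr_Rintegral mO Ik) _.
  have IbO := rintegrableS measurableT mO (@subsetT _ Omega) Ib.
  apply: (@le_trans _ _ (\int[leb]_(y in Omega) (C * s ^+ 2 / rho x ^+ 2 * gauss b s (x - y)))).
    apply: le_Rintegral => //; [exact: rintegrable_norm|exact: rintegrableZ|].
    move=> y Oy; rewrite normrM -[leRHS]mulr1; apply: ler_pM => //; last exact: f1.
    by have [] := Hb s x y s0 s1 Ox Oy.
  rewrite RintegralZl// (_ : C * gm / rho x ^+ 2 * s ^+ 2 = C * s ^+ 2 / rho x ^+ 2 * gm); last by lra.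
  apply: ler_wpM2l; first by rewrite mulr_ge0 ?invr_ge0 ?sqr_ge0// mulr_ge0 ?sqr_ge0.
  rewrite -[gm]Eb.
  rewrite -lee_fin !EFin_Rintegral//; apply: ge0_subset_integral => //.
    by apply/measurable_EFinP; exact: rintegrable_measurable Ib.
  by move=> y _; rewrite lee_fin gauss_ge0// ltW.
have IFg := rintegrableB measurableT IF (rintegrableZ (f x) measurableT Ig).
apply: le_trans (le_normr_Rintegral measurableT IFg) _.
have J1 := rintegrableZ eta measurableT Ig.
have J2 := rintegrableZ (16 / r ^+ 2 * s ^+ 2) measurableT I8.
apply: (@le_trans _ _ (\int[leb]_y (eta * gauss (1 / 4) s (x - y) +
   16 / r ^+ 2 * s ^+ 2 * gauss (1 / 8) s (x - y)))).
  apply: le_Rintegral => //; [exact: rintegrable_norm|exact: rintegrableD|].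
  move=> y _; have g0 : 0 <= gauss (1 / 4) s (x - y) by exact/gauss_ge0/ltW.
  have g8 : 0 <= gauss (1 / 8) s (x - y) by exact/gauss_ge0/ltW.
  have p1 : 0 <= eta * gauss (1 / 4) s (x - y) by rewrite mulr_ge0.
  have p2 : 0 <= 16 / r ^+ 2 * s ^+ 2 * gauss (1 / 8) s (x - y).
    by rewrite mulr_ge0// mulr_ge0 ?sqr_ge0// mulr_ge0// invr_ge0 sqr_ge0.
  have [yr|yr] := ltP (sqn (x - y)) (r ^+ 2).
    have [Oy fy] := Hr y yr; rewrite FO// mulrC -mulrBl normrM (ger0_norm g0).
    by apply: le_trans (ler_wpM2r g0 fy) _; rewrite lerDl.
  have [q4 q48 q42] := @quarters R.
  have := gauss_tail q0 s0 r0 yr; rewrite q48 q42 => GT.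
  have : `|F y - f x * gauss (1 / 4) s (x - y)| <= 2 * gauss (1 / 4) s (x - y).
    apply: le_trans (ler_normB _ _) _.
    have h1 : `|F y| <= gauss (1 / 4) s (x - y).
      rewrite /F; have [Oy|nO] := boolP (y \in Omega); last by rewrite normr0.
      by rewrite normrM (ger0_norm g0) ler_piMr// f1//; exact: set_mem.
    have h2 : `|f x * gauss (1 / 4) s (x - y)| <= gauss (1 / 4) s (x - y).
      by rewrite normrM (ger0_norm g0) ler_piMl// f1.
    lra.
  move=> /le_trans; apply; apply: (@le_trans _ _ (2 * (8 * s ^+ 2 / r ^+ 2 * gauss (1 / 8) s (x - y)))).
    by rewrite ler_wpM2l.
  rewrite (_ : 2 * _ = 16 / r ^+ 2 * s ^+ 2 * gauss (1 / 8) s (x - y)) ?lerDr//.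
  by move: (gauss _ _ _) (r ^- 2) (s ^+ 2) => *; lra.
have Z1 := RintegralZl eta measurableT Ig.
have Z2 := RintegralZl (16 / r ^+ 2 * s ^+ 2) measurableT I8.
rewrite RintegralD// Z1 Z2 Eg E8 -/kappa.
by rewrite lerD2l mulrAC.
Qed.

(** Starts at 1/2, so that all these times lie strictly between 0 and 1. *)
Definition tn n : R := n.+2%:R^-1.

Lemma tn_bounds n : 0 < tn n /\ tn n < 1.
Proof. by rewrite /tn invr_gt0 ltr0n; split => //; rewrite invf_lt1 ?ltr0n// ltr1n. Qed.

Lemma tn_cvg : tn n @[n --> \oo] --> (0 : R).
Proof.
apply/cvgrPdist_lt => e e0; near=> n; rewrite sub0r normrN.
have [t0 _] := tn_bounds n; rewrite ger0_norm ?(ltW t0)// /tn.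
rewrite invf_plt ?posrE//; have : e^-1 < n%:R by near: n; exact: nbhs_infty_gtr.
by move=> /lt_le_trans; apply; rewrite ler_nat leqW// leqW.
Unshelve. all: by end_near. Qed.

Lemma smoothing_cvg f x : admissible Omega f -> Omega x -> {for x, continuous f} ->
  smoothing Omega k (tn n) f x @[n --> \oo] --> kappa * f x.
Proof.
move=> Hf Ox cf; apply/cvgrPdist_le => e e0.
have k0 := kappa_gt0; pose eta := e / 2 / kappa.
have eta0 : 0 < eta by rewrite !divr_gt0.
have [r [r0 Hr]] : exists r : R, 0 < r /\ forall y, sqn (x - y) < r ^+ 2 -> Omega y /\ `|f y - f x| <= eta.
  have : \forall y \near x, Omega y /\ `|f y - f x| <= eta.
    have H := (cvgrPdist_le (FF := nbhs_filter x) f (f x)).1 cf _ eta0.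
    near=> y; split; first by near: y; exact: open_nbhs_nbhs.
    by rewrite distrC; near: y.
  move=> /nbhs_ballP[r /= r0 Hr]; exists r; split => // y yr; apply: Hr.
  by apply: ball_norm_lt; apply: norm_lt_sqn => //; rewrite sqnB.
pose A := C * gm / rho x ^+ 2 + 16 / r ^+ 2 * gauss_mass d (1 / 8).
have g8 : 0 < gauss_mass d (1 / 8 : R) by apply: gauss_mass_gt0; lra.
have A0 : 0 <= A.
  apply: addr_ge0; first by rewrite mulr_ge0 ?invr_ge0 ?sqr_ge0// mulr_ge0// ltW.
  by rewrite mulr_ge0 ?(ltW g8)// mulr_ge0// invr_ge0 sqr_ge0.
have A1 : 0 < A + 1 by rewrite ltr_wpDl.
have tA' : \forall n \near \oo, tn n <= e / 2 / (A + 1).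
  have H : 0 < e / 2 / (A + 1) by rewrite !divr_gt0.
  have := (cvgrPdist_le (FF := eventually_filter) tn 0).1 tn_cvg _ H; apply: filterS => n.
  by have [t0 _] := tn_bounds n; rewrite sub0r normrN ger0_norm// ltW.
near=> n; have [t0 t1] := tn_bounds n.
rewrite distrC; apply: le_trans (smoothing_near t0 (ltW t1) Hf Ox (ltW eta0) r0 Hr) _.
have E1 : eta * kappa = e / 2 by rewrite /eta divfK// gt_eqF.
have tA : tn n <= e / 2 / (A + 1) by near: n.
have t2 : tn n ^+ 2 <= tn n by rewrite expr2 ler_piMr ?(ltW t0)// ltW.
have : A * tn n ^+ 2 <= e / 2.
  apply: (@le_trans _ _ ((A + 1) * (e / 2 / (A + 1)))); last by rewrite mulrC divfK// gt_eqF.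
  by apply: ler_pM => //; [rewrite sqr_ge0|rewrite lerDl|exact: le_trans tA].
rewrite -/A E1; lra.
Unshelve. all: by end_near. Qed.

(** The integral of kappa u f is the limit of that of u times exp(- lam eps^2) [smoothing], which by
    [generator_estimate] is the hypothesis up to sign and a small multiple of the norm of u; f is
    then taken close to the sign of u. *)
Lemma core_estimate u (B lam : R) : L1 Omega u -> 0 < lam ->
  (forall eps f, 0 < eps -> eps < 1 -> pcontinuous setT f -> (forall x, `|f x| <= 1) ->
    `|\int[leb]_(x in Omega) (u x * (laplacian (potential Omega k lam f `[eps, 1]%classic) x -
       lam * potential Omega k lam f `[eps, 1]%classic x))| <= B) ->
  kappa * \int[leb]_(x in Omega) `|u x| <=
  B + @remainder_bound R d b C lam * \int[leb]_(x in Omega) `|u x|.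
Proof.
move=> Lu lam0 HB; have k0 := kappa_gt0.
pose N := \int[leb]_(x in Omega) `|u x|; rewrite -/N.
have N0 : 0 <= N by exact: Rintegral_abs_ge0.
have Iu : rintegrable leb Omega u by exact: Lu.
have mu' := rintegrable_measurable Iu.
pose om := @remainder_bound R d b C lam.
have step f : pcontinuous setT f -> (forall x, `|f x| <= 1) ->
    `|kappa * \int[leb]_(x in Omega) (u x * f x)| <= B + om * N.
  move=> cf f1; have Hf : admissible Omega f.
    by split => //; apply: measurable_funTS; exact: pcontinuous_measurableT.
  have Hn n : `|\int[leb]_(x in Omega) (u x * (expR (- (lam * tn n ^+ 2)) * smoothing Omega k (tn n) f x))| <= B + om * N.
    have [t0 t1] := tn_bounds n; have [HS _] := timesI t0 (lexx 1).
    pose Phi := potential Omega k lam f `[tn n, 1]%classic.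
    have rP := regc_potential oO bO par HS (ltW lam0) Hf 2.
    have mP : measurable_fun Omega (fun x => laplacian Phi x - lam * Phi x).
      have cP : pcontinuous W (fun x => laplacian Phi x - lam * Phi x).
        move=> x Wx; apply: for_continuousD.
          apply: continuous_rsum => i.
          exact: (regc_continuous (regc_partial i (regc_partial i rP))).
        apply/for_continuousN/for_continuousM; first exact: for_continuous_cst.
        exact: (regc_continuous rP).
      by apply: (pcontinuous_measurable oO) => x Ox; exact: cP (OW Ox).
    have [cS _ bS] := smoothing_facts oO bO par t0 (ltW t1) Hf.
    have mS : measurable_fun Omega (fun x => expR (- (lam * tn n ^+ 2)) * smoothing Omega k (tn n) f x).
      apply: measurable_funM; first exact: measurable_cst.
      by apply: (pcontinuous_measurable oO) => x Ox; exact: cS (OW Ox).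
    have est x : Omega x -> `|laplacian Phi x - lam * Phi x + expR (- (lam * tn n ^+ 2)) * smoothing Omega k (tn n) f x| <= om.
      by move=> Ox; exact: (generator_estimate oO bO par lam0 t0 t1 Hf Ox).
    have mR : measurable_fun Omega (fun x => laplacian Phi x - lam * Phi x + expR (- (lam * tn n ^+ 2)) * smoothing Omega k (tn n) f x).
      exact: measurable_funD.
    have IR := rintegrableMb mO Iu mR est.
    have e1 : expR (- (lam * tn n ^+ 2)) <= 1.
      by rewrite -expR0 ler_expR oppr_le0 mulr_ge0 ?sqr_ge0// ltW.
    have IS : rintegrable leb Omega (fun x => u x * (expR (- (lam * tn n ^+ 2)) * smoothing Omega k (tn n) f x)).
      apply: (rintegrableMb mO Iu mS (C := C * gm)) => x Ox.
      rewrite normrM (ger0_norm (expR_ge0 _)) -[leRHS]mul1r.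
      by apply: (ler_pM (expR_ge0 _) (normr_ge0 _) e1); exact: bS.
    have IP : rintegrable leb Omega (fun x => u x * (laplacian Phi x - lam * Phi x)).
      apply: rintegrable_eq (rintegrableB mO IR IS) => // x _.
      by rewrite -mulrBr addrK.
    have -> : \int[leb]_(x in Omega) (u x * (expR (- (lam * tn n ^+ 2)) * smoothing Omega k (tn n) f x)) =
      \int[leb]_(x in Omega) (u x * (laplacian Phi x - lam * Phi x + expR (- (lam * tn n ^+ 2)) * smoothing Omega k (tn n) f x)) -
      \int[leb]_(x in Omega) (u x * (laplacian Phi x - lam * Phi x)).
      rewrite -RintegralB//; apply: eq_Rintegral => x _.
      by rewrite -mulrBr [_ + _ * smoothing _ _ _ _ _]addrC addrK.
    apply: le_trans (ler_normB _ _) _; rewrite [leRHS]addrC; apply: lerD.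
      exact: Rintegral_normM.
    exact: (HB (tn n) f t0 t1 cf f1).
  have L : (fun n => \int[leb]_(x in Omega) (u x * (expR (- (lam * tn n ^+ 2)) * smoothing Omega k (tn n) f x))) @ \oo
      --> \int[leb]_(x in Omega) (u x * (kappa * f x)).
    have Iu' := rintegrableZ (C * gm) mO (rintegrable_norm mO Iu).
    apply: (proj2 (Rintegral_dominated mO _ _ _ Iu' _)).
    - move=> n; have [t0 t1] := tn_bounds n; have [cS _ _] := smoothing_facts oO bO par t0 (ltW t1) Hf.
      apply: measurable_funM => //; apply: measurable_funM; first exact: measurable_cst.
      by apply: (pcontinuous_measurable oO) => x Ox; exact: cS (OW Ox).
    - apply: measurable_funM => //; apply: measurable_funM; first exact: measurable_cst.
      by case: Hf.
    - move=> x Ox; apply: cvgM; first exact: cvg_cst.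
      rewrite -[kappa * f x]mul1r; apply: cvgM; last exact: (smoothing_cvg Hf Ox (cf x I)).
      rewrite -expR0; apply: continuous_cvg; first exact: continuous_expR.
      have tt : tn n ^+ 2 @[n --> \oo] --> (0 : R) * 0 by exact: (cvgM tn_cvg tn_cvg).
      have := cvgN (cvgM (cvg_cst lam) tt); rewrite !mulr0 oppr0; exact.
    - move=> n x Ox; have [t0 t1] := tn_bounds n; have [_ _ bS] := smoothing_facts oO bO par t0 (ltW t1) Hf.
      rewrite normrM mulrC ler_wpM2r// normrM (ger0_norm (expR_ge0 _)) -[leRHS]mul1r.
      apply: (ler_pM (expR_ge0 _) (normr_ge0 _)); last exact: bS.
      by rewrite -expR0 ler_expR oppr_le0 mulr_ge0 ?sqr_ge0// ltW.
  have Iuf : rintegrable leb Omega (fun x => u x * f x).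
    by apply: (rintegrableMb mO Iu _ (C := 1)); [case: Hf|move=> x _; exact: f1].
  rewrite -RintegralZl// (_ : \int[leb]_(x in Omega) (kappa * (u x * f x)) = \int[leb]_(x in Omega) (u x * (kappa * f x))); last first.
    by apply: eq_Rintegral => x _; rewrite mulrCA.
  apply: (cvgr_to_le (cvg_norm L)).
  by near=> n; exact: Hn.
rewrite -subr_le0; apply: (@le_small _ _ kappa); first exact: ltW.
move=> eta e0; have [f [cf f1 Hf]] := sign_approximation mO Iu e0.
have H1 := le_trans (ler_norm _) (step f cf f1).
have H2 := ler_wpM2l (ltW k0) Hf; rewrite -/N in H2.
rewrite -/om; lra.
Unshelve. all: by end_near. Qed.

End core.

(** * Compactness *)

Section pieces.
Context {R : realType} {d : nat}.
Implicit Types (x y : 'rV[R]_d) (f g u : 'rV[R]_d -> R) (A E : set 'rV[R]_d).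
Local Notation leb := (lebesgue_rV d : {sigma_finite_measure set 'rV[R]_d -> \bar R}).

Definition oscillation_le B (eta : R) g := forall x y, B x -> B y -> `|g x - g y| <= eta.

Lemma piece_estimate A u g (eta M : R) : measurable A -> rintegrable leb A u ->
  measurable_fun A g -> (forall x, A x -> `|g x| <= M) -> oscillation_le A eta g -> 0 <= M ->
  `|\int[leb]_(x in A) (u x * g x)| <=
  eta * \int[leb]_(x in A) `|u x| + M * `|\int[leb]_(x in A) u x|.
Proof.
move=> mA Iu mg gM osc M0.
have [->|/set0P[y Ay]] := eqVneq A set0.
- by rewrite !Rintegral_set0 normr0 !mulr0 addr0.
have Ig : rintegrable leb A (fun x => u x * (g x - g y)).
  apply: (rintegrableMb mA Iu (C := eta)); last by move=> x Ax; exact: osc.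
  by apply: measurable_funB => //; exact: measurable_cst.
have Iy := rintegrableZ (g y) mA Iu.
have -> : \int[leb]_(x in A) (u x * g x) =
    \int[leb]_(x in A) (u x * (g x - g y)) + g y * \int[leb]_(x in A) u x.
  have Z := RintegralZl (g y) mA Iu; rewrite -Z -RintegralD//.
  by apply: eq_Rintegral => x _; rewrite mulrBr [g y * _]mulrC subrK.
apply: le_trans (ler_normD _ _) _; apply: lerD.
  apply: Rintegral_normM => //; last by move=> x Ax; exact: osc.
  by apply: measurable_funB => //; exact: measurable_cst.
by rewrite normrM ler_wpM2r//; exact: gM.
Qed.

(** The sets E are the successive differences of the covering balls, fixed before u and g are given;
    on each of them g is nearly constant, so only the integral of u over it counts. *)
Lemma finite_pieces (s : seq 'rV[R]_d) (r : 'rV[R]_d -> R) A : measurable A ->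
  (forall x, A x -> exists2 c, c \in s & sqn (x - c) < r c ^+ 2) ->
  exists n (E : nat -> set 'rV[R]_d),
    (forall i, measurable (E i) /\ E i `<=` A) /\
    forall u g (eta M : R), rintegrable leb A u -> measurable_fun A g ->
      (forall x, A x -> `|g x| <= M) -> 0 <= M ->
      (forall c, c \in s -> oscillation_le ([set x | sqn (x - c) < r c ^+ 2] `&` A) eta g) ->
      `|\int[leb]_(x in A) (u x * g x)| <= eta * \int[leb]_(x in A) `|u x| +
        M * \sum_(i < n) `|\int[leb]_(x in E i) u x|.
Proof.
elim: s A => [|c s IH] A mA cov.
  exists 0%N, (fun=> set0); split; first by move=> i; split.
  have -> : A = set0 by apply/seteqP; split => // x /cov[].
  by move=> u g eta M *; rewrite !Rintegral_set0 big_ord0 normr0 !mulr0 addr0.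
pose B := [set x | sqn (x - c) < r c ^+ 2].
have mB : measurable B by apply: open_measurable_rV; apply: open_lt_fun; exact: continuous_sqnB.
have mAB : measurable (B `&` A) by exact: measurableI.
have mAD : measurable (A `\` B) by exact: measurableD.
have [n [E [HE Hn]]] : exists n (E : nat -> set 'rV[R]_d),
    (forall i, measurable (E i) /\ E i `<=` A `\` B) /\
    forall u g (eta M : R), rintegrable leb (A `\` B) u -> measurable_fun (A `\` B) g ->
      (forall x, (A `\` B) x -> `|g x| <= M) -> 0 <= M ->
      (forall c, c \in s -> oscillation_le ([set x | sqn (x - c) < r c ^+ 2] `&` (A `\` B)) eta g) ->
      `|\int[leb]_(x in A `\` B) (u x * g x)| <= eta * \int[leb]_(x in A `\` B) `|u x| +
        M * \sum_(i < n) `|\int[leb]_(x in E i) u x|.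
  apply: IH => // x [Ax nB]; have [c' c's xc'] := cov x Ax.
  exists c' => //; move: c's; rewrite inE => /orP[/eqP cc|//].
  by exfalso; apply: nB; rewrite /B/= -cc.
exists n.+1, (fun i => if i is i'.+1 then E i' else B `&` A); split.
  move=> [|i]; first by split => // x [].
  by have [mE EA] := HE i; split => // x /EA[].
move=> u g eta M Iu mg gM M0 osc.
have AE : A = (B `&` A) `|` (A `\` B) by rewrite setIC; exact: esym (setUIDK _ _).
have dj : [disjoint B `&` A & A `\` B].
  by apply/disj_setPS => x [[Bx _] [_ nB]]; exact: nB.
have I1 : rintegrable leb (B `&` A) u by apply: (rintegrableS mA) => // x [].
have I2 : rintegrable leb (A `\` B) u by apply: (rintegrableS mA) => // x [].
have Iug : rintegrable leb A (fun x => u x * g x) by exact: (rintegrableMb mA Iu mg gM).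
have Iau := rintegrable_norm mA Iu.
have S1 : \int[leb]_(x in A) (u x * g x) =
    \int[leb]_(x in B `&` A) (u x * g x) + \int[leb]_(x in A `\` B) (u x * g x).
  by rewrite {1}AE; apply: Rintegral_setU => //; rewrite -AE.
have S2 : \int[leb]_(x in A) `|u x| =
    \int[leb]_(x in B `&` A) `|u x| + \int[leb]_(x in A `\` B) `|u x|.
  by rewrite {1}AE; apply: Rintegral_setU => //; rewrite -AE.
have H1 : `|\int[leb]_(x in B `&` A) (u x * g x)| <=
    eta * \int[leb]_(x in B `&` A) `|u x| + M * `|\int[leb]_(x in B `&` A) u x|.
  apply: piece_estimate => //.
  - by apply: measurable_funS mg => // x [].
  - by move=> x [_ Ax]; exact: gM.
  - by apply: osc; rewrite inE eqxx.
have H2 := Hn u g eta M I2.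
have {}H2 : `|\int[leb]_(x in A `\` B) (u x * g x)| <= eta * \int[leb]_(x in A `\` B) `|u x| +
        M * \sum_(i < n) `|\int[leb]_(x in E i) u x|.
  apply: H2 => //.
  - by apply: measurable_funS mg => // x [].
  - by move=> x [Ax _]; exact: gM.
  - move=> c' c's x y [xc [Ax _]] [yc [Ay _]].
    by apply: (osc c') => //; rewrite inE c's orbT.
rewrite S1 S2 big_ord_recl/=; apply: le_trans (ler_normD _ _) _.
move: H1 H2; rewrite !mulrDr; move: (M * `|_|) (M * \sum_(_ < _) _) => a1 a2.
move: (eta * _) (eta * _) => a3 a4; clear; lra.
Qed.

End pieces.

Section compact.
Context {R : realType} {d : nat}.
Implicit Types (x y z : 'rV[R]_d) (f g h u : 'rV[R]_d -> R) (s lam eps : R).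
Local Notation leb := (lebesgue_rV d : {sigma_finite_measure set 'rV[R]_d -> \bar R}).
Local Notation leb1 := (@lebesgue_measure R).
Local Notation Zt := (measurableTypeR R * 'rV[R]_d)%type.

(* The form in which the norm of a vector field solving the Neumann problem enters. *)
Definition weak_bound (Omega : set 'rV[R]_d) u (V : R) :=
  forall phi (K : R), neumann_test Omega phi -> 0 <= K ->
    (forall i x, Omega x -> `|partial i phi x| <= K) ->
    `|\int[leb]_(x in Omega) (u x * laplacian phi x)| <= K * V.

Context (Omega : set 'rV[R]_d) (rho : 'rV[R]_d -> R) (W : set 'rV[R]_d)
  (k kt : R -> 'rV[R]_d -> 'rV[R]_d -> R) (b C : R).
Context (oO : open Omega) (bO : bounded_set Omega) (par : parametrix Omega rho W k kt b C).

Let mO : measurable Omega. Proof. exact: open_measurable_rV. Qed.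
Let Ooo : (leb Omega < +oo)%E. Proof. exact: lebesgue_rV_bounded. Qed.
Let oW : open W. Proof. by case: par => -[]. Qed.
Let cOW : closure Omega `<=` W. Proof. by case: par => -[]. Qed.
Let OW : Omega `<=` W. Proof. by move=> x /subset_closure; exact: cOW. Qed.
Let b0 : 0 < b. Proof. by case: par => -[]. Qed.
Let C0 : 0 <= C. Proof. by case: par => -[]. Qed.
Let gm := gauss_mass d b.
Let gm0 : 0 < gm. Proof. exact: gauss_mass_gt0. Qed.
Let mu := (leb1 \x leb)%E.

(** For times at least delta the derivatives of the kernel are bounded near x0, uniformly in time
    and y. With both points in the ball of radius r / 3, the ball of radius 2 r / 3 about x' stays
    in the ball of radius r. *)
Lemma kernel_lipschitz x0 (delta : R) : 0 < delta -> closure Omega x0 ->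
  exists r M : R, [/\ 0 < r, 0 <= M, ball x0 r `<=` W &
    forall s y x x', delta <= s -> s <= 1 -> Omega y -> ball x0 (r / 3) x -> ball x0 (r / 3) x' ->
      `|k s x y - k s x' y| <= M * `|x - x'|].
Proof.
move=> d0 cx0; have [HD _] := timesI d0 (lexx 1).
pose D : set Zt := `[delta, 1]%classic `*` Omega.
have D_eps (p : Zt) : D p -> delta <= (p.1 : R) /\ Omega p.2.
  by move=> [Sp Op]; have [_ _ H] := HD; have [] := H _ Sp.
have mD : measurable D by apply: measurableX => //; case: HD.
have [_ /(_ delta D 1 d0 mD D_eps)[Kk _] _ _ _] := par.
have Wx0 := cOW cx0.
have /choice[c Hc] : forall i : 'I_d, exists a : R, \forall x \near x0, forall p, D p -> `|partial i (k p.1 ^~ p.2) x| <= a.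
  by move=> i; have [_ H _] := kreg_kreg0 (kreg_kpartial i Kk); have [a Ha] := H x0 Wx0; exists a.
pose M := \sum_i `|c i|.
have M0 : 0 <= M by exact: sumr_ge0.
have HM : \forall x \near x0, forall i p, D p -> `|partial i (k p.1 ^~ p.2) x| <= M.
  have : \forall x \near x0, forall i, forall p, D p -> `|partial i (k p.1 ^~ p.2) x| <= c i.
    exact: (@filter_forall _ _ (fun i x => forall p, D p -> `|partial i (k p.1 ^~ p.2) x| <= c i) (nbhs x0) _ Hc).
  apply: filterS => x Hx i p Dp; apply: le_trans (Hx i p Dp) _.
  apply: le_trans (ler_norm _) _; rewrite /M (bigD1 i)//= lerDl; exact: sumr_ge0.
have [r /= r0 Hr] : exists2 r : R, 0 < r & ball x0 r `<=` [set x | W x /\ forall i p, D p -> `|partial i (k p.1 ^~ p.2) x| <= M].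
  have : \forall x \near x0, W x /\ forall i p, D p -> `|partial i (k p.1 ^~ p.2) x| <= M.
    by near=> x; split; near: x => //; exact: open_nbhs_nbhs.
  by move=> /nbhs_ballP[r /= r0 Hr]; exists r.
exists r, (d%:R * M); split => //; [by rewrite mulr_ge0|by move=> x /Hr[]|].
move=> s y x x' ds s1 Oy bx bx'.
have Dp : D (s, y) by split => //=; rewrite in_itv/= ds.
have r3 : r / 3 + r / 3 + r / 3 = r by move: r0 => _; lra.
have xx' : `|x - x'| < r / 3 + r / 3.
  have := ball_triangle (ball_sym bx) bx'; rewrite -ball_normE /= => H; exact: H.
have bsub z : ball x' (r / 3 + r / 3) z -> ball x0 r z.
  by move=> bz; have := ball_triangle bx' bz; rewrite addrA r3.
have Hd : `|k s (x' + (x - x')) y - k s x' y - \sum_i (x - x') 0 i * 0| <= d%:R * (`|x - x'| * M).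
  apply: (@diff_bound R d (k s ^~ y) x' (x - x') (r / 3 + r / 3) M (fun=> 0)) => //.
  - move=> i z /bsub/Hr[Wz _].
    by have [] := regc_drv i (kreg_regc Kk Dp) Wz.
  - by move=> i z /bsub/Hr[_ /(_ i _ Dp)]; rewrite subr0.
move: Hd; rewrite subrKC big1 ?subr0; last by move=> i _; rewrite mulr0.
by rewrite (_ : d%:R * (`|x - x'| * M) = d%:R * M * `|x - x'|)//; rewrite -mulrA [`|_| * M]mulrC.
Unshelve. all: by end_near. Qed.

(** The radius is independent of S, lam and f: the weight is at most 2 for all of them, so only the
    Lipschitz constant of the kernel and the measure of the parameter set enter. *)
Lemma potential_oscillation x0 (delta eta : R) : 0 < delta -> 0 < eta -> closure Omega x0 ->
  exists r : R, 0 < r /\ forall S lam f, times delta S -> 0 <= lam -> admissible Omega f ->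
    oscillation_le ([set x | sqn (x - x0) < r ^+ 2] `&` Omega) eta (potential Omega k lam f S).
Proof.
move=> d0 e0 cx0; have [r [M [r0 M0 _ Hk]]] := kernel_lipschitz d0 cx0.
have [HI _] := timesI d0 (lexx 1).
pose V := fine (mu (`[delta, 1]%classic `*` Omega)).
have V0 : 0 <= V by exact: fine_ge0.
have P0 : 0 < 4 * M * V + 1 by rewrite ltr_wpDl// mulr_ge0// mulr_ge0.
pose q := Num.min (r / 3) (eta / (4 * M * V + 1)).
have q0 : 0 < q by rewrite lt_min !divr_gt0.
exists q; split => // S lam f HS lam0 Hf x y [xq Ox] [yq Oy].
have mS : measurable S by case: HS.
have mD : measurable (S `*` Omega) by exact: measurableX.
have Doo := product_lty oO bO HS.
have Kp := kreg_potential oO par HS lam0 Hf 0.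
have I1 := kreg0_rintegrable mD Doo (kreg_kreg0 Kp) (OW Ox).
have I2 := kreg0_rintegrable mD Doo (kreg_kreg0 Kp) (OW Oy).
have bq z : sqn (z - x0) < q ^+ 2 -> ball x0 q z.
  by move=> H; apply: ball_norm_lt; apply: norm_lt_sqn => //; rewrite sqnB.
have sub3 z : ball x0 q z -> ball x0 (r / 3) z.
  by apply: le_ball; rewrite ge_min lexx.
have xy : `|x - y| <= 2 * q.
  have := ball_triangle (ball_sym (bq _ xq)) (bq _ yq); rewrite -ball_normE /= => /ltW H.
  by apply: le_trans H _; rewrite mulr2n mulrDl mul1r.
rewrite /potential /kint -RintegralB//.
apply: (@le_trans _ _ (2 * (M * (2 * q)) * fine (mu (S `*` Omega)))).
  apply: Rintegral_bound => //.
    exact: (rintegrable_measurable (rintegrableB mD I1 I2)).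
  move=> p Dp; have [_ w2] := weight_le HS lam0 Hf Dp; rewrite -mulrBr normrM.
  apply: (ler_pM (normr_ge0 _) (normr_ge0 _) w2).
  have [Sp Op] := Dp; have [_ _ /(_ _ Sp)[dp p1]] := HS.
  apply: le_trans (Hk _ _ _ _ dp p1 Op (sub3 _ (bq _ xq)) (sub3 _ (bq _ yq))) _.
  by rewrite ler_wpM2l.
have SV : fine (mu (S `*` Omega)) <= V.
  apply: fine_le; rewrite ?ge0_fin_numE//; first exact: (product_lty oO bO HI).
  apply: le_measure; rewrite ?inE//; first by apply: measurableX => //; case: HI.
  move=> p [Sp Op]; split => //=; have [_ _ /(_ _ Sp)[dp p1]] := HS.
  by rewrite in_itv/= dp.
have c0 : 0 <= 2 * (M * (2 * q)) by rewrite !mulr_ge0// ltW.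
apply: le_trans (ler_wpM2l c0 SV) _.
apply: (@le_trans _ _ ((4 * M * V + 1) * q)).
  have -> : 2 * (M * (2 * q)) * V = 4 * M * V * q by move: (q) (V) (M) => q' V' M'; lra.
  by rewrite [leRHS]mulrDl mul1r lerDl ltW.
have : q <= eta / (4 * M * V + 1) by rewrite ge_min lexx orbT.
by move=> H; apply: le_trans (ler_wpM2l (ltW P0) H) _; rewrite mulrC divfK// gt_eqF.
Qed.

(** Finitely many balls of small oscillation cover the compact closure; they, and so the sets E,
    depend only on delta and eta. *)
Lemma potential_pieces (delta eta : R) : 0 < delta -> 0 < eta ->
  exists n (E : nat -> set 'rV[R]_d),
    (forall i, measurable (E i) /\ E i `<=` Omega) /\
    forall u S lam f, L1 Omega u -> times delta S -> 0 <= lam -> admissible Omega f ->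
      `|\int[leb]_(x in Omega) (u x * potential Omega k lam f S x)| <=
      eta * \int[leb]_(x in Omega) `|u x| +
      2 * C * gm * \sum_(i < n) `|\int[leb]_(x in E i) u x|.
Proof.
move=> d0 e0.
have /choice[r Hr] : forall x0, exists r : R, closure Omega x0 ->
    0 < r /\ forall S lam f, times delta S -> 0 <= lam -> admissible Omega f ->
    oscillation_le ([set x | sqn (x - x0) < r ^+ 2] `&` Omega) eta (potential Omega k lam f S).
  move=> x0; have [cx0|nc] := pselect (closure Omega x0); last by exists 0.
  by have [r H] := potential_oscillation d0 e0 cx0; exists r.
have := compact_closure_bounded bO; rewrite compact_cover.
move=> /(_ _ (closure Omega) (fun a => [set x | sqn (x - a) < r a ^+ 2])) [].
- by move=> a ca; apply: open_lt_fun; exact: continuous_sqnB.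
- move=> a ca; exists a => //=; rewrite subrr.
  have -> : sqn (0 : 'rV[R]_d) = 0 by apply: big1 => i _; rewrite mxE mul0r.
  by rewrite exprn_gt0//; case: (Hr a ca).
move=> D DO cov; pose s : seq 'rV[R]_d := finmap.enum_fset D.
have cov' x : Omega x -> exists2 c, c \in s & sqn (x - c) < r c ^+ 2.
  by move=> /subset_closure/cov[a /= aD H]; exists a.
have [n [E [HE Hn]]] := finite_pieces mO cov'.
exists n, E; split => // u S lam f Lu HS lam0 Hf.
have rP := regc_potential oO bO par HS lam0 Hf 0.
have cP := regc_continuous rP.
have g0 : 0 <= 2 * C * gm by rewrite mulr_ge0 ?(ltW gm0)// mulr_ge0.
have Shas x : Omega x -> `|potential Omega k lam f S x| <= 2 * C * gm.
  move=> Ox; have S1 t : S t -> t <= 1 by move=> St; have [_ _ /(_ _ St)[]] := HS.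
  apply: le_trans (potential_le oO bO par HS lam0 Hf Ox S1) _.
  rewrite mulr1 ler_piMr//.
  have : (leb1 S <= leb1 `[0%R, 1%R]%classic)%E.
    apply: le_measure; rewrite ?inE//; first by case: HS.
    move=> t St; have [_ _ /(_ _ St)[dt t1]] := HS; rewrite /= in_itv/= t1 andbT.
    exact: le_trans (ltW d0) dt.
  rewrite lebesgue_measure_itv/= lte_fin ltr01 sube0 => H.
  rewrite -lee_fin fineK//; rewrite ge0_fin_numE//; exact: times_lty HS.
apply: (Hn u _ eta (2 * C * gm)) => //.
  by apply: (pcontinuous_measurable oO) => x Ox; exact: cP (OW Ox).
move=> c cs; have cc : closure Omega c by have := DO c cs; rewrite inE.
by have [_] := Hr c cc; exact.
Qed.

(** The potential is itself an admissible test function, and its gradient bound 2 C gm does not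
    depend on eps. *)
Lemma resolvent_weak_bound u (V eps lam : R) f : 0 < eps -> eps < 1 -> 0 <= lam -> admissible Omega f ->
  L1 Omega u -> 0 <= V -> weak_bound Omega u V ->
  `|\int[leb]_(x in Omega) (u x * (laplacian (potential Omega k lam f `[eps, 1]%classic) x -
       lam * potential Omega k lam f `[eps, 1]%classic x))| <=
  2 * C * gm * V + lam * `|\int[leb]_(x in Omega) (u x * potential Omega k lam f `[eps, 1]%classic x)|.
Proof.
move=> e0 e1 lam0 Hf Lu V0 wu; have [HS _] := timesI e0 (lexx 1).
have g0 : 0 <= 2 * C * gm by rewrite mulr_ge0 ?(ltW gm0)// mulr_ge0.
have m1 : 0 <= fine (leb1 `[eps, 1]%classic) <= 1.
  rewrite fine_ge0//= lebesgue_measure_itv/= lte_fin e1 /=; lra.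
have Iu : rintegrable leb Omega u by exact: Lu.
have T := neumann_potential oO bO par HS lam0 Hf.
have rP := regc_potential oO bO par HS lam0 Hf.
set Phi := potential _ _ _ _ _ in T rP *.
have bP x : Omega x -> `|Phi x| <= 2 * C * gm * 1 * fine (leb1 `[eps, 1]%classic).
  move=> Ox; apply: (potential_le oO bO par HS lam0 Hf Ox) => s.
  by rewrite /= in_itv/= => /andP[].
have mPhi : measurable_fun Omega Phi.
  by apply: (pcontinuous_measurable oO) => x Ox; exact: (regc_continuous (rP 0)) (OW Ox).
have I1 : rintegrable leb Omega (fun x => u x * Phi x) by exact: (rintegrableMb mO Iu mPhi bP).
have rL i : regc W 0 (partial i (partial i Phi)) by exact: regc_partial (regc_partial i (rP 2)).
have cL : pcontinuous W (laplacian Phi).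
  by move=> x Wx; apply: continuous_rsum => i; exact: (regc_continuous (rL i)).
have [M HM] := ce_bounded bO (pcontinuous_ce oW cOW cL).
have mL : measurable_fun Omega (laplacian Phi).
  by apply: (pcontinuous_measurable oO) => x Ox; exact: cL (OW Ox).
have I2 : rintegrable leb Omega (fun x => u x * laplacian Phi x) by exact: (rintegrableMb mO Iu mL HM).
have -> : \int[leb]_(x in Omega) (u x * (laplacian Phi x - lam * Phi x)) =
    \int[leb]_(x in Omega) (u x * laplacian Phi x) - lam * \int[leb]_(x in Omega) (u x * Phi x).
  have Z := RintegralZl lam mO I1; rewrite -Z -RintegralB//; last exact: rintegrableZ.
  by apply: eq_Rintegral => x _; rewrite mulrBr [u x * (lam * _)]mulrCA.
apply: le_trans (ler_normB _ _) _; rewrite normrM (ger0_norm lam0) lerD2r.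
apply: (wu Phi) => // i x Ox; apply: le_trans (partial_potential_le oO bO par HS lam0 Hf i Ox) _.
by case/andP: m1 => _ m1; rewrite ler_piMr.
Qed.

(** The parameters are chosen in the order lam, delta, eta: the remainder takes a quarter of kappa,
    short times and oscillation an eighth each, and the other half of kappa stays on the left. *)
Lemma compact_estimate : exists (c : R) n (E : nat -> set 'rV[R]_d),
  [/\ 0 <= c, forall i, measurable (E i) /\ E i `<=` Omega &
   forall u (V : R), L1 Omega u -> 0 <= V -> weak_bound Omega u V ->
     \int[leb]_(x in Omega) `|u x| <= c * (V + \sum_(i < n) `|\int[leb]_(x in E i) u x|)].
Proof.
have k0 := @kappa_gt0 R d; set ka := kappa in k0.
pose A := 2 * C * gm; have A0 : 0 <= A by rewrite /A mulr_ge0 ?(ltW gm0)// mulr_ge0.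
have [lam [lam0 Hlam]] := remainder_bound_small par (divr_gt0 k0 (ltr0n _ 4)).
pose delta := Num.min (1 / 2) (ka / 8 / (lam * A + 1)).
have P0 : 0 < lam * A + 1 by rewrite ltr_wpDl// mulr_ge0// ltW.
have d0 : 0 < delta by rewrite lt_min !divr_gt0.
have d1 : delta < 1 by rewrite gt_min; apply/orP; left; lra.
have d2 : lam * (A * delta * delta) <= ka / 8.
  have h : (lam * A + 1) * delta <= ka / 8.
    have : delta <= ka / 8 / (lam * A + 1) by rewrite ge_min lexx orbT.
    by move=> H; apply: le_trans (ler_wpM2l (ltW P0) H) _; rewrite mulrC divfK// gt_eqF.
  apply: le_trans h; rewrite mulrDl mul1r -[leLHS]addr0; apply: lerD; last exact: ltW.
  have h : 0 <= lam * A * delta by rewrite mulr_ge0 ?(ltW d0)// mulr_ge0// ltW.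
  by rewrite mulrA (mulrA lam A delta) ler_piMr// ltW.
pose eta := ka / 8 / lam; have e0 : 0 < eta by rewrite !divr_gt0.
have e1 : lam * eta = ka / 8 by rewrite mulrC divfK// gt_eqF.
have [n [E [HE Hn]]] := potential_pieces d0 e0.
exists (2 * (A + lam * A) / ka), n, E; split => //.
  by rewrite divr_ge0 ?(ltW k0)// mulr_ge0// addr_ge0// mulr_ge0// ltW.
move=> u V Lu V0 wu; set N := \int[leb]_(x in Omega) `|u x|; set S := \sum_(_ < _) _.
have N0 : 0 <= N by exact: Rintegral_abs_ge0.
have S0 : 0 <= S by exact: sumr_ge0.
have Iu : rintegrable leb Omega u by exact: Lu.
have core : ka * N <= A * V + lam * (A * delta * delta * N + eta * N + A * S) + @remainder_bound R d b C lam * N.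
  apply: (core_estimate oO bO par Lu lam0) => eps f eps0 eps1 cf f1.
  have Hf : admissible Omega f.
    by split => //; apply: measurable_funTS; exact: pcontinuous_measurableT.
  apply: le_trans (resolvent_weak_bound eps0 eps1 (ltW lam0) Hf Lu V0 wu) _.
  rewrite lerD2l ler_pM2l//.
  (* Short times are [eps, m[ and long times [m, 1]; the maximum covers the case eps >= delta, in
     which there are no short times. *)
  pose m := Num.max eps delta.
  have m0 : 0 < m by rewrite lt_max eps0.
  have m1 : m <= 1 by rewrite ge_max (ltW eps1) ltW.
  have [_ H1] := timesI eps0 m1.
  have [H2 _] := timesI m0 (lexx 1).
  have H2' : times delta (`[m, 1]%classic : set (measurableTypeR R)).
    have [? _ Hm] := H2; split => // s /Hm[ms s1]; split => //; apply: le_trans ms.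
    by rewrite le_max lexx orbT.
  have [HS _] := timesI eps0 (lexx 1).
  have split_ x : Omega x -> potential Omega k lam f `[eps, 1]%classic x =
      potential Omega k lam f `[eps, m[%classic x + potential Omega k lam f `[m, 1]%classic x.
    move=> Ox; rewrite /potential /kint.
    have Kp := kreg_potential oO par HS (ltW lam0) Hf 0.
    have I0 := kreg0_rintegrable (measurableX _ mO) (product_lty oO bO HS) (kreg_kreg0 Kp) (OW Ox).
    have SE : `[eps, 1]%classic `*` Omega = (`[eps, m[%classic `*` Omega) `|` (`[m, 1]%classic `*` Omega).
      apply/seteqP; split => [p [Sp Op]|p [[Sp Op]|[Sp Op]]].
      - have [pm|pm] := ltP (p.1 : R) m; [left|right]; split => //=; move: Sp; rewrite /= !in_itv/= => /andP[? ?]; exact/andP.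
      - split => //; move: Sp; rewrite /= !in_itv/= => /andP[-> pm] /=.
        by apply: ltW; apply: lt_le_trans pm _; rewrite ge_max (ltW eps1) (ltW d1).
      - split => //; move: Sp; rewrite /= !in_itv/= => /andP[mp ->]; rewrite andbT.
        by apply: le_trans mp; rewrite le_max lexx.
    rewrite {1}SE; apply: Rintegral_setU => //.
    - by apply: measurableX => //; case: H1.
    - by apply: measurableX => //; case: H2.
    - by rewrite -SE; apply: I0; case: HS.
    - apply/disj_setPS => p [[Sp _] [Sp' _]]; move: Sp Sp'; rewrite /= !in_itv/= => /andP[_ pm] /andP[mp _].
      by have := le_lt_trans mp pm; rewrite ltxx.
  have mPot eps' S' : times eps' S' -> measurable_fun Omega (potential Omega k lam f S').
    move=> HS'; have rP := regc_potential oO bO par HS' (ltW lam0) Hf 0.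
    by apply: (pcontinuous_measurable oO) => x Ox; exact: (regc_continuous rP) (OW Ox).
  have B1 x : Omega x -> `|potential Omega k lam f `[eps, m[%classic x| <= A * delta * delta.
    move=> Ox.
    have se s : `[eps, m[%classic s -> s <= delta.
      rewrite /= in_itv/= => /andP[es]; rewrite lt_max => /orP[se|/ltW//].
      by have := le_lt_trans es se; rewrite ltxx.
    apply: le_trans (potential_le oO bO par H1 (ltW lam0) Hf Ox se) _.
    apply: ler_wpM2l; first by rewrite mulr_ge0 ?(ltW d0).
    rewrite lebesgue_measure_itv/= lte_fin; case: ltP => _ /=; last exact: ltW.
    rewrite /m lerBlDr; have [H|H] := leP eps delta.
      by rewrite lerDl ltW.
    by rewrite lerDr ltW.
  have B2 x : Omega x -> `|potential Omega k lam f `[m, 1]%classic x| <= A.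
    move=> Ox; have se s : `[m, 1]%classic s -> s <= 1 by rewrite /= in_itv/= => /andP[].
    apply: le_trans (potential_le oO bO par H2 (ltW lam0) Hf Ox se) _.
    rewrite -/gm -/A mulr1 ler_piMr// lebesgue_measure_itv/= lte_fin; case: ltP => _ //=.
    by rewrite lerBlDr lerDl ltW.
  have J1 := rintegrableMb mO Iu (mPot _ _ H1) B1.
  have J2 := rintegrableMb mO Iu (mPot _ _ H2) B2.
  have -> : \int[leb]_(x in Omega) (u x * potential Omega k lam f `[eps, 1]%classic x) =
     \int[leb]_(x in Omega) (u x * potential Omega k lam f `[eps, m[%classic x) +
     \int[leb]_(x in Omega) (u x * potential Omega k lam f `[m, 1]%classic x).
    by rewrite -RintegralD//; apply: eq_Rintegral => x /set_mem Ox; rewrite split_// mulrDr.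
  apply: le_trans (ler_normD _ _) _; rewrite -addrA; apply: lerD.
    exact: (Rintegral_normM mO Iu (mPot _ _ H1) B1).
  exact: (Hn u _ lam f Lu H2' (ltW lam0) Hf).
have {core}core : ka * N <= A * V + (ka / 8 * N + ka / 8 * N + lam * A * S) + ka / 4 * N.
  apply: le_trans core _; apply: lerD; last by rewrite ler_wpM2r.
  rewrite lerD2l !mulrDr; apply: lerD; last by rewrite mulrA.
  by apply: lerD; [rewrite mulrA ler_wpM2r|rewrite mulrA e1].
have N2 : ka / 2 * N <= A * V + lam * A * S.
  by move: core; move: (lam * A * S) (A * V) => a1 a2; lra.
have N3 : A * V + lam * A * S <= (A + lam * A) * (V + S).
  rewrite mulrDl !mulrDr; apply: lerD; first by rewrite lerDl mulr_ge0.
  by rewrite lerDr mulr_ge0// mulr_ge0// ltW.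
rewrite (_ : 2 * (A + lam * A) / ka * (V + S) = (A + lam * A) * (V + S) * 2 / ka); last first.
  by move: (A + _) (V + _) (ka^-1) => *; lra.
rewrite ler_pdivlMr//.
by move: N2 N3; move: (A * V + _) ((A + _) * _) => a1 a2; lra.
Qed.

End compact.

(** * Neumann series for the resolvent *)

Section resolvent.
Context {R : realType} {d : nat}.
Implicit Types (x y z : 'rV[R]_d) (f g h u : 'rV[R]_d -> R) (s eps : R).
Local Notation leb := (lebesgue_rV d : {sigma_finite_measure set 'rV[R]_d -> \bar R}).

Context (Omega : set 'rV[R]_d) (rho : 'rV[R]_d -> R) (W : set 'rV[R]_d)
  (k kt : R -> 'rV[R]_d -> 'rV[R]_d -> R) (b C : R).
Context (oO : open Omega) (bO : bounded_set Omega) (par : parametrix Omega rho W k kt b C).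

Let mO : measurable Omega. Proof. exact: open_measurable_rV. Qed.
Let Ooo : (leb Omega < +oo)%E. Proof. exact: lebesgue_rV_bounded. Qed.
Let oW : open W. Proof. by case: par => -[]. Qed.
Let cOW : closure Omega `<=` W. Proof. by case: par => -[]. Qed.
Let OW : Omega `<=` W. Proof. by move=> x /subset_closure; exact: cOW. Qed.
Let b0 : 0 < b. Proof. by case: par => -[]. Qed.
Let C0 : 0 <= C. Proof. by case: par => -[]. Qed.
Let gm := gauss_mass d b.
Let gm0 : 0 < gm. Proof. exact: gauss_mass_gt0. Qed.
Let ka := @kappa R d.
Let ka0 : 0 < ka. Proof. exact: kappa_gt0. Qed.

Let Rint0 : \int[leb]_(x in Omega) (0 : R) = 0. Proof. by rewrite Rintegral_cst// mul0r. Qed.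

(** Regularity on the neighbourhood W of the closure makes boundary values genuine values, so that
    linear combinations and products are easily differentiated up to the boundary. *)
Definition smooth_neumann f := (forall n, regc W n f) /\
  forall x, bdry Omega x -> dotv (\row_i partial i f x) (outer_normal Omega x) = 0.

Lemma smooth_neumann_test f : smooth_neumann f -> neumann_test Omega f.
Proof.
move=> [rf Nf]; split; first exact: regc_ce oW cOW (rf 2).
move=> x Bx; rewrite -[RHS](Nf x Bx); congr dotv; apply/rowP => i; rewrite !mxE.
have [cx _] := Bx.
exact: pcontinuous_bdry_value oW (cOW cx) cx (regc_continuous (regc_partial i (rf 1))).
Qed.

Lemma smooth_neumann0 : smooth_neumann (fun=> 0).
Proof.
split=> [n|x _]; first exact: regc_cst.
by rewrite /dotv big1// => i _; rewrite mxE partial_cst mul0r.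
Qed.

Lemma smooth_neumannDZ f g (c : R) : smooth_neumann f -> smooth_neumann g ->
  smooth_neumann (fun x => f x + c * g x).
Proof.
move=> [rf Nf] [rg Ng]; split=> [n|x Bx]; first exact: (regcD oW (rf n) (regcZ c oW (rg n))).
have [cx _] := Bx; have Wx := cOW cx.
have -> : dotv (\row_i partial i (fun y => f y + c * g y) x) (outer_normal Omega x) =
   dotv (\row_i partial i f x) (outer_normal Omega x) + c * dotv (\row_i partial i g x) (outer_normal Omega x).
  rewrite /dotv mulr_sumr -big_split/=; apply: eq_bigr => i _; rewrite !mxE.
  rewrite (partialD i Wx (rf 1) (regcZ c oW (rg 1))) (partialZ c i Wx (rg 1)).
  by rewrite mulrDl mulrA.
by rewrite Nf// Ng// mulr0 addr0.
Qed.

Lemma smooth_neumann_potential eps S (lam : R) f : times eps S -> 0 <= lam -> admissible Omega f ->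
  smooth_neumann (potential Omega k lam f S).
Proof.
move=> HS lam0 Hf; have rP := regc_potential oO bO par HS lam0 Hf; split => // x Bx.
have [_ /(_ x Bx) <-] := neumann_potential oO bO par HS lam0 Hf.
congr dotv; apply/rowP => i; rewrite !mxE; have [cx _] := Bx; apply: esym.
exact: pcontinuous_bdry_value oW (cOW cx) cx (regc_continuous (regc_partial i (rP 1))).
Qed.

Definition resolvent_op (lam : R) f x := laplacian f x - lam * f x.

Lemma laplacian_pcontinuous f : regc W 2 f -> pcontinuous W (laplacian f).
Proof.
move=> rf x Wx; apply: continuous_rsum => i.
exact: (regc_continuous (regc_partial i (regc_partial i rf))).
Qed.

Lemma resolvent_op_pcontinuous lam f : regc W 2 f -> pcontinuous W (resolvent_op lam f).
Proof.
move=> rf x Wx; apply: for_continuousD; first exact: laplacian_pcontinuous.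
by apply/for_continuousN/for_continuousM; [exact: for_continuous_cst|exact: (regc_continuous rf)].
Qed.

Lemma pcontinuous_closure_facts f : pcontinuous W f ->
  [/\ measurable_fun Omega f, rintegrable leb Omega f & exists M, forall x, Omega x -> `|f x| <= M].
Proof.
move=> cf; have [M HM] := ce_bounded bO (pcontinuous_ce oW cOW cf).
have mf : measurable_fun Omega f.
  by apply: (pcontinuous_measurable oO) => x Ox; exact: cf (OW Ox).
by split => //; [exact: rintegrable_bounded mO Ooo mf HM|exists M].
Qed.

Lemma resolvent_opDZ lam f g (c : R) x : W x -> regc W 2 f -> regc W 2 g ->
  resolvent_op lam (fun y => f y + c * g y) x = resolvent_op lam f x + c * resolvent_op lam g x.
Proof.
move=> Wx rf rg; rewrite /resolvent_op (laplacianD oW Wx rf (regcZ c oW rg)) (laplacianZ c oW Wx rg).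
by move: (laplacian f x) (laplacian g x) => l1 l2; lra.
Qed.

Context (lam : R) (lam0 : 0 < lam) (Hlam : @remainder_bound R d b C lam <= ka / 2).

(** One step of the series: the potential of h / M solves the equation up to the remainder, which
    [remainder_bound lam <= ka / 2] halves, and up to the difference between h and its smoothing,
    which is small only in L^1. *)
Lemma resolvent_step h (M eta : R) : pcontinuous Omega h -> 0 < M ->
  (forall x, Omega x -> `|h x| <= M) -> 0 < eta ->
  exists phi r, [/\ smooth_neumann phi, pcontinuous Omega r,
    forall x, Omega x -> `|r x| <= M / 2 &
    \int[leb]_(x in Omega) `|h x - resolvent_op lam phi x - r x| <= eta].
Proof.
move=> ch M0 hM e0; pose f x := M^-1 * h x.
have mh : measurable_fun Omega h by exact: pcontinuous_measurable.
have Hf : admissible Omega f.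
  split; first by apply: measurable_funM => //; exact: measurable_cst.
  move=> x Ox; rewrite normrM gtr0_norm ?invr_gt0// mulrC ler_pdivrMr// mul1r; exact: hM.
have fc x : Omega x -> {for x, continuous f}.
  by move=> Ox; apply: for_continuousM; [exact: for_continuous_cst|exact: ch].
(* Undoes both the normalisation of f and the factor kappa in the limit of the smoothing. *)
pose c := M / ka; have c0 : 0 < c by rewrite divr_gt0.
pose E n := expR (- (lam * tn n ^+ 2)) : R.
have E01 n : 0 <= E n <= 1.
  by rewrite expR_ge0/= -expR0 ler_expR oppr_le0 mulr_ge0 ?sqr_ge0// ltW.
pose D n x := h x - c * (E n * smoothing Omega k (tn n) f x).
have HS n : times (tn n) (`[tn n, 1]%classic : set (measurableTypeR R)).
  by have [t0 _] := @tn_bounds R n; have [] := timesI t0 (lexx 1).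
have Sf n : [/\ pcontinuous W (smoothing Omega k (tn n) f),
   forall x, Omega x -> rintegrable leb Omega (fun y => k (tn n) x y * f y) &
   forall x, Omega x -> `|smoothing Omega k (tn n) f x| <= C * gauss_mass d b].
  by have [t0 t1] := @tn_bounds R n; exact: (smoothing_facts oO bO par t0 (ltW t1) Hf).
have cDn n : pcontinuous Omega (D n).
  move=> x Ox; apply: for_continuousD; first exact: ch.
  have [cS _ _] := Sf n; apply/for_continuousN/for_continuousM; first exact: for_continuous_cst.
  by apply: for_continuousM; [exact: for_continuous_cst|exact: cS (OW Ox)].
have bD n x : Omega x -> `|D n x| <= M + c * (C * gm).
  move=> Ox; apply: le_trans (ler_normB _ _) _; apply: lerD; first exact: hM.
  rewrite normrM (gtr0_norm c0) ler_wpM2l ?(ltW c0)// normrM -[leRHS]mul1r.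
  have /andP[E0 E1] := E01 n; rewrite (ger0_norm E0).
  by apply: (ler_pM E0 (normr_ge0 _) E1); have [_ _] := Sf n; exact.
have L : (fun n => \int[leb]_(x in Omega) `|D n x|) @ \oo --> \int[leb]_(x in Omega) (0 : R).
  have Ic : rintegrable leb Omega (fun=> M + c * (C * gm)) by exact: rintegrable_cst.
  apply: (proj2 (Rintegral_dominated mO _ _ _ Ic _)).
  - move=> n; apply: measurableT_comp; first exact: normr_measurable.
    exact: pcontinuous_measurable.
  - exact: measurable_cst.
  - move=> x Ox; rewrite -[X in _ --> X](@normr0 _ R); apply: cvg_norm.
    have -> : (0 : R) = h x - c * (1 * (ka * f x)).
      by rewrite mul1r /c /f mulrA divfK ?gt_eqF// mulrA divff ?gt_eqF// mul1r subrr.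
    apply: cvgB; first exact: cvg_cst.
    apply: cvgM; first exact: cvg_cst.
    apply: cvgM; last exact: (smoothing_cvg oO bO par Hf Ox (fc x Ox)).
    rewrite -expR0; apply: continuous_cvg; first exact: continuous_expR.
    have tt : (tn n ^+ 2 : R) @[n --> \oo] --> (0 : R) * 0 by exact: (cvgM (@tn_cvg R) (@tn_cvg R)).
    have := cvgN (cvgM (cvg_cst lam) tt); rewrite !mulr0 oppr0; exact.
  - by move=> n x Ox; rewrite normr_id; exact: bD.
have [n Hn] : exists n, \int[leb]_(x in Omega) `|D n x| <= eta.
  rewrite Rint0 in L.
  have [N _ HN] := (cvgrPdist_le (FF := eventually_filter) _ 0).1 L _ e0.
  exists N; have := HN N (leqnn N); rewrite /= sub0r normrN ger0_norm//.
  exact: Rintegral_abs_ge0.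
have [t0 t1] := @tn_bounds R n.
pose Phi := potential Omega k lam f `[tn n, 1]%classic.
have nP : smooth_neumann Phi by exact: (smooth_neumann_potential (HS n) (ltW lam0) Hf).
have [rP _] := nP.
pose q x := resolvent_op lam Phi x + E n * smoothing Omega k (tn n) f x.
have cq : pcontinuous Omega q.
  move=> x Ox; apply: for_continuousD; first exact: resolvent_op_pcontinuous (rP 2) _ (OW Ox).
  by have [cS _ _] := Sf n; apply: for_continuousM; [exact: for_continuous_cst|exact: cS (OW Ox)].
exists (fun x => 0 + (- c) * Phi x), (fun x => c * q x); split.
- exact: smooth_neumannDZ smooth_neumann0 nP.
- by move=> x Ox; apply: for_continuousM; [exact: for_continuous_cst|exact: cq].
- move=> x Ox; rewrite normrM (gtr0_norm c0).
  have H : `|q x| <= ka / 2.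
    by apply: le_trans Hlam; exact: (generator_estimate oO bO par lam0 t0 t1 Hf Ox).
  apply: le_trans (ler_wpM2l (ltW c0) H) _; rewrite /c mulrA divfK ?gt_eqF//.
- rewrite (_ : \int[leb]_(x in Omega) _ = \int[leb]_(x in Omega) `|D n x|)//.
  apply: eq_Rintegral => x /set_mem Ox; congr (`|_|).
  rewrite (resolvent_opDZ lam (- c) (OW Ox) (regc_cst 2 0 oW) (rP 2)).
  have -> : resolvent_op lam (fun=> 0) x = 0 by rewrite /resolvent_op laplacian_cst mulr0 subrr.
  rewrite /D /q; move: (resolvent_op _ _ _) (E n * _) => a1 a2; rewrite mulrDr; lra.
Qed.

(** The step is applied again to the remainder: the sup bound halves each time, and half of the
    allowed L^1 error is reserved for each stage. *)
Lemma resolvent_iter m h (M eta : R) : pcontinuous Omega h -> 0 < M ->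
  (forall x, Omega x -> `|h x| <= M) -> 0 < eta ->
  exists phi r, [/\ smooth_neumann phi, pcontinuous Omega r,
    forall x, Omega x -> `|r x| <= M / 2 ^+ m &
    \int[leb]_(x in Omega) `|h x - resolvent_op lam phi x - r x| <= eta].
Proof.
elim: m M h eta => [|m IH] M h eta ch M0 hM e0.
  exists (fun=> 0), h; split => //; [exact: smooth_neumann0|by move=> x Ox; rewrite expr0 divr1; exact: hM|].
  rewrite (_ : \int[leb]_(x in Omega) _ = 0) ?ltW// -[RHS]Rint0.
  apply: eq_Rintegral => x _.
  by rewrite /resolvent_op laplacian_cst mulr0 !subr0 subrr normr0.
have e20 : 0 < eta / 2 by rewrite divr_gt0.
have [phi [r [nphi cr rM Hr]]] := resolvent_step ch M0 hM e20.
have M20 : 0 < M / 2 by rewrite divr_gt0.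
have [psi [r' [npsi cr' rM' Hr']]] := IH (M / 2) r (eta / 2) cr M20 rM e20.
have [rphi _] := nphi; have [rpsi _] := npsi.
exists (fun x => phi x + 1 * psi x), r'; split => //; first exact: smooth_neumannDZ.
  by move=> x /rM'; rewrite exprS invfM mulrA.
have bnd g (K : R) : pcontinuous Omega g -> (forall x, Omega x -> `|g x| <= K) -> rintegrable leb Omega g.
  by move=> cg; apply: rintegrable_bounded => //; exact: pcontinuous_measurable.
have [_ I1 _] := pcontinuous_closure_facts (resolvent_op_pcontinuous (lam:=lam) (rphi 2)).
have [_ I2 _] := pcontinuous_closure_facts (resolvent_op_pcontinuous (lam:=lam) (rpsi 2)).
have Ih := bnd _ _ ch hM; have Ir := bnd _ _ cr rM; have Ir' := bnd _ _ cr' rM'.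
have J1 := rintegrableB mO (rintegrableB mO Ih I1) Ir.
have J2 := rintegrableB mO (rintegrableB mO Ir I2) Ir'.
have := Rintegral_absD mO J1 J2.
rewrite (_ : \int[leb]_(x in Omega) `|h x - resolvent_op lam phi x - r x + _| =
  \int[leb]_(x in Omega) `|h x - resolvent_op lam (fun x => phi x + 1 * psi x) x - r' x|); last first.
  apply: eq_Rintegral => x /set_mem Ox; congr (`|_|).
  rewrite (resolvent_opDZ lam 1 (OW Ox) (rphi 2) (rpsi 2)).
  by move: (resolvent_op lam phi x) (resolvent_op lam psi x) => a1 a2; lra.
by move: Hr Hr'; move: (\int[leb]_(x in Omega) _) (\int[leb]_(x in Omega) _) (\int[leb]_(x in Omega) _) => a1 a2 a3; lra.
Qed.

Lemma resolvent_range g (eta : R) : L1 Omega g -> 0 < eta ->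
  exists phi, smooth_neumann phi /\ \int[leb]_(x in Omega) `|g x - resolvent_op lam phi x| <= eta.
Proof.
move=> Lg e0; have Ig : rintegrable leb Omega g by exact: Lg.
have e3 : 0 < eta / 3 by rewrite divr_gt0.
have [h [ch [M HM] Hh]] := continuous_dense mO Ooo Ig e3.
pose M' := `|M| + 1; have M0 : 0 < M' by rewrite ltr_wpDl.
have hM x : Omega x -> `|h x| <= M'.
  by move=> _; apply: le_trans (HM x) _; apply: le_trans (ler_norm _) _; rewrite lerDl.
have chO : pcontinuous Omega h by move=> x _; exact: ch.
pose V := fine (leb Omega); have V0 : 0 <= V by exact: fine_ge0.
have [m Hm] : exists m, M' / 2 ^+ m * V <= eta / 3.
  have P0 : 0 < eta / 3 / (M' * V + 1) by rewrite divr_gt0// ltr_wpDl// mulr_ge0// ltW.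
  have h1 : `|2^-1 : R| < 1 by rewrite ger0_norm; lra.
  have [N _ HN] := (cvgrPdist_le (FF := eventually_filter) _ 0).1 (cvg_expr h1) _ P0.
  have := HN N (leqnn N); rewrite /= sub0r normrN exprVn ger0_norm ?invr_ge0 ?exprn_ge0// => Hq; exists N.
  have MV : 0 <= M' * V by rewrite mulr_ge0// ltW.
  rewrite mulrAC; apply: le_trans (ler_wpM2l MV Hq) _.
  by rewrite mulrA ler_pdivrMr ?ltr_wpDl// mulrC ler_wpM2l ?(ltW e3)// lerDl.
have [phi [r [nphi cr rM Hr]]] := resolvent_iter m chO M0 hM e3.
have [rphi _] := nphi; exists phi; split => //.
have bnd f (K : R) : pcontinuous Omega f -> (forall x, Omega x -> `|f x| <= K) -> rintegrable leb Omega f.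
  by move=> cg; apply: rintegrable_bounded => //; exact: pcontinuous_measurable.
have [_ I1 _] := pcontinuous_closure_facts (resolvent_op_pcontinuous (lam:=lam) (rphi 2)).
have Ih := bnd _ _ chO hM; have Ir := bnd _ _ cr rM.
have J1 := rintegrableB mO (rintegrableB mO Ih I1) Ir.
have J2 := rintegrableD mO J1 Ir.
have J0 := rintegrableB mO Ig Ih.
have H1 := Rintegral_absD mO J0 J2.
have H2 := Rintegral_absD mO J1 Ir.
have H3 : \int[leb]_(x in Omega) `|r x| <= M' / 2 ^+ m * V.
  apply: le_trans (ler_norm _) _; apply: Rintegral_bound => //.
    apply: measurableT_comp; first exact: normr_measurable.
    exact: pcontinuous_measurable.
  by move=> x Ox; rewrite normr_id; exact: rM.
rewrite (_ : \int[leb]_(x in Omega) `|g x - h x + _| =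
  \int[leb]_(x in Omega) `|g x - resolvent_op lam phi x|) in H1; last first.
  apply: eq_Rintegral => x _; congr (`|_|).
  by move: (resolvent_op lam phi x) => a1; lra.
move: H1 H2 H3 Hm Hr Hh.
move: (\int[leb]_(x in Omega) `|g x - resolvent_op _ _ _|) (\int[leb]_(x in Omega) `|g x - h x|) => a1 a2.
move: (\int[leb]_(x in Omega) `|r x|) (\int[leb]_(x in Omega) _) (\int[leb]_(x in Omega) _) (_ * V) => a3 a4 a5 a6.
lra.
Qed.

End resolvent.

(** For p = phi, v = u, P the potential, and L, l the Laplacians of P and phi. After integration the
    first and third terms cancel by symmetry and the second vanishes because u is a weak solution;
    only the residual against P remains. *)
Lemma resolvent_identity (R : realType) (p v L l lam P : R) :
  (p - v) * (L - lam * P) = p * L - v * L - l * P - (- lam * v - (l - lam * p)) * P.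
Proof. lra. Qed.

Lemma telescope (R : realType) (a1 a2 c e p q l m t : R) : a1 = a2 -> a2 = c - t -> c = e - m ->
  e = p - q -> p = l -> q = 0 -> l = m -> a1 = - t.
Proof. lra. Qed.

Lemma am_gm (R : realType) (th a S : R) : 0 < th -> a ^+ 2 <= S ->
  `|a| <= th / 2 + th^-1 / 2 * S.
Proof.
move=> th0 aS; have E : th * (th / 2 + th^-1 / 2 * S) = (th ^+ 2 + S) / 2.
  by rewrite mulrDr !mulrA divff ?gt_eqF// mul1r expr2 mulrDl [2^-1 * S]mulrC.
rewrite -(ler_pM2l th0) E.
have := sqr_ge0 (th - `|a|); rewrite sqrrB real_normK ?num_real//; lra.
Qed.

(** * Uniqueness *)

Section atan.
Context {R : realType} {d : nat}.
Implicit Types (x : 'rV[R]_d) (W : set 'rV[R]_d) (f : 'rV[R]_d -> R).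

Lemma atan_lipschitz (a b : R) : `|atan a - atan b| <= `|a - b|.
Proof.
wlog ab : a b / a <= b.
  move=> H; have [/H//|/ltW/H] := leP a b.
  by rewrite distrC [X in _ <= X]distrC.
have [c _ E] : exists2 c, c \in `[a, b] & atan b - atan a = (1 + c ^+ 2)^-1 * (b - a).
  apply: (MVT_segment ab); apply: continuous_subspaceT => x; exact: continuous_atan.
rewrite distrC E normrM [X in _ <= X]distrC ler_piMl//.
have c2 : 1 <= 1 + c ^+ 2 by rewrite lerDl sqr_ge0.
by rewrite ger0_norm ?invr_ge0 ?(le_trans ler01)// invf_le1// (lt_le_trans ltr01).
Qed.

Lemma atan_bounded (a : R) : `|atan a| <= pi / 2.
Proof. by rewrite ler_norml !ltW// ?atan_gtNpi2// atan_ltpi2. Qed.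

Lemma pcontinuous_eq_on W (f g : 'rV[R]_d -> R) : open W -> (forall x, W x -> g x = f x) ->
  pcontinuous W f -> pcontinuous W g.
Proof.
move=> oW E cf x Wx; apply/(@cvgrPdist_le _ _ _ (nbhs x)) => e e0.
have Hc := (cvgrPdist_le (FF := nbhs_filter x) f (f x)).1 (cf x Wx) e e0.
have Wn : \forall y \near x, W y by exact: open_nbhs_nbhs.
apply: (@filterS _ (nbhs x) (nbhs_filter x) _ _ _ (filterI Hc Wn)) => y [H Wy]; by rewrite !E.
Qed.

Lemma partial_atan W f i x : regc W 1 f -> W x ->
  is_derive x (delta_mx 0 i) (fun y => atan (f y)) ((1 + f x ^+ 2)^-1 * partial i f x).
Proof. by move=> rf Wx; exact: is_derive_comp_dir (regc_drv i rf Wx) (is_derive1_atan _). Qed.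

Lemma regc_atan W f : open W -> regc W 1 f -> regc W 1 (fun x => atan (f x)).
Proof.
move=> oW rf; have cf := regc_continuous rf.
have ca : pcontinuous W (fun x => atan (f x)).
  by move=> x Wx; apply: for_continuous_comp; [exact: cf|exact: continuous_atan].
have cp i : pcontinuous W (partial i (fun x => atan (f x))).
  apply: (@pcontinuous_eq_on _ (fun x => (1 + f x ^+ 2)^-1 * partial i f x)) => //.
    by move=> x Wx; apply/partial_is_derive; exact: partial_atan rf Wx.
  move=> x Wx; apply: for_continuousM; last exact: (regc_continuous (regc_partial i rf)).
  apply: continuousV; first by rewrite gt_eqF// (lt_le_trans ltr01)// lerDl sqr_ge0.
  apply: for_continuousD; first exact: for_continuous_cst.
  exact: (for_continuousM (cf x Wx) (cf x Wx)).
have dp i x : W x -> derivable (fun x => atan (f x)) x (delta_mx 0 i).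
  by move=> Wx; case: (partial_atan i rf Wx).
Transparent regc.
split => // i; split; [exact: dp|split => //].
Opaque regc.
Qed.

End atan.

(** * Approximation of weak solutions with zero vector field *)

Section neumann_solutions.
Context {R : realType} {d : nat}.
Implicit Types (x y z : 'rV[R]_d) (f g h u : 'rV[R]_d -> R) (s eps : R).
Local Notation leb := (lebesgue_rV d : {sigma_finite_measure set 'rV[R]_d -> \bar R}).

Context (Omega : set 'rV[R]_d) (rho : 'rV[R]_d -> R) (W : set 'rV[R]_d)
  (k kt : R -> 'rV[R]_d -> 'rV[R]_d -> R) (b C : R).
Context (oO : open Omega) (bO : bounded_set Omega) (dr : defining_function Omega rho)
  (par : parametrix Omega rho W k kt b C).

Let mO : measurable Omega. Proof. exact: open_measurable_rV. Qed.
Let Ooo : (leb Omega < +oo)%E. Proof. exact: lebesgue_rV_bounded. Qed.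
Let oW : open W. Proof. by case: par => -[]. Qed.
Let cOW : closure Omega `<=` W. Proof. by case: par => -[]. Qed.
Let OW : Omega `<=` W. Proof. by move=> x /subset_closure; exact: cOW. Qed.
Let b0 : 0 < b. Proof. by case: par => -[]. Qed.
Let C0 : 0 <= C. Proof. by case: par => -[]. Qed.
Let gm := gauss_mass d b.
Let gm0 : 0 < gm. Proof. exact: gauss_mass_gt0. Qed.
Let ka := @kappa R d.
Let ka0 : 0 < ka. Proof. exact: kappa_gt0. Qed.

(** This is [ibp] for the function 1, whose distributional gradient is the zero charge. *)
Lemma divergence_theorem (F : 'I_d -> 'rV[R]_d -> R) : (forall i, regc W 1 (F i)) ->
  (forall x, bdry Omega x -> dotv (\row_i F i x) (outer_normal Omega x) = 0) ->
  \int[leb]_(x in Omega) (\sum_i partial i (F i) x) = 0.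
Proof.
move=> rF NF.
have L1c : L1 Omega (cst 1) by exact: (@rintegrable_cst _ _ _ leb Omega 1 mO Ooo).
have := ibp oO bO dr L1c (distributional_gradient1 oO) (fun i => regc_ce oW cOW (rF i)).
rewrite big1 ?addr0; last by move=> i _; rewrite charge_integral0.
move=> H; rewrite -[RHS]H.
  by apply: eq_Rintegral => x _; rewrite mul1r.
move=> x Bx; rewrite -[RHS](NF x Bx); congr dotv; apply/rowP => i; rewrite !mxE.
have [cx _] := Bx; exact: pcontinuous_bdry_value oW (cOW cx) cx (regc_continuous (rF i)).
Qed.

Lemma neumann_green a f : regc W 1 a -> smooth_neumann Omega W f ->
  \int[leb]_(x in Omega) (a x * laplacian f x + \sum_i partial i a x * partial i f x) = 0.
Proof.
move=> ra [rf Nf]; rewrite -[RHS](@divergence_theorem (fun i x => a x * partial i f x)).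
- apply: eq_Rintegral => x /set_mem Ox; rewrite /laplacian mulr_sumr -big_split/=.
  apply: eq_bigr => i _.
  by rewrite (partialM i (OW Ox) ra (regc_partial i (rf 2))) addrC.
- by move=> i; exact: regcM oW ra (regc_partial i (rf 2)).
- move=> x Bx; have := congr1 (fun t => a x * t) (Nf x Bx); rewrite mulr0 /dotv mulr_sumr => H.
  by rewrite -[RHS]H; apply: eq_bigr => i _; rewrite !mxE mulrA.
Qed.

Let facts := fun f (cf : pcontinuous W f) => pcontinuous_closure_facts oO bO par cf.

Lemma pcontinuous_gradM a f : regc W 1 a -> regc W 1 f ->
  pcontinuous W (fun x => \sum_i partial i a x * partial i f x).
Proof.
move=> ra rf x Wx; apply: continuous_rsum => i; apply: for_continuousM.
  exact: (regc_continuous (regc_partial i ra)).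
exact: (regc_continuous (regc_partial i rf)).
Qed.

Lemma neumann_green_split a f : regc W 1 a -> smooth_neumann Omega W f ->
  \int[leb]_(x in Omega) (a x * laplacian f x) =
  - \int[leb]_(x in Omega) (\sum_i partial i a x * partial i f x).
Proof.
move=> ra nf; have G := neumann_green ra nf; have [rf _] := nf.
have [_ I1 _] := facts (pcontinuous_gradM ra (rf 1)).
have cL : pcontinuous W (fun x => a x * laplacian f x).
  move=> x Wx; apply: for_continuousM; first exact: (regc_continuous ra).
  exact: laplacian_pcontinuous (rf 2) _ Wx.
have [_ I2 _] := facts cL; rewrite RintegralD// in G.
by apply/eqP; rewrite -addr_eq0; apply/eqP.
Qed.

Lemma neumann_symmetric f g : smooth_neumann Omega W f -> smooth_neumann Omega W g ->
  \int[leb]_(x in Omega) (f x * laplacian g x) = \int[leb]_(x in Omega) (g x * laplacian f x).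
Proof.
move=> nf ng; have [[rf _] [rg _]] := (nf, ng).
have E1 := neumann_green_split (rf 1) ng; have E2 := neumann_green_split (rg 1) nf.
have M : \int[leb]_(x in Omega) (\sum_i partial i f x * partial i g x) =
    \int[leb]_(x in Omega) (\sum_i partial i g x * partial i f x).
  by apply: eq_Rintegral => x _; apply: eq_bigr => i _; rewrite mulrC.
by rewrite M in E1; exact: etrans E1 (esym E2).
Qed.

(** phi solves (Laplacian - lam) phi = - lam u up to a residual r small in L^1. The difference phi -
    u then solves weakly the equation with right-hand side - r, so [core_estimate] makes it small,
    and Laplacian phi = - r + lam (phi - u). *)
Lemma solution_approximation u (eta : R) : L1 Omega u ->
  (forall phi, neumann_test Omega phi -> \int[leb]_(x in Omega) (u x * laplacian phi x) = 0) ->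
  0 < eta -> exists phi, [/\ smooth_neumann Omega W phi,
    \int[leb]_(x in Omega) `|phi x - u x| <= eta & \int[leb]_(x in Omega) `|laplacian phi x| <= eta].
Proof.
move=> Lu wu eta0; have Iu : rintegrable leb Omega u by exact: Lu.
have [lam [lam0 Hlam]] := remainder_bound_small par (divr_gt0 ka0 (ltr0n _ 2)).
pose A := 2 * C * gm; have A0 : 0 <= A by rewrite /A mulr_ge0 ?(ltW gm0)// mulr_ge0.
pose q := 2 * A / ka; have q0 : 0 <= q by rewrite divr_ge0 ?(ltW ka0)// mulr_ge0.
pose P := 1 + q + lam * q.
have P0 : 0 < P by rewrite /P -addrA ltr_pwDl// addr_ge0// mulr_ge0// ltW.
pose e := eta / P; have e0 : 0 < e by rewrite divr_gt0.
have Lg : L1 Omega (fun x => - lam * u x) by exact: rintegrableZ.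
have [phi [nphi He]] := resolvent_range oO bO par lam0 Hlam Lg e0.
have [rphi _] := nphi; exists phi.
have cphi := regc_continuous (rphi 0).
have cLphi := laplacian_pcontinuous (rphi 2).
have [_ Iphi [Mphi HMphi]] := facts cphi.
have [_ ILphi _] := facts cLphi.
have cop := resolvent_op_pcontinuous (lam := lam) (rphi 2).
have [_ Iop _] := facts cop.
pose r x := - lam * u x - resolvent_op lam phi x.
have Ir : rintegrable leb Omega r by exact: rintegrableB.
have Iz : rintegrable leb Omega (fun x => phi x - u x) by exact: rintegrableB.
pose Z := \int[leb]_(x in Omega) `|phi x - u x|.
have Z1 : Z <= q * e.
  have core : ka * Z <= A * e + @remainder_bound R d b C lam * Z.
    apply: (core_estimate oO bO par Iz lam0) => eps f eps0 eps1 cf f1.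
    have Hf : admissible Omega f.
      by split => //; apply: measurable_funTS; exact: pcontinuous_measurableT.
    have [HS _] := timesI eps0 (lexx 1).
    have nP := smooth_neumann_potential oO bO par HS (ltW lam0) Hf.
    have Pb x : Omega x -> `|potential Omega k lam f `[eps, 1]%classic x| <= A.
      move=> Ox; have se s : `[eps, 1]%classic s -> s <= 1 by rewrite /= in_itv/= => /andP[].
      apply: le_trans (potential_le oO bO par HS (ltW lam0) Hf Ox se) _.
      rewrite -/gm -/A mulr1 ler_piMr// lebesgue_measure_itv/= lte_fin eps1 /=.
      by rewrite lerBlDr lerDl ltW.
    have [Psi PsiE] : {Psi | Psi = potential Omega k lam f `[eps, 1]%classic} by eexists.
    rewrite -PsiE in nP Pb *.
    have [rP _] := nP.
    have cP := regc_continuous (rP 0); have cLP := laplacian_pcontinuous (rP 2).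
    have [mP IP _] := facts cP; have [mLP ILP [MLP HMLP]] := facts cLP.
    have J1 : rintegrable leb Omega (fun x => phi x * laplacian Psi x) by exact: (rintegrableMb mO Iphi mLP HMLP).
    have J2 : rintegrable leb Omega (fun x => u x * laplacian Psi x) by exact: (rintegrableMb mO Iu mLP HMLP).
    have J3 : rintegrable leb Omega (fun x => laplacian phi x * Psi x) by exact: (rintegrableMb mO ILphi mP Pb).
    have J4 : rintegrable leb Omega (fun x => r x * Psi x) by exact: (rintegrableMb mO Ir mP Pb).
    have E1 := neumann_symmetric nphi nP.
    have E2 := wu Psi (smooth_neumann_test par nP).
    have E3 : \int[leb]_(x in Omega) (Psi x * laplacian phi x) = \int[leb]_(x in Omega) (laplacian phi x * Psi x).
      by apply: eq_Rintegral => x _; rewrite mulrC.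
    rewrite (_ : \int[leb]_(x in Omega) _ = - \int[leb]_(x in Omega) (r x * Psi x)).
      rewrite normrN; apply: le_trans (Rintegral_normM mO Ir mP Pb) _.
      by rewrite ler_wpM2l.
    have K1 := rintegrableB mO J1 J2; have K2 := rintegrableB mO K1 J3; have K3 := rintegrableB mO K2 J4.
    have S1 : \int[leb]_(x in Omega) ((phi x - u x) * (laplacian Psi x - lam * Psi x)) =
       \int[leb]_(x in Omega) (phi x * laplacian Psi x - u x * laplacian Psi x - laplacian phi x * Psi x - r x * Psi x).
      by apply: eq_Rintegral => x _; exact: resolvent_identity.
    have B1 := RintegralB mO K2 J4; have B2 := RintegralB mO K1 J3; have B3 := RintegralB mO J1 J2.
    exact: (telescope S1 B1 B2 B3 E1 E2 E3).
  have Z0 : 0 <= Z by exact: Rintegral_abs_ge0.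
  have h1 : @remainder_bound R d b C lam * Z <= ka / 2 * Z by rewrite ler_wpM2r.
  rewrite /q mulrAC ler_pdivlMr//.
  rewrite -(mulrA 2 A e).
  by move: core h1; move: (A * e) (remainder_bound _ _ _ * Z) => a1 a2; lra.
have Z2 : \int[leb]_(x in Omega) `|laplacian phi x| <= e + lam * Z.
  have T := rintegrableZ lam mO Iz.
  have H := Rintegral_absD mO (rintegrableN mO Ir) T.
  rewrite (_ : \int[leb]_(x in Omega) `|- r x + _| = \int[leb]_(x in Omega) `|laplacian phi x|) in H; last first.
    apply: eq_Rintegral => x _; congr (`|_|); rewrite /r /resolvent_op.
    by move: (laplacian phi x) => a1; lra.
  apply: le_trans H _; rewrite (Rintegral_absZ _ mO Iz) (gtr0_norm lam0) lerD2r.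
  apply: le_trans _ He; rewrite le_eqVlt; apply/orP; left; apply/eqP.
  by apply: eq_Rintegral => x _; rewrite normrN.
have eP : e * P = eta by rewrite divfK// gt_eqF.
have lq : 0 <= lam * q by rewrite mulr_ge0// ltW.
split => //.
  apply: le_trans Z1 _; rewrite -eP mulrC ler_wpM2l ?(ltW e0)// /P.
  by move: (lam * q) lq => a1 ?; lra.
apply: le_trans Z2 _; apply: (@le_trans _ _ (e + lam * (q * e))).
  by rewrite lerD2l ler_wpM2l// ltW.
rewrite -eP mulrA -{1}[e]mulr1 [lam * q * e]mulrC -mulrDr ler_wpM2l ?(ltW e0)// /P.
by move: (lam * q) => a1; lra.
Qed.

(** Testing Laplacian phi with the bounded function atan phi bounds the integral of grad (atan phi)
    . grad phi by pi / 2 times the L^1 norm of Laplacian phi. As the derivative of atan lies in ]0,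
    1], this integrand dominates |grad (atan phi)|^2. *)
Lemma atan_solution_gradient u (tau : R) : L1 Omega u ->
  (forall phi, neumann_test Omega phi -> \int[leb]_(x in Omega) (u x * laplacian phi x) = 0) ->
  0 < tau -> exists w, [/\ regc W 1 w,
    \int[leb]_(x in Omega) `|w x - atan (u x)| <= tau &
    forall i, \int[leb]_(x in Omega) `|partial i w x| <= tau].
Proof.
move=> Lu wu tau0; have Iu : rintegrable leb Omega u by exact: Lu.
pose V := fine (leb Omega); have V0 : 0 <= V by exact: fine_ge0.
pose th := tau / (V + 1); have V1 : 0 < V + 1 by rewrite ltr_wpDl.
have th0 : 0 < th by rewrite divr_gt0.
pose p := pi / 2 : R; have p0 : 0 < p by rewrite divr_gt0// pi_gt0.
(* With th of order tau, the constant part th / 2 of [am_gm] integrates to at most tau / 2, and this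
   eta makes the energy part p eta / (2 th) at most tau / 2. *)
pose eta := Num.min tau (th * tau / p).
have eta0 : 0 < eta by rewrite lt_min tau0/= divr_gt0// mulr_gt0.
have [phi [nphi H1 H2]] := solution_approximation Lu wu eta0; have [rphi _] := nphi.
have ra := regc_atan oW (rphi 1).
have mu_ := rintegrable_measurable Iu.
have cphi := regc_continuous (rphi 0); have [mphi Iphi _] := facts cphi.
exists (fun x => atan (phi x)); split => //.
  have I1 := rintegrableB mO Iphi Iu.
  have ma : measurable_fun Omega (fun x => atan (u x)).
    apply: (measurableT_comp (f := atan)) => //; apply: continuous_measurable_fun => x; exact: continuous_atan.
  have [maphi _ _] := facts (regc_continuous ra).
  have I2 : rintegrable leb Omega (fun x => atan (phi x) - atan (u x)).
    apply: (rintegrable_bounded mO Ooo (C := p + p)); first exact: measurable_funB.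
    by move=> x _; apply: le_trans (ler_normB _ _) _; rewrite lerD ?atan_bounded.
  apply: (@le_trans _ _ (\int[leb]_(x in Omega) `|phi x - u x|)).
    by apply: le_Rintegral_abs => // x _; exact: atan_lipschitz.
  by apply: le_trans H1 _; rewrite ge_min lexx.
have cL := laplacian_pcontinuous (rphi 2); have [mL IL _] := facts cL.
have cg := pcontinuous_gradM ra (rphi 1); have [_ Ig _] := facts cg.
have E i x : Omega x -> partial i (fun x => atan (phi x)) x = (1 + phi x ^+ 2)^-1 * partial i phi x.
  by move=> Ox; apply/partial_is_derive; exact: partial_atan (rphi 1) (OW Ox).
have energy : \int[leb]_(x in Omega) (\sum_i partial i (fun x => atan (phi x)) x * partial i phi x) <= p * eta.
  have := neumann_green_split ra nphi => G.
  rewrite -[leLHS]opprK -G; apply: le_trans (ler_norm _) _; rewrite normrN.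
  rewrite (_ : \int[leb]_(x in Omega) _ = \int[leb]_(x in Omega) (laplacian phi x * atan (phi x))); last first.
    by apply: eq_Rintegral => x _; rewrite mulrC.
  have [maphi _ _] := facts (regc_continuous ra).
  apply: le_trans (Rintegral_normM mO IL maphi (fun x _ => atan_bounded (phi x))) _.
  by rewrite ler_wpM2l// ltW.
move=> i; have [_ Ii _] := facts (regc_continuous (regc_partial i ra)).
have Ib : rintegrable leb Omega (fun x => th / 2 + th^-1 / 2 * \sum_j partial j (fun x => atan (phi x)) x * partial j phi x).
  by apply: rintegrableD => //; [exact: rintegrable_cst|exact: rintegrableZ].
apply: (@le_trans _ _ (\int[leb]_(x in Omega) (th / 2 + th^-1 / 2 * \sum_j partial j (fun x => atan (phi x)) x * partial j phi x))).
  apply: le_Rintegral => //; first exact: rintegrable_norm.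
  move=> x Ox.
  have term j : 0 <= partial j (fun x => atan (phi x)) x * partial j phi x.
    by rewrite E// -mulrA -expr2 mulr_ge0 ?sqr_ge0// invr_ge0 addr_ge0 ?sqr_ge0.
  have : partial i (fun x => atan (phi x)) x ^+ 2 <= \sum_j partial j (fun x => atan (phi x)) x * partial j phi x.
    rewrite (bigD1 i)//= -[leLHS]addr0; apply: lerD; last by apply: sumr_ge0 => m _; exact: term.
    rewrite E//; move: (partial i phi x) => t.
    have c1 : 1 <= 1 + phi x ^+ 2 by rewrite lerDl sqr_ge0.
    have c0 : 0 <= (1 + phi x ^+ 2)^-1 by rewrite invr_ge0 (le_trans ler01).
    have c2 : (1 + phi x ^+ 2)^-1 <= 1 by rewrite invf_le1// (lt_le_trans ltr01).
    rewrite expr2 mulrACA -!mulrA ler_wpM2l// ler_piMl//.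
    by rewrite -expr2 sqr_ge0.
  move: (\sum_j _) (partial i _ x) => S a Sa.
  exact: am_gm.
have Ic : rintegrable leb Omega (fun=> th / 2) by exact: rintegrable_cst.
have Z := RintegralZl (th^-1 / 2) mO Ig.
rewrite RintegralD//; last exact: rintegrableZ.
rewrite Z Rintegral_cst// -/V.
have h1 : th / 2 * V <= tau / 2.
  rewrite mulrAC ler_wpM2r ?invr_ge0//.
  by rewrite /th -mulrA ler_piMr ?(ltW tau0)// mulrC ler_pdivrMr// mul1r lerDl.
have h2 : th^-1 / 2 * \int[leb]_(x in Omega) (\sum_j partial j (fun x => atan (phi x)) x * partial j phi x) <= tau / 2.
  have t0 : 0 <= th^-1 / 2 by rewrite divr_ge0// invr_ge0 ltW.
  apply: le_trans (ler_wpM2l t0 energy) _.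
  have : p * eta <= th * tau.
    have : eta <= th * tau / p by rewrite ge_min lexx orbT.
    by rewrite ler_pdivlMr// mulrC.
  move=> /(ler_wpM2l t0)/le_trans; apply; rewrite le_eqVlt; apply/orP; left; apply/eqP.
  by rewrite mulrAC mulrA mulVf ?gt_eqF// mul1r.
by move: h1 h2; move: (th / 2 * V) (th^-1 / 2 * _) => a1 a2; lra.
Qed.

End neumann_solutions.

Section marginals.
Context d1 d2 (T1 : measurableType d1) (T2 : measurableType d2) (R : realType).
Variables (m1 : {sigma_finite_measure set T1 -> \bar R})
          (m2 : {sigma_finite_measure set T2 -> \bar R}).
Variables (A : set T1) (B : set T2).
Hypotheses (mA : measurable A) (mB : measurable B).

Lemma rintegrable_marginal (f : T1 * T2 -> R) (C : R) : (m1 A < +oo)%E -> (m2 B < +oo)%E ->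
  measurable_fun (A `*` B) f -> (forall z, (A `*` B) z -> 0 <= f z <= C) ->
  rintegrable m2 B (fun y => \int[m1]_(x in A) f (x, y)).
Proof.
move=> Aoo Boo mf fC.
have f0 z : (A `*` B) z -> 0 <= f z by move=> /fC/andP[].
pose F := f \_ (A `*` B).
have mF : measurable_fun setT (fun z => (F z)%:E).
  apply/measurable_EFinP; apply/(measurable_restrictT _ _).1 => //.
  exact: measurableX.
have F0 z : (0 <= (F z)%:E)%E.
  by rewrite lee_fin /F patchE; case: ifPn => // /set_mem; exact: f0.
have mG := measurable_fun_fubini_tonelli_G (m1 := m1) _ mF F0.
have E y : B y -> \int[m1]_(x in A) f (x, y) = fine (fubini_G m1 (fun z => (F z)%:E) y).
  move=> By; rewrite /fubini_G /Rintegral; congr fine; rewrite [LHS]integral_mkcond.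
  by apply: eq_integral => x _; rewrite /F !patchE in_setX (mem_set By) andbT; case: ifPn.
have ms y : B y -> measurable_fun A (fun x => f (x, y)).
  move=> By; apply: (measurable_comp (F := A `*` B)) => //.
  - exact: measurableX.
  - by move=> _ [x Ax <-].
  - by apply: measurable_funTS; exact: measurable_pair2.
apply: (rintegrable_bounded mB Boo (C := C * fine (m1 A))).
  apply: (@eq_measurable_fun _ _ _ _ B (fun y => fine (fubini_G m1 (fun z => (F z)%:E) y))).
    by move=> y /set_mem By; rewrite E.
  by apply: measurable_funTS; apply: (measurableT_comp (f := fine)) mG; exact: fine_measurable.
move=> y By; apply: Rintegral_bound => //; first exact: ms.
by move=> x Ax; have /andP[h1 h2] := fC (x, y) (conj Ax By); rewrite ger0_norm.
Qed.

End marginals.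

(** * Finite differences in L^1 *)

Section translations.
Context {R : realType} {d : nat}.
Implicit Types (x y z h : 'rV[R]_d) (f g w V : 'rV[R]_d -> R) (A D B : set 'rV[R]_d).
Local Notation leb := (lebesgue_rV d : {sigma_finite_measure set 'rV[R]_d -> \bar R}).
Local Notation leb1 := (@lebesgue_measure R).

Lemma Rintegral_abs_subset A D g : measurable A -> measurable D -> A `<=` D ->
  rintegrable leb D g -> \int[leb]_(x in A) `|g x| <= \int[leb]_(x in D) `|g x|.
Proof.
move=> mA mD AD Ig; have Ia := rintegrable_norm mD Ig.
have IA := rintegrableS mD mA AD Ia.
rewrite -lee_fin !EFin_Rintegral//; apply: ge0_subset_integral => //.
by apply/measurable_EFinP; exact: rintegrable_measurable Ia.
Qed.

Lemma translate_integral_le B D g h : measurable B -> measurable D ->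
  (forall x, B x -> D (x + h)) -> rintegrable leb D g ->
  rintegrable leb B (fun x => g (x + h)) /\
  \int[leb]_(x in B) `|g (x + h)| <= \int[leb]_(x in D) `|g x|.
Proof.
move=> mB mD BD Ig; have [I1 _] := Rintegral_rV_translate h mD Ig.
have [_ E] := Rintegral_rV_translate h mD (rintegrable_norm mD Ig).
have mT : measurable ((fun x : 'rV[R]_d => x + h) @^-1` D).
  by rewrite -[X in measurable X]setTI; exact: measurable_addr.
split; first exact: rintegrableS mT mB BD I1.
by rewrite -E; exact: Rintegral_abs_subset mB mT BD I1.
Qed.

Lemma measurable_comp_rV d0 (Z : measurableType d0) (S : set Z) D g (q : Z -> 'rV[R]_d) :
  measurable S -> measurable D -> measurable_fun D g -> measurable_fun setT q ->
  (forall p : Z, S p -> D (q p)) -> measurable_fun S (fun p => g (q p)).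
Proof.
move=> mS mD mg mq SD; apply: (measurable_comp (F := D)) => //.
  by move=> _ [z Sz <-]; exact: SD.
exact: measurable_funTS.
Qed.

Lemma measurable_segment h :
  measurable_fun setT (fun p : measurableTypeR R * 'rV[R]_d => p.2 + (p.1 : R) *: h).
Proof.
apply: measurable_fun_rV => i; under eq_fun do rewrite !mxE.
apply: measurable_funD; first exact: measurableT_comp (measurable_coord i) measurable_snd.
by apply: measurable_funM; [exact: measurable_fst|exact: measurable_cst].
Qed.

Lemma measurable_add_rV :
  measurable_fun setT (fun p : 'rV[R]_d * 'rV[R]_d => p.2 + p.1).
Proof.
apply: measurable_fun_rV => i; under eq_fun do rewrite !mxE.
apply: measurable_funD; first exact: measurableT_comp (measurable_coord i) measurable_snd.
exact: measurableT_comp (measurable_coord i) measurable_fst.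
Qed.

(** The difference is the integral of the derivative along the segment; after Fubini each time slice
    is a translate of an integral over D. Unlike the gradient bound, this estimate survives the L^1
    limit. *)
Lemma translation_estimate D B w h (M tau : R) : open D -> measurable B -> (leb B < +oo)%E ->
  (forall x (t : R), B x -> 0 <= t <= 1 -> D (x + t *: h)) -> regc D 1 w -> 0 <= M ->
  rintegrable leb D w -> (forall i, rintegrable leb D (partial i w)) ->
  (forall i x, D x -> `|partial i w x| <= M) ->
  (forall i, \int[leb]_(x in D) `|partial i w x| <= tau) ->
  \int[leb]_(x in B) `|w (x + h) - w x| <= d%:R * `|h| * tau.
Proof.
move=> oD mB Boo BD rw M0 Iw Ip HM Hp.
have mD : measurable D by exact: open_measurable_rV.
pose I : set (measurableTypeR R) := `[0, 1]%classic.
have mI : measurable I by exact: measurable_itv.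
have lebI : leb1 I = 1%E by rewrite lebesgue_measure_itv/= lte_fin ltr01 sube0.
have Ioo : (leb1 I < +oo)%E by rewrite lebI ltry.
have I01 t : I t -> 0 <= (t : R) <= 1 by rewrite /I/= in_itv/=.
pose G x (t : R) := \sum_i h 0 i * partial i w (x + t *: h).
have mp i : measurable_fun D (partial i w) by exact: rintegrable_measurable (Ip i).
pose f (p : measurableTypeR R * 'rV[R]_d) := `|G p.2 p.1|.
have mIB : measurable (I `*` B) by exact: measurableX.
have mf : measurable_fun (I `*` B) f.
  apply: measurableT_comp; first exact: normr_measurable.
  apply: measurable_sum => i; apply: measurable_funM; first exact: measurable_cst.
  apply: (measurable_comp_rV mIB mD (mp i) (measurable_segment h)).
  by move=> p [Ip' Bp]; apply: BD => //; exact: I01.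
pose K := \sum_(i < d) `|h 0 i| * M.
have GK x (t : R) : D (x + t *: h) -> `|G x t| <= K.
  move=> Dx; apply: le_trans (ler_norm_sum _ _ _) _; apply: ler_sum => i _.
  by rewrite normrM ler_wpM2l//; exact: HM.
have fK p : (I `*` B) p -> 0 <= f p <= K.
  by move=> [Ip' Bp]; rewrite normr_ge0/=; apply: GK; apply: BD => //; exact: I01.
have fK' p : (I `*` B) p -> `|f p| <= K by move=> /fK/andP[f0 fK1]; rewrite ger0_norm.
have J1 : rintegrable leb B (fun x => \int[leb1]_(t in I) f (t, x)).
  exact: (rintegrable_marginal (m1 := leb1) (m2 := leb) mI mB Ioo Boo mf fK).
have [F1 F2] := fubini_set (m1 := leb1) (m2 := leb) mI mB Ioo Boo mf fK'.
have Iwh : rintegrable leb B (fun x => w (x + h)).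
  have [] := translate_integral_le mB mD (h := h) _ Iw => // x Bx.
  by have := BD x 1 Bx; rewrite scale1r; apply; rewrite ler01 lexx.
have BDs : B `<=` D.
  by move=> x Bx; have := BD x 0 Bx; rewrite scale0r addr0; apply; rewrite ler01 lexx.
have IwB : rintegrable leb B w by exact: rintegrableS mD mB BDs Iw.
have ftc x : B x -> `|w (x + h) - w x| <= \int[leb1]_(t in I) f (t, x).
  move=> Bx.
  have ct (t : R) : 0 <= t <= 1 -> {for t, continuous (G x)}.
    move=> t01; have Dt := BD x t Bx t01; apply: continuous_rsum => i.
    apply: for_continuousM; first exact: for_continuous_cst.
    apply: (@continuous_comp _ _ _ (fun t : R => x + t *: h) (partial i w)); last first.
      exact: (regc_continuous (regc_partial i rw)) Dt.
    apply: cvgD; first exact: cvg_cst.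
    by apply: cvgZr_tmp; exact: cvg_id.
  have dt (t : R) : 0 <= t <= 1 -> is_derive t 1 (fun s : R => w (x + s *: h)) (G x t).
    by move=> t01; exact: (proj1 (is_derive_line w x h t _) (regc_drv_dir h oD rw (BD x t Bx t01))).
  have cdt (t : R) : 0 <= t <= 1 -> {for t, continuous (fun s : R => w (x + s *: h))}.
    move=> t01; have Dt := BD x t Bx t01.
    apply: (@continuous_comp _ _ _ (fun t : R => x + t *: h) w); last exact: (regc_continuous rw) Dt.
    apply: cvgD; first exact: cvg_cst.
    by apply: cvgZr_tmp; exact: cvg_id.
  have cG : {within `[0, 1], continuous (G x)}.
    by apply: continuous_in_subspaceT => t /set_mem; rewrite /= in_itv/=; exact: ct.
  have E : \int[leb1]_(t in I) G x t = w (x + h) - w x.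
    rewrite /Rintegral /I (@continuous_FTC2 _ (G x) (fun s => w (x + s *: h)))//.
    - by rewrite /= scale1r scale0r addr0.
    - split.
      + move=> t; rewrite in_itv/= => /andP[t0 t1].
        by have [] := dt t; rewrite ?(ltW t0) ?(ltW t1).
      + by apply: cvg_at_right_filter; apply: cdt; rewrite lexx ler01.
      + by apply: cvg_at_left_filter; apply: cdt; rewrite lexx ler01.
    - move=> t; rewrite in_itv/= => /andP[t0 t1]; rewrite derive1E.
      have t01 : 0 <= t <= 1 by rewrite (ltW t0) ltW.
      by have [_] := dt t t01.
  rewrite -E; apply: le_normr_Rintegral => //.
  by apply: continuous_compact_integrable => //; exact: segment_compact.
apply: (@le_trans _ _ (\int[leb]_(x in B) \int[leb1]_(t in I) f (t, x))).
  by apply: le_Rintegral => //; apply: rintegrable_norm => //; exact: rintegrableB.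
rewrite -F2 F1.
have inner t : I t -> \int[leb]_(x in B) f (t, x) <= d%:R * `|h| * tau.
  move=> It; have t01 := I01 t It.
  have BDt x : B x -> D (x + (t : R) *: h) by move=> Bx; exact: BD.
  have Ti i := translate_integral_le mB mD BDt (Ip i).
  have Isum : rintegrable leb B (fun x => \sum_i `|h 0 i| * `|partial i w (x + (t : R) *: h)|).
    by apply: rintegrable_sum => // i; apply: rintegrableZ => //; apply: rintegrable_norm => //; case: (Ti i).
  have IG : rintegrable leb B (fun x => G x t).
    by apply: rintegrable_sum => // i; apply: rintegrableZ => //; case: (Ti i).
  apply: (@le_trans _ _ (\int[leb]_(x in B) \sum_i `|h 0 i| * `|partial i w (x + (t : R) *: h)|)).
    apply: le_Rintegral => //; first exact: rintegrable_norm.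
    by move=> x Bx; rewrite /f/=; apply: le_trans (ler_norm_sum _ _ _) _; apply: ler_sum => i _; rewrite normrM.
  rewrite Rintegral_sum//; last first.
    by move=> i; apply: rintegrableZ => //; apply: rintegrable_norm => //; case: (Ti i).
  rewrite (_ : d%:R * `|h| * tau = \sum_(i < d) `|h| * tau); last first.
    by rewrite sumr_const card_ord -mulrA mulr_natl.
  apply: ler_sum => i _; have [Ii Hi] := Ti i.
  have Z := RintegralZl `|h 0 i| mB (rintegrable_norm mB Ii); rewrite Z.
  have N0 : 0 <= \int[leb]_(x in B) `|partial i w (x + (t : R) *: h)| by exact: Rintegral_abs_ge0.
  exact: (ler_pM (normr_ge0 _) N0 (coord_le_norm h i) (le_trans Hi (Hp i))).
have mft : measurable (B `*` I) by exact: measurableX.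
have J2 : rintegrable leb1 I (fun t => \int[leb]_(x in B) f (t, x)).
  apply: (rintegrable_marginal (m1 := leb) (m2 := leb1) (f := fun p => f (p.2, p.1)) mB mI Boo Ioo (C := K)).
    apply: (measurable_comp (F := I `*` B)) => //.
      by move=> _ [p [Bp Ip'] <-].
    by apply: measurable_funTS; apply/measurable_fun_pair; [exact: measurable_snd|exact: measurable_fst].
  by move=> p [Bp Ip']; exact: fK.
apply: (@le_trans _ _ (\int[leb1]_(t in I) (d%:R * `|h| * tau))).
  by apply: le_Rintegral => //; exact: rintegrable_cst.
by rewrite Rintegral_cst// -[X in _ * fine X]/(leb1 I) lebI mulr1.
Qed.

End translations.

(** * Functions that are constant almost everywhere *)

Section local_constancy.
Context {R : realType} {d : nat}.
Implicit Types (x y h : 'rV[R]_d) (f g w V u : 'rV[R]_d -> R) (A D B : set 'rV[R]_d).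
Local Notation leb := (lebesgue_rV d : {sigma_finite_measure set 'rV[R]_d -> \bar R}).

Definition nball x (r : R) : set 'rV[R]_d := [set y | `|y - x| < r].

Lemma open_nball x (r : R) : open (nball x r).
Proof.
rewrite (_ : nball x r = ball x r); first exact: ball_open.
by apply/seteqP; split => y; rewrite /nball -ball_normE /= distrC.
Qed.

Lemma measurable_nball x (r : R) : measurable (nball x r).
Proof. by apply: open_measurable_rV; exact: open_nball. Qed.

Lemma nball_lty x (r : R) : (leb (nball x r) < +oo)%E.
Proof.
apply: lebesgue_rV_bounded; first exact: measurable_nball.
exists (r + `|x|); split=> [|M rM y xy]; first exact: num_real.
apply: le_trans (ltW rM); rewrite -[y](subrK x); apply: le_trans (ler_normD _ _) _.
by rewrite lerD2r; exact: ltW.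
Qed.

Lemma nball_neq0 x (r : R) : 0 < r -> leb (nball x r) != 0%E.
Proof.
move=> r0; apply/eqP => N0; move/eqP: (eball_gt0 r0 (d := d)); apply.
have mE := @measurable_eball R d r.
rewrite -(lebesgue_rV_translate (- x) mE).
have mT : measurable ((fun y : 'rV[R]_d => y + - x) @^-1` eball r).
  by rewrite -[X in measurable X]setTI; exact: measurable_addr.
apply/eqP; rewrite eq_le measure_ge0 andbT -[leRHS]N0.
apply: le_measure; rewrite ?inE//; first exact: measurable_nball.
by move=> y /(eball_norm r0).
Qed.

Lemma ae_exists B (Q : 'rV[R]_d -> Prop) : measurable B -> leb B != 0%E ->
  {ae leb, forall x, B x -> Q x} -> exists2 x, B x & Q x.
Proof.
move=> mB B0 [N [mN N0 HN]]; apply: contrapT => nex.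
move: B0 => /eqP; apply; apply/eqP; rewrite eq_le measure_ge0 andbT -N0.
apply: le_measure; rewrite ?inE// => x Bx; apply: HN => /= BQ; apply: nex.
by exists x => //; exact: BQ.
Qed.

Lemma ae_translate (P : 'rV[R]_d -> Prop) x : {ae leb, forall h, P h} ->
  {ae leb, forall y, P (y - x)}.
Proof.
move=> [N [mN N0 HN]]; exists ((fun y : 'rV[R]_d => y + - x) @^-1` N); split.
- by rewrite -[X in measurable X]setTI; exact: measurable_addr.
- by rewrite lebesgue_rV_translate.
- by move=> y nP; exact: HN.
Qed.

(** By Fubini, for almost every x the equality V (x + h) = V x holds for almost every small h; one
    such x close to the centre fixes the constant. *)
Lemma ae_constant_ball D x0 (r M : R) V : open D -> 0 < r -> nball x0 (2 * r) `<=` D ->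
  measurable_fun D V -> (forall x, D x -> `|V x| <= M) ->
  (forall h, `|h| < r -> \int[leb]_(x in nball x0 r) `|V (x + h) - V x| = 0) ->
  exists c : R, {ae leb, forall x, nball x0 (r / 2) x -> V x = c}.
Proof.
move=> oD r0 sD mV VM H0.
have mD : measurable D by exact: open_measurable_rV.
pose H := nball 0 r; pose B := nball x0 r.
have mH : measurable H by exact: measurable_nball.
have mB : measurable B by exact: measurable_nball.
have mHB : measurable (H `*` B) by exact: measurableX.
have Hh h : H h -> `|h| < r by rewrite /H /nball/= subr0.
have BD x : B x -> D x.
  by move=> Bx; apply: sD; apply: lt_le_trans Bx _; rewrite ler_peMl ?(ltW r0)// ler1n.
have HBD h x : H h -> B x -> D (x + h).
  move=> /Hh hr Bx; apply: sD; rewrite /nball/= addrAC; apply: le_lt_trans (ler_normD _ _) _.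
  by rewrite mulr2n mulrDl mul1r ltrD.
pose f (p : 'rV[R]_d * 'rV[R]_d) := `|V (p.2 + p.1) - V p.2|.
have mf : measurable_fun (H `*` B) f.
  apply: measurableT_comp; first exact: normr_measurable.
  apply: measurable_funB.
    apply: (measurable_comp_rV mHB mD mV measurable_add_rV).
    by move=> p [Hp Bp]; exact: HBD.
  apply: (measurable_comp_rV mHB mD mV measurable_snd).
  by move=> p [Hp Bp]; exact: BD.
have fM p : (H `*` B) p -> 0 <= f p <= M + M.
  move=> [Hp Bp]; rewrite normr_ge0/=; apply: le_trans (ler_normB _ _) _.
  by apply: lerD; apply: VM; [exact: HBD|exact: BD].
have fM' p : (H `*` B) p -> `|f p| <= M + M by move=> /fM/andP[f0 f1]; rewrite ger0_norm.
have J1 := rintegrable_marginal (m1 := leb) (m2 := leb) mH mB (nball_lty 0 r) (nball_lty x0 r) mf fM.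
have [F1 F2] := fubini_set (m1 := leb) (m2 := leb) mH mB (nball_lty 0 r) (nball_lty x0 r) mf fM'.
have Z : \int[leb]_(x in B) \int[leb]_(h in H) f (h, x) = 0.
  rewrite -F2 F1 -[RHS](mul0r (fine (leb H))) -(Rintegral_cst leb mH).
  by apply: eq_Rintegral => h /set_mem /Hh hr; exact: H0.
have JP x : 0 <= \int[leb]_(h in H) f (h, x) by apply: Rintegral_ge0 => h _; exact: normr_ge0.
have : \int[leb]_(x in B) `|\int[leb]_(h in H) f (h, x)| = 0.
  by rewrite -[RHS]Z; apply: eq_Rintegral => x _; rewrite ger0_norm.
move=> /(Rintegral_abs_eq0 mB J1) aeJ.
have r20 : 0 < r / 2 by rewrite divr_gt0.
have sub2 x : nball x0 (r / 2) x -> B x.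
  by move=> xr; apply: lt_trans xr _; lra.
(* Taking x in the half ball makes every y of the half ball a translate x + h with |h| < r. *)
have [x xB' Jx] : exists2 x, nball x0 (r / 2) x & \int[leb]_(h in H) f (h, x) = 0.
  apply: (ae_exists (@measurable_nball x0 (r / 2)) (nball_neq0 x0 r20)).
  by move: aeJ; apply: filterS => x Hx /sub2; exact: Hx.
exists (V x).
have Bx := sub2 _ xB'.
have If : rintegrable leb H (fun h => V (x + h) - V x).
  apply: (rintegrable_bounded mH (nball_lty 0 r) (C := M + M)).
    apply: measurable_funB; last exact: measurable_cst.
    apply: (measurable_comp_rV mH mD mV (q := fun h => x + h)).
      by rewrite (_ : (fun h => x + h) = (fun h => h + x)); [exact: measurable_addr|apply/funext => h; rewrite addrC].
    by move=> h Hh'; exact: HBD.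
  by move=> h Hh'; have /andP[_] := fM (h, x) (conj Hh' Bx).
have /(ae_translate x) := proj1 (Rintegral_abs_eq0 mH If) Jx.
apply: filterS => y Hy yB; have : H (y - x).
  rewrite /H /nball/= subr0 -(subrK x0 y) -addrA; apply: le_lt_trans (ler_normD _ _) _.
  rewrite [`|x0 - x|]distrC; move: yB xB'; rewrite /nball/= => h1 h2.
  by rewrite [X in _ < X](splitr r) ltrD.
by move=> /Hy /eqP; rewrite subrKC subr_eq0 => /eqP.
Qed.

Lemma rational_ball x (r : R) : 0 < r -> exists (q : 'rV[rat]_d) (n : nat),
  ball (map_mx ratr q : 'rV[R]_d) n.+1%:R^-1 x /\ ball (map_mx ratr q : 'rV[R]_d) n.+1%:R^-1 `<=` ball x r.
Proof.
move=> r0; have r20 : 0 < r / 2 by rewrite divr_gt0.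
have [k ke] : exists k, k.+1%:R^-1 < r / 2.
  by have [k _ /(_ _ (leqnn k)) kP] := near_infty_natSinv_lt (PosNum r20); exists k.
have k0 : 0 < k.+1%:R^-1 :> R by rewrite invr_gt0.
have /choice[q Hq] : forall i : 'I_d, exists a : rat, `|ratr a - x 0 i| < k.+1%:R^-1.
  move=> i; have lt_k : x 0 i - k.+1%:R^-1 < x 0 i + k.+1%:R^-1 by rewrite ltrD2l gtrN.
  by have [a] := rat_in_itvoo lt_k; rewrite in_itv/= -ltr_distl => Ha; exists a.
exists (\row_i q i), k.
have xq : ball (map_mx ratr (\row_i q i) : 'rV[R]_d) k.+1%:R^-1 x.
  by split=> // a i; rewrite /ball/= !mxE (ord1 a); exact: Hq.
split => // y qy; rewrite (splitr r).
apply: le_ball (ball_triangle (ball_sym xq) qy).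
by rewrite lerD// ltW.
Qed.

(** The sets [S c] are open and disjoint, because two constants valid on a common ball agree; they
    cover D, so connectedness leaves a single c0. *)
Lemma ae_constant_connected D V : open D -> connected D -> D !=set0 ->
  (forall x, D x -> exists r c : R, 0 < r /\ {ae leb, forall y, nball x r y -> V y = c}) ->
  exists c : R, {ae leb, forall x, D x -> V x = c}.
Proof.
move=> oD cD [x0 Dx0] HV.
pose S (c : R) : set 'rV[R]_d := [set x | D x /\ exists r : R, 0 < r /\ {ae leb, forall y, nball x r y -> V y = c}].
have oS c : open (S c).
  rewrite openE => x [Dx [r [r0 Hr]]].
  have r20 : 0 < r / 2 by rewrite divr_gt0.
  have N1 : \forall y \near x, `|y - x| < r / 2 by exact: near_norm_lt.
  have N2 : \forall y \near x, D y by exact: open_nbhs_nbhs.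
  apply: (@filterS _ (nbhs x) (nbhs_filter x) _ _ _ (filterI N1 N2)) => y [yx Dy].
  split => //; exists (r / 2); split => //.
  move: Hr; apply: filterS => t Ht ty; apply: Ht; rewrite /nball/= -(subrK y t) -addrA.
  by apply: le_lt_trans (ler_normD _ _) _; rewrite (splitr r) ltrD.
have [r0 [c0 [r00 Hc0]]] := HV x0 Dx0; exists c0.
have SD : S c0 = D.
  apply: cD.
  - by exists x0; split => //; exists r0.
  - by exists (S c0) => //; apply/seteqP; split => x; [move=> Sx; split => //; case: Sx|case].
  - exists (~` (\bigcup_(c in [set c | c != c0]) S c)).
      by rewrite closedC; apply: bigcup_open => c _.
    apply/seteqP; split => x.
      move=> [Dx [r [rp Hr]]]; split => // -[c /= cc0 [_ [r' [rp' Hr']]]].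
      pose m := Num.min r r'; have m0 : 0 < m by rewrite lt_min rp.
      have [y ym [Vy Vy']] : exists2 y, nball x m y & V y = c0 /\ V y = c.
        apply: (ae_exists (@measurable_nball x m) (nball_neq0 x m0)).
        move: Hr Hr'; apply: filterS2 => y h1 h2 ym; split.
          by apply: h1; apply: lt_le_trans ym _; rewrite ge_min lexx.
        by apply: h2; apply: lt_le_trans ym _; rewrite ge_min lexx orbT.
      by move: cc0; rewrite -Vy' Vy eqxx.
    move=> [Dx nT]; have [r [c [rp Hr]]] := HV x Dx.
    have [cc|cc] := eqVneq c c0; first by rewrite -cc; split => //; exists r.
    by exfalso; apply: nT; exists c => //; split => //; exists r.
(* The exceptional set is covered by countably many balls with rational centres and radii 1 / (n +
   1); [F] keeps just those whose bad part is negligible, and every point of D lies in one of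
   them. *)
pose bad : set 'rV[R]_d := [set x | V x <> c0].
pose Bp (p : 'rV[rat]_d * nat) : set 'rV[R]_d := ball (map_mx ratr p.1 : 'rV[R]_d) p.2.+1%:R^-1 `&` bad.
pose F (n : nat) : set 'rV[R]_d :=
  if unpickle n is Some p then (if `[< leb.-negligible (Bp p) >] then Bp p else set0) else set0.
have nF n : leb.-negligible (F n).
  rewrite /F; case: unpickle => [p|]; last exact: negligible_set0.
  by case: asboolP => // _; exact: negligible_set0.
have := negligible_bigcup nF; apply: negligibleS => x /= /not_implyP[Dx Vx].
have : S c0 x by rewrite SD.
move=> [_ [r [rp Hr]]]; have [q [n [xq qr]]] := rational_ball x rp.
exists (pickle (q, n)) => //; rewrite /F pickleK; case: asboolP => [_|nneg]; first by split.
exfalso; apply: nneg; move: Hr; apply: negligibleS => y [qy Vy] /=; apply/not_implyP; split => //.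
by have := qr y qy; rewrite -ball_normE /= distrC.
Qed.

End local_constancy.

(** * Weak solutions with zero vector field are constant *)

Section uniqueness.
Context {R : realType} {d : nat}.
Implicit Types (x y h : 'rV[R]_d) (u w : 'rV[R]_d -> R).
Local Notation leb := (lebesgue_rV d : {sigma_finite_measure set 'rV[R]_d -> \bar R}).

Context (Omega : set 'rV[R]_d) (rho : 'rV[R]_d -> R) (W : set 'rV[R]_d)
  (k kt : R -> 'rV[R]_d -> 'rV[R]_d -> R) (b C : R).
Context (oO : open Omega) (bO : bounded_set Omega) (dr : defining_function Omega rho)
  (par : parametrix Omega rho W k kt b C) (cO : connected Omega) (O0 : Omega !=set0).

Let mO : measurable Omega. Proof. exact: open_measurable_rV. Qed.
Let Ooo : (leb Omega < +oo)%E. Proof. exact: lebesgue_rV_bounded. Qed.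
Let oW : open W. Proof. by case: par => -[]. Qed.
Let cOW : closure Omega `<=` W. Proof. by case: par => -[]. Qed.
Let OW : Omega `<=` W. Proof. by move=> x /subset_closure; exact: cOW. Qed.

Lemma open_nball_sub x : Omega x -> exists2 r : R, 0 < r & nball x r `<=` Omega.
Proof.
move=> Ox; have /nbhs_ballP[r /= r0 Hr] : \forall y \near x, Omega y by exact: open_nbhs_nbhs.
by exists r => // y yx; apply: Hr; exact: ball_norm_lt.
Qed.

(** On a ball with room to translate, atan u is compared with the functions w of
    [atan_solution_gradient]: two errors tau for the approximation and d |h| tau for the difference
    of w. So its finite differences vanish, atan u is locally constant, and tan recovers u. *)
Lemma weak_solution_constant u : L1 Omega u ->
  (forall phi, neumann_test Omega phi -> \int[leb]_(x in Omega) (u x * laplacian phi x) = 0) ->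
  exists c : R, {ae leb, forall x, Omega x -> u x = c}.
Proof.
move=> Lu wu; have Iu : rintegrable leb Omega u by exact: Lu.
pose V x := atan (u x).
have mV : measurable_fun Omega V.
  apply: (measurableT_comp (f := atan)); last exact: rintegrable_measurable Iu.
  by apply: continuous_measurable_fun => x; exact: continuous_atan.
have VM x : Omega x -> `|V x| <= pi / 2 by move=> _; exact: atan_bounded.
have IV : rintegrable leb Omega V by exact: rintegrable_bounded mO Ooo mV VM.
have [c Hc] : exists c : R, {ae leb, forall x, Omega x -> V x = c}.
  apply: ae_constant_connected => // x0 Ox0.
  have [r r0 Hr] := open_nball_sub Ox0.
  pose s := r / 2; have s0 : 0 < s by rewrite divr_gt0.
  have s2 : 2 * s = r by rewrite mulrC divfK.
  have sO : nball x0 (2 * s) `<=` Omega by rewrite s2.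
  have BO : nball x0 s `<=` Omega.
    by move=> x xs; apply: sO; apply: lt_le_trans xs _; rewrite ler_peMl ?(ltW s0)// ler1n.
  have mB := @measurable_nball R d x0 s.
  suff H0 h : `|h| < s -> \int[leb]_(x in nball x0 s) `|V (x + h) - V x| = 0.
    have [c Hc] := ae_constant_ball oO s0 sO mV VM H0; exists (s / 2), c; split => //.
    by rewrite divr_gt0.
  move=> hs; apply/eqP; rewrite eq_le Rintegral_ge0 ?andbT//.
  have BDt x (t : R) : nball x0 s x -> 0 <= t <= 1 -> Omega (x + t *: h).
    move=> xs /andP[t0 t1]; apply: sO; rewrite /nball/= addrAC; apply: le_lt_trans (ler_normD _ _) _.
    rewrite mulr2n mulrDl mul1r; apply: ltr_leD => //; rewrite normrZ (ger0_norm t0).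
    by apply: le_trans (ltW hs); rewrite ler_piMl.
  have BDh x : nball x0 s x -> Omega (x + h).
    by move=> xs; have := BDt x 1 xs; rewrite scale1r; apply; rewrite ler01 lexx.
  apply: (@le_small _ _ (2 + d%:R * `|h|)); first by rewrite addr_ge0// mulr_ge0.
  move=> tau tau0; have [w [rw Hw Hp]] := atan_solution_gradient oO bO dr par Lu wu tau0.
  have [_ Iw _] := pcontinuous_closure_facts oO bO par (regc_continuous rw).
  have fp i := pcontinuous_closure_facts oO bO par (regc_continuous (regc_partial i rw)).
  have Ip i : rintegrable leb Omega (partial i w) by case: (fp i).
  have /choice[M HM] : forall i : 'I_d, exists M, forall x, Omega x -> `|partial i w x| <= M by move=> i; case: (fp i).
  pose Ms := \sum_i `|M i|; have Ms0 : 0 <= Ms by exact: sumr_ge0.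
  have HMs i x : Omega x -> `|partial i w x| <= Ms.
    move=> Ox; apply: le_trans (HM i x Ox) _; apply: le_trans (ler_norm _) _.
    by rewrite /Ms (bigD1 i)//= lerDl; exact: sumr_ge0.
  have rwO : regc Omega 1 w by exact: regcS rw.
  have T := translation_estimate oO mB (nball_lty x0 s) BDt rwO Ms0 Iw Ip HMs Hp.
  have Iwv : rintegrable leb Omega (fun x => w x - V x) by exact: rintegrableB.
  have [K1 N1] := translate_integral_le mB mO BDh Iwv.
  have [K2 _] := translate_integral_le mB mO BDh Iw.
  have K3 := rintegrableS mO mB BO Iw.
  have K4 := rintegrableS mO mB BO Iwv.
  have N4 := Rintegral_abs_subset mB mO BO Iwv.
  have K5 := rintegrableB mB K2 K3.
  have K6 := rintegrableB mB K4 K1.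
  have A1 := Rintegral_absD mB K5 K6.
  have A2 := Rintegral_absD mB K4 (rintegrableN mB K1).
  rewrite (_ : \int[leb]_(x in nball x0 s) `|w (x + h) - w x + _| =
    \int[leb]_(x in nball x0 s) `|V (x + h) - V x|) in A1; last first.
    by apply: eq_Rintegral => x _; congr (`|_|); move: (w _) (w _) (V _) (V _) => *; lra.
  rewrite (_ : \int[leb]_(x in nball x0 s) `|- _| =
    \int[leb]_(x in nball x0 s) `|w (x + h) - V (x + h)|) in A2; last first.
    by apply: eq_Rintegral => x _; rewrite normrN.
  have -> : tau * (2 + d%:R * `|h|) = d%:R * `|h| * tau + (tau + tau).
    by move: (d%:R * _) => a1; lra.
  apply: le_trans A1 _; apply: lerD T _; apply: le_trans A2 _.
  by apply: lerD; [exact: le_trans N4 Hw|exact: le_trans N1 Hw].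
exists (tan c); move: Hc; apply: filterS => x Hx Ox.
by rewrite -(Hx Ox) /V atanK.
Qed.

Lemma weak_solution_eq0 u : L1_diamond Omega u ->
  (forall phi, neumann_test Omega phi -> \int[leb]_(x in Omega) (u x * laplacian phi x) = 0) ->
  \int[leb]_(x in Omega) `|u x| = 0.
Proof.
move=> [Lu u0] wu; have Iu : rintegrable leb Omega u by exact: Lu.
have [c Hc] := weak_solution_constant Lu wu.
have [x0 Ox0] := O0; have [r r0 Hr] := open_nball_sub Ox0.
have V0 : 0 < fine (leb Omega).
  rewrite fine_gt0// Ooo andbT lt0e measure_ge0 andbT.
  apply: contra_neq (nball_neq0 x0 r0) => O00; apply/eqP; rewrite eq_le measure_ge0 andbT -O00.
  by apply: le_measure; rewrite ?inE//; exact: measurable_nball.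
have E : \int[leb]_(x in Omega) u x = \int[leb]_(x in Omega) c.
  congr fine; apply: ae_eq_integral => //.
  - by apply/measurable_EFinP; exact: rintegrable_measurable Iu.
  - by move: Hc; apply: filterS => x Hx Ox; rewrite Hx.
have c0 : c = 0.
  move: E; rewrite u0 Rintegral_cst// => /eqP; rewrite eq_sym mulf_eq0 (gt_eqF V0) orbF.
  by move/eqP.
apply/(Rintegral_abs_eq0 mO Iu); move: Hc; apply: filterS => x Hx Ox.
by rewrite Hx.
Qed.

End uniqueness.

(** * Poincare inequality *)

Section fast_cauchy.
Context {dT : measure_display} {T : measurableType dT} {R : realType}.
Context (mu : {measure set T -> \bar R}) (D : set T) (mD : measurable D).

(** Completeness of L^1 in the Riesz-Fischer manner: the sum [G] of the absolute increments is
    integrable, so the sequence converges where G is finite, dominated by its first term plus G. *)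
Lemma fast_cauchy_cvg (v_ : nat -> T -> R) : (forall n, rintegrable mu D (v_ n)) ->
  (forall n, \int[mu]_(x in D) `|v_ n.+1 x - v_ n x| <= 2^-1 ^+ n) ->
  exists U, rintegrable mu D U /\
    (fun n => \int[mu]_(x in D) `|v_ n x - U x|) @ \oo --> (0 : R).
Proof.
move=> Iv Hv.
pose D_ n x := `|v_ n.+1 x - v_ n x|.
have ID n : rintegrable mu D (D_ n) by apply: rintegrable_norm => //; exact: rintegrableB.
have mD_ n : measurable_fun D (fun x => (D_ n x)%:E).
  by apply/measurable_EFinP; exact: rintegrable_measurable.
have D0 n x : (0 <= (D_ n x)%:E)%E by rewrite lee_fin /D_.
pose G x := (\sum_(n <oo) (D_ n x)%:E)%E.
have G0 x : (0 <= G x)%E by exact: nneseries_ge0.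
have mG : measurable_fun D G by apply: ge0_emeasurable_sum => // n _.
have IG : (\int[mu]_(x in D) G x <= 2%:E)%E.
  rewrite /G integral_nneseries//.
  apply: lime_le; first by apply: is_cvg_nneseries => n _ _; exact: integral_ge0.
  have part N : (\sum_(0 <= n < N) \int[mu]_(x in D) (D_ n x)%:E <= (2 - 2 * 2^-1 ^+ N)%:E)%E.
    elim: N => [|N IH]; first by rewrite big_geq// lee_fin expr0 mulr1 subrr.
    rewrite big_nat_recr//= -EFin_Rintegral//; have := Hv N; rewrite -lee_fin => H.
    apply: le_trans (leeD IH H) _; rewrite -EFinD lee_fin exprS.
    by move: (_ ^+ N) => a; lra.
  near=> N; apply: le_trans (part N) _.
  by rewrite lee_fin lerBlDr lerDl mulr_ge0// exprn_ge0// invr_ge0.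
pose S := D `&` G @^-1` (~` [set +oo%E]).
have mS : measurable S by apply: mG => //; exact: measurableC.
have Gfin x : S x -> (fine (G x))%:E = G x.
  by move=> [_ /= Gx]; rewrite fineK// ge0_fin_numE// ltey; apply/eqP.
have part x n : S x -> \sum_(0 <= j < n) D_ j x <= fine (G x).
  by move=> Sx; rewrite -lee_fin Gfin// -sumEFin; apply: nneseries_lim_ge.
have tel x n : v_ n x = v_ 0%N x + \sum_(0 <= j < n) (v_ j.+1 x - v_ j x).
  by rewrite telescope_sumr// subrKC.
have vb x n : S x -> `|v_ n x| <= `|v_ 0%N x| + fine (G x).
  move=> Sx; rewrite tel; apply: le_trans (ler_normD _ _) _; rewrite lerD2l.
  by apply: le_trans (ler_norm_sum _ _ _) _; exact: part.
have cv x : S x -> cvgn (v_ ^~ x).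
  move=> Sx; have H : cvgn [normed series (fun j => v_ j.+1 x - v_ j x)].
    apply: nondecreasing_is_cvgn.
      by move=> a1 b1 ab; rewrite /series/= [leRHS](big_cat_nat (n := a1))//= lerDl; exact: sumr_ge0.
    by exists (fine (G x)) => _ [n _ <-]; exact: part.
  have := normed_cvg H => /(is_cvgD (is_cvg_cst (v_ 0%N x))).
  by rewrite (_ : v_ ^~ x = cst (v_ 0%N x) \+ series (fun j => v_ j.+1 x - v_ j x))//; apply/funext => n; rewrite /= [LHS]tel.
(* Set to 0 where G is infinite, a negligible subset of D. *)
pose U x := lim (v_ ^~ x @ \oo) * \1_S x.
pose h n x := v_ n x * \1_S x.
have i1 x : S x -> \1_S x = 1 :> R by move=> Sx; rewrite indicE mem_set.
have i0 x : ~ S x -> \1_S x = 0 :> R by move=> Sx; rewrite indicE memNset.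
have mi : measurable_fun D (\1_S : T -> R) by exact: measurable_indic.
have mh n : measurable_fun D (h n) by apply: measurable_funM => //; exact: rintegrable_measurable.
have hU x : h ^~ x @ \oo --> U x.
  rewrite /h /U; have [Sx|Sx] := pselect (S x); first by apply: cvgM; [exact: cv|exact: cvg_cst].
  by rewrite (i0 _ Sx) mulr0; under eq_fun do rewrite mulr0; exact: cvg_cst.
have mU : measurable_fun D U by apply: (measurable_fun_cvg mh) => x _; exact: hU.
have If : rintegrable mu D (fun x => fine (G x) * \1_S x).
  apply: rintegrable_ge0.
  - apply: measurable_funM => //; apply: (measurableT_comp (f := fine)) => //; exact: fine_measurable.
  - by move=> x _; rewrite mulr_ge0 ?fine_ge0// indicE.
  - apply: (@le_lt_trans _ _ (\int[mu]_(x in D) G x)%E); last exact: le_lt_trans IG (ltry _).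
    apply: ge0_le_integral => //.
    + by move=> x _; rewrite lee_fin mulr_ge0 ?fine_ge0// indicE.
    + apply/measurable_EFinP/measurable_funM => //.
      by apply: (measurableT_comp (f := fine)) => //; exact: fine_measurable.
    + move=> x Dx; have [Sx|Sx] := pselect (S x); first by rewrite i1// mulr1 Gfin.
      by rewrite i0// mulr0.
pose g x := `|v_ 0%N x| + fine (G x) * \1_S x.
have Ig : rintegrable mu D g by apply: rintegrableD => //; exact: rintegrable_norm.
have hg n x : D x -> `|h n x| <= g x.
  move=> _; rewrite /h /g; have [Sx|Sx] := pselect (S x).
    by rewrite i1// !mulr1; exact: vb.
  by rewrite i0// !mulr0 normr0 addr0.
have [IU _] := Rintegral_dominated mD mh mU (fun x _ => hU x) Ig hg.
exists U; split => //.
have [_ L] : rintegrable mu D (fun=> 0) /\ (fun n => \int[mu]_(x in D) `|h n x - U x|) @ \oo --> \int[mu]_(x in D) (0 : R).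
  apply: (Rintegral_dominated (g := fun x => g x + `|U x|)) => //.
  - move=> n; apply: measurableT_comp; first exact: normr_measurable.
    exact: measurable_funB.
  - move=> x Dx; apply/cvgrPdist_le => e e0.
    have := (cvgrPdist_le (FF := eventually_filter) _ _).1 (hU x) e e0.
    by apply: filterS => n; rewrite sub0r normrN normr_id distrC.
  - by apply: rintegrableD => //; exact: rintegrable_norm.
  - by move=> n x Dx; rewrite normr_id; apply: le_trans (ler_normB _ _) _; rewrite lerD2r; exact: hg.
have E n : \int[mu]_(x in D) `|v_ n x - U x| = \int[mu]_(x in D) `|h n x - U x|.
  have mv := rintegrable_measurable (Iv n).
  congr fine; apply: ae_eq_integral => //.
  - by apply/measurable_EFinP; apply: measurableT_comp; [exact: normr_measurable|exact: measurable_funB].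
  - by apply/measurable_EFinP; apply: measurableT_comp; [exact: normr_measurable|exact: measurable_funB].
  - have IGi : mu.-integrable D G.
      apply/integrableP; split => //; rewrite (eq_integral G) => [|x _]; last by rewrite gee0_abs.
      exact: le_lt_trans IG (ltry _).
    have := integrable_ae mD IGi; apply: filterS => x Hx Dx.
    have Sx : S x by split => //= Gx; have := Hx Dx; rewrite Gx.
    by rewrite /h i1// mulr1.
rewrite -[X in _ --> X](_ : \int[mu]_(x in D) (0 : R) = 0); last by rewrite /Rintegral integral0.
by under eq_fun do rewrite E.
Unshelve. all: by end_near. Qed.

End fast_cauchy.

(** * Linear structure and norm of vector measures *)

Section vector_measure_algebra.
Context {R : realType} {d : nat}.
Implicit Types (x y : 'rV[R]_d) (Omega : set 'rV[R]_d) (u w : 'rV[R]_d -> R) (v : @vmeasure R d)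
  (phi : 'rV[R]_d -> 'rV[R]_d).
Local Notation leb := (lebesgue_rV d : {sigma_finite_measure set 'rV[R]_d -> \bar R}).

Definition vmeasure_add v1 v2 : @vmeasure R d := fun i => cadd (v1 i) (v2 i).
Definition vmeasure_scale (c : R) v : @vmeasure R d := fun i => cscale c (v i).

Definition bounded_field Omega phi := exists M : R, forall i,
  measurable_fun Omega (fun x => phi x 0 i) /\ forall x, Omega x -> `|phi x 0 i| <= M.

Lemma vintegral_add Omega phi v1 v2 : measurable Omega -> bounded_field Omega phi ->
  vintegral Omega phi (vmeasure_add v1 v2) = vintegral Omega phi v1 + vintegral Omega phi v2.
Proof.
move=> mO [M HM]; rewrite /vintegral -big_split/=; apply: eq_bigr => i _.
by have [m1 b1] := HM i; exact: charge_integralD mO m1 b1.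
Qed.

Lemma vintegral_scale Omega phi (c : R) v : measurable Omega -> bounded_field Omega phi ->
  vintegral Omega phi (vmeasure_scale c v) = c * vintegral Omega phi v.
Proof.
move=> mO [M HM]; rewrite /vintegral mulr_sumr; apply: eq_bigr => i _.
by have [m1 b1] := HM i; exact: charge_integralZ mO m1 b1.
Qed.

Lemma vintegralZ Omega phi (c : R) v : measurable Omega -> bounded_field Omega phi ->
  vintegral Omega (fun x => c *: phi x) v = c * vintegral Omega phi v.
Proof.
move=> mO [M HM]; rewrite /vintegral mulr_sumr; apply: eq_bigr => i _.
have [m1 b1] := HM i; rewrite -(charge_integralM (v i) c mO m1 b1).
by apply: eq_charge_integral => x _; rewrite mxE.
Qed.

Lemma coord_le_enorm x i : `|x 0 i| <= enorm x.
Proof.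
rewrite -sqrtr_sqr /enorm ler_wsqrtr// /dotv (bigD1 i)//= -expr2 lerDl.
by apply: sumr_ge0 => j _; rewrite -expr2 sqr_ge0.
Qed.

Lemma within_coord_measurable Omega phi i : open Omega -> {within Omega, continuous phi} ->
  measurable_fun Omega (fun x => phi x 0 i).
Proof.
move=> oO cphi; apply: (pcontinuous_measurable oO) => x Ox.
have cx : {for x, continuous phi} by move: cphi; rewrite continuous_open_subspace// => H; exact/H/mem_set.
apply: (@continuous_comp _ _ _ phi (fun y : 'rV[R]_d => y 0 i)) => //.
exact: coord_continuous.
Qed.

Lemma test_field_bounded Omega phi : open Omega -> {within Omega, continuous phi} ->
  (forall x, Omega x -> enorm (phi x) <= 1) -> bounded_field Omega phi.
Proof.
move=> oO cphi e1; exists 1 => i; split; first exact: within_coord_measurable.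
by move=> x Ox; apply: le_trans (coord_le_enorm _ _) _; exact: e1.
Qed.

Lemma grad_bounded Omega f : open Omega -> bounded_set Omega -> Ck_closure Omega 2 f ->
  bounded_field Omega (grad f).
Proof.
move=> oO bO [_ Hf].
have ce i : continuous_extends Omega (partial i f) by have [_ []] := Hf i.
have /choice[M HM] : forall i : 'I_d, exists M : R, forall x, Omega x -> `|partial i f x| <= M.
  by move=> i; exact: ce_bounded.
exists (\sum_i `|M i|) => i; split.
  by under eq_fun do rewrite mxE; exact: continuous_extends_measurable.
move=> x Ox; rewrite mxE; apply: le_trans (HM i x Ox) _; apply: le_trans (ler_norm _) _.
by rewrite (bigD1 i)//= lerDl; exact: sumr_ge0.
Qed.

Lemma vmeasure_norm_ge0 Omega v : (0 <= vmeasure_norm Omega v)%E.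
Proof.
apply: ereal_sup_ubound; exists (fun=> 0).
  split; first by apply: continuous_subspaceT; exact: cst_continuous.
  by move=> x _; rewrite /enorm /dotv big1 ?sqrtr0 ?ler01// => i _; rewrite mxE mul0r.
rewrite /vintegral big1// => i _; rewrite /charge_integral /Rintegral.
by rewrite !integral0_eq ?subrr// => x _; rewrite mxE.
Qed.

Lemma vmeasure_norm_add Omega v1 v2 : open Omega ->
  (vmeasure_norm Omega (vmeasure_add v1 v2) <= vmeasure_norm Omega v1 + vmeasure_norm Omega v2)%E.
Proof.
move=> oO; have mO := open_measurable_rV oO.
apply: ub_ereal_sup => _ [phi [cphi e1] <-].
rewrite (vintegral_add _ _ mO (test_field_bounded oO cphi e1)) EFinD.
by apply: leeD; apply: ereal_sup_ubound; exists phi.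
Qed.

(** The sign of c is moved into the test field, which stays admissible. *)
Lemma vmeasure_norm_scale Omega (c : R) v : open Omega ->
  (vmeasure_norm Omega (vmeasure_scale c v) <= `|c|%:E * vmeasure_norm Omega v)%E.
Proof.
move=> oO; have mO := open_measurable_rV oO.
apply: ub_ereal_sup => _ [phi [cphi e1] <-].
have bphi := test_field_bounded oO cphi e1.
rewrite (vintegral_scale _ _ mO bphi).
rewrite (_ : c * vintegral Omega phi v = `|c| * (Num.sg c * vintegral Omega phi v)); last first.
  by rewrite mulrA [`|c| * _]mulrC -numEsg.
rewrite -(vintegralZ _ _ mO bphi) EFinM lee_wpmul2l ?lee_fin//.
apply: ereal_sup_ubound; exists (fun x => Num.sg c *: phi x) => //; split.
  move: cphi; rewrite !continuous_open_subspace// => H.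
  by move=> x Ox; apply: (@continuousZ _ _ _ (fun=> Num.sg c) phi); [exact: for_continuous_cst|exact: H].
move=> x Ox; apply: le_trans (e1 x Ox); rewrite /enorm ler_wsqrtr//.
apply: ler_sum => i _; rewrite !mxE mulrACA ler_piMl//; first by rewrite -expr2 sqr_ge0.
by rewrite -expr2 sqr_sg; case: (c != 0).
Qed.

End vector_measure_algebra.

(** * The Poincare inequality and the norm properties of the functional *)

Section poincare.
Context {R : realType} {d : nat}.
Implicit Types (x y : 'rV[R]_d) (u w : 'rV[R]_d -> R) (v : @vmeasure R d).
Local Notation leb := (lebesgue_rV d : {sigma_finite_measure set 'rV[R]_d -> \bar R}).
Context (Omega : set 'rV[R]_d) (sO : smooth_bounded_domain Omega).

Let oO : open Omega. Proof. by case: sO. Qed.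
Let bO : bounded_set Omega. Proof. by case: sO. Qed.
Let mO : measurable Omega. Proof. exact: open_measurable_rV. Qed.
Let Ooo : (leb Omega < +oo)%E. Proof. exact: lebesgue_rV_bounded. Qed.

Lemma laplacian_integrableM u phi : L1 Omega u -> neumann_test Omega phi ->
  [/\ measurable_fun Omega (laplacian phi), exists M, forall x, Omega x -> `|laplacian phi x| <= M &
    rintegrable leb Omega (fun x => u x * laplacian phi x)].
Proof.
move=> Lu [[_ Cphi] _].
have ce i : continuous_extends Omega (partial i (partial i phi)).
  by have [_ [_ /(_ i)[_ []]]] := Cphi i.
have mL : measurable_fun Omega (laplacian phi).
  by apply: measurable_sum => i; exact: continuous_extends_measurable.
have /choice[M HM] : forall i : 'I_d, exists M : R, forall x, Omega x -> `|partial i (partial i phi) x| <= M.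
  by move=> i; exact: ce_bounded.
have bL x : Omega x -> `|laplacian phi x| <= \sum_i M i.
  by move=> Ox; apply: le_trans (ler_norm_sum _ _ _) _; apply: ler_sum => i _; exact: HM.
by split => //; [exists (\sum_i M i)|exact: (rintegrableMb mO Lu mL bL)].
Qed.

Lemma weak_boundB u1 u2 (V1 V2 : R) : L1 Omega u1 -> L1 Omega u2 ->
  weak_bound Omega u1 V1 -> weak_bound Omega u2 V2 ->
  weak_bound Omega (fun x => u1 x - u2 x) (V1 + V2).
Proof.
move=> L1u L2u B1 B2 phi K Tphi K0 HK.
have [_ _ I1] := laplacian_integrableM L1u Tphi; have [_ _ I2] := laplacian_integrableM L2u Tphi.
rewrite (_ : \int[leb]_(x in Omega) _ = \int[leb]_(x in Omega) (u1 x * laplacian phi x) -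
   \int[leb]_(x in Omega) (u2 x * laplacian phi x)); last first.
  by rewrite -RintegralB//; apply: eq_Rintegral => x _; rewrite mulrBl.
by apply: le_trans (ler_normB _ _) _; rewrite mulrDr lerD ?B1 ?B2.
Qed.

Lemma weak_boundZ u (V c : R) : L1 Omega u -> weak_bound Omega u V ->
  weak_bound Omega (fun x => c * u x) (`|c| * V).
Proof.
move=> Lu B phi K Tphi K0 HK; have [_ _ I1] := laplacian_integrableM Lu Tphi.
rewrite (_ : \int[leb]_(x in Omega) _ = c * \int[leb]_(x in Omega) (u x * laplacian phi x)).
  by rewrite normrM mulrCA ler_wpM2l//; exact: B.
by rewrite -RintegralZl//; apply: eq_Rintegral => x _; rewrite mulrA.
Qed.

(** A field with components at most K has Euclidean norm at most (d + 1) K, a crude bound that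
    avoids square roots. Dividing by K + eta allows for K = 0, and the sign e turns the one-sided
    supremum into a bound of the absolute value. *)
Lemma vmeasure_weak_bound u v (V : R) : weak_no_flux_poisson Omega u v ->
  (vmeasure_norm Omega v <= V%:E)%E -> weak_bound Omega u (d.+1%:R * V).
Proof.
move=> wuv vV phi K Tphi K0 HK.
have V0 : 0 <= V by rewrite -lee_fin; apply: le_trans vV; exact: vmeasure_norm_ge0.
have bg := grad_bounded oO bO (proj1 Tphi).
have -> : \int[leb]_(x in Omega) (u x * laplacian phi x) = - vintegral Omega (grad phi) v.
  by apply/eqP; rewrite -addr_eq0; apply/eqP; exact: wuv.
rewrite normrN -subr_le0; apply: (@le_small _ _ (d.+1%:R * V)); first by rewrite mulr_ge0.
move=> eta e0; have K1 : 0 < K + eta by rewrite ltr_wpDl.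
pose c := (d.+1%:R * (K + eta))^-1; have c0 : 0 < c by rewrite invr_gt0 mulr_gt0.
have side (e : R) : `|e| = 1 -> e * vintegral Omega (grad phi) v <= (K + eta) * (d.+1%:R * V).
  move=> e1.
  pose ps x := (e * c) *: grad phi x.
  have : ((vintegral Omega ps v)%:E <= V%:E)%E.
    apply: le_trans vV; apply: ereal_sup_ubound; exists ps => //; split.
      rewrite continuous_open_subspace// => x /set_mem Ox.
      apply: (@continuousZ _ _ _ (fun=> e * c) (grad phi)); first exact: for_continuous_cst.
      have rphi := ce_regc oO (proj1 Tphi).
      apply/(@cvgrPdist_le _ _ _ (nbhs x)) => t t0.
      have H i : \forall y \near x, `|partial i phi x - partial i phi y| <= t.
        exact: (cvgrPdist_le (FF := nbhs_filter x) _ _).1 (regc_continuous (regc_partial i rphi) Ox) t t0.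
      have F := @filter_forall _ _ (fun i y => `|partial i phi x - partial i phi y| <= t) (nbhs x) (nbhs_filter x) H.
      apply: (@filterS _ (nbhs x) (nbhs_filter x) _ _ _ F) => y Hy; rewrite /Num.norm/= mx_normrE; apply: bigmax_le; first exact: ltW.
      by move=> [a i] _; rewrite !mxE; exact: Hy.
    have e2 : e ^+ 2 = 1 by rewrite -(real_normK (num_real e)) e1 expr1n.
    move=> x Ox; rewrite /enorm -[leRHS]sqrtr1 ler_wsqrtr//.
    apply: (@le_trans _ _ (\sum_(i < d) (d.+1%:R^-1 : R))).
      apply: ler_sum => i _; rewrite !mxE -expr2 exprMn exprMn e2 mul1r.
      have -> : c = (K + eta)^-1 * d.+1%:R^-1 by rewrite /c invfM mulrC.
      rewrite exprMn mulrAC -exprMn.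
      have h1 : ((K + eta)^-1 * partial i phi x) ^+ 2 <= 1.
        rewrite -(real_normK (num_real _)) expr_le1// normrM gtr0_norm ?invr_gt0// mulrC ler_pdivrMr// mul1r.
        by apply: le_trans (HK i x Ox) _; rewrite lerDl ltW.
      have h2 : (d.+1%:R^-1 : R) ^+ 2 <= d.+1%:R^-1.
        by rewrite expr2 ler_piMl// ?invr_ge0// invf_le1// ler1n.
      rewrite -[leRHS]mul1r; apply: ler_pM => //; exact: sqr_ge0.
    by rewrite sumr_const card_ord -[_^-1 *+ d]mulr_natl ler_pdivrMr// mul1r ler_nat.
  rewrite lee_fin (vintegralZ _ _ (open_measurable_rV oO) bg) => H.
  have : e * vintegral Omega (grad phi) v * c <= V by apply: le_trans H; rewrite mulrAC.
  rewrite /c ler_pdivrMr ?mulr_gt0// => h.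
  by rewrite (_ : (K + eta) * (d.+1%:R * V) = V * (d.+1%:R * (K + eta)))// mulrC -mulrA mulrCA.
have h1 := side 1 (normr1 _); have h2 := side (-1) (normrN1 _).
have : `|vintegral Omega (grad phi) v| <= (K + eta) * (d.+1%:R * V).
  by rewrite ler_norml; move: h1 h2; rewrite mul1r mulN1r => -> h; rewrite andbT lerNl.
by rewrite mulrDl lerBlDl.
Qed.

Lemma compact_cluster n (m_ : nat -> 'rV[R]_n) (M : R) : (forall j, `|m_ j| <= M) ->
  exists p : 'rV[R]_n, forall (e : R) N, 0 < e -> exists2 j, (N <= j)%N & `|m_ j - p| < e.
Proof.
move=> mM; have cpt := @compact_cball R n M.
have F0 : (m_ @ \oo) [set x : 'rV[R]_n | `|x| <= M] by exists 0%N => // j _; exact: mM.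
have [p [_ cp]] := cpt (m_ @ \oo) _ F0; exists p => e N e0.
have FA : (m_ @ \oo) (m_ @` [set j | (N <= j)%N]).
  by exists N => // j Nj; exists j.
by have [_ [[j Nj <-] pj]] := cp _ _ FA (near_norm_lt p e0); exists j.
Qed.

(** Normalised counterexamples have weak bounds tending to 0. Along a subsequence the finitely many
    integrals of [compact_estimate] converge fast, so that estimate, applied to differences, makes
    the functions Cauchy in L^1. The limit has norm 1 but is 0 by [weak_solution_eq0]. *)
Lemma poincare : exists c : R, 0 < c /\ forall u (V : R), L1_diamond Omega u -> 0 <= V ->
  weak_bound Omega u V -> \int[leb]_(x in Omega) `|u x| <= c * V.
Proof.
have [_ cO O0 _ _] := sO.
have [rho dr] := exists_defining_function sO.
have [W [k [kt [b [C par]]]]] := exists_parametrix oO bO dr.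
have [c [n [E [c0 HE Hc]]]] := compact_estimate oO bO par.
apply: contrapT => nP.
have bad j : exists w, [/\ L1_diamond Omega w, \int[leb]_(x in Omega) `|w x| = 1 &
    weak_bound Omega w (j.+1%:R^-1)].
  apply: contrapT => nw; apply: nP; exists j.+1%:R; split => // u V [Lu u0] V0 wu.
  rewrite leNgt; apply/negP => H; apply: nw.
  set N := \int[leb]_(x in Omega) `|u x| in H.
  have N0 : 0 < N by apply: le_lt_trans H; rewrite mulr_ge0.
  exists (fun x => N^-1 * u x); split.
  - split; first exact: rintegrableZ.
    have Z := RintegralZl N^-1 mO Lu; rewrite Z u0 mulr0//.
  - by rewrite (Rintegral_absZ _ mO Lu) gtr0_norm ?invr_gt0// mulVf// gt_eqF.
  - move=> phi K Tphi K0 HK; apply: le_trans (weak_boundZ N^-1 Lu wu Tphi K0 HK) _.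
    rewrite ler_wpM2l// gtr0_norm ?invr_gt0// ler_pdivrMl//.
    by rewrite ler_pdivlMr// mulrC ltW.
have /choice[w Hw] := bad.
(* Calibrated so that the bound c (2 eta l + n (2 eta l)) for consecutive differences is at most
   2^-l, as [fast_cauchy_cvg] asks. *)
pose q := 2 * c * (1 + n%:R) + 1; have q0 : 0 < q by rewrite ltr_wpDl// !mulr_ge0// addr_ge0.
pose eta j : R := 2^-1 ^+ j / q.
have eta0 j : 0 < eta j by rewrite divr_gt0// exprn_gt0// invr_gt0.
pose m_ j : 'rV[R]_n := \row_(i < n) \int[leb]_(x in E i) w j x.
have Iw j : rintegrable leb Omega (w j) by have [[]] := Hw j.
have IE j i : rintegrable leb (E i) (w j) by have [mE sE] := HE i; exact: rintegrableS mO mE sE (Iw j).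
have mM j : `|m_ j| <= 1.
  rewrite /Num.norm/= mx_normrE; apply: bigmax_le => // -[a i] _; rewrite mxE.
  have [mE sE] := HE i; apply: le_trans (le_normr_Rintegral mE (IE j i)) _.
  by have [_ <- _] := Hw j; exact: Rintegral_abs_subset.
have [p Hp] := compact_cluster mM.
have /choice[s Hs] : forall l : nat, exists j, `|m_ j - p| < eta l /\ j.+1%:R^-1 <= eta l.
  move=> l; have [N _ HN] := near_infty_natSinv_lt (PosNum (eta0 l)).
  have [j Nj Hj] := Hp (eta l) N (eta0 l); exists j; split => //.
  by apply: ltW; exact: HN.
pose g l := w (s l).
have fast l : \int[leb]_(x in Omega) `|g l.+1 x - g l x| <= 2^-1 ^+ l.
  have [[L1' _] _ B1] := Hw (s l.+1); have [[L2 _] _ B2] := Hw (s l).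
  have [d1 e1] := Hs l.+1; have [d2 e2] := Hs l.
  have es : eta l.+1 <= eta l by rewrite /eta ler_wpM2r ?invr_ge0 ?(ltW q0)// exprS ler_piMl ?exprn_ge0 ?invr_ge0//; lra.
  have LB : L1 Omega (fun x => g l.+1 x - g l x) by exact: rintegrableB.
  have V0 : 0 <= (s l.+1).+1%:R^-1 + (s l).+1%:R^-1 :> R by rewrite addr_ge0// invr_ge0.
  apply: le_trans (Hc _ _ LB V0 (weak_boundB L1' L2 B1 B2)) _.
  have H1 : (s l.+1).+1%:R^-1 + (s l).+1%:R^-1 <= 2 * eta l.
    by rewrite mulr2n mulrDl mul1r lerD// (le_trans e1).
  have H2 : \sum_(i < n) `|\int[leb]_(x in E i) (g l.+1 x - g l x)| <= n%:R * (2 * eta l).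
    rewrite -[n in n%:R]card_ord mulr_natl -sumr_const; apply: ler_sum => i _.
    have [mE sE] := HE i; have IB := RintegralB mE (IE (s l.+1) i) (IE (s l) i); rewrite IB.
    have -> : \int[leb]_(x in E i) g l.+1 x - \int[leb]_(x in E i) g l x = (m_ (s l.+1) - m_ (s l)) 0 i.
      by rewrite !mxE.
    apply: le_trans (coord_le_norm _ _) _; rewrite -[m_ _](subrK p) -addrA.
    apply: le_trans (ler_normD _ _) _; rewrite [`|p - _|]distrC mulr2n mulrDl mul1r.
    by apply: lerD; [exact: le_trans (ltW d1) es|exact: ltW].
  apply: (@le_trans _ _ (c * (2 * eta l + n%:R * (2 * eta l)))).
    by rewrite ler_wpM2l// lerD.
  rewrite (_ : c * _ = 2 * c * (1 + n%:R) / q * 2^-1 ^+ l); last first.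
    by rewrite /eta; move: (2^-1 ^+ l) (q^-1) (n%:R) => a1 a2 a3; lra.
  rewrite ler_piMl ?exprn_ge0 ?invr_ge0// ler_pdivrMr// mul1r /q lerDl//.
have Ig l : rintegrable leb Omega (g l) by exact: Iw.
have [U [IU LU]] := fast_cauchy_cvg mO Ig fast.
have near_e (e : R) : 0 < e -> exists2 l, \int[leb]_(x in Omega) `|g l x - U x| <= e & eta l <= e.
  move=> e0.
  have h1 := (cvgrPdist_le (FF := eventually_filter) _ _).1 LU e e0.
  have hh : `|2^-1 : R| < 1 by rewrite ger0_norm; lra.
  have h2 := (cvgrPdist_le (FF := eventually_filter) _ _).1 (cvg_expr hh) (e * q) (mulr_gt0 e0 q0).
  have [l Hl] := filter_ex (filterI h1 h2); move: Hl => /= [H1 H2]; exists l.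
    by move: H1; rewrite sub0r normrN ger0_norm//; exact: Rintegral_abs_ge0.
  by rewrite /eta ler_pdivrMr//; apply: le_trans H2; rewrite sub0r normrN ler_norm.
have U0 : L1_diamond Omega U.
  split=> //; apply/eqP; rewrite -normr_le0; apply: (@le_small _ _ 1) => // e e0.
  have [l Hl _] := near_e e e0; have [[_ z0] _ _] := Hw (s l).
  have -> : \int[leb]_(x in Omega) U x = - \int[leb]_(x in Omega) (g l x - U x).
    have z1 : \int[leb]_(x in Omega) g l x = 0 by exact: z0.
    by rewrite (RintegralB mO (Ig l) IU) z1 sub0r opprK.
  rewrite normrN mulr1; apply: le_trans _ Hl; apply: le_normr_Rintegral => //.
  exact: rintegrableB.
have wU phi : neumann_test Omega phi -> \int[leb]_(x in Omega) (U x * laplacian phi x) = 0.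
  move=> Tphi; have [mL [M HM] IUL] := laplacian_integrableM IU Tphi.
  have [K HK] := grad_bounded oO bO (proj1 Tphi).
  have HK' i x : Omega x -> `|partial i phi x| <= `|K|.
    move=> Ox; have [_ /(_ x Ox)] := HK i; rewrite mxE => H.
    by apply: le_trans H _; exact: ler_norm.
  have HM' x : Omega x -> `|laplacian phi x| <= `|M|.
    by move=> Ox; apply: le_trans (HM x Ox) _; exact: ler_norm.
  apply/eqP; rewrite -normr_le0; apply: (@le_small _ _ (`|K| + `|M|)); first exact: addr_ge0.
  move=> e e0; have [l Hl He] := near_e e e0.
  have [[Lg _] _ Bg] := Hw (s l); have [_ _ Igl] := laplacian_integrableM Lg Tphi.
  have -> : \int[leb]_(x in Omega) (U x * laplacian phi x) =
     \int[leb]_(x in Omega) (g l x * laplacian phi x) - \int[leb]_(x in Omega) ((g l x - U x) * laplacian phi x).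
    have I3 : rintegrable leb Omega (fun x => (g l x - U x) * laplacian phi x).
      by apply: (rintegrableMb mO _ mL HM'); exact: rintegrableB.
    rewrite -RintegralB//; apply: eq_Rintegral => x _.
    by move: (laplacian phi x) => a; lra.
  apply: le_trans (ler_normB _ _) _; rewrite mulrDr [e * _]mulrC; apply: lerD.
    apply: le_trans (Bg phi `|K| Tphi (normr_ge0 _) HK') _; rewrite ler_wpM2l//.
    by have [_ h] := Hs l; exact: le_trans h He.
  have IgU : rintegrable leb Omega (fun x => g l x - U x) by exact: rintegrableB.
  apply: le_trans (Rintegral_normM mO IgU mL HM') _.
  by rewrite mulrC ler_wpM2r.
have Z := weak_solution_eq0 oO bO dr par cO O0 U0 wU.
have [l Hl _] := near_e (1 / 2) (divr_gt0 ltr01 (ltr0n _ 2)).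
have [_ N1 _] := Hw (s l).
have := Rintegral_absD mO (rintegrableB mO (Ig l) IU) IU.
rewrite Z addr0 (_ : \int[leb]_(x in Omega) `|g l x - U x + U x| = 1).
  by move=> /le_trans/(_ Hl); lra.
by rewrite -N1; apply: eq_Rintegral => x _; rewrite subrK.
Qed.

Lemma sparse_reg_ge0 u : (0 <= sparse_reg Omega u)%E.
Proof. by apply: le_ereal_inf_tmp => _ [v _ <-]; exact: vmeasure_norm_ge0. Qed.

(** The infimum may not be attained, so a vector field within e / (c (d + 1)) of it is used; this
    slack costs exactly e. *)
Lemma sparse_reg_poincare : exists c : R, 0 < c /\ forall u, L1_diamond Omega u ->
  (L1_norm Omega u <= c%:E * sparse_reg Omega u)%E.
Proof.
have [c [c0 Hc]] := poincare.
exists (c * d.+1%:R); split => [|u Lu]; first by rewrite mulr_gt0.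
have NE : L1_norm Omega u = (\int[leb]_(x in Omega) `|u x|)%:E.
  by rewrite /L1_norm EFin_Rintegral//; apply: rintegrable_norm => //; case: Lu.
rewrite NE; apply/lee_addgt0Pr => e e0.
have [Roo|] := eqVneq (sparse_reg Omega u) +oo%E.
  by rewrite Roo gt0_muley ?lte_fin ?mulr_gt0// addye ?leey// ltNye.
rewrite -ltey => Rlt.
have Rfin : sparse_reg Omega u \is a fin_num by rewrite ge0_fin_numE// sparse_reg_ge0.
have t0 : 0 < e / (c * d.+1%:R) by rewrite divr_gt0// mulr_gt0.
have [_ [v [_ wuv] <-] Hv] := lb_ereal_inf_adherent t0 Rfin.
have wb := vmeasure_weak_bound (V := fine (sparse_reg Omega u) + e / (c * d.+1%:R)) wuv.
have {}wb : weak_bound Omega u (d.+1%:R * (fine (sparse_reg Omega u) + e / (c * d.+1%:R))).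
  by apply: wb; rewrite EFinD fineK//; exact: ltW.
have R0 : 0 <= fine (sparse_reg Omega u) by rewrite fine_ge0// sparse_reg_ge0.
have V0 : 0 <= d.+1%:R * (fine (sparse_reg Omega u) + e / (c * d.+1%:R)).
  by rewrite mulr_ge0// addr_ge0// ltW.
have := Hc u _ Lu V0 wb; rewrite -(fineK Rfin) -EFinM -EFinD lee_fin => /le_trans; apply.
by rewrite mulrA mulrDr [_ / _]mulrC mulVKf// mulf_neq0// gt_eqF.
Qed.

Lemma sparse_reg_add u w : L1 Omega u -> L1 Omega w ->
  (sparse_reg Omega (u \+ w)%R <= sparse_reg Omega u + sparse_reg Omega w)%E.
Proof.
move=> Lu Lw.
have [->|Ru] := eqVneq (sparse_reg Omega u) +oo%E.
  by rewrite addye ?leey// gt_eqF// (lt_le_trans (ltNyr 0))// sparse_reg_ge0.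
have [->|Rw] := eqVneq (sparse_reg Omega w) +oo%E.
  by rewrite addey ?leey// gt_eqF// (lt_le_trans (ltNyr 0))// sparse_reg_ge0.
have fu : sparse_reg Omega u \is a fin_num by rewrite ge0_fin_numE ?ltey// sparse_reg_ge0.
have fw : sparse_reg Omega w \is a fin_num by rewrite ge0_fin_numE ?ltey// sparse_reg_ge0.
apply/lee_addgt0Pr => e e0; have e20 : 0 < e / 2 by rewrite divr_gt0.
have [_ [v1 [on1 w1] <-] H1] := lb_ereal_inf_adherent e20 fu.
have [_ [v2 [on2 w2] <-] H2] := lb_ereal_inf_adherent e20 fw.
apply: (@le_trans _ _ (vmeasure_norm Omega (vmeasure_add v1 v2))).
  apply: ereal_inf_lbound; exists (vmeasure_add v1 v2) => //; split.
    by move=> i A mA AO; have E : vmeasure_add v1 v2 i A = (v1 i A + v2 i A)%E by []; rewrite E on1// on2// adde0.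
  move=> phi Tphi; have [_ _ I1] := laplacian_integrableM Lu Tphi.
  have [_ _ I2] := laplacian_integrableM Lw Tphi.
  rewrite (vintegral_add _ _ mO (grad_bounded oO bO (proj1 Tphi))).
  rewrite (_ : \int[leb]_(x in Omega) _ = \int[leb]_(x in Omega) (u x * laplacian phi x) +
     \int[leb]_(x in Omega) (w x * laplacian phi x)).
    by rewrite addrACA w1// w2// addr0.
  by rewrite -RintegralD//; apply: eq_Rintegral => x _; rewrite mulrDl.
apply: le_trans (vmeasure_norm_add _ _ oO) _; apply: le_trans (leeD (ltW H1) (ltW H2)) _.
by rewrite addeACA -EFinD -splitr.
Qed.

Lemma sparse_reg0 : sparse_reg Omega (cst 0) = 0%E.
Proof.
apply/eqP; rewrite eq_le sparse_reg_ge0 andbT.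
pose z : @vmeasure R d := fun=> czero.
have vz phi : vintegral Omega phi z = 0.
  by rewrite /vintegral big1// => i _; exact: charge_integral0.
apply: (@le_trans _ _ (vmeasure_norm Omega z)).
  apply: ereal_inf_lbound; exists z => //; split; first by [].
  move=> phi Tphi; rewrite vz addr0 /Rintegral integral0_eq// => x _.
  by rewrite mul0r.
by apply: ub_ereal_sup => _ [phi _ <-]; rewrite vz.
Qed.

Lemma sparse_reg_scale_le u (c : R) : L1 Omega u -> (sparse_reg Omega u < +oo)%E ->
  (sparse_reg Omega (fun x => c * u x)%R <= `|c|%:E * sparse_reg Omega u)%E.
Proof.
move=> Lu Ru.
have fu : sparse_reg Omega u \is a fin_num by rewrite ge0_fin_numE// sparse_reg_ge0.
apply/lee_addgt0Pr => e e0.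
have c1 : 0 < `|c| + 1 by rewrite ltr_wpDl.
have e20 : 0 < e / (`|c| + 1) by rewrite divr_gt0.
have [_ [v [on w] <-] H] := lb_ereal_inf_adherent e20 fu.
apply: (@le_trans _ _ (vmeasure_norm Omega (vmeasure_scale c v))).
  apply: ereal_inf_lbound; exists (vmeasure_scale c v) => //; split.
    by move=> i A mA AO; have E : vmeasure_scale c v i A = (c%:E * v i A)%E by []; rewrite E on// mule0.
  move=> phi Tphi; have [_ _ I1] := laplacian_integrableM Lu Tphi.
  rewrite (vintegral_scale _ _ mO (grad_bounded oO bO (proj1 Tphi))).
  rewrite (_ : \int[leb]_(x in Omega) _ = c * \int[leb]_(x in Omega) (u x * laplacian phi x)).
    by rewrite -mulrDr w// mulr0.
  by rewrite -RintegralZl//; apply: eq_Rintegral => x _; rewrite mulrA.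
apply: le_trans (vmeasure_norm_scale _ _ oO) _.
apply: (@le_trans _ _ (`|c|%:E * (sparse_reg Omega u + (e / (`|c| + 1))%:E))%E).
  by rewrite lee_wpmul2l ?lee_fin// ltW.
rewrite -(fineK fu) -EFinD -!EFinM -EFinD lee_fin mulrDr lerD2l mulrCA ler_piMr ?(ltW e0)//.
by rewrite ler_pdivrMr// mul1r lerDl.
Qed.

Lemma sparse_reg_scale u (c : R) : L1 Omega u -> (sparse_reg Omega u < +oo)%E ->
  sparse_reg Omega (fun x => c * u x) = (`|c|%:E * sparse_reg Omega u)%E.
Proof.
move=> Lu Ru; have [->|c0] := eqVneq c 0.
  rewrite normr0 mul0e -sparse_reg0; congr sparse_reg; apply/funext => x.
  by rewrite mul0r.
apply/eqP; rewrite eq_le sparse_reg_scale_le//=.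
have Lc : L1 Omega (fun x => c * u x) by exact: rintegrableZ.
have fu : sparse_reg Omega u \is a fin_num by rewrite ge0_fin_numE// sparse_reg_ge0.
have Rc : (sparse_reg Omega (fun x => c * u x)%R < +oo)%E.
  by apply: le_lt_trans (sparse_reg_scale_le c Lu Ru) _; rewrite -(fineK fu) -EFinM ltry.
(* The reverse inequality is the first one for the factor 1/c applied to c u. *)
have := sparse_reg_scale_le c^-1 Lc Rc.
rewrite (_ : (fun x => c^-1 * (c * u x)) = u); last by apply/funext => x; rewrite mulKf.
move=> /(lee_wpmul2l (_ : (0 <= `|c|%:E)%E)) H; apply: le_trans (H _) _; first by rewrite lee_fin.
by rewrite muleA -EFinM -normrM mulfV// normr1 mul1e.
Qed.

Lemma sparse_reg_eq0 u : L1_diamond Omega u -> sparse_reg Omega u = 0%E <-> ae_eq_on Omega u (cst 0).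
Proof.
move=> Lu; have [Lu1 _] := Lu; split => [R0|u0].
  have [c [c0 Hc]] := sparse_reg_poincare; have := Hc u Lu; rewrite R0 mule0.
  rewrite /L1_norm -EFin_Rintegral//; last exact: rintegrable_norm.
  rewrite lee_fin => H; apply/(Rintegral_abs_eq0 mO Lu1)/eqP.
  by rewrite eq_le H Rintegral_abs_ge0.
rewrite -sparse_reg0; apply: sparse_reg_ae_eq => //.
exact: (@rintegrable_cst _ _ _ leb Omega 0 mO Ooo).
Qed.

End poincare.

Unset Implicit Arguments.
Set Strict Implicit.
Set Printing Implicit Defensive.

Theorem theorem1 (R : realType) (d : nat) (d_gt0 : (0 < d)%N)
    (Omega : set 'rV[R]_d) (Omega_dom : smooth_bounded_domain Omega) :
  [/\ exists c : R, 0 < c /\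
        forall u, L1_diamond Omega u ->
          (L1_norm Omega u <= c%:E * sparse_reg Omega u)%E,
      linear_subspace (dom_sparse_reg Omega) /\
        norm_on Omega (dom_sparse_reg Omega `&` L1_diamond Omega)
          (sparse_reg Omega) &
      forall (u : 'rV[R]_d -> R) (uBV : BV Omega u),
        (sparse_reg Omega u <= TV uBV)%E].
Proof.
have [oO _ _ bO _] := Omega_dom; have mO := open_measurable_rV oO.
split; [exact: sparse_reg_poincare| |by move=> u uBV; exact: sparse_reg_le_TV].
split; first split.
- split; last by rewrite sparse_reg0// ltry.
  exact: (@rintegrable_cst _ _ _ (lebesgue_rV d) Omega 0 mO (lebesgue_rV_bounded mO bO)).
- move=> u w [Lu Ru] [Lw Rw]; split; first exact: rintegrableD.
  by apply: le_lt_trans (sparse_reg_add Omega_dom Lu Lw) _; rewrite lte_add_pinfty.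
- move=> a u [Lu Ru]; split; first exact: rintegrableZ.
  rewrite (sparse_reg_scale Omega_dom a Lu Ru).
  by rewrite -(@fineK _ (sparse_reg Omega u)) ?ge0_fin_numE ?sparse_reg_ge0// -EFinM ltry.
split.
- by move=> u [[_ Ru] _]; rewrite Ru sparse_reg_ge0.
- by move=> u [_ Lu]; exact: sparse_reg_eq0.
- by move=> a u [[Lu Ru] _]; exact: sparse_reg_scale.
- by move=> u w [[Lu _] _] [[Lw _] _]; exact: sparse_reg_add.
Qed.
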